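(* Let $\theta\in(0,1)$ and let $f\in\mathcal F_\theta(\Sigma_A^+)$ be a real-valued function with $f>0$ on $\Sigma_A^+$. Assume that $f$ is non-lattice and that the Ruelle transfer operators related to $f$ are weakly contracting. Let $\rho$ be such that $0<\rho_1<\rho<1$ and the weak contraction estimate (W) of the context holds with $\rho$, where $\rho_1\in(0,1)$ is the constant described in the context. Let $d_0=\min f$, $d_1=\max f$, and $\epsilon_n=e^{-\delta n}$ with $0<\delta<-\frac{(\log\rho)\,\alpha}{3d_1}$. Then for any $0\le z\le\alpha$, any $p<q$ and any fixed $a>0$, setting $r=\frac{\pi}{4\alpha}$, $$e^{P_f(z+n\alpha)}(q-p)\,\epsilon_n\frac{1}{\sqrt{\pi n}\,\sigma_0}\,\frac{2r}{a}\bigl(1+o_a(1)\bigr)\le I(z,p,q;\epsilon_n)\le e^{P_f(z+n\alpha)}(q-p)\,\epsilon_n\frac{2\sqrt{2n}}{\sqrt\pi\,\sigma_0}\Bigl[\sqrt{\tfrac{\alpha}{d_0}}-\sqrt{\tfrac{\alpha}{d_1}}+o(1)\Bigr]$$ as $n\to\infty$, uniformly with respect to $z$, where $o_a(1)\to0$ as $n\to\infty$ with convergence depending on $a$.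
   Context: Symbol space. $\kappa_0\ge2$ is an integer and $A=(A(i,j))_{i,j=1}^{\kappa_0}$ is a matrix of $0$'s and $1$'s which is aperiodic ($A^M$ has strictly positive entries for some $M\ge1$). $\Sigma_A^+=\{(i_j)_{j=0}^\infty:1\le i_j\le\kappa_0,\ A(i_j,i_{j+1})=1\ \forall j\ge0\}$, with shift $\sigma((i_j)_j)=(i_{j+1})_j$. For $\theta\in(0,1)$, $d_\theta(\xi,\eta)=0$ if $\xi=\eta$, and $d_\theta(\xi,\eta)=\theta^m$ if $\xi_i=\eta_i$ for $0\le i<m$ and $m$ is maximal with this property. $\mathcal F_\theta(\Sigma_A^+)$ is the space of $d_\theta$-Lipschitz functions $g:\Sigma_A^+\to\mathbb C$; $|g|_\theta$ is the Lipschitz constant of $g$, $\|g\|_\theta=\|g\|_\infty+|g|_\theta$, and for $u\in\mathbb R\setminus\{0\}$, $\|g\|_{\theta,u}=\|g\|_\infty+|g|_\theta/|u|$. The same symbols denote the induced operator norms. $f^n(x)=f(x)+f(\sigma x)+\dots+f(\sigma^{n-1}x)$. Counting function: $$I(z,p,q;\epsilon_n)=\#\{\xi\in\Sigma_A^+:\ \exists\,m\in\mathbb N\text{ with }\sigma^m(\xi)=\xi\text{ and }z+n\alpha+p\,\epsilon_n\le f^m(\xi)\le z+n\alpha+q\,\epsilon_n\}.$$ Ruelle operator: $(\mathcal L_g v)(\xi)=\sum_{\sigma\eta=\xi}e^{g(\eta)}v(\eta)$. Pressure: for real-valued $F\in\mathcal F_\theta(\Sigma_A^+)$, $\mathrm{Pr}(F)=\sup_\mu\left[h(\mu)+\int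 F\,d\mu\right]$, the supremum over $\sigma$-invariant Borel probability measures, $h(\mu)$ being the measure-theoretic entropy of $\mu$; an equilibrium state of $F$ is a measure attaining the supremum. For real-valued $F,G\in\mathcal F_\theta(\Sigma_A^+)$ and small $|u|$, $\mathrm{Pr}(F+\mathrm iuG)$ denotes the analytic continuation (the logarithm of the simple ''maximal'' eigenvalue of $\mathcal L_{F+\mathrm iuG}$). $P_f\in\mathbb R$ is the unique number with $\mathrm{Pr}(-P_f f)=0$; $m_0$ is the equilibrium state of $-P_f f$; $\alpha=\int f\,dm_0$; and $\sigma_0>0$ is defined by $\frac{d^2}{du^2}\mathrm{Pr}(-P_f f+\mathrm iuf)\big|_{u=0}=-\sigma_0^2$ (such $\sigma_0>0$ exists when $f$ is non-lattice). Non-lattice: there do not exist constants $\gamma_0,\gamma_1$, a bounded function $G$ on $\Sigma_A^+$ and a bounded integer-valued function $Z$ on $\Sigma_A^+$ such that $f=G\circ\sigma-G+\gamma_0+\gamma_1Z$ on $\Sigma_A^+$. Weakly contracting: for every $\epsilon>0$ there exist $a_0>0$, $\rho\in(0,1)$ and $A_\epsilon>0$ (possibly depending on $f$ and $\epsilon$) such that $$\text{(W)}\qquad \|\mathcal L^n_{(-P_f+\mathrm iu)f}\|_{\theta,u}\le A_\epsilon\,\rho^n|u|^\epsilon\qquad\text{for all }|u|\ge a_0\text{ and all integers }n\ge0.$$ ''(W) holds with $\rho$'' means that for every $\epsilon>0$ there are $a_0,A_\epsilon>0$ such that this estimate holds with this same $\rho$. The constant $\rho_1$: let $\chi_i$ be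 the characteristic function of the cylinder $\mathcal C_i=\{\eta\in\Sigma_A^+:\eta_0=i\}$ and fix arbitrary points $x_i\in\mathcal C_i$, $i=1,\dots,\kappa_0$. By a known version of Ruelle's Lemma there is a constant $\rho_1\in(0,1)$ such that for $a_0,b_0>0$ and every $\epsilon>0$ there is $C_\epsilon>0$ with $$\Big|\sum_{\sigma^nx=x}e^{(t+\mathrm iu)f^n(x)}-\sum_{i=1}^{\kappa_0}\mathcal L^n_{(t+\mathrm iu)f}\chi_i(x_i)\Big|\le C_\epsilon|u|\sum_{m=2}^n\|\mathcal L^{n-m}_{(t+\mathrm iu)f}\|_\theta\,\rho_1^m e^{m(\epsilon+\mathrm{Pr}(tf))}$$ for all $n\in\mathbb N$, $|t|\le a_0$, $|u|\ge b_0$; $\rho_1$ is this constant. *)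

(* Defs.v *)
From HB Require Import structures.
From mathcomp Require Import all_boot all_order all_algebra.
From mathcomp Require Import all_classical all_reals all_analysis.
From mathcomp Require Import complex.

Set Implicit Arguments.
Unset Strict Implicit.
Unset Printing Implicit Defensive.

Import Order.TTheory GRing.Theory Num.Theory.
Import numFieldNormedType.Exports.

Local Open Scope classical_set_scope.
Local Open Scope ring_scope.

(* Bundling aperiodicity with the matrix makes the shift space provably
   inhabited, which [measurableType] requires.  Symbols are 0, ..., kappa - 1. *)
Record transition := Transition {
  kappa : nat;
  tmx : 'M[nat]_kappa;
  kappa_ge2 : (2 <= kappa)%N;
  tmx01 : forall i j, tmx i j = 0%N \/ tmx i j = 1%N;
  tmx_aperiodic : exists2 M : nat, (1 <= M)%N &
    forall i j, (0 < (tmx ^+ M) i j)%N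
}.

Record shift_space (A : transition) := ShiftSpace {
  coord :> nat -> 'I_(kappa A);
  coordP : forall j, tmx A (coord j) (coord j.+1) = 1%N
}.

HB.instance Definition _ (A : transition) := gen_eqMixin (shift_space A).
HB.instance Definition _ (A : transition) := gen_choiceMixin (shift_space A).

Lemma shift_space_inhabited (A : transition) : $|shift_space A|.
Proof.
have succ (i : 'I_(kappa A)) : {j | tmx A i j = 1%N}.
  apply: cid; have [[//|M] _ hM] := tmx_aperiodic A.
  have := hM i i; rewrite exprS mxE; apply: contraPP => /forallNP h.
  rewrite big1 // => j _.
  by have [->|/h//] := tmx01 i j; rewrite mul0r.
have i0 : 'I_(kappa A) := Ordinal (leq_trans (isT : 0 < 2)%N (kappa_ge2 A)).
pose x n := iter n (fun i => projT1 (succ i)) i0.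
by apply: squash; exists x => j; rewrite /x iterS; case: (succ _).
Qed.

HB.instance Definition _ (A : transition) :=
  isPointed.Build (shift_space A) (unsquash (shift_space_inhabited A)).

Definition left_shift (A : transition) (x : shift_space A) : shift_space A :=
  ShiftSpace (fun j => coordP x j.+1).

Definition agree (A : transition) (m : nat) (x y : shift_space A) : Prop :=
  forall i, (i < m)%N -> x i = y i.

(* The topology defined by the metrics d_theta does not depend on theta; its
   open sets are the unions of cylinders. *)
Definition shift_open (A : transition) : set (set (shift_space A)) :=
  [set U | forall x, U x -> exists m, forall y, agree m x y -> U y].

Definition borel_shift (A : transition) := g_sigma_algebraType (@shift_open A).

Section function_space.
Variables (R : realType) (A : transition).
Local Notation X := (shift_space A).

Definition cexp (z : R[i]) : R[i] :=
  let: (x +i* y)%C := z in (expR x * cos y +i* (expR x * sin y))%C.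

Definition cfun (f : X -> R) : X -> R[i] := fun x => (f x)%:C%C.

Definition birkhoff (f : X -> R) (n : nat) (x : X) : R :=
  \sum_(j < n) f (iter j (@left_shift A) x).

Definition dist_theta (theta : R) (x y : X) : R :=
  if x == y then 0
  else theta ^+ xget 0%N [set m | agree m x y /\
                                  forall m', agree m' x y -> (m' <= m)%N].

Section norms.
Local Open Scope ereal_scope.

(* Norms take values in \bar R, so that an unbounded function has norm +oo
   (the supremum in R would be 0). *)
Definition norm_sup (g : X -> R[i]) : \bar R :=
  ereal_sup [set (Normc.normc (g x))%:E | x in [set: X]].

(* The diagonal terms are 0 / 0 = 0. *)
Definition lip_const (theta : R) (g : X -> R[i]) : \bar R :=
  ereal_sup [set (Normc.normc (g p.1 - g p.2)%R / dist_theta theta p.1 p.2)%:E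
            | p in [set: X * X]].

Definition lipschitz_theta (theta : R) : set (X -> R[i]) :=
  [set g | lip_const theta g < +oo].

Definition norm_theta (theta : R) (g : X -> R[i]) : \bar R :=
  norm_sup g + lip_const theta g.

Definition norm_theta_u (theta u : R) (g : X -> R[i]) : \bar R :=
  norm_sup g + lip_const theta g * (`|u|^-1)%:E.

Definition opnorm (theta : R) (N : (X -> R[i]) -> \bar R)
    (T : (X -> R[i]) -> (X -> R[i])) : \bar R :=
  ereal_sup [set N (T g) | g in [set g | lipschitz_theta theta g /\ N g <= 1]].

End norms.

Definition ruelle_op (g v : X -> R[i]) : X -> R[i] := fun x =>
  \sum_(y \in [set y : X | left_shift y = x]) cexp (g y) * v y.

End function_space.

Section pressure.
Variables (R : realType) (A : transition).
Local Notation X := (shift_space A).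
Local Notation prob := (probability (borel_shift A) R).

Definition invariant_measure (mu : prob) : Prop :=
  forall B : set (borel_shift A), measurable B ->
    mu (@left_shift A @^-1` B) = mu B.

(* A finite measurable partition is given by its labelling [P : X -> 'I_N];
   empty blocks are allowed and contribute nothing. *)
Definition measurable_partition (N : nat) (P : X -> 'I_N) : Prop :=
  forall i, measurable (P @^-1` [set i] : set (borel_shift A)).

(* The blocks of the join of left_shift^-j P, j < n, are indexed by words of length n. *)
Definition join_block (N : nat) (P : X -> 'I_N) (n : nat)
    (w : {ffun 'I_n -> 'I_N}) : set (borel_shift A) :=
  [set x | forall j : 'I_n, P (iter j (@left_shift A) x) = w j].

(* The convention 0 log 0 = 0 holds since [ln 0 = 0]. *)
Definition join_entropy (mu : prob) (N : nat) (P : X -> 'I_N) (n : nat) : R :=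
  - \sum_(w : {ffun 'I_n -> 'I_N})
      fine (mu (join_block P w)) * ln (fine (mu (join_block P w))).

Definition partition_entropy (mu : prob) (N : nat) (P : X -> 'I_N) : R :=
  limn (fun n : nat => join_entropy mu P n / n%:R).

Definition entropy (mu : prob) : \bar R :=
  ereal_sup [set h | exists (N : nat) (P : X -> 'I_N),
    measurable_partition P /\ h = (partition_entropy mu P)%:E].

Definition free_energy (F : X -> R) (mu : prob) : \bar R :=
  (entropy mu + \int[mu]_x (F x)%:E)%E.

Definition pressure (F : X -> R) : \bar R :=
  ereal_sup [set free_energy F mu | mu in [set mu | invariant_measure mu]].

Definition equilibrium_state (F : X -> R) (mu : prob) : Prop :=
  invariant_measure mu /\ free_energy F mu = pressure F.

(* [lam] is an algebraically simple eigenvalue of [ruelle_op g] on the space of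
   Lipschitz functions, of modulus larger than that of all other eigenvalues. *)
Definition simple_maximal_eigenvalue (theta : R) (g : X -> R[i]) (lam : R[i])
    : Prop :=
  let E := @lipschitz_theta R A theta in
  let T z (v : X -> R[i]) x := ruelle_op g v x - z * v x in
  (exists v, [/\ E v, v <> (fun=> 0), T lam v = (fun=> 0) &
    forall w n, E w -> iter n (T lam) w = (fun=> 0) ->
      exists c, w = (fun x => c * v x)]) /\
  (forall z v, E v -> v <> (fun=> 0) -> T z v = (fun=> 0) -> z <> lam ->
    Normc.normc z < Normc.normc lam).

(* [Phi s] is Pr(F + s G) for small complex s; in particular Pr(F + iuG) is
   [Phi (0 +i* u)]. *)
Definition pressure_continuation (theta : R) (F G : X -> R)
    (Phi : R[i] -> R[i]) : Prop :=
  exists2 r : R, 0 < r &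
  [/\ exists c : nat -> R[i], forall s : R[i], Normc.normc s < r ->
        Normc.normc (\sum_(k < n) c k * s ^+ k - Phi s) @[n --> \oo] --> (0 : R),
      forall t : R, `|t| < r ->
        pressure (fun x => F x + t * G x) = (complex.Re (Phi t%:C%C))%:E /\
        complex.Im (Phi t%:C%C) = 0 &
      forall u : R, `|u| < r ->
        simple_maximal_eigenvalue theta (fun x => (F x +i* (u * G x))%C)
          (cexp (Phi (0 +i* u)%C))].

End pressure.

Section transfer_operators.
Variables (R : realType) (A : transition).
Local Notation X := (shift_space A).
Implicit Types f : X -> R.

Definition non_lattice f : Prop :=
  ~ exists (g0 g1 : R) (G : X -> R) (Z : X -> int),
      [/\ exists M : R, forall x, `|G x| <= M,
          exists M : int, forall x, `|Z x| <= M &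
          forall x, f x = G (left_shift x) - G x + g0 + g1 * (Z x)%:~R].

Definition transfer (s : R[i]) f : (X -> R[i]) -> (X -> R[i]) :=
  ruelle_op (fun x => s * cfun f x).

Definition contraction_estimate (theta Pf : R) f (eps rho a0 Aeps : R) : Prop :=
  forall (u : R) (n : nat), a0 <= `|u| ->
    let s := (- Pf +i* u)%C in
    (opnorm theta (norm_theta_u theta u) (iter n (transfer s f))
     <= (Aeps * rho ^+ n * (`|u| `^ eps))%:E)%E.

Definition weakly_contracting (theta Pf : R) f : Prop :=
  forall eps : R, 0 < eps -> exists a0 rho Aeps : R,
    [/\ 0 < a0, 0 < rho < 1, 0 < Aeps &
        contraction_estimate theta Pf f eps rho a0 Aeps].

Definition contraction_with (theta Pf : R) f (rho : R) : Prop :=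
  forall eps : R, 0 < eps -> exists a0 Aeps : R,
    [/\ 0 < a0, 0 < Aeps & contraction_estimate theta Pf f eps rho a0 Aeps].

Definition cylinder_fun (i : 'I_(kappa A)) : X -> R[i] :=
  fun x => if x 0%N == i then 1 else 0.

(* The estimate is required for n >= 2 only: for n = 1 its right-hand side is an
   empty sum, while the left-hand side need not vanish. *)
Definition ruelle_lemma_constant (theta : R) f (xi : 'I_(kappa A) -> X)
    (rho1 : R) : Prop :=
  forall a0 b0 eps : R, 0 < a0 -> 0 < b0 -> 0 < eps ->
  exists2 C : R, 0 < C &
  forall (n : nat) (t u : R), (2 <= n)%N -> `|t| <= a0 -> b0 <= `|u| ->
  let s := (t +i* u)%C in
  ((Normc.normc
      (\sum_(x \in [set x : X | iter n (@left_shift A) x = x])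
          cexp (s * (birkhoff f n x)%:C%C)
       - \sum_(i < kappa A) iter n (transfer s f) (cylinder_fun i) (xi i))%R)%:E
   <= (C * `|u|)%:E * \sum_(2 <= m < n.+1)
        opnorm theta (norm_theta theta) (iter (n - m) (transfer s f)) *
        (rho1 ^+ m *
         expR (m%:R * (eps + fine (pressure (fun x => t * f x)%R))))%:E)%E.

(* [counting] is the cardinality, with value +oo on infinite sets.  Periods m
   are positive. *)
Definition periodic_count f (alpha : R) (n : nat) (z p q epsn : R) : \bar R :=
  counting [set x : X | exists m : nat,
    [/\ (1 <= m)%N, iter m (@left_shift A) x = x &
        z + n%:R * alpha + p * epsn <= birkhoff f m x
          <= z + n%:R * alpha + q * epsn]].

End transfer_operators.

(* Main.v *)
(* Normalising the transfer operator of -P_f f by its Perron eigenfunction turns its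
twists by exp(iuf) into averaging operators M_u v (x) = sum_j p_j(x) exp(iuf(jx)) v(jx).
Near u = 0 a second conjugation, by the eigenfunction of M_u, gives weights close to
stochastic ones, and M_u^n decays like lambda(u)^n. For u in a compact set away from 0,
the weak contraction of M_{ku} for some integer k with |ku| large forces that of M_u:
if |M_u^n v| were close to 1, so would be |M_{ku}^n (v^k)|. For large |u| the weak
contraction itself applies. Periodic sums are traces over words; telescoping the trace
over the word length gives S_n(u) = sum_{sigma^n x = x} exp((-P_f + iu) f^n(x)), equal
to lambda(u)^n + o(1) near 0 and exponentially small in n, up to |u|^epsilon, elsewhere.

The pressure expansion gives lambda(u/sqrt n)^n exp(-iu alpha sqrt n) -> exp(-sigma_0^2 u^2/2).
Fourier inversion against a Gaussian-smoothed window yields a local limit theorem for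
f^n over periodic points in windows of width exp(-delta n).

A point counted by I(z,p,q;eps_n) has a period m between about n alpha/d1 and
n alpha/d0. By the local limit theorem the m-th contribution is at most
exp(P_f(z + n alpha)) eps_n / sqrt n times a Gaussian in (m - n) alpha / sqrt n plus o(1),
so summing over the O(n) possible m gives o(sqrt n) exp(P_f(z + n alpha)) eps_n; the upper
bound follows because d0 < d1 by the non-lattice hypothesis. For the lower bound,
each of K consecutive periods from n on contributes at least a fixed multiple of
exp(P_f(z + n alpha)) eps_n / sqrt n, and K is chosen large in terms of a. *)

Require Import Defs.
From HB Require Import structures.
From mathcomp Require Import all_boot all_order all_algebra.
From mathcomp Require Import all_classical all_reals all_analysis.
From mathcomp Require Import measurable_realfun complex ring lra zify.

Set Implicit Arguments.
Unset Strict Implicit.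
Unset Printing Implicit Defensive.

Import Order.TTheory GRing.Theory Num.Theory.
Import numFieldNormedType.Exports.

Local Open Scope classical_set_scope.
Local Open Scope ring_scope.

(** * Complex norms and words *)

(** The number 3 in the condition on [delta] counts the powers of the window width lost in Fourier
    inversion. At large frequencies the periodic sums are bounded by a multiple of
    [m rho^m |u|^(2+e)]: one factor [|u|] stands in Ruelle's lemma, the other is the price of
    passing from [norm_theta_u] to [norm_theta]. Integrating this up to the scale [1 / eps] costs
    [eps^(-3-e)]. Relevant periods are at least about [n alpha / d1], so a small [e] suffices as
    soon as [rho^(alpha / d1) < exp(- 3 delta)]. The two bounds of the theorem differ by a factor of
    order [n]. Comparing windows with Gaussians up to constants is therefore enough, provided that
    the lower constant does not depend on the number of periods used. One contraction theorem
    carries the operator part. It concerns chains of averaging operators whose weights may change at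
    every step; they may be complex, but must sum exactly to 1 and stay close to probabilities. It
    gives the Perron eigenfunction, the mixing at [u = 0] and the decay for small [u]; the last case
    is the reason for conjugating by eigenfunctions, which makes the sums exact. *)

Section complex_norm.
Variable R : realType.
Implicit Types z w : R[i].
Local Notation nc := (@Normc.normc R).

Lemma normc_ge0 z : 0 <= nc z.
Proof. by case: z => a b; exact: sqrtr_ge0. Qed.

Lemma normcD z w : nc (z + w) <= nc z + nc w.
Proof. exact: le_normcD. Qed.

Lemma normc_opp z : nc (- z) = nc z.
Proof. exact: normcN. Qed.

Lemma normc_subC z w : nc (z - w) = nc (w - z).
Proof. by rewrite -normc_opp opprB. Qed.

Lemma normcB z w : nc (z - w) <= nc z + nc w.
Proof. by rewrite -(normc_opp w) normcD. Qed.

Lemma normc_dist z w v : nc (z - w) <= nc (z - v) + nc (v - w).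
Proof. by rewrite -[z - w](subrKA v) normcD. Qed.

Lemma normc_lerB z w : nc z - nc w <= nc (z - w).
Proof. by rewrite lerBlDr -{1}(subrK w z) normcD. Qed.

Lemma normc_sum (I : Type) (r : seq I) (P : pred I) (F : I -> R[i]) :
  nc (\sum_(i <- r | P i) F i) <= \sum_(i <- r | P i) nc (F i).
Proof.
elim/big_rec2: _ => [|i y x _ h]; first by rewrite Normc.normc0.
by rewrite (le_trans (normcD _ _))// lerD2l.
Qed.

Lemma normc_real (x : R) : nc x%:C%C = `|x|.
Proof. by rewrite /= expr0n /= addr0 sqrtr_sqr. Qed.

Lemma normcX z n : nc (z ^+ n) = nc z ^+ n.
Proof.
by elim: n => [|n ih]; rewrite ?expr0 ?Normc.normc1// !exprS Normc.normcM ih.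
Qed.

Lemma normc_eq0 z : nc z = 0 -> z = 0.
Proof. exact: Normc.eq0_normc. Qed.

Lemma Re_le_normc z : `|complex.Re z| <= nc z.
Proof. by case: z => a b /=; rewrite -sqrtr_sqr ler_wsqrtr // lerDl sqr_ge0. Qed.

Lemma Im_le_normc z : `|complex.Im z| <= nc z.
Proof. by case: z => a b /=; rewrite -sqrtr_sqr ler_wsqrtr // lerDr sqr_ge0. Qed.

Lemma normc_le_ReIm z : nc z <= `|complex.Re z| + `|complex.Im z|.
Proof.
case: z => a b /=; rewrite -(@ler_pXn2r _ 2) ?nnegrE ?sqrtr_ge0 ?addr_ge0//.
rewrite sqr_sqrtr ?addr_ge0 ?sqr_ge0// sqrrD !real_normK ?num_real//.
by rewrite lerD2r lerDl mulrn_wge0 ?mulr_ge0.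
Qed.

Lemma ReD z w : complex.Re (z + w) = complex.Re z + complex.Re w.
Proof. by case: z => a b; case: w. Qed.

Lemma ImD z w : complex.Im (z + w) = complex.Im z + complex.Im w.
Proof. by case: z => a b; case: w. Qed.

Lemma ReB z w : complex.Re (z - w) = complex.Re z - complex.Re w.
Proof. by case: z => a b; case: w. Qed.

Lemma ImB z w : complex.Im (z - w) = complex.Im z - complex.Im w.
Proof. by case: z => a b; case: w. Qed.

Lemma Re_sum (I : Type) (r : seq I) (P : pred I) (F : I -> R[i]) :
  complex.Re (\sum_(i <- r | P i) F i) = \sum_(i <- r | P i) complex.Re (F i).
Proof. by rewrite (big_morph _ ReD (erefl : complex.Re (0 : R[i]) = 0)). Qed.

Lemma Im_sum (I : Type) (r : seq I) (P : pred I) (F : I -> R[i]) :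
  complex.Im (\sum_(i <- r | P i) F i) = \sum_(i <- r | P i) complex.Im (F i).
Proof. by rewrite (big_morph _ ImD (erefl : complex.Im (0 : R[i]) = 0)). Qed.

Lemma Re_realM (x : R) z : complex.Re (x%:C%C * z) = x * complex.Re z.
Proof. by case: z => a b /=; rewrite mul0r subr0. Qed.

Lemma Im_realM (x : R) z : complex.Im (x%:C%C * z) = x * complex.Im z.
Proof. by case: z => a b /=; rewrite mul0r addr0. Qed.

Definition cis (t : R) : R[i] := (cos t +i* sin t)%C.

Lemma normc_cis t : nc (cis t) = 1.
Proof. by rewrite /= cos2Dsin2 sqrtr1. Qed.

Lemma cis0 : cis 0 = 1.
Proof. by rewrite /cis cos0 sin0. Qed.

Lemma cisD s t : cis (s + t) = cis s * cis t.
Proof.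
rewrite /cis cosD sinD.
by rewrite -[RHS]/((_ +i* _)%C) [sin s * _ + _]addrC.
Qed.

Lemma cisX t n : cis t ^+ n = cis (n%:R * t).
Proof.
elim: n => [|n ih]; first by rewrite mul0r cis0.
by rewrite exprS ih -cisD -natr1 mulrDl mul1r addrC.
Qed.

Lemma lipschitz1_from_derive (g g' : R -> R) :
  (forall x : R, is_derive x (1 : R) g (g' x)) -> (forall x, `|g' x| <= 1) ->
  forall s t, `|g s - g t| <= `|s - t|.
Proof.
move=> dg g1 s t; wlog st : s t / s <= t => [h|].
  by have [/h//|/ltW/h] := leP s t; rewrite distrC (distrC t).
have cg : {within `[s, t], continuous g}.
  apply: continuous_subspaceT => x; apply: differentiable_continuous.
  by apply/derivable1_diffP; apply: ex_derive.
have [c _ h] := MVT_segment st (fun x _ => dg x) cg.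
by rewrite distrC h (distrC s) normrM ler_piMl.
Qed.

Lemma normc_cisB s t : nc (cis s - cis t) <= 2 * `|s - t|.
Proof.
rewrite (le_trans (normc_le_ReIm _))// mulr2n mulrDl mul1r ReB ImB /=.
apply: lerD.
  apply: (lipschitz1_from_derive (g' := fun x => - sin x)) => // x.
  by rewrite normrN sin_max.
by apply: (lipschitz1_from_derive (g' := cos)) => // x; rewrite cos_max.
Qed.

Lemma expR_sub_le (a b : R) : expR a - expR b <= expR a * (a - b).
Proof.
have e : expR a * expR (b - a) = expR b by rewrite -expRD addrC subrK.
have := expR_ge1Dx (b - a); rewrite -(@ler_pM2l _ (expR a)) ?expR_gt0//.
by rewrite e; lra.
Qed.

Lemma expR_sub_norm (a b : R) : `|expR a - expR b| <= expR a * expR `|a - b| * `|a - b|.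
Proof.
have h1 : 1 <= expR `|a - b| by rewrite -expR0 ler_expR.
have ha := expR_gt0 a.
rewrite ler_norml; apply/andP; split.
  rewrite lerNl opprB (le_trans (expR_sub_le _ _))//.
  have [ab|ab] := leP a b.
    rewrite (ler0_norm (x := a - b)) ?subr_le0// opprB.
    by rewrite ler_wpM2r ?subr_ge0// -expRD addrC subrK.
  apply: (@le_trans _ _ 0).
    by rewrite mulr_ge0_le0 ?expR_ge0// subr_le0 ltW.
  by rewrite !mulr_ge0 ?expR_ge0.
rewrite (le_trans (expR_sub_le _ _))//.
rewrite -mulrA ler_wpM2l ?expR_ge0// (le_trans (ler_norm _))//.
by rewrite ler_peMl.
Qed.

End complex_norm.

Section words.
Variable A : transition.
Local Notation X := (shift_space A).
Local Notation I := 'I_(kappa A).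
Local Notation sg := (@left_shift A).
Implicit Types (x y z : X) (j : I).

Lemma shift_ext x y : (forall i, x i = y i) -> x = y.
Proof.
case: x y => [x hx] [y hy] /= /funext exy; rewrite exy in hx *.
by rewrite (Prop_irrelevance hx hy).
Qed.

Definition adm j x := tmx A j (x 0%N) == 1%N.

Lemma pcons_coordP j x (h : adm j x) n :
  let c n := if n is k.+1 then x k else j in tmx A (c n) (c n.+1) = 1%N.
Proof. by case: n => [|n] /=; [exact/eqP | exact: coordP]. Qed.

(* The point j x; the value x is junk when the word j x is not admissible. *)
Definition pcons j x : X :=
  if pselect (adm j x) is left h then ShiftSpace (pcons_coordP h) else x.

Lemma pcons0 j x : adm j x -> pcons j x 0%N = j.
Proof. by rewrite /pcons; case: pselect. Qed.

Lemma pconsS j x n : adm j x -> pcons j x n.+1 = x n.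
Proof. by rewrite /pcons; case: pselect. Qed.

Lemma pconsK j x : adm j x -> sg (pcons j x) = x.
Proof. by move=> h; apply: shift_ext => i /=; rewrite pconsS. Qed.

Lemma adm_head x : adm (x 0%N) (sg x).
Proof. by apply/eqP; exact: coordP. Qed.

Lemma pcons_head x : pcons (x 0%N) (sg x) = x.
Proof.
have h := adm_head x.
by apply: shift_ext => -[|i]; rewrite ?pcons0 ?pconsS.
Qed.

Lemma agreeW m n x y : (m <= n)%N -> agree n x y -> agree m x y.
Proof. by move=> mn h i /leq_trans/(_ mn)/h. Qed.

Lemma agree_sym m x y : agree m x y -> agree m y x.
Proof. by move=> h i /h. Qed.

Lemma agree_adm m x y j : agree m.+1 x y -> adm j x = adm j y.
Proof. by move=> /(_ 0%N isT) h; rewrite /adm h. Qed.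

Lemma agree_pcons m x y j : adm j x -> adm j y -> agree m x y ->
  agree m.+1 (pcons j x) (pcons j y).
Proof. by move=> hx hy h [|i] im; rewrite ?pcons0 ?pconsS// h. Qed.

Lemma iter_shift m x i : iter m sg x i = x (m + i)%N.
Proof.
by elim: m i => [|m ih] i //; rewrite iterS /= ih addnS.
Qed.

Lemma ex_adm x : exists j, adm j x.
Proof.
have [[//|M] _ hM] := tmx_aperiodic A.
have := hM (x 0%N) (x 0%N); rewrite exprSr mxE lt0n sum_nat_eq0.
move=> /forallPn[j]; rewrite muln_eq0 negb_or => /andP[_ h].
by exists j; apply/eqP; have [h0|//] := tmx01 j (x 0%N); rewrite h0 in h.
Qed.

Lemma ex_path_pow M i x : (0 < (tmx A ^+ M) i (x 0%N))%N ->
  exists z, z 0%N = i /\ iter M sg z = x.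
Proof.
elim: M i => [|M ih] i.
  by rewrite expr0 mxE; case: eqVneq => // -> _; exists x.
rewrite exprS mxE lt0n sum_nat_eq0 => /forallPn[k].
rewrite muln_eq0 negb_or => /andP[hik]; rewrite -lt0n => /ih[z [zk hz]].
have ai : adm i z.
  by rewrite /adm zk; have [h0|->//] := tmx01 i k; rewrite h0 in hik.
by exists (pcons i z); rewrite pcons0// iterSr pconsK.
Qed.

(** By aperiodicity one symbol reaches both [x 0] and [y 0] in [M] steps, so [x] and [y] have
    preimages with a common first symbol. Prepending the same admissible symbols to both keeps them
    together for [k.+1] coordinates. *)
Lemma ex_close_preimages : exists M : nat, forall k x y, exists z z',
  [/\ iter (k + M) sg z = x, iter (k + M) sg z' = y & agree k.+1 z z'].
Proof.
have [M _ hM] := tmx_aperiodic A; exists M => k x y; elim: k => [|k].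
  pose i := x 0%N.
  have [z [z0 zx]] := ex_path_pow (hM i (x 0%N)).
  have [z' [z0' zy]] := ex_path_pow (hM i (y 0%N)).
  by exists z, z'; split => // -[]// _; rewrite z0.
move=> [z [z' [zx zy h]]]; have [j jz] := ex_adm z.
have jz' : adm j z' by rewrite -(agree_adm _ h).
exists (pcons j z), (pcons j z'); split; last exact: agree_pcons.
  by rewrite addSn iterSr pconsK.
by rewrite addSn iterSr pconsK.
Qed.

End words.

(** * Contraction of chains of weighted averaging operators *)

Section real_sequences.
Variable R : realType.

Lemma geometric_small (t e : R) : 0 <= t < 1 -> 0 < e -> exists k, t ^+ k <= e.
Proof.
move=> /andP[t0 t1] e0.
have := @cvg_expr R t; rewrite ger0_norm// => /(_ t1) /cvgrPdist_le /(_ _ e0).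
case=> k _ /(_ k (leqnn k)); rewrite sub0r normrN ger0_norm ?exprn_ge0// => h.
by exists k.
Qed.

Lemma geometric_cauchy (u : nat -> R) (C g : R) : 0 <= g < 1 ->
  (forall n, `|u n.+1 - u n| <= C * g ^+ n) ->
  exists L, forall n, `|u n - L| <= C / (1 - g) * g ^+ n.
Proof.
move=> /andP[g0 g1] hu; set B := C / (1 - g).
have C0 : 0 <= C by have := hu 0%N; rewrite expr0 mulr1; apply: le_trans.
have B0 : 0 <= B by rewrite divr_ge0// subr_ge0 ltW.
have BC n : B * g ^+ n - B * g ^+ n.+1 = C * g ^+ n.
  rewrite exprS mulrCA -[X in X - _]mul1r -mulrBl mulrCA mulrA; congr (_ * _).
  by rewrite /B divfK// subr_eq0 gt_eqF.
pose lo n := u n - B * g ^+ n; pose hi n := u n + B * g ^+ n.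
have lohi n : lo n <= hi n.
  by rewrite /lo /hi lerD2l ge0_cp// mulr_ge0// exprn_ge0.
have lo_step n : lo n <= lo n.+1.
  by have := hu n; have := BC n; rewrite /lo ler_norml => ? /andP[? ?]; lra.
have hi_step n : hi n.+1 <= hi n.
  by have := hu n; have := BC n; rewrite /hi ler_norml => ? /andP[? ?]; lra.
have lo_le m n : (m <= n)%N -> lo m <= lo n.
  by move=> mn; apply: (homo_leq (f := lo) (r := fun a b => a <= b)) mn => // ? ? ?; exact: le_trans.
have hi_le m n : (m <= n)%N -> hi n <= hi m.
  move=> /subnK <-; elim: (n - m)%N => [|k ih]//.
  by rewrite addSn (le_trans (hi_step _)).
have lohi2 m n : lo m <= hi n.
  rewrite (le_trans (lo_le m (maxn m n) _))// ?leq_maxl//.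
  by rewrite (le_trans (lohi _))// hi_le// leq_maxr.
have ubl : has_ubound (range lo) by exists (hi 0%N) => _ [m _ <-].
exists (sup (range lo)) => n.
have h1 : lo n <= sup (range lo) by apply: ub_le_sup => //; exists n.
have h2 : sup (range lo) <= hi n.
  by apply: ge_sup; [exists (lo 0%N), 0%N | move=> _ [m _ <-]].
by rewrite ler_norml; rewrite /lo /hi in h1 h2; apply/andP; split; lra.
Qed.

Lemma geometric_cauchy_complex (u : nat -> R[i]) (C g : R) : 0 <= g < 1 ->
  (forall n, Normc.normc (u n.+1 - u n) <= C * g ^+ n) ->
  exists L, forall n, Normc.normc (u n - L) <= 2 * (C / (1 - g)) * g ^+ n.
Proof.
move=> hg hu.
have [a ha] := @geometric_cauchy (fun n => complex.Re (u n)) C g hg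
  (fun n => le_trans (eq_ind _ (fun z => `|z| <= _) (Re_le_normc _) _ (ReB _ _)) (hu n)).
have [b hb] := @geometric_cauchy (fun n => complex.Im (u n)) C g hg
  (fun n => le_trans (eq_ind _ (fun z => `|z| <= _) (Im_le_normc _) _ (ImB _ _)) (hu n)).
exists (a +i* b)%C => n.
rewrite (le_trans (normc_le_ReIm _))// ReB ImB/=.
by rewrite -mulrA mulr2n mulrDl !mul1r lerD.
Qed.

(** Spreads a contraction by [g0] over [N] steps into a rate per step: Bernoulli's inequality for
    [1 - (1 - g0) / N.+1] serves all [n <= N] at once. *)
Lemma bernoulli_root (N : nat) (g0 : R) : 1 / 2 <= g0 < 1 ->
  exists2 g : R, 0 < g < 1 & forall n, (n <= N)%N -> g0 <= g ^+ n.
Proof.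
move=> /andP[g02 g01]; have N0 : 0 < N.+1%:R :> R by [].
pose h : R := (1 - g0) / N.+1%:R; have h0 : 0 < h by rewrite divr_gt0// subr_gt0.
have hN : N.+1%:R * h = 1 - g0 by rewrite mulrC divfK// gt_eqF.
have hb : h <= 1 - g0 by rewrite -hN ler_peMl ?(ltW h0)// ler1n.
have h1 : 0 <= 1 - h by lra.
exists (1 - h); first by apply/andP; split; lra.
have bern n : 1 - n%:R * h <= (1 - h) ^+ n.
  elim: n => [|n ih]; first by rewrite expr0 mul0r subr0.
  rewrite exprS (le_trans _ (ler_wpM2l h1 ih))// -natr1.
  have := mulr_ge0 (mulr_ge0 (ler0n R n) (ltW h0)) (ltW h0).
  by lra.
move=> n nN; apply: le_trans (bern n); rewrite -[g0 in leLHS](subKr 1) -hN lerD2l lerN2.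
by rewrite ler_wpM2r ?(ltW h0)// ler_nat leqW.
Qed.

(** The incomplete last block costs the factor 2, since [g] raised to fewer than [N] steps is still
    at least [g0 >= 1 / 2]. *)
Lemma block_geometric (N n : nat) (g0 g : R) : (0 < N)%N -> 1 / 2 <= g0 -> 0 < g ->
  (forall n, (n <= N)%N -> g0 <= g ^+ n) -> g0 ^+ (n %/ N) <= 2 * g ^+ n.
Proof.
move=> N0 g02 gpos gN; rewrite [n in leRHS](divn_eq n N) exprD mulnC.
have g00 : 0 <= g0 by lra.
have h3 : g0 ^+ (n %/ N) <= g ^+ (N * (n %/ N)).
  by rewrite exprM lerXn2r ?nnegrE ?exprn_ge0 ?(ltW gpos) ?gN.
have h5 : 0 <= g ^+ (N * (n %/ N)) by rewrite exprn_ge0// ltW.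
have h6 : 1 / 2 <= g ^+ (n %% N) by rewrite (le_trans g02)// gN// ltnW// ltn_pmod.
by have := ler_wpM2l h5 h6; lra.
Qed.

(** The inequality [(1 + e) * (1 - e) <= 1] turns the upper bound for [(1 + e) ^+ N] into
    Bernoulli's lower bound for [(1 - e) ^+ N]. *)
Lemma small_excess (N : nat) (s : R) : 0 < s -> exists2 e : R, 0 < e & (1 + e) ^+ N <= 1 + s.
Proof.
move=> s0; exists (s / ((N.+1)%:R * (1 + s))).
  by rewrite divr_gt0// mulr_gt0// ?ltr0n//; lra.
set e := _ / _.
have n0 : (0 : R) < (N.+1)%:R by rewrite ltr0n.
have e0 : 0 < e by rewrite divr_gt0// mulr_gt0//; lra.
have eN : (N.+1)%:R * e = s / (1 + s).
  by rewrite /e invfM mulrCA [X in _ * X]mulrA divff ?gt_eqF// mul1r.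
have Ne : N%:R * e <= s / (1 + s) by rewrite -eN ler_pM2r// ler_nat.
have s1 : s / (1 + s) < 1 by rewrite ltr_pdivrMr ?mul1r; lra.
have e1 : e < 1.
  by rewrite (le_lt_trans _ s1)// -eN ler_peMl ?(ltW e0)// ler1n.
have bern : 1 - N%:R * e <= (1 - e) ^+ N.
  move: e e0 e1 {eN Ne} => e e0 e1.
  elim: N {n0} => [|n ih]; first by rewrite expr0 mul0r subr0.
  have h1 : 0 <= 1 - e by lra.
  rewrite exprS (le_trans _ (ler_wpM2l h1 ih))//.
  rewrite -natr1; have : 0 <= n%:R * e * e by rewrite !mulr_ge0// ltW.
  by nra.
have h2 : (1 + e) ^+ N * (1 - e) ^+ N <= 1.
  by rewrite -exprMn exprn_ile1//; nra.
have h3 : (1 + s)^-1 <= (1 - e) ^+ N.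
  rewrite (le_trans _ bern)//.
  have : 1 - s / (1 + s) = (1 + s)^-1 by field; lra.
  by lra.
have h4 : (1 + e) ^+ N * (1 + s)^-1 <= 1.
  by rewrite (le_trans _ h2)// ler_wpM2l// exprn_ge0//; lra.
by rewrite -(mul1r (1 + s)) -ler_pdivrMr//; lra.
Qed.

End real_sequences.

Section contraction.
Variables (R : realType) (A : transition) (theta : R).
Hypotheses (t0 : 0 < theta) (t1 : theta < 1).
Local Notation X := (shift_space A).
Local Notation I := 'I_(kappa A).
Local Notation sg := (@left_shift A).
Local Notation nc := (@Normc.normc R).
Implicit Types (w : X -> R[i]) (p : I -> X -> R) (q : I -> X -> R[i]).
Implicit Types (c e D O K : R).

Definition weighted_op q w : X -> R[i] :=
  fun x => \sum_(j | adm j x) q j x * w (pcons j x).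

Definition normc_bound (B : R) w := forall x, nc (w x) <= B.

Definition osc_bound (O : R) w := forall x y, nc (w x - w y) <= O.

(** Only points with a common first symbol are compared: the same symbols can be prepended to both,
    so the averaging operators act on such pairs branch by branch. Other pairs are left to
    [osc_bound]. *)
Definition lip_bound (K : R) w :=
  forall m x y, agree m.+1 x y -> nc (w x - w y) <= K * theta ^+ m.+1.

Definition lip_weights (D : R) q := forall m x y, agree m.+1 x y ->
  \sum_(j | adm j x) nc (q j x - q j y) <= D * theta ^+ m.+1.

(** The complex weights [q] fix constants exactly while staying close to true transition
    probabilities [p]. Exactness makes an average depend on the oscillation of [w] alone; a defect
    in the sum would bring back the sup norm. *)
Definition near_stochastic (c e : R) p q :=
  [/\ forall x, \sum_(j | adm j x) p j x = 1,
      forall x j, adm j x -> c <= p j x,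
      forall x, \sum_(j | adm j x) q j x = 1 &
      forall x, \sum_(j | adm j x) nc (q j x - (p j x)%:C%C) <= e].

Lemma weighted_opB q w v x :
  weighted_op q (fun y => w y - v y) x = weighted_op q w x - weighted_op q v x.
Proof.
by rewrite /weighted_op -sumrB; apply: eq_bigr => j _; rewrite mulrBr.
Qed.

Lemma sum_weights_le c e p q : 0 < c -> near_stochastic c e p q ->
  forall x, \sum_(j | adm j x) nc (q j x) <= 1 + e.
Proof.
move=> c0 [p1 pc _ qp] x; rewrite -(p1 x).
apply: le_trans (lerD (lexx _) (qp x)); rewrite -big_split/=.
apply: ler_sum => j jx; have pj : 0 <= p j x by rewrite (le_trans (ltW c0))// pc.
rewrite -{1}(subrK (p j x)%:C%C (q j x)) (le_trans (normcD _ _))// addrC.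
by rewrite lerD2l normc_real ger0_norm.
Qed.

Lemma osc_ge0 O w : osc_bound O w -> 0 <= O.
Proof. by move=> /(_ point point); apply: le_trans; exact: normc_ge0. Qed.

Lemma weighted_op_osc c e p q w O :
  0 < c -> near_stochastic c e p q -> osc_bound O w ->
  forall x y, nc (weighted_op q w x - w y) <= (1 + e) * O.
Proof.
move=> c0 h hO x y; have [_ _ q1 _] := h.
have -> : weighted_op q w x - w y = \sum_(j | adm j x) q j x * (w (pcons j x) - w y).
  rewrite -[w y in LHS]mul1r -(q1 x) mulr_suml -sumrB.
  by apply: eq_bigr => j _; rewrite mulrBr.
apply: le_trans (normc_sum _ _ _) _.
apply: le_trans (ler_wpM2r (osc_ge0 hO) (sum_weights_le c0 h x)).
rewrite mulr_suml; apply: ler_sum => j _; rewrite Normc.normcM.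
by rewrite ler_wpM2l ?normc_ge0.
Qed.

(* The product coupling of the two averages charges the pair (z, z') with mass
   at least c ^+ 2. *)
Lemma weighted_op_pair c e p q w O :
  0 < c -> near_stochastic c e p q -> osc_bound O w ->
  forall z z', nc (weighted_op q w (sg z) - weighted_op q w (sg z'))
    <= (1 + 2 * e) * O - c ^+ 2 * (O - nc (w z - w z')).
Proof.
move=> c0 [p1 pc q1 qp] hO z z'; set x := sg z; set y := sg z'.
pose t i j : R := nc (w (pcons i x) - w (pcons j y)).
have p0 j u : adm j u -> 0 <= p j u by move=> ju; rewrite (le_trans (ltW c0))// pc.
pose E u := \sum_(j | adm j u) (q j u - (p j u)%:C%C) * (w (pcons j u) - w z).
pose P u := \sum_(j | adm j u) (p j u)%:C%C * w (pcons j u).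
have eE u : weighted_op q w u = P u + E u.
  rewrite /E (eq_bigr (fun j => q j u * w (pcons j u) - (p j u)%:C%C * w (pcons j u)
    - (q j u - (p j u)%:C%C) * w z)); last by move=> j _; ring.
  rewrite !sumrB -mulr_suml sumrB q1 -(rmorph_sum (real_complex R)) p1 subrr mul0r subr0.
  by rewrite addrC subrK.
have bE u : nc (E u) <= e * O.
  apply: le_trans (normc_sum _ _ _) _; apply: le_trans (ler_wpM2r (osc_ge0 hO) (qp u)).
  rewrite mulr_suml; apply: ler_sum => j _; rewrite Normc.normcM.
  by rewrite ler_wpM2l ?normc_ge0.
have PP : nc (P x - P y) <= \sum_(i | adm i x) \sum_(j | adm j y) p i x * p j y * t i j.
  have -> : P x - P y = \sum_(i | adm i x) \sum_(j | adm j y)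
      (p i x * p j y)%:C%C * (w (pcons i x) - w (pcons j y)).
    under eq_bigr => i _ do (under eq_bigr => j _ do rewrite mulrBr; rewrite sumrB).
    rewrite sumrB; congr (_ - _).
      apply: eq_bigr => i _; rewrite -mulr_suml; congr (_ * _).
      by rewrite -(rmorph_sum (real_complex R)) -mulr_sumr p1 mulr1.
    rewrite exchange_big/=; apply: eq_bigr => j _; rewrite -mulr_suml; congr (_ * _).
    by rewrite -(rmorph_sum (real_complex R)) -mulr_suml p1 mul1r.
  apply: le_trans (normc_sum _ _ _) _; apply: ler_sum => i ix.
  apply: le_trans (normc_sum _ _ _) _; apply: ler_sum => j jy.
  by rewrite Normc.normcM normc_real ger0_norm// mulr_ge0// p0.
have S1 : \sum_(i | adm i x) \sum_(j | adm j y) p i x * p j y * O = O.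
  under eq_bigr => i _ do rewrite -mulr_suml -mulr_sumr p1 mulr1.
  by rewrite -mulr_suml p1 mul1r.
have tO i j : 0 <= O - t i j by rewrite subr_ge0; exact: hO.
have S2 : c ^+ 2 * (O - nc (w z - w z')) <=
    \sum_(i | adm i x) \sum_(j | adm j y) p i x * p j y * (O - t i j).
  have ax : adm (z 0%N) x := adm_head z; have ay : adm (z' 0%N) y := adm_head z'.
  rewrite (bigD1 (z 0%N))//= (bigD1 (z' 0%N))//= -addrA ler_wpDr//; last first.
    rewrite /t !pcons_head ler_wpM2r ?subr_ge0//.
    by rewrite expr2 ler_pM ?(ltW c0) ?pc.
  rewrite addr_ge0// ?sumr_ge0// => [j /andP[jy _]|i /andP[ix _]].
    by rewrite !mulr_ge0// p0.
  by rewrite sumr_ge0// => j jy; rewrite !mulr_ge0// p0.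
have S3 : \sum_(i | adm i x) \sum_(j | adm j y) p i x * p j y * t i j =
    O - \sum_(i | adm i x) \sum_(j | adm j y) p i x * p j y * (O - t i j).
  rewrite -{1}S1 -sumrB; apply: eq_bigr => i _.
  by rewrite -sumrB; apply: eq_bigr => j _; ring.
have -> : weighted_op q w x - weighted_op q w y = (P x - P y) + (E x - E y).
  by rewrite !eE; ring.
have h1 := normcD (P x - P y) (E x - E y); have h2 := normcB (E x) (E y).
by have := bE x; have := bE y; lra.
Qed.

(** At both points the weights sum to 1, so the differences of weights sum to 0 and [w] may be
    replaced by [w - w x] in front of them. This term then costs [D * O], with the oscillation
    instead of the sup norm. *)
Lemma weighted_op_lip c e D p q w O K :
  0 < c -> near_stochastic c e p q -> lip_weights D q ->
  osc_bound O w -> lip_bound K w -> 0 <= K ->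
  lip_bound ((1 + e) * theta * K + D * O) (weighted_op q w).
Proof.
move=> c0 h hD hO hK K0 m x y xy; have [_ _ q1 _] := h.
pose a := w x.
have eqy : weighted_op q w y = \sum_(j | adm j x) q j y * w (pcons j y).
  by apply: eq_bigl => j; rewrite (agree_adm _ xy).
have s0 : \sum_(j | adm j x) (q j x - q j y) = 0.
  rewrite sumrB q1 (eq_bigl (fun j => adm j y)) ?q1 ?subrr// => j.
  by rewrite (agree_adm _ xy).
have -> : weighted_op q w x - weighted_op q w y =
    \sum_(j | adm j x) q j x * (w (pcons j x) - w (pcons j y)) +
    \sum_(j | adm j x) (q j x - q j y) * (w (pcons j y) - a).
  rewrite eqy -[RHS]big_split/= [RHS](eq_bigr (fun j => q j x * w (pcons j x) -
    q j y * w (pcons j y) - (q j x - q j y) * a)); last by move=> j _; ring.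
  by rewrite sumrB -mulr_suml s0 mul0r subr0 sumrB.
apply: le_trans (normcD _ _) _; rewrite mulrDl; apply: lerD.
  apply: le_trans (normc_sum _ _ _) _.
  have -> : (1 + e) * theta * K * theta ^+ m.+1 = (1 + e) * (K * theta ^+ m.+2).
    by rewrite !exprS; ring.
  have kt : 0 <= K * theta ^+ m.+2 by rewrite mulr_ge0// exprn_ge0// ltW.
  apply: le_trans (ler_wpM2r kt (sum_weights_le c0 h x)).
  rewrite mulr_suml; apply: ler_sum => j jx; rewrite Normc.normcM.
  rewrite ler_wpM2l ?normc_ge0//; apply: hK; apply: agree_pcons => //.
  by rewrite -(agree_adm _ xy).
apply: le_trans (normc_sum _ _ _) _; rewrite mulrAC.
apply: le_trans (ler_wpM2r (osc_ge0 hO) (hD m x y xy)).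
rewrite mulr_suml; apply: ler_sum => j jx; rewrite Normc.normcM.
by rewrite ler_wpM2l ?normc_ge0//; exact: hO.
Qed.

Section chain.
Variables (c e D : R) (p : nat -> I -> X -> R) (q : nat -> I -> X -> R[i]).
Variable w : nat -> X -> R[i].
Hypotheses (c0 : 0 < c) (c1 : c <= 1) (e0 : 0 <= e) (D0 : 0 <= D).
Hypothesis hpq : forall n, near_stochastic c e (p n) (q n).
Hypothesis hq : forall n, lip_weights D (q n).
Hypothesis hw : forall n x, w n.+1 x = weighted_op (q n) (w n) x.

Let funw n : w n.+1 = weighted_op (q n) (w n).
Proof. by apply/funext => x; rewrite hw. Qed.

Lemma chain_osc O n k : osc_bound O (w k) -> osc_bound ((1 + 2 * e) ^+ n * O) (w (n + k)%N).
Proof.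
move=> hO; elim: n => [|n ih]; first by rewrite expr0 mul1r.
move=> x y; have [j jx] := ex_adm x; have [i iy] := ex_adm y.
rewrite addSn funw -(pconsK jx) -(pconsK iy).
apply: le_trans (weighted_op_pair c0 (hpq _) ih _ _) _.
rewrite [X in _ <= X * O]exprS -[X in _ <= X]mulrA lerBlDr lerDl mulr_ge0 ?exprn_ge0 ?(ltW c0)// subr_ge0.
exact: ih.
Qed.

Lemma chain_pair O n k z z' : osc_bound O (w k) ->
  nc (w (n + k)%N (iter n sg z) - w (n + k)%N (iter n sg z')) <=
  (1 + 2 * e) ^+ n * O - (c ^+ 2) ^+ n * (O - nc (w k z - w k z')).
Proof.
move=> hO; elim: n => [|n ih].
  by rewrite !expr0 !mul1r /= opprB addrCA subrr addr0.
rewrite addSn funw !iterS.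
apply: le_trans (weighted_op_pair c0 (hpq _) (chain_osc n hO) _ _) _.
have := ler_wpM2l (sqr_ge0 c) ih.
move: (c ^+ 2) => c2; rewrite !exprS.
move: ((1 + 2 * e) ^+ n) (c2 ^+ n) (nc _) (nc _) => a b u v h.
have -> : (1 + 2 * e) * (a * O) - c2 * (a * O - v) =
  (1 + 2 * e) * a * O - c2 * (a * O) + c2 * v by ring.
have -> : (1 + 2 * e) * a * O - c2 * b * (O - u) =
  (1 + 2 * e) * a * O - c2 * (a * O) + c2 * (a * O - b * (O - u)) by ring.
by rewrite lerD2l.
Qed.

(** A Lasota-Yorke inequality: the initial constant is contracted, and what the weights create at
    each step is controlled by the oscillation and summed geometrically. *)
Lemma chain_lip O K n k : (1 + e) * theta < 1 -> 0 <= K ->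
  osc_bound O (w k) -> lip_bound K (w k) ->
  lip_bound (((1 + e) * theta) ^+ n * K +
    D * ((1 + 2 * e) ^+ n * O) / (1 - (1 + e) * theta)) (w (n + k)%N).
Proof.
set s := (1 + e) * theta => s1 K0 hO hK; have e0' := e0.
have s0 : 0 < s by rewrite mulr_gt0 ?t0//; lra.
have O0 := osc_ge0 hO.
have pos n' : 0 <= s ^+ n' * K + D * ((1 + 2 * e) ^+ n' * O) / (1 - s).
  have h1 : 0 <= (1 + 2 * e) by lra.
  by rewrite addr_ge0// ?divr_ge0// ?mulr_ge0// ?exprn_ge0// ?(ltW s0)// subr_ge0 ltW.
elim: n => [|n ih].
  move=> m x y xy; rewrite !expr0 !mul1r (le_trans (hK m x y xy))//.
  rewrite ler_wpM2r ?exprn_ge0 ?(ltW t0)// lerDl divr_ge0// ?mulr_ge0// subr_ge0 ltW//.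
rewrite addSn funw => m x y xy.
apply: le_trans (weighted_op_lip c0 (hpq _) (hq _) (chain_osc n hO) ih (pos n) xy) _.
rewrite ler_wpM2r ?exprn_ge0 ?(ltW t0)// -/s.
set a := (1 + 2 * e) ^+ n * O; have a0 : 0 <= a.
  by rewrite mulr_ge0// exprn_ge0//; lra.
have -> : s * (s ^+ n * K + D * a / (1 - s)) + D * a = s ^+ n.+1 * K + D * a / (1 - s).
  by rewrite exprS; field; lra.
rewrite lerD2l ler_wpM2r ?invr_ge0 ?subr_ge0 ?(ltW s1)// ler_wpM2l//.
rewrite exprS -mulrA -/a ler_peMl//; lra.
Qed.

End chain.

(** The order of the choices matters. The midpoint [s2] of [theta] and 1 dominates [(1 + e) * theta]
    for every admissible [e], so [L] and the depth [k] depend on [theta] and [D] only. They fix the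
    block length and the coupling mass [b]; the perturbation [e] comes last, small enough for its
    growth over a block to stay below [b / 4]. *)
Lemma contraction_constants (c D : R) (M : nat) : 0 < c <= 1 -> 0 <= D ->
  exists (e g L : R) (k : nat),
  let b : R := (c ^+ 2) ^+ (k.+1 + M) in let i : R := (4 * (16 * L + 1))^-1 in
  [/\ [/\ 0 < e, (1 + e) * theta < 1, 0 <= L & D / (1 - (1 + e) * theta) <= 2 * L],
      0 < g < 1 /\ 0 < b <= 1,
      forall n, (n <= k.+1 + M)%N -> 1 - b / 4 <= g ^+ n,
      forall n, (n <= k.+1 + M)%N -> (1 + 2 * e) ^+ n <= 1 + b / 4
    & theta ^+ k.+2 <= i /\ ((1 + e) * theta) ^+ (k.+1 + M) <= i].
Proof.
move=> /andP[c0 c1] D0; have [t0' t1'] := (t0, t1).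
pose s2 : R := (1 + theta) / 2; have [s20 s21] : 0 <= s2 /\ s2 < 1 by split; rewrite /s2; lra.
pose L : R := D / (1 - theta); have L0 : 0 <= L by rewrite divr_ge0// subr_ge0 ltW.
pose i : R := (4 * (16 * L + 1))^-1.
have [k hk] : exists k, s2 ^+ k <= i.
  by apply: geometric_small; rewrite ?s20// invr_gt0; lra.
have s2n n : (k <= n)%N -> s2 ^+ n <= i.
  by move=> kn; rewrite (le_trans _ hk)// ler_wiXn2l// ltW.
pose N := (k.+1 + M)%N; pose b : R := (c ^+ 2) ^+ N.
have b0 : 0 < b by rewrite !exprn_gt0.
have b1 : b <= 1 by rewrite !exprn_ile1 ?sqr_ge0// ltW.
have [e' e'0 he'] := small_excess N (divr_gt0 b0 (ltr0n _ 4)).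
pose e : R := Order.min (e' / 2) ((1 - theta) / 2).
have e0 : 0 < e by rewrite lt_min; apply/andP; split; rewrite divr_gt0// subr_gt0.
have ee' : 2 * e <= e'.
  by have : e <= e' / 2; [rewrite ge_min lexx | lra].
have e2 : e <= (1 - theta) / 2 by rewrite ge_min lexx orbT.
have st2 : (1 + e) * theta <= s2 by rewrite /s2; nra.
have st0 : 0 <= (1 + e) * theta by rewrite mulr_ge0 ?(ltW t0)//; lra.
have g02 : 1 / 2 <= 1 - b / 4 < 1 by apply/andP; split; lra.
have [g g01 hg] := bernoulli_root N g02.
exists e, g, L, k; split => //.
- split => //; first exact: le_lt_trans s21.
  have -> : 2 * L = D / (1 - s2) by rewrite /L /s2; field; do ?(apply/andP; split); lra.
  by rewrite ler_wpM2l// lef_pV2 ?posrE; lra.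
- by rewrite b0.
- move=> n nN; apply: le_trans he'.
  apply: (@le_trans _ _ ((1 + e') ^+ n)); first by rewrite lerXn2r ?nnegrE//; lra.
  by rewrite ler_weXn2l//; lra.
- split.
    rewrite (@le_trans _ _ (s2 ^+ k.+2)) ?s2n ?leqW//.
    by rewrite lerXn2r ?nnegrE ?(ltW t0)// /s2; lra.
  rewrite (@le_trans _ _ (s2 ^+ N)) ?s2n// ?lerXn2r ?nnegrE//.
  by rewrite /N addSn ltnW// ltnS leq_addr.
Qed.

Section blocks.
Variables (c e g L D : R) (k M : nat).
Let N := (k.+1 + M)%N.
Let b : R := (c ^+ 2) ^+ N.
(** The slope of an invariant cone. After a block the inherited Lipschitz constant is at most
    [O' / 4] and the newly created one at most [4 * L * O']; their sum is below half of [Ks * O'],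
    while the oscillation keeps the factor [1 - b / 4 >= 1 / 2]. *)
Let Ks : R := 16 * L + 1.
Hypotheses (c0 : 0 < c) (D0 : 0 <= D) (e0 : 0 < e) (st1 : (1 + e) * theta < 1).
Hypotheses (L0 : 0 <= L) (DL : D / (1 - (1 + e) * theta) <= 2 * L) (g01 : 0 < g < 1).
Hypotheses (b01 : 0 < b <= 1) (gN : forall n, (n <= N)%N -> 1 - b / 4 <= g ^+ n).
Hypothesis aN : forall n, (n <= N)%N -> (1 + 2 * e) ^+ n <= 1 + b / 4.
Hypotheses (tk : theta ^+ k.+2 <= (4 * Ks)^-1) (stN : ((1 + e) * theta) ^+ N <= (4 * Ks)^-1).
Hypothesis hM : forall x y, exists z z',
  [/\ iter N sg z = x, iter N sg z' = y & agree k.+2 z z'].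
Variables (p : nat -> I -> X -> R) (q : nat -> I -> X -> R[i]) (w : nat -> X -> R[i]).
Hypotheses (hpq : forall n, near_stochastic c e (p n) (q n)).
Hypotheses (hq : forall n, lip_weights D (q n)).
Hypothesis hw : forall n x, w n.+1 x = weighted_op (q n) (w n) x.

Let Ks1 : 1 <= Ks. Proof. by rewrite lerDr mulr_ge0. Qed.
Let Ks0 : 0 <= Ks. Proof. exact: le_trans Ks1. Qed.
Let iKs : (4 * Ks)^-1 * Ks = 1 / 4.
Proof. by field; rewrite gt_eqF// (lt_le_trans _ Ks1). Qed.

Let memory_bound (O' : R) n : (n <= N)%N -> 0 <= O' ->
  D * ((1 + 2 * e) ^+ n * O') / (1 - (1 + e) * theta) <= 4 * L * O'.
Proof.
move=> nN O'0; have e0' := e0; have h : (1 + 2 * e) ^+ n <= 2.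
  by apply: le_trans (aN nN) _; case/andP: b01 => _ ?; lra.
rewrite mulrAC (_ : 4 * L * O' = 2 * L * (2 * O')); last by ring.
apply: ler_pM => //; last by rewrite ler_wpM2r.
- by rewrite divr_ge0// subr_ge0 ltW.
- by rewrite mulr_ge0// exprn_ge0//; lra.
Qed.

(* A block of N steps contracts the cone of oscillation and Lipschitz bounds of the
   form (O', Ks O') by 1 - b / 4. *)
Let block_osc (O' : R) n : osc_bound O' (w n) -> lip_bound (Ks * O') (w n) ->
  osc_bound ((1 - b / 4) * O') (w (N + n)%N).
Proof.
move=> h1 h2; have O'0 := osc_ge0 h1.
move=> x y; have [z [z' [zx zy zz]]] := hM x y.
rewrite -zx -zy; apply: le_trans (chain_pair c0 hpq hw N z z' h1) _.
have d2 : nc (w n z - w n z') <= O' / 2.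
  apply: le_trans (h2 _ _ _ zz) _.
  rewrite (le_trans (ler_wpM2l _ tk)) ?mulr_ge0// mulrAC [Ks * _]mulrC iKs; lra.
rewrite -/b; have := ler_wpM2r O'0 (aN (leqnn N)).
by case/andP: b01 => b0 _; have := ler_wpM2l (ltW b0) d2; set u := nc _; nra.
Qed.

Let block_lip (O' : R) n : osc_bound O' (w n) -> lip_bound (Ks * O') (w n) ->
  lip_bound (Ks * ((1 - b / 4) * O')) (w (N + n)%N).
Proof.
move=> h1 h2; have O'0 := osc_ge0 h1.
have KO0 : 0 <= Ks * O' by rewrite mulr_ge0.
move=> m x y xy; apply: le_trans (chain_lip c0 (ltW e0) D0 hpq hq hw N st1 KO0 h1 h2 xy) _.
rewrite ler_wpM2r ?exprn_ge0 ?(ltW t0)//.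
have := memory_bound (leqnn N) O'0.
have := ler_wpM2r KO0 stN; rewrite [(4 * Ks)^-1 * _]mulrA iKs.
have : Ks * (1 / 2 * O') <= Ks * ((1 - b / 4) * O').
  by rewrite ler_wpM2l// ler_wpM2r//; case/andP: b01 => _ ?; lra.
have := mulr_ge0 L0 O'0; have : Ks * (1 / 2 * O') = 8 * (L * O') + 1 / 2 * O' by rewrite /Ks; field.
by move: (Ks * (1 / 2 * O')) (Ks * ((1 - b / 4) * O')) => ? ?; lra.
Qed.

Let all_blocks O K a : osc_bound O (w 0%N) -> lip_bound K (w 0%N) -> 0 <= K ->
  osc_bound ((1 - b / 4) ^+ a * (O + K)) (w (a * N)%N) /\
  lip_bound (Ks * ((1 - b / 4) ^+ a * (O + K))) (w (a * N)%N).
Proof.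
move=> hO hK K0; have O0 := osc_ge0 hO.
elim: a => [|a [ih1 ih2]].
  rewrite expr0 mul1r mul0n; split.
    by move=> x y; rewrite (le_trans (hO x y))// lerDl.
  move=> m x y xy; rewrite (le_trans (hK m x y xy))// ler_wpM2r ?exprn_ge0 ?(ltW t0)//.
  by rewrite (@le_trans _ _ (O + K)) ?lerDr// ler_peMl// addr_ge0.
have := block_lip ih1 ih2; have := block_osc ih1 ih2.
by rewrite -mulSn exprS mulrA.
Qed.

Let block_rate n (T : R) : 0 <= T -> (1 - b / 4) ^+ (n %/ N) * T <= 2 * (T * g ^+ n).
Proof.
move=> T0; rewrite mulrC mulrCA ler_wpM2l//.
case/andP: b01 => b0 b1; case/andP: g01 => g0 _.
by apply: block_geometric => //; lra.
Qed.

Lemma chain_contraction_block O K n :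
  osc_bound O (w 0%N) -> lip_bound K (w 0%N) -> 0 <= K ->
  osc_bound (4 * Ks * (O + K) * g ^+ n) (w n) /\ lip_bound (4 * Ks * (O + K) * g ^+ n) (w n).
Proof.
move=> hO hK K0; have O0 := osc_ge0 hO.
have nr : (n %% N <= N)%N by rewrite ltnW// ltn_mod.
have [h1 h2] := all_blocks (n %/ N) hO hK K0.
have O'n := block_rate n (addr_ge0 O0 K0); have O'0 := osc_ge0 h1.
set O' := _ * (O + K) in h1 h2 O'n O'0.
have KO0 : 0 <= Ks * O' by rewrite mulr_ge0.
have KO : Ks * O' <= Ks * (2 * ((O + K) * g ^+ n)) by rewrite ler_wpM2l.
rewrite (_ : w n = w (n %% N + n %/ N * N)%N); last by rewrite addnC -divn_eq.
split.
  move=> x y; apply: le_trans (chain_osc c0 hpq hw (n %% N) h1 x y) _.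
  apply: (@le_trans _ _ (2 * O')).
    by rewrite ler_wpM2r// (le_trans (aN nr))//; case/andP: b01 => _ ?; lra.
  have : O' <= Ks * O' by rewrite ler_peMl.
  rewrite -!mulrA; lra.
move=> m x y xy.
apply: le_trans (chain_lip c0 (ltW e0) D0 hpq hq hw (n %% N) st1 KO0 h1 h2 xy) _.
rewrite ler_wpM2r ?exprn_ge0 ?(ltW t0)//.
have := memory_bound nr O'0.
have : ((1 + e) * theta) ^+ (n %% N) * (Ks * O') <= Ks * O'.
  by rewrite ler_piMl// exprn_ile1 ?(ltW st1)// mulr_ge0 ?(ltW t0)// addr_ge0 ?(ltW e0).
have : 4 * L * O' <= Ks * O' by have := L0 => ?; rewrite ler_wpM2r// /Ks; lra.
rewrite -!mulrA; lra.
Qed.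

End blocks.

(** The rate depends on [c] and [D] (and on [theta] and the matrix), not on the chain, and the
    weights may vary with [n]. The varying weights serve the construction of the Perron
    eigenfunction; the complex ones serve the conjugated twisted operators. *)
Theorem chain_contraction (c D : R) : 0 < c <= 1 -> 0 <= D -> exists e g C : R,
  [/\ 0 < e, 0 < g < 1, 0 < C &
  forall (p : nat -> I -> X -> R) (q : nat -> I -> X -> R[i]) (w : nat -> X -> R[i]),
  (forall n, near_stochastic c e (p n) (q n)) -> (forall n, lip_weights D (q n)) ->
  (forall n x, w n.+1 x = weighted_op (q n) (w n) x) ->
  forall O K, osc_bound O (w 0%N) -> lip_bound K (w 0%N) -> 0 <= K ->
  forall n, osc_bound (C * (O + K) * g ^+ n) (w n) /\ lip_bound (C * (O + K) * g ^+ n) (w n)].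
Proof.
move=> c01 D0; have [M hM] := ex_close_preimages A.
have [e [g [L [k]]]] := contraction_constants M c01 D0.
move=> [[e0 st1 L0 DL] [g01 b01] gN aN [tk stN]]; case/andP: c01 => c0 _.
exists e, g, (4 * (16 * L + 1)); split => //; first by rewrite mulr_gt0// ltr_wpDl// mulr_ge0.
move=> p q w hpq hq hw O K hO hK K0 n.
have hMk x y := hM k.+1 x y.
exact: (chain_contraction_block c0 D0 e0 st1 L0 DL g01 b01 gN aN tk stN hMk hpq hq hw n hO hK K0).
Qed.

End contraction.

(** * Perron eigenfunction *)

Section geometric_limits.
Variable R : realType.

Lemma geometric_cvg (u : nat -> R) (L C g : R) : 0 <= g < 1 ->
  (forall n, `|u n - L| <= C * g ^+ n) -> u n @[n --> \oo] --> L.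
Proof.
move=> /andP[g0 g1] hu.
have h0 : C * g ^+ n @[n --> \oo] --> 0.
  rewrite -[X in _ --> X](mulr0 C); apply: cvgMl_tmp => //.
  by apply: cvg_expr; rewrite ger0_norm.
have h1 : (fun n => u n - L) @ \oo --> 0.
  apply/norm_cvg0P; apply: squeeze_cvgr h0; last exact: cvg_cst.
  by apply: nearW => n; rewrite normr_ge0 hu.
rewrite -[L]add0r; rewrite (_ : (fun n => u n) = (fun n => (u n - L) + L)); last first.
  by apply/funext => n; rewrite subrK.
by apply: cvgD => //; exact: cvg_cst.
Qed.

Lemma ratio_norm_le (a b s : R) : 0 <= a -> 0 <= b -> 0 <= s ->
  a <= expR s * b -> b <= expR s * a -> `|a - b| <= s * expR s * (a + b).
Proof.
move=> a0 b0 s0 ab ba; have := expR_sub_le s 0; rewrite expR0 subr0 => h.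
have h' := expR_gt0 s.
have ka : (expR s - 1) * a <= s * expR s * a by rewrite ler_wpM2r// mulrC.
have kb : (expR s - 1) * b <= s * expR s * b by rewrite ler_wpM2r// mulrC.
have pa : 0 <= s * expR s * a by rewrite !mulr_ge0// ltW.
have pb : 0 <= s * expR s * b by rewrite !mulr_ge0// ltW.
by rewrite ler_norml; apply/andP; split; nra.
Qed.

End geometric_limits.

Section perron.
Variables (R : realType) (A : transition) (theta : R).
Hypotheses (t0 : 0 < theta) (t1 : theta < 1).
Local Notation X := (shift_space A).
Local Notation I := 'I_(kappa A).
Local Notation sg := (@left_shift A).

(** Multiplicative regularity is preserved by sums of positive functions and by pointwise limits,
    and it is insensitive to normalisation; hence one constant can hold for all iterates of a
    positive operator. *)
Definition log_lip (E : R) (g : X -> R) := forall m x y, agree m.+1 x y ->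
  g x <= expR (E * theta ^+ m.+1) * g y.

Variables (phi : X -> R) (F : R).
Hypothesis F0 : 0 <= F.
Hypothesis hF : forall m x y, agree m x y -> `|phi x - phi y| <= F * theta ^+ m.

Let B : R := `|phi point| + F.

Let B0 : 0 <= B. Proof. by rewrite /B addr_ge0. Qed.

Let phiB x : `|phi x| <= B.
Proof.
rewrite -[phi x](subrK (phi point)) (le_trans (ler_normD _ _))// addrC lerD2l.
by have := @hF 0 x point; rewrite expr0 mulr1; apply.
Qed.

Let aup x : expR (phi x) <= expR B.
Proof. by rewrite ler_expR (le_trans (ler_norm _)). Qed.

Let alow x : expR (- B) <= expR (phi x).
Proof. by rewrite ler_expR lerNl (le_trans (ler_norm _))// normrN. Qed.

Let real_op (v : X -> R) x := \sum_(j | adm j x) expR (phi (pcons j x)) * v (pcons j x).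

Let l n := iter n real_op (fun=> 1).

Let lS n x : l n.+1 x = \sum_(j | adm j x) expR (phi (pcons j x)) * l n (pcons j x).
Proof. by []. Qed.

Let l_gt0 n x : 0 < l n x.
Proof.
elim: n x => [|n ih] x; first exact: ltr01.
have [j jx] := ex_adm x; rewrite lS (bigD1 j)//= ltr_wpDr//; last by rewrite mulr_gt0 ?expR_gt0.
by apply: sumr_ge0 => i _; rewrite mulr_ge0 ?expR_ge0// ltW.
Qed.

(** The solution of [E = F * theta + E * theta]: one application of the operator adds the variation
    of [phi] on the new symbol and contracts the earlier one. *)
Let E : R := F * theta / (1 - theta).

Let E0 : 0 <= E.
Proof. by rewrite /E divr_ge0 ?subr_ge0 ?mulr_ge0// ltW. Qed.

Let phi_ratio m j x y : adm j x -> adm j y -> agree m.+1 x y ->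
  expR (phi (pcons j x)) <= expR (F * theta * theta ^+ m.+1) * expR (phi (pcons j y)).
Proof.
move=> jx jy xy; rewrite -expRD ler_expR -lerBlDr -mulrA -exprS.
by rewrite (le_trans (ler_norm _))// hF//; exact: agree_pcons.
Qed.

Let l_log_lip n : log_lip E (l n).
Proof.
have t1' := t1.
elim: n => [|n ih] m x y xy.
  rewrite mulr1 -[X in X <= _]expR0 ler_expR mulr_ge0// exprn_ge0// ltW//.
rewrite !lS mulr_sumr (eq_bigl (fun j => adm j y)); last first.
  by move=> j; rewrite (agree_adm _ xy).
apply: ler_sum => j jy; have jx : adm j x by rewrite (agree_adm _ xy).
have -> : E * theta ^+ m.+1 = F * theta * theta ^+ m.+1 + E * theta ^+ m.+2.
  by rewrite exprS [theta ^+ m.+2]exprS exprS /E; field; lra.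
rewrite expRD mulrACA; apply: ler_pM; rewrite ?expR_ge0 ?(ltW (l_gt0 _ _))//.
  exact: phi_ratio.
by apply: ih; exact: agree_pcons.
Qed.

Let k : R := (kappa A)%:R.

Let k1 : 1 <= k.
Proof. by rewrite /k ler1n (leq_trans _ (kappa_ge2 A)). Qed.

Let sum_adm_le (G : I -> R) (S : R) x : 0 <= S -> (forall j, adm j x -> G j <= S) ->
  \sum_(j | adm j x) G j <= k * S.
Proof.
move=> S0 h; apply: (@le_trans _ _ (\sum_(j | adm j x) S)); first exact: ler_sum.
rewrite (le_trans (_ : _ <= \sum_(j : I) S))//.
  by rewrite [leRHS](bigID (fun j => adm j x))/= lerDl sumr_ge0.
by rewrite sumr_const card_ord mulr_natl.
Qed.

Let l_up n N S : 0 <= S -> (forall z, l n z <= S) -> forall x, l (N + n)%N x <= (k * expR B) ^+ N * S.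
Proof.
move=> S0 hS; elim: N => [|N ih] x; first by rewrite expr0 mul1r.
rewrite addSn lS exprS -!mulrA; apply: sum_adm_le.
  by rewrite !mulr_ge0 ?expR_ge0// exprn_ge0// mulr_ge0 ?expR_ge0// (le_trans ler01).
by move=> j _; rewrite ler_pM ?expR_ge0// ltW.
Qed.

Let l_low n N z : expR (- B) ^+ N * l n z <= l (N + n)%N (iter N sg z).
Proof.
elim: N => [|N ih]; first by rewrite expr0 mul1r.
have ax := adm_head (iter N sg z).
rewrite addSn lS iterS (bigD1 _ ax)/= pcons_head ler_wpDr//.
  by rewrite sumr_ge0// => j _; rewrite mulr_ge0 ?expR_ge0// ltW.
by rewrite exprS -mulrA ler_pM ?expR_ge0// mulr_ge0 ?exprn_ge0 ?expR_ge0// ltW.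
Qed.

(** A Harnack inequality. By aperiodicity [x] has a preimage [z] of order [M] with the first symbol
    of [y]; distortion compares [l n y] with [l n z], which is one term of [l (M + n) x]. The [M]
    additional steps change [l] by bounded factors, and for [n < M] crude bounds suffice. *)
Let l_comparable : exists2 C : R, 1 <= C & forall n x y, l n x <= C * l n y.
Proof.
have [M _ hM] := tmx_aperiodic A.
pose a : R := k * expR B; have a1 : 1 <= a.
  by rewrite /a -[leLHS]mulr1 ler_pM// -[leLHS]expR0 ler_expR.
pose b : R := expR B; have b1 : 1 <= b by rewrite -[leLHS]expR0 ler_expR.
have bK n : b ^+ n * expR (- B) ^+ n = 1 by rewrite -exprMn /b expRxMexpNx_1 expr1n.
pose C1 : R := b ^+ M * expR E.
have C11 : 1 <= C1.
  by rewrite /C1 -[leLHS]mulr1 ler_pM ?exprn_ege1// -[leLHS]expR0 ler_expR.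
have aM1 : 1 <= a ^+ M by rewrite exprn_ege1.
have step n x y : l n y <= C1 * l (M + n)%N x.
  have [z [zy zx]] := ex_path_pow (hM (y 0%N) (x 0%N)).
  have yz : agree 1 y z by case=> // _; rewrite zy.
  have h1 := l_log_lip n yz; rewrite expr1 in h1.
  have h2 := l_low n M z; rewrite zx in h2.
  have h3 : l n z <= b ^+ M * l (M + n)%N x.
    by rewrite -[leLHS]mul1r -(bK M) -mulrA ler_wpM2l// exprn_ge0// expR_ge0.
  apply: le_trans h1 _.
  have -> : C1 * l (M + n)%N x = expR E * (b ^+ M * l (M + n)%N x) by rewrite /C1; ring.
  apply: ler_pM; rewrite ?expR_ge0 ?(ltW (l_gt0 _ _))//.
  by rewrite ler_expR ler_piMr// ltW.
exists (a ^+ M * C1 * b ^+ M).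
  by rewrite -[leLHS]mulr1 ler_pM ?exprn_ege1// -[leLHS]mulr1 ler_pM.
move=> n x y; have [Mn|nM] := leqP M n.
  rewrite -(subnKC Mn); set m := (n - M)%N.
  have h : forall z, l m z <= C1 * l (M + m)%N y by move=> z; exact: step.
  have Cl : 0 <= C1 * l (M + m)%N y by rewrite mulr_ge0 ?(ltW (l_gt0 _ _))// (le_trans ler01).
  rewrite (le_trans (l_up M Cl h x))// mulrA -/a.
  rewrite ler_wpM2r ?(ltW (l_gt0 _ _))// ler_peMr ?exprn_ege1//.
  by rewrite mulr_ge0// (le_trans ler01).
have h1 : l n x <= a ^+ M.
  have := @l_up 0%N n 1 ler01 (fun=> lexx _) x; rewrite addn0 mulr1 => h.
  by rewrite (le_trans h)// ler_weXn2l// ltnW.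
have h2 : 1 <= b ^+ M * l n y.
  have := l_low 0 n.
  have [z zy] : exists z, iter n sg z = y.
    elim: n y {nM h1} => [|n ih] y; first by exists y.
    by have [j jy] := ex_adm y; have [z hz] := ih (pcons j y); exists z; rewrite iterS hz pconsK.
  move=> /(_ z); rewrite zy addn0 mulr1 => h.
  rewrite (@le_trans _ _ (b ^+ n * l n y))//.
    by rewrite -(bK n) ler_wpM2l// exprn_ge0// expR_ge0.
  by rewrite ler_wpM2r ?(ltW (l_gt0 _ _))// ler_weXn2l// ltnW.
rewrite (le_trans h1)// -mulrA -[leLHS]mulr1 ler_pM//.
  by rewrite (le_trans ler01).
by rewrite ler_peMr// (le_trans ler01).
Qed.

(** The ratios [r n = l n.+1 / l n] satisfy an averaging recursion with the probabilities [p n],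
    which vary with [n]. By [chain_contraction] they converge exponentially fast to a constant, the
    eigenvalue; then [l n], normalised at a base point, is a Cauchy sequence whose limit is the
    eigenfunction. *)
Lemma perron_eigenfunction : exists (lam c D : R) (h : X -> R),
  [/\ 0 < lam, 0 < c, 0 <= D &
  [/\ forall x, c <= h x <= c^-1, log_lip D h &
   forall x, \sum_(j | adm j x) expR (phi (pcons j x)) * h (pcons j x) = lam * h x]].
Proof.
have [E1 E10 l_log_lip1] : exists2 E1 : R, 0 <= E1 & forall n, log_lip E1 (l n).
  by exists E.
have [C C1 hC] := l_comparable.
have Cpos : 0 < C by rewrite (lt_le_trans ltr01).
have kpos : 0 < k by rewrite (lt_le_trans ltr01).
pose p n j x : R := expR (phi (pcons j x)) * l n (pcons j x) / l n.+1 x.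
(* Lower bound for the weights [p]: [expR (- B)] bounds [expR (phi _)] below, and [l n.+1 x] is at
   most [k * (expR B * C)] times [l n] at any preimage of [x]. *)
pose c : R := expR (- B) * (k * (expR B * C))^-1.
have c0 : 0 < c by rewrite mulr_gt0 ?expR_gt0// invr_gt0 !mulr_gt0 ?expR_gt0.
have l1up n j x : adm j x -> l n.+1 x <= k * (expR B * C) * l n (pcons j x).
  move=> jx; rewrite lS -!mulrA; apply: sum_adm_le.
    by rewrite !mulr_ge0 ?expR_ge0 ?(ltW (l_gt0 _ _))// ltW.
  by move=> i _; rewrite ler_pM ?expR_ge0 ?(ltW (l_gt0 _ _)).
have pc n x j : adm j x -> c <= p n j x.
  move=> jx; rewrite /p ler_pdivlMr// /c.
  rewrite -mulrA ler_pM ?expR_ge0//.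
    by rewrite mulr_ge0 ?(ltW (l_gt0 _ _))// invr_ge0 !mulr_ge0 ?expR_ge0// ltW.
  rewrite mulrC ler_pdivrMr; first by rewrite mulrC l1up.
  by rewrite !mulr_gt0 ?expR_gt0.
have p_sum n x : \sum_(j | adm j x) p n j x = 1.
  by rewrite -mulr_suml -lS divff// gt_eqF.
have c1 : c <= 1.
  have [j jx] := ex_adm (point : X); apply: le_trans (pc 0%N _ _ jx) _.
  rewrite -(p_sum 0%N point) (bigD1 j)//= lerDl sumr_ge0// => i /andP[ix _].
  by rewrite (le_trans (ltW c0))// pc.
pose G : R := F * theta + E1 + E1.
have G0 : 0 <= G by rewrite /G !addr_ge0// mulr_ge0// ltW.
have p_ratio n m j x y : adm j x -> adm j y -> agree m.+1 x y ->
    p n j x <= expR (G * theta ^+ m.+1) * p n j y.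
  move=> jx jy xy; have tm : 0 <= theta ^+ m.+1 by rewrite exprn_ge0// ltW.
  rewrite /p /G !mulrDl !expRD.
  set e1 := expR (F * _ * _); set e2 := expR (E1 * _).
  have h1 : expR (phi (pcons j x)) <= e1 * expR (phi (pcons j y)) by exact: phi_ratio.
  have h2 : l n (pcons j x) <= e2 * l n (pcons j y).
    have jxy := agree_pcons jx jy xy.
    by apply: l_log_lip1; apply: agreeW jxy.
  have h3 : l n.+1 y <= e2 * l n.+1 x by apply: l_log_lip1; exact: agree_sym.
  rewrite ler_pdivrMr//.
  have e20 : 0 < e2 := expR_gt0 _.
  have -> : e1 * e2 * e2 * (expR (phi (pcons j y)) * l n (pcons j y) / l n.+1 y) * l n.+1 x
    = e1 * expR (phi (pcons j y)) * (e2 * l n (pcons j y)) * (e2 * l n.+1 x / l n.+1 y) by ring.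
  rewrite -[leLHS]mulr1 ler_pM ?mulr_ge0 ?expR_ge0 ?(ltW (l_gt0 _ _))//.
    by rewrite ler_pM ?expR_ge0 ?(ltW (l_gt0 _ _)).
  by rewrite ler_pdivlMr// mul1r.
pose D : R := 2 * (G * expR G).
have D0 : 0 <= D by rewrite /D !mulr_ge0 ?expR_ge0.
have tm1 m : theta ^+ m.+1 <= 1 by rewrite exprn_ile1// ltW.
have p_lip n : lip_weights theta D (fun j x => (p n j x)%:C%C).
  move=> m x y xy.
  have tm : 0 <= theta ^+ m.+1 by rewrite exprn_ge0// ltW.
  have Gt : G * theta ^+ m.+1 <= G by rewrite ler_piMr.
  apply: (@le_trans _ _ (\sum_(j | adm j x) G * theta ^+ m.+1 * expR G * (p n j x + p n j y))).
    apply: ler_sum => j jx; have jy : adm j y by rewrite -(agree_adm _ xy).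
    rewrite -(rmorphB (real_complex R)) normc_real.
    have px : 0 <= p n j x by rewrite (le_trans (ltW c0))// pc.
    have py : 0 <= p n j y by rewrite (le_trans (ltW c0))// pc.
    apply: le_trans (ratio_norm_le (s := G * theta ^+ m.+1) _ _ _ _ _) _ => //.
    - by rewrite mulr_ge0.
    - exact: p_ratio.
    - by apply: p_ratio => //; exact: agree_sym.
    - by rewrite ler_wpM2r ?addr_ge0// ler_wpM2l ?mulr_ge0// ler_expR.
  rewrite -mulr_sumr big_split/= p_sum (eq_bigl (fun j => adm j y)) ?p_sum.
    by rewrite le_eqVlt; apply/orP; left; apply/eqP; rewrite /D; ring.
  by move=> j; rewrite (agree_adm _ xy).
have [e [g [K [e0 g01 K0 contr]]]] := chain_contraction A t0 t1 (andb_true_intro (conj c0 c1)) D0.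
have hns n : near_stochastic c e (p n) (fun j x => (p n j x)%:C%C).
  split => //; first exact: pc.
    by move=> x; rewrite -(rmorph_sum (real_complex R)) p_sum.
  by move=> x; rewrite big1 ?ltW// => j _; rewrite subrr Normc.normc0.
pose r n x : R := l n.+1 x / l n x.
have r_step n x : (r n.+1 x)%:C%C = weighted_op (fun j y => (p n j y)%:C%C) (fun y => (r n y)%:C%C) x.
  rewrite /weighted_op.
  under eq_bigr => j _ do rewrite -(rmorphM (real_complex R)).
  rewrite -(rmorph_sum (real_complex R)); congr (_%:C%C).
  rewrite /r lS mulr_suml; apply: eq_bigr => j jx; rewrite /p.
  by field; rewrite ?gt_eqF.
have rE x : r 0 x = l 1 x by rewrite /r [l 0%N x]/(1 : R) divr1.
have r0_osc : osc_bound (C * l 1 point + C * l 1 point) (fun x => (r 0 x)%:C%C).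
  move=> x y; rewrite -(rmorphB (real_complex R)) normc_real.
  rewrite !rE (le_trans (ler_normB _ _))//.
  by rewrite lerD// ger0_norm ?hC// ltW// l_gt0.
have r0_lip : lip_bound theta (E1 * expR E1 * (C * l 1 point + C * l 1 point)) (fun x => (r 0 x)%:C%C).
  move=> m x y xy; rewrite -(rmorphB (real_complex R)) normc_real !rE.
  have tm : 0 <= theta ^+ m.+1 by rewrite exprn_ge0// ltW.
  have lx := ltW (l_gt0 1 x); have ly := ltW (l_gt0 1 y).
  apply: le_trans (ratio_norm_le (s := E1 * theta ^+ m.+1) _ _ _ _ _) _ => //.
  - by rewrite mulr_ge0.
  - exact: (l_log_lip1 1).
  - by apply: (l_log_lip1 1); exact: agree_sym.
  have -> : E1 * theta ^+ m.+1 * expR (E1 * theta ^+ m.+1) * (l 1 x + l 1 y) =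
    E1 * expR (E1 * theta ^+ m.+1) * (l 1 x + l 1 y) * theta ^+ m.+1 by ring.
  rewrite ler_wpM2r// ler_pM ?mulr_ge0 ?addr_ge0 ?expR_ge0 ?lerD ?hC//.
  by rewrite ler_wpM2l// ler_expR ler_piMr.
have r0K : 0 <= E1 * expR E1 * (C * l 1 point + C * l 1 point).
  by rewrite !mulr_ge0 ?expR_ge0// addr_ge0// mulr_ge0 ?(ltW Cpos)// ltW.
have hr n := (contr p _ (fun n x => (r n x)%:C%C) hns p_lip r_step _ _ r0_osc r0_lip r0K n).1.
move: (K * _) hr => Q hr.
have g0 : 0 <= g < 1 by case/andP: g01 => /ltW -> ->.
have rosc n x y : `|r n x - r n y| <= Q * g ^+ n.
  by have := hr n x y; rewrite -(rmorphB (real_complex R)) normc_real.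
have rdrift n x : `|r n.+1 x - r n x| <= (1 + e) * Q * g ^+ n.
  have := weighted_op_osc c0 (hns n) (hr n) x x.
  by rewrite -r_step -(rmorphB (real_complex R)) normc_real mulrA.
have Q0 n : 0 <= Q * g ^+ n := le_trans (normr_ge0 _) (rosc n point point).
pose b : R := expR (- B) / C; have b0 : 0 < b by rewrite divr_gt0 ?expR_gt0.
have rlow n x : b <= r n x.
  rewrite /r ler_pdivlMr//; have [j jx] := ex_adm x.
  rewrite lS (bigD1 j)//= ler_wpDr//.
    by rewrite sumr_ge0// => i _; rewrite mulr_ge0 ?expR_ge0// ltW.
  rewrite /b -mulrA ler_pM ?expR_ge0//.
    by rewrite mulr_ge0 ?invr_ge0 ?(ltW Cpos) ?(ltW (l_gt0 _ _)).
  by rewrite mulrC ler_pdivrMr// mulrC hC.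
pose h n x : R := l n x / l n point.
have hup n x : h n x <= C by rewrite /h ler_pdivrMr.
have hlow n x : C^-1 <= h n x by rewrite /h ler_pdivlMr// mulrC ler_pdivrMr// mulrC hC.
(* The relative increment of [h] is the relative deviation of [r n] between [x] and the base point,
   so it decays like the oscillation of [r n]. *)
have hstep n x : `|h n.+1 x - h n x| <= C * Q / b * g ^+ n.
  have -> : h n.+1 x - h n x = h n x * (r n x - r n point) / r n point.
    by rewrite /h /r; field; rewrite ?gt_eqF.
  have h0 : 0 <= h n x by rewrite (le_trans _ (hlow _ _))// invr_ge0 ltW.
  have rp : 0 < r n point by rewrite (lt_le_trans b0).
  rewrite normrM normrM (ger0_norm h0) normfV (ger0_norm (ltW rp)).
  have -> : C * Q / b * g ^+ n = C * (Q * g ^+ n) / b by ring.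
  have h1 := hup n x; have d0 := normr_ge0 (r n x - r n point).
  have d1 := rosc n x point; have r1 := rlow n point.
  move: (h n x) (r n point) (`|r n x - r n point|) h0 rp h1 d0 d1 r1 => u v d u0 v0 u1 d0 d1 r1.
  apply: ler_pM; rewrite ?mulr_ge0 ?invr_ge0 ?(ltW v0)//; first exact: ler_pM.
  by rewrite lef_pV2.
have /choice[H hH] : forall x, exists L, forall n, `|h n x - L| <= C * Q / b / (1 - g) * g ^+ n.
  by move=> x; exact: (geometric_cauchy g0 (fun n => hstep n x)).
have [lam hlam] := geometric_cauchy g0 (fun n => rdrift n point).
have cH x : h n x @[n --> \oo] --> H x := geometric_cvg g0 (hH x).
have cr : r n point @[n --> \oo] --> lam := geometric_cvg g0 hlam.
have lam0 : 0 < lam.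
  rewrite (lt_le_trans b0)//; apply: (ler_cvg_to (cvg_cst b) cr).
  by apply: nearW => n; exact: rlow.
exists lam, C^-1, E1, H; split; rewrite ?invr_gt0//; split.
- move=> x; apply/andP; split.
    by apply: (ler_cvg_to (cvg_cst _) (cH x)); apply: nearW => n; exact: hlow.
  by rewrite invrK; apply: (ler_cvg_to (cH x) (cvg_cst _)); apply: nearW => n; exact: hup.
- move=> m x y xy.
  have cy : expR (E1 * theta ^+ m.+1) * h n y @[n --> \oo] -->
    expR (E1 * theta ^+ m.+1) * H y by apply: cvgMl_tmp.
  apply: (ler_cvg_to (cH x) cy).
  apply: nearW => n; rewrite /h mulrA ler_wpM2r ?invr_ge0 ?(ltW (l_gt0 _ _))//.
  exact: l_log_lip1.
move=> x.
have c1' : \sum_(j | adm j x) expR (phi (pcons j x)) * h n (pcons j x) @[n --> \oo] -->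
    \sum_(j | adm j x) expR (phi (pcons j x)) * H (pcons j x).
  by apply: cvg_big => [|j _]; [exact: add_continuous | apply: cvgMl_tmp].
have c2' : r n point * h n.+1 x @[n --> \oo] --> lam * H x.
  by apply: cvgM => //; have := cH x; rewrite -(cvg_shiftS (h ^~ x)).
have <- := cvg_lim (@Rhausdorff R) c1'; have <- := cvg_lim (@Rhausdorff R) c2'.
congr (lim (_ @ \oo)); apply/funext => n; have -> : r n point * h n.+1 x = l n.+1 x / l n point.
  by rewrite /r /h; field; rewrite ?gt_eqF.
by rewrite lS mulr_suml; apply: eq_bigr => j _; rewrite /h mulrA.
Qed.

End perron.

(** * Operator norms *)

Section definitions_unfolded.
Variables (R : realType) (A : transition) (theta : R).
Hypotheses (t0 : 0 < theta) (t1 : theta < 1).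
Local Notation X := (shift_space A).
Local Notation sg := (@left_shift A).
Local Notation nc := (@Normc.normc R).
Implicit Types (g w : X -> R[i]).

Lemma dist_thetaE (x y : X) : x <> y -> exists m,
  [/\ dist_theta theta x y = theta ^+ m, agree m x y &
      forall m', agree m' x y -> (m' <= m)%N].
Proof.
move=> xy; have : exists i, x i != y i.
  apply: contrapT => /forallNP h; apply: xy; apply: shift_ext => i.
  by apply/eqP; apply: contrapT => /negP; exact: h.
move=> /ex_minnP[m xym mmin].
have am : agree m x y.
  move=> i im; apply/eqP; apply: contraTT im => /mmin; by rewrite -leqNgt.
have maxm m' : agree m' x y -> (m' <= m)%N.
  by move=> h; rewrite leqNgt; apply/negP => /h e; rewrite e eqxx in xym.
exists m; split => //; rewrite /dist_theta; case: eqP => // _; congr (_ ^+ _).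
by case: xgetP => [k _ [h1 h2]|/(_ m)[]]//; apply/eqP; rewrite eqn_leq h2// maxm.
Qed.

Lemma lipschitz_bounds g : lipschitz_theta theta g ->
  exists2 K : R, 0 <= K & forall m x y, agree m x y -> nc (g x - g y) <= K * theta ^+ m.
Proof.
rewrite /lipschitz_theta /= => hg.
have ub (p : X * X) : ((nc (g p.1 - g p.2) / dist_theta theta p.1 p.2)%:E <= lip_const theta g)%E.
  by apply: ereal_sup_ubound; exists p.
have l0 : (0 <= lip_const theta g)%E.
  by have := ub (point, point); rewrite /= subrr Normc.normc0 mul0r.
have fl : lip_const theta g \is a fin_num by rewrite ge0_fin_numE.
exists (fine (lip_const theta g)) => [|m x y xy]; first exact: fine_ge0.
have [->|/eqP nxy] := eqVneq x y.
  by rewrite subrr Normc.normc0 mulr_ge0 ?fine_ge0// exprn_ge0// ltW.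
have [k [dk ak kmax]] := dist_thetaE nxy.
have := ub (x, y); rewrite /= dk -(fineK fl) lee_fin ler_pdivrMr ?exprn_gt0// => h.
rewrite (le_trans h)// ler_wpM2l ?fine_ge0// ler_wiXn2l ?(ltW t0) ?(ltW t1)//.
exact: kmax.
Qed.

Lemma norm_sup_le g (B : R) : normc_bound B g -> (norm_sup g <= B%:E)%E.
Proof. by move=> h; apply: ge_ereal_sup => _ [x _ <-]; rewrite lee_fin. Qed.

Lemma norm_sup_ub g x : ((nc (g x))%:E <= norm_sup g)%E.
Proof. by apply: ereal_sup_ubound; exists x. Qed.

Lemma lip_const_ge0 g : (0 <= lip_const theta g)%E.
Proof.
apply: (@le_trans _ _ (nc (g point - g point) / dist_theta theta point point)%:E).
  by rewrite subrr Normc.normc0 mul0r.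
by apply: ereal_sup_ubound; exists (point, point).
Qed.

Lemma norm_sup_ge0 g : (0 <= norm_sup g)%E.
Proof. by apply: le_trans (norm_sup_ub g point); rewrite lee_fin normc_ge0. Qed.

(** The summand [2 * B] pays for points with distinct first symbols: they are at distance 1 and
    [lip_bound] says nothing about them. *)
Lemma lip_const_le g (B K : R) : 0 <= K -> normc_bound B g -> lip_bound theta K g ->
  (lip_const theta g <= (K + 2 * B)%:E)%E.
Proof.
move=> K0 hB hK; have B0 : 0 <= B := le_trans (normc_ge0 _) (hB point).
apply: ge_ereal_sup => _ [[x y] _ <-]; rewrite lee_fin /=.
have [->|/eqP nxy] := eqVneq x y.
  by rewrite subrr Normc.normc0 mul0r addr_ge0// mulr_ge0.
have [[|k] [-> ak kmax]] := dist_thetaE nxy.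
  have := normcB (g x) (g y); have := hB x; have := hB y.
  by rewrite expr0 divr1; lra.
rewrite ler_pdivrMr ?exprn_gt0// (le_trans (hK _ _ _ ak))//.
by rewrite ler_wpM2r ?exprn_ge0 ?(ltW t0)// lerDl mulr_ge0.
Qed.

Lemma sup_lip_lipschitz g (B K : R) : 0 <= K -> normc_bound B g -> lip_bound theta K g ->
  lipschitz_theta theta g.
Proof.
by move=> K0 hB hK; rewrite /lipschitz_theta /= (le_lt_trans (lip_const_le K0 hB hK))// ltry.
Qed.

Lemma ruelle_opE g w x :
  ruelle_op g w x = \sum_(j | adm j x) cexp (g (pcons j x)) * w (pcons j x).
Proof.
pose r := [seq pcons j x | j <- enum 'I_(kappa A) & adm j x].
have ur : uniq r.
  rewrite map_inj_in_uniq; first by apply: filter_uniq; exact: enum_uniq.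
  move=> i j; rewrite !mem_filter => /andP[ix _] /andP[jx _] /(congr1 (fun z : X => z 0%N)).
  by rewrite !pcons0.
rewrite /ruelle_op (_ : [set y | sg y = x] = [set` r]).
  by rewrite -fsbig_seq// big_map big_filter big_enum_cond.
apply/seteqP; split => y /=.
  move=> yx; apply/mapP; exists (y 0%N); last by rewrite -yx pcons_head.
  by rewrite mem_filter mem_enum -yx adm_head.
by move=> /mapP[j]; rewrite mem_filter => /andP[jx _] ->; rewrite pconsK.
Qed.

Lemma cexp_transfer (Pf u a : R) :
  cexp ((- Pf +i* u)%C * a%:C%C) = (expR (- Pf * a))%:C%C * cis (u * a).
Proof.
rewrite -[(- Pf +i* u)%C * _]/((_ +i* _)%C) /= !mulr0 subr0 add0r /cis.
by rewrite -[RHS]/((_ +i* _)%C) !mul0r subr0 addr0.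
Qed.

Lemma opnorm_sup (T : (X -> R[i]) -> X -> R[i]) (u c B K : R) w :
  (forall (a : R) v, T (fun x => a%:C%C * v x) = (fun x => a%:C%C * T v x)) ->
  (opnorm theta (norm_theta_u theta u) T <= c%:E)%E -> u != 0 -> 0 < B -> 0 <= K ->
  normc_bound B w -> lip_bound theta K w ->
  normc_bound (c * (B + (K + 2 * B) * `|u|^-1)) (T w).
Proof.
move=> hT hc u0 B0 K0 hB hK; set a := B + _.
have iu : 0 <= `|u|^-1 by rewrite invr_ge0.
have a0 : 0 < a by rewrite ltr_pwDl// mulr_ge0// addr_ge0// mulr_ge0// ltW.
pose g : X -> R[i] := fun x => (a^-1)%:C%C * w x.
have ia : 0 <= a^-1 by rewrite invr_ge0 ltW.
have gB : normc_bound (a^-1 * B) g.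
  by move=> x; rewrite Normc.normcM normc_real ger0_norm// ler_wpM2l.
have gK : lip_bound theta (a^-1 * K) g.
  move=> m x y xy; rewrite -mulrBr Normc.normcM normc_real ger0_norm// -mulrA ler_wpM2l//.
  exact: hK.
have aK : 0 <= a^-1 * K by rewrite mulr_ge0.
have gl := sup_lip_lipschitz aK gB gK.
have gn : (norm_theta_u theta u g <= 1)%E.
  apply: (@le_trans _ _ ((a^-1 * B)%:E + (a^-1 * K + 2 * (a^-1 * B))%:E * (`|u|^-1)%:E)%E).
    by rewrite leeD ?norm_sup_le// lee_wpmul2r ?lee_fin// lip_const_le.
  rewrite -EFinM -EFinD lee_fin.
  have aE (i : R) : i * B + (i * K + 2 * (i * B)) / `|u| = i * a by rewrite /a; ring.
  by rewrite aE mulVf// gt_eqF.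
have Tg : (norm_theta_u theta u (T g) <= c%:E)%E.
  by apply: le_trans hc; apply: ereal_sup_ubound; exists g.
move=> x; have h : nc (T g x) <= c.
  rewrite -lee_fin; apply: le_trans Tg; apply: le_trans (norm_sup_ub _ x) _.
  by rewrite leeDl// mule_ge0// ?lip_const_ge0// lee_fin.
by move: h; rewrite /g hT Normc.normcM normc_real ger0_norm// mulrC ler_pdivrMr.
Qed.

(** For [|u| >= 1] one has [norm_theta_u <= norm_theta <= |u| * norm_theta_u]. The factor [|u|] lost
    here is one of the two powers in [periodic_sum_large_frequencies]. *)
Lemma opnorm_theta_le (T : (X -> R[i]) -> X -> R[i]) (u c : R) : 1 <= `|u| -> 0 <= c ->
  (opnorm theta (norm_theta_u theta u) T <= c%:E)%E ->
  (opnorm theta (norm_theta theta) T <= (`|u| * c)%:E)%E.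
Proof.
move=> u1 c0 hc; have u0 : 0 < `|u| by rewrite (lt_le_trans ltr01).
apply: ge_ereal_sup => _ [g [gl gn] <-].
have gu : (norm_theta_u theta u g <= 1)%E.
  apply: le_trans gn; rewrite leeD2l// -[leRHS]mule1 lee_wpmul2l ?lip_const_ge0//.
  by rewrite lee_fin invf_le1.
have Tg : (norm_theta_u theta u (T g) <= c%:E)%E.
  by apply: le_trans hc; apply: ereal_sup_ubound; exists g.
rewrite EFinM; apply: le_trans (lee_wpmul2l _ Tg); last by rewrite lee_fin.
rewrite /norm_theta_u ge0_muleDr ?norm_sup_ge0 ?mule_ge0 ?lip_const_ge0 ?lee_fin ?invr_ge0//.
apply: leeD.
  by rewrite lee_pemull ?norm_sup_ge0 ?lee_fin.
by rewrite muleCA -EFinM divff ?mule1// gt_eqF.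
Qed.

End definitions_unfolded.

(** * Twisted averaging operators *)

Section complex_quotients.
Variable R : realType.
Local Notation nc := (@Normc.normc R).
Implicit Types a b c d : R[i].

Lemma normc_gt_neq0 a : 0 < nc a -> a != 0.
Proof. by apply: contraTneq => ->; rewrite Normc.normc0 ltxx. Qed.

Lemma normc_quotient_dist a b c d : 1 / 2 <= nc b -> 1 / 2 <= nc d ->
  nc (a / b - c / d) <= 4 * (nc (a - c) * nc d + nc c * nc (b - d)).
Proof.
move=> hb hd; have b0 : 0 < nc b by lra. have d0 : 0 < nc d by lra.
have -> : a / b - c / d = ((a - c) * d - c * (b - d)) / (b * d).
  by field; rewrite !normc_gt_neq0.
rewrite Normc.normcM Normc.normcV Normc.normcM mulrC.
apply: ler_pM; rewrite ?normc_ge0 ?invr_ge0 ?mulr_ge0 ?normc_ge0//.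
  by rewrite invf_ple ?posrE ?mulr_gt0//; nra.
by rewrite (le_trans (normcB _ _))// !Normc.normcM.
Qed.

Lemma normc_near1 a (e : R) : nc (a - 1) <= e -> e <= 1 / 2 -> 1 / 2 <= nc a <= 3 / 2.
Proof.
move=> h e2; have h1 := normcD (a - 1) 1; rewrite subrK Normc.normc1 in h1.
have h2 := normc_lerB 1 (1 - a); rewrite Normc.normc1 subKr normc_subC in h2.
by apply/andP; split; lra.
Qed.

Lemma ler_of_eq (x y : R) : x = y -> x <= y.
Proof. by move=> ->. Qed.

Lemma ler_geometric (x y C g : R) : 0 <= g < 1 -> (forall n, x <= y + C * g ^+ n) -> x <= y.
Proof.
move=> g01 h.
have [C0|C0] := leP C 0.
  by have := h 0%N; rewrite expr0; lra.
apply/ler_addgt0Pr => e e0.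
have [n hn] := geometric_small g01 (divr_gt0 e0 C0).
rewrite (le_trans (h n))// lerD2l.
by rewrite -(divfK (lt0r_neq0 C0) e) mulrC ler_wpM2r// ltW.
Qed.

End complex_quotients.

Section twisted.
Variables (R : realType) (A : transition) (theta : R).
Hypotheses (t0 : 0 < theta) (t1 : theta < 1).
Local Notation X := (shift_space A).
Local Notation I := 'I_(kappa A).
Local Notation nc := (@Normc.normc R).
Implicit Types (w g : X -> R[i]) (B K u : R).

(** A g-function in the sense of Keane: [p j x] is the probability of passing from [x] to its
    preimage [j x], bounded below and Lipschitz. *)
Definition g_function (c D : R) (p : I -> X -> R) :=
  [/\ 0 < c <= 1, 0 <= D, forall x, \sum_(j | adm j x) p j x = 1,
      forall x j, adm j x -> c <= p j x &
      lip_weights theta D (fun j x => (p j x)%:C%C)].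

Definition lip_function (d F : R) (f : X -> R) :=
  [/\ 0 <= d, 0 <= F, forall x, `|f x| <= d &
      forall m x y, agree m x y -> `|f x - f y| <= F * theta ^+ m].

Variables (p : I -> X -> R) (f : X -> R) (c D d F : R).
Hypotheses (hp : g_function c D p) (hf : lip_function d F f).

Definition twisted_weight u j x : R[i] := (p j x)%:C%C * cis (u * f (pcons j x)).

Definition twisted_op u w : X -> R[i] := weighted_op (twisted_weight u) w.

Let p0 j x : adm j x -> 0 <= p j x.
Proof. by case: hp => /andP[c0 _] _ _ pc _ /pc; apply: le_trans; exact: ltW. Qed.

Let D0 : 0 <= D. Proof. by case: hp. Qed.
Let d0 : 0 <= d. Proof. by case: hf. Qed.
Let F0 : 0 <= F. Proof. by case: hf. Qed.

Lemma normc_twist_weight u j x : adm j x -> nc (twisted_weight u j x) = p j x.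
Proof.
by move=> jx; rewrite Normc.normcM normc_real normc_cis mulr1 ger0_norm// p0.
Qed.

Lemma sum_twist_weight u x : \sum_(j | adm j x) nc (twisted_weight u j x) = 1.
Proof.
have [_ _ p1 _ _] := hp; rewrite -(p1 x); apply: eq_bigr => j jx.
exact: normc_twist_weight.
Qed.

Lemma normc_bound_ge0 B w : normc_bound B w -> 0 <= B.
Proof. by move=> h; exact: le_trans (normc_ge0 _) (h point). Qed.

Lemma twist_bound u B w : normc_bound B w -> normc_bound B (twisted_op u w).
Proof.
move=> hB x; apply: le_trans (normc_sum _ _ _) _.
rewrite -[leRHS]mul1r -(sum_twist_weight u x) mulr_suml.
by apply: ler_sum => j jx; rewrite Normc.normcM ler_wpM2l ?normc_ge0.
Qed.

Lemma twist_weight_lip u : lip_weights theta ((D + 2 * F) * (1 + `|u|)) (twisted_weight u).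
Proof.
have [_ _ p1 _ pl] := hp; have [_ _ _ fl] := hf.
move=> m x y xy; have tm : 0 <= theta ^+ m.+1 by rewrite exprn_ge0// ltW.
apply: (@le_trans _ _ (\sum_(j | adm j x) (nc ((p j x)%:C%C - (p j y)%:C%C) +
    p j y * (2 * (`|u| * (F * theta ^+ m.+2)))))).
  apply: ler_sum => j jx; have jy : adm j y by rewrite -(agree_adm _ xy).
  have -> : twisted_weight u j x - twisted_weight u j y =
    ((p j x)%:C%C - (p j y)%:C%C) * cis (u * f (pcons j x)) +
    (p j y)%:C%C * (cis (u * f (pcons j x)) - cis (u * f (pcons j y))).
    by rewrite /twisted_weight; ring.
  apply: le_trans (normcD _ _) _; rewrite !Normc.normcM normc_cis mulr1 lerD2l.
  rewrite normc_real ger0_norm ?p0// ler_wpM2l ?p0//.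
  rewrite (le_trans (normc_cisB _ _))// ler_wpM2l// -mulrBr normrM ler_wpM2l//.
  by apply: fl; exact: agree_pcons.
rewrite big_split/= (le_trans (lerD (pl _ _ _ xy) (lexx _)))//.
rewrite -mulr_suml (eq_bigl (fun j => adm j y)); last by move=> j; rewrite (agree_adm _ xy).
rewrite p1 mul1r.
have -> : (D + 2 * F) * (1 + `|u|) * theta ^+ m.+1 = D * theta ^+ m.+1 +
  (D * `|u| + 2 * F + 2 * `|u| * F) * theta ^+ m.+1 by ring.
rewrite lerD2l.
have -> : 2 * (`|u| * (F * theta ^+ m.+2)) = 2 * `|u| * F * theta * theta ^+ m.+1.
  by rewrite [theta ^+ m.+2]exprS; ring.
rewrite ler_wpM2r//.
have h1 : 0 <= D * `|u| by rewrite mulr_ge0.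
have h2 : 2 * `|u| * F * theta <= 2 * `|u| * F by rewrite ler_piMr ?mulr_ge0// ltW.
by have := F0; lra.
Qed.

Lemma twist_lip u B K w : normc_bound B w -> lip_bound theta K w -> 0 <= K ->
  lip_bound theta (theta * K + (D + 2 * F) * (1 + `|u|) * B) (twisted_op u w).
Proof.
move=> hB hK K0 m x y xy.
have eqy : twisted_op u w y = \sum_(j | adm j x) twisted_weight u j y * w (pcons j y).
  by apply: eq_bigl => j; rewrite (agree_adm _ xy).
have -> : twisted_op u w x - twisted_op u w y =
    \sum_(j | adm j x) twisted_weight u j x * (w (pcons j x) - w (pcons j y)) +
    \sum_(j | adm j x) (twisted_weight u j x - twisted_weight u j y) * w (pcons j y).
  rewrite eqy -[RHS]big_split/= -sumrB; apply: eq_bigr => j _ /=; ring.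
apply: le_trans (normcD _ _) _; rewrite mulrDl; apply: lerD.
  apply: le_trans (normc_sum _ _ _) _.
  rewrite -[leRHS]mul1r -(sum_twist_weight u x) mulr_suml.
  apply: ler_sum => j jx; rewrite Normc.normcM ler_wpM2l ?normc_ge0//.
  rewrite mulrAC -exprS mulrC; apply: hK; apply: agree_pcons => //.
  by rewrite -(agree_adm _ xy).
apply: le_trans (normc_sum _ _ _) _; rewrite mulrAC.
apply: le_trans (ler_wpM2r (normc_bound_ge0 hB) (twist_weight_lip u xy)).
rewrite mulr_suml; apply: ler_sum => j jx; rewrite Normc.normcM.
by rewrite ler_wpM2l ?normc_ge0//; exact: hB.
Qed.

Lemma twist_iter_bound n u B w : normc_bound B w -> normc_bound B (iter n (twisted_op u) w).
Proof. by move=> h; elim: n => //= n ih; exact: twist_bound. Qed.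

Definition twist_lip_const : R := (D + 2 * F) / (1 - theta).

Lemma twist_lip_const_ge0 : 0 <= twist_lip_const.
Proof.
rewrite /twist_lip_const divr_ge0//; last by rewrite subr_ge0 ltW.
by rewrite addr_ge0// mulr_ge0.
Qed.

Lemma twist_iter_lip n u B K w : normc_bound B w -> lip_bound theta K w -> 0 <= K ->
  lip_bound theta (theta ^+ n * K + twist_lip_const * (1 + `|u|) * B) (iter n (twisted_op u) w).
Proof.
move=> hB hK K0; have B0 := normc_bound_ge0 hB; have t1' := t1.
set L := twist_lip_const * (1 + `|u|) * B.
have L0 : 0 <= L.
  by apply: mulr_ge0 => //; apply: mulr_ge0; [exact: twist_lip_const_ge0 | exact: addr_ge0].
have LE : (D + 2 * F) * (1 + `|u|) * B = (1 - theta) * L.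
  by rewrite /L /twist_lip_const; field; lra.
elim: n => [|n ih].
  move=> m x y xy; rewrite expr0 mul1r (le_trans (hK _ _ _ xy))//.
  by rewrite ler_wpM2r ?exprn_ge0 ?(ltW t0)// lerDl.
have K'0 : 0 <= theta ^+ n * K + L by rewrite addr_ge0// mulr_ge0// exprn_ge0// ltW.
move=> m x y xy; apply: le_trans (twist_lip u (twist_iter_bound n u hB) ih K'0 xy) _.
rewrite ler_wpM2r ?exprn_ge0 ?(ltW t0)// LE exprS.
by rewrite le_eqVlt; apply/orP; left; apply/eqP; ring.
Qed.

Lemma twistB u w v x : twisted_op u (fun y => w y - v y) x = twisted_op u w x - twisted_op u v x.
Proof. exact: weighted_opB. Qed.

Lemma twist_iter_diff n u B w : normc_bound B w ->
  normc_bound (n%:R * (2 * (`|u| * d) * B)) (fun x => iter n (twisted_op u) w x - iter n (twisted_op 0) w x).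
Proof.
move=> hB; have [_ p1 p2 _ _] := hp; have [_ _ fd _] := hf.
elim: n => [|n ih] x; first by rewrite subrr Normc.normc0 mul0r.
pose v := iter n (twisted_op 0) w.
rewrite !iterS -/v.
have -> : twisted_op u (iter n (twisted_op u) w) x - twisted_op 0 v x =
    twisted_op u (fun y => iter n (twisted_op u) w y - v y) x + (twisted_op u v x - twisted_op 0 v x).
  by rewrite twistB subrKA.
apply: le_trans (normcD _ _) _; rewrite -natr1 mulrDl mul1r; apply: lerD.
  exact: twist_bound.
rewrite /twisted_op /weighted_op -sumrB; apply: le_trans (normc_sum _ _ _) _.
apply: (@le_trans _ _ (\sum_(j | adm j x) p j x * (2 * (`|u| * d) * B))); last first.
  by rewrite -mulr_suml p2 mul1r.
apply: ler_sum => j jx.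
rewrite /twisted_weight mul0r cis0 -mulrBl -mulrBr mulrA -!mulrA !Normc.normcM.
rewrite normc_real ger0_norm ?p0// ler_wpM2l ?p0//.
have hv : nc (v (pcons j x)) <= B by exact: twist_iter_bound.
have hc : nc (cis (u * f (pcons j x)) - 1) <= 2 * (`|u| * d).
  rewrite -cis0 (le_trans (normc_cisB _ _))// subr0 normrM ler_wpM2l// ler_wpM2l//.
by rewrite (mulrA `|u|) (mulrA 2); apply: ler_pM => //; exact: normc_ge0.
Qed.

(** At [u = 0] the operator averages with probabilities, so the chain theorem applies with [p = q].
    The limit [L] is a number, the mean of [w] for the stationary measure, and the rate is common to
    all [w]. *)
Lemma twist0_cvg : exists (C g : R), [/\ 0 < g < 1, 0 < C & forall w O K,
  osc_bound O w -> lip_bound theta K w -> 0 <= K ->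
  exists L : R[i], forall n x, nc (iter n (twisted_op 0) w x - L) <= C * (O + K) * g ^+ n].
Proof.
have [c01 _ p1 pc pl] := hp.
have [e [g [C [e0 g01 C0 contr]]]] := chain_contraction A t0 t1 c01 D0.
have g0 : 0 <= g < 1 by case/andP: g01 => /ltW -> ->.
pose q j x : R[i] := (p j x)%:C%C.
have hns : near_stochastic c e p q.
  split => // x; first by rewrite -(rmorph_sum (real_complex R)) p1.
  by rewrite big1 ?ltW// => j _; rewrite subrr Normc.normc0.
have tw0 w : twisted_op 0 w = weighted_op q w.
  apply/funext => x; apply: eq_bigr => j _.
  by rewrite /twisted_weight mul0r cis0 mulr1.
have c0 : 0 < c by case/andP: c01.
exists (2 * ((1 + e) * C / (1 - g)) + C), g; split => //.
  rewrite addr_gt0// !mulr_gt0 ?invr_gt0 ?subr_gt0//; [lra|by case/andP: g01].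
move=> w O K hO hK K0.
have hw n x : iter n.+1 (twisted_op 0) w x = weighted_op q (iter n (twisted_op 0) w) x by rewrite iterS tw0.
have st := contr (fun=> p) (fun=> q) (fun n => iter n (twisted_op 0) w) (fun=> hns) (fun=> pl) hw O K hO hK K0.
pose Q : R := C * (O + K).
have drift n : nc (iter n.+1 (twisted_op 0) w point - iter n (twisted_op 0) w point) <= (1 + e) * Q * g ^+ n.
  rewrite iterS tw0.
  have := weighted_op_osc c0 hns (st n).1 point point; by rewrite mulrA.
have [L hL] := geometric_cauchy_complex g0 drift.
exists L => n x; apply: le_trans (normc_dist _ _ (iter n (twisted_op 0) w point)) _.
rewrite addrC !mulrDl; apply: lerD; last exact: (st n).1.
rewrite (le_trans (hL n))// le_eqVlt; apply/orP; left; apply/eqP.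
by rewrite /Q; ring.
Qed.

(** Twice the constant [Kc] below. [Kc] is the sum of a geometric series of ratio [theta / s2],
    where [s2 = (1 + theta) / 2] bounds the eigenvalue from below; the factor 2 comes from dividing
    an eigenfunction by a value larger than half of its supremum. *)
Definition eigen_lip_const : R :=
  2 * ((D + 2 * F) * 2 / ((1 + theta) / 2) / (1 - theta / ((1 + theta) / 2))).

Let s2 : R := (1 + theta) / 2.
Let Kc : R := (D + 2 * F) * 2 / s2 / (1 - theta / s2).

Let s20 : 0 < s2. Proof. by have := t0 => ?; rewrite /s2; lra. Qed.

Let ts2 : 0 <= theta / s2 < 1.
Proof.
rewrite divr_ge0 ?(ltW t0) ?(ltW s20)//= ltr_pdivrMr// mul1r.
by have := t1 => ?; rewrite /s2; lra.
Qed.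

Let Kc0 : 0 <= Kc.
Proof.
case/andP: ts2 => _ h; apply: divr_ge0; last by rewrite subr_ge0 ltW.
by apply: divr_ge0 (ltW s20); rewrite mulr_ge0// addr_ge0// mulr_ge0.
Qed.

Lemma eigen_lip_const_ge0 : 0 <= eigen_lip_const.
Proof. exact: mulr_ge0. Qed.

Lemma eigen_iter u w a : (forall x, twisted_op u w x = a * w x) ->
  forall n x, iter n (twisted_op u) w x = a ^+ n * w x.
Proof.
move=> hw; elim=> [|n ih] x; first by rewrite expr0 mul1r.
rewrite iterS (_ : iter n _ _ = fun x => a ^+ n * w x); last exact/funext.
rewrite exprS -mulrA [RHS]mulrCA -hw /twisted_op /weighted_op mulr_sumr.
by apply: eq_bigr => i _; rewrite mulrCA.
Qed.

(** Writing [v] as the image of [v] divided by [a] multiplies any Lipschitz constant by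
    [theta / s2 < 1] and adds a fixed multiple of [B]. Iteration makes the unknown initial constant
    [K] disappear. *)
Lemma eigen_lip u v a B K : `|u| <= 1 -> (1 + theta) / 2 <= nc a ->
  (forall x, twisted_op u v x = a * v x) -> normc_bound B v -> lip_bound theta K v ->
  lip_bound theta (Kc * B) v.
Proof.
rewrite -/s2 => u1 as2 hv hB hK'; have B0 := normc_bound_ge0 hB.
have [K0 K00 hK] : exists2 K0 : R, 0 <= K0 & lip_bound theta K0 v.
  exists (Order.max 0 K); first by rewrite le_max lexx.
  move=> m x y xy; rewrite (le_trans (hK' _ _ _ xy))// ler_wpM2r ?exprn_ge0 ?(ltW t0)//.
  by rewrite le_max lexx orbT.
have a0 : a != 0 by rewrite normc_gt_neq0// (lt_le_trans s20).
have vE x : v x = a^-1 * twisted_op u v x by rewrite hv mulKf.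
pose b : R := (D + 2 * F) * 2 * B / s2.
have DF : 0 <= D + 2 * F by rewrite addr_ge0// mulr_ge0.
have b0 : 0 <= b by apply: divr_ge0 (ltW s20); rewrite !mulr_ge0.
have t2 : 0 < 1 - theta / s2 by rewrite subr_gt0; case/andP: ts2.
have lipn n : lip_bound theta ((theta / s2) ^+ n * K0 + b / (1 - theta / s2)) v.
  elim: n => [|n ih].
    move=> m x y xy; rewrite expr0 mul1r (le_trans (hK _ _ _ xy))//.
    by rewrite ler_wpM2r ?exprn_ge0 ?(ltW t0)// lerDl divr_ge0// ltW.
  set Kn := _ + _ in ih.
  have Kn0 : 0 <= Kn.
    apply: addr_ge0; last by apply: divr_ge0 => //; exact: ltW.
    by apply: mulr_ge0 => //; apply: exprn_ge0; case/andP: ts2.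
  move=> m x y xy; rewrite !vE -mulrBr Normc.normcM Normc.normcV.
  have h := twist_lip u hB ih Kn0 xy.
  have h2 : (D + 2 * F) * (1 + `|u|) * B <= (D + 2 * F) * 2 * B.
    by rewrite ler_wpM2r// ler_wpM2l// (lerD2l 1 _ 1).
  have -> : (theta / s2) ^+ n.+1 * K0 + b / (1 - theta / s2) =
      s2^-1 * (theta * Kn + (D + 2 * F) * 2 * B).
    rewrite exprS /Kn /b; set z := (theta / s2) ^+ n; field.
    by have [t0' t1'] := (t0, t1); apply/andP; split; rewrite gt_eqF// /s2; lra.
  rewrite -[leRHS]mulrA; apply: ler_pM; rewrite ?normc_ge0 ?invr_ge0 ?normc_ge0//.
    by rewrite lef_pV2// posrE (lt_le_trans s20).
  by rewrite (le_trans h)// ler_wpM2r ?exprn_ge0 ?(ltW t0)// lerD2l.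
move=> m x y xy; apply: (ler_geometric (C := K0 * theta ^+ m.+1) ts2) => n.
apply: le_trans (lipn n m x y xy) _; rewrite mulrDl.
have -> : b / (1 - theta / s2) = Kc * B by rewrite /b /Kc; ring.
by apply: ler_of_eq; ring.
Qed.

Lemma ex_normc_sup (v : X -> R[i]) B : normc_bound B v -> v <> (fun=> 0) ->
  exists B' x0, [/\ 0 < B', normc_bound B' v & B' / 2 < nc (v x0)].
Proof.
move=> hB' vn0; pose S := [set nc (v x) | x in [set: X]].
have supS : has_sup S.
  split; first by exists (nc (v point)); exists point.
  by exists B => _ [x _ <-].
have hB : normc_bound (sup S) v by move=> x; apply: sup_upper_bound => //; exists x.
have B0 : 0 < sup S.
  rewrite lt_def (normc_bound_ge0 hB) andbT; apply/eqP => B0; apply: vn0.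
  apply/funext => x; apply: normc_eq0; apply/eqP; rewrite eq_le normc_ge0 andbT.
  by have := hB x; rewrite B0.
have [_ [x0 _ <-] hx0] := sup_adherent (divr_gt0 B0 (ltr0n _ 2)) supS.
by exists (sup S), x0; split => //; lra.
Qed.

(** [a ^+ k * v] is the [k]-th iterate of [v] at frequency [u]; for small [u] it is close to the
    iterate at frequency 0, which is nearly constant. *)
Lemma eigen_osc (e : R) k u v a B L : normc_bound B v ->
  (forall x, twisted_op u v x = a * v x) -> 1 / 2 <= nc a ^+ k ->
  k%:R * (2 * (`|u| * d)) <= e / 8 ->
  (forall x, nc (iter k (twisted_op 0) v x - L) <= e / 8 * B) ->
  forall x y, nc (v x - v y) <= e * B.
Proof.
move=> hB hv ak uk hL x y; have B0 := normc_bound_ge0 hB.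
have close z : nc (a ^+ k * v z - L) <= e / 8 * B + e / 8 * B.
  rewrite -(eigen_iter hv); apply: le_trans (normc_dist _ _ (iter k (twisted_op 0) v z)) _.
  apply: lerD => //; apply: le_trans (twist_iter_diff k u hB z) _.
  by rewrite mulrA ler_wpM2r.
have h1 : nc (a ^+ k * v x - a ^+ k * v y) <= e / 2 * B.
  apply: le_trans (normc_dist _ _ L) _; rewrite [X in _ + X]normc_subC.
  by have := close x; have := close y; lra.
move: h1; rewrite -mulrBr Normc.normcM normcX => h1.
by have := ler_wpM2r (normc_ge0 (v x - v y)) ak; lra.
Qed.

Section small_frequencies.
Variables (r : R) (lam : R -> R[i]).
Hypothesis r0 : 0 < r.
Hypothesis eig : forall u, `|u| < r -> exists v B K,
  [/\ normc_bound B v, lip_bound theta K v, v <> (fun=> 0) & forall x, twisted_op u v x = lam u * v x].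
Hypothesis lam_cvg : forall e : R, 0 < e ->
  exists2 u0 : R, 0 < u0 & forall u, `|u| <= u0 -> nc (lam u - 1) <= e.

Lemma eigenvalue_power_near1 (e : R) k : 0 < e ->
  exists2 u0 : R, 0 < u0 & forall u, `|u| <= u0 ->
  [/\ nc (lam u - 1) <= e, 1 / 2 <= nc (lam u) ^+ k & (1 + theta) / 2 <= nc (lam u)].
Proof.
move=> e0; have t1' := t1.
have g02 : 1 / 2 <= (3 / 4 : R) < 1 by apply/andP; split; lra.
have [g /andP[g0 g1] hg] := bernoulli_root k g02.
pose e1 : R := Order.min e (Order.min (1 - g) ((1 - theta) / 2)).
have e10 : 0 < e1 by rewrite !lt_min e0 subr_gt0 g1 divr_gt0// subr_gt0.
have [u0 u00 hu0] := lam_cvg e10; exists u0 => // u /hu0.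
rewrite !le_min => /and3P[h1 h2 h3].
have low : 1 - nc (lam u - 1) <= nc (lam u).
  by have := normc_lerB 1 (1 - lam u); rewrite Normc.normc1 subKr normc_subC; lra.
split => //; last by lra.
apply: le_trans (_ : g ^+ k <= _); first by have := hg k (leqnn k); lra.
by rewrite lerXn2r ?nnegrE ?normc_ge0 ?(ltW g0)//; lra.
Qed.

(** The number [k] of steps is fixed first, by mixing at [u = 0]; then [u] is taken so small that
    [k] twisted steps hardly differ from [k] untwisted ones. Dividing by a value of nearly maximal
    modulus puts the eigenfunction close to 1, with a Lipschitz constant that does not depend on
    [eta]. *)
Lemma normalised_eigenfunction (eta : R) : 0 < eta -> exists2 u1 : R, 0 < u1 & forall u, `|u| <= u1 ->
  exists w, [/\ forall x, twisted_op u w x = lam u * w x, forall x, nc (w x - 1) <= eta,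
    lip_bound theta eigen_lip_const w & nc (lam u - 1) <= eta].
Proof.
move=> eta0; have [C [g [g01 C0 hC]]] := twist0_cvg.
have g0 : 0 <= g < 1 by case/andP: g01 => /ltW -> ->.
have Ck : 0 < C * (2 + Kc) by apply: mulr_gt0 => //; apply: (ltr_wpDr Kc0).
have eta16 : 0 < eta / 2 / 8 by rewrite !divr_gt0.
have [k hk] : exists k, g ^+ k <= eta / 2 / 8 / (C * (2 + Kc)).
  by apply: geometric_small => //; rewrite divr_gt0.
have hk' : C * (2 + Kc) * g ^+ k <= eta / 2 / 8 by rewrite mulrC -ler_pdivlMr.
have [u0 u00 hu0] := eigenvalue_power_near1 k eta0.
have dk : 0 < k.+1%:R * (2 * (d + 1)) by rewrite !mulr_gt0// ltr_wpDl.
exists (Order.min (Order.min u0 (r / 2)) (Order.min 1 (eta / 2 / 8 / (k.+1%:R * (2 * (d + 1)))))).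
  by rewrite !lt_min u00 ltr01 !divr_gt0.
move=> u; rewrite !le_min => /andP[/andP[/hu0[lam1 lamk lams2] ur] /andP[u1 ue]].
have [v [B' [K' [hB' hK' vn0 hv]]]] : exists v B K,
  [/\ normc_bound B v, lip_bound theta K v, v <> (fun=> 0) & forall x, twisted_op u v x = lam u * v x].
  by apply: eig; rewrite (le_lt_trans ur)// ltr_pdivrMr// ltr_pMr// ltr1n.
have [B [x0 [B0 hB hx0]]] := ex_normc_sup hB' vn0.
have lipv := eigen_lip u1 lams2 hv hB hK'.
have oscv : osc_bound (2 * B) v.
  by move=> x y; rewrite (le_trans (normcB _ _))// mulr_natl mulr2n lerD.
have [L hL] := hC v (2 * B) (Kc * B) oscv lipv (mulr_ge0 Kc0 (ltW B0)).
have osc2 x : nc (v x - v x0) <= eta / 2 * B.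
  apply: (eigen_osc (k := k) (L := L) hB hv lamk).
    move: ue; rewrite ler_pdivlMr//; apply: le_trans.
    have -> : k%:R * (2 * (`|u| * d)) = `|u| * (k%:R * (2 * d)) by ring.
    by rewrite ler_wpM2l// ler_pM ?mulr_ge0 ?ler_nat// ler_wpM2l// lerDl.
  move=> y; apply: le_trans (hL k y) _.
  have -> : C * (2 * B + Kc * B) * g ^+ k = C * (2 + Kc) * g ^+ k * B by ring.
  by rewrite ler_wpM2r// ltW.
have vx0 : 0 < nc (v x0) by rewrite (lt_trans _ hx0)// divr_gt0.
have vx0n := normc_gt_neq0 vx0.
exists (fun x => v x / v x0); split => //.
- move=> x; rewrite mulrA -hv /twisted_op /weighted_op mulr_suml.
  by apply: eq_bigr => j _; rewrite mulrA.
- move=> x; rewrite -(divff vx0n) -mulrBl Normc.normcM Normc.normcV ler_pdivrMr//.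
  by rewrite (le_trans (osc2 x))// mulrAC -mulrA ler_wpM2l ?(ltW eta0) ?ltW.
- move=> m x y xy; rewrite -mulrBl Normc.normcM Normc.normcV ler_pdivrMr//.
  rewrite (le_trans (lipv m x y xy))// /eigen_lip_const -/s2 -/Kc.
  have -> : 2 * Kc * theta ^+ m.+1 * nc (v x0) = Kc * (nc (v x0) * 2) * theta ^+ m.+1 by ring.
  by rewrite ler_wpM2r ?exprn_ge0 ?(ltW t0)// ler_wpM2l// -ler_pdivrMr// ltW.
Qed.

End small_frequencies.
End twisted.

(** * Decay of the twisted operators at small frequencies *)

Section twisted_decay.
Variables (R : realType) (A : transition) (theta : R).
Hypotheses (t0 : 0 < theta) (t1 : theta < 1).
Local Notation X := (shift_space A).
Local Notation I := 'I_(kappa A).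
Local Notation nc := (@Normc.normc R).
Implicit Types (w g : X -> R[i]) (B K u : R).
Variables (p : I -> X -> R) (f : X -> R) (c D d F : R).
Hypotheses (hp : g_function theta c D p) (hf : lip_function theta d F f).
Local Notation twist := (twisted_op p f).
Local Notation twist_weight := (twisted_weight p f).

Definition twist_decay (u C b : R) := forall n w B K,
  normc_bound B w -> lip_bound theta K w -> 0 <= K ->
  normc_bound (C * b ^+ n * (B + K)) (iter n (twist u) w) /\
  lip_bound theta (C * b ^+ n * (B + K)) (iter n (twist u) w).

Section conjugation.
Variables (u : R) (a : R[i]) (w : X -> R[i]) (eta K2 : R).
Hypotheses (eta2 : eta <= 1 / 2) (K20 : 0 <= K2) (u1 : `|u| <= 1) (ud : `|u| * (2 * d) <= eta).
Hypotheses (hw : forall x, twist u w x = a * w x) (w1 : forall x, nc (w x - 1) <= eta).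
Hypotheses (wK : lip_bound theta K2 w) (a1 : nc (a - 1) <= eta).

(** A complex Doob transform: the eigenvalue equation for [w] says precisely that these weights sum
    to 1. *)
Definition conjugated_weight j x : R[i] := twist_weight u j x * w (pcons j x) / (a * w x).
Local Notation q := conjugated_weight.

Let wb x : 1 / 2 <= nc (w x) <= 3 / 2 := normc_near1 (w1 x) eta2.
Let ab : 1 / 2 <= nc a <= 3 / 2 := normc_near1 a1 eta2.
Let w0 x : 0 < nc (w x). Proof. by have /andP[? _] := wb x; lra. Qed.
Let a0 : 0 < nc a. Proof. by have /andP[? _] := ab; lra. Qed.

Let p0 x j : adm j x -> 0 <= p j x.
Proof. by have [/andP[/ltW c0 _] _ _ pc _] := hp => /pc; apply: le_trans. Qed.

Let sum_conjugated x : \sum_(j | adm j x) q j x = 1.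
Proof.
rewrite -mulr_suml (_ : \sum_(j | _) _ = a * w x); last by rewrite -hw.
by rewrite divff// mulf_neq0// normc_gt_neq0.
Qed.

Let conjugated_near e x j : 24 * eta <= e -> adm j x -> nc (q j x - (p j x)%:C%C) <= p j x * e.
Proof.
move=> etae jx; have px := p0 jx; have [_ _ fd _] := hf.
pose b := cis (u * f (pcons j x)); pose w' := w (pcons j x).
have -> : q j x - (p j x)%:C%C = (p j x)%:C%C * ((b * w' - a * w x) / (a * w x)).
  by rewrite /q /twisted_weight -/b -/w'; field; rewrite !normc_gt_neq0.
rewrite Normc.normcM normc_real ger0_norm// ler_wpM2l//.
rewrite Normc.normcM Normc.normcV Normc.normcM ler_pdivrMr ?mulr_gt0//.
(* The four pieces add up to at most [5 * eta], and [a * w x] has modulus at least [1 / 4]; hence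
   [20 * eta], below the assumed [24 * eta <= e]. *)
have -> : b * w' - a * w x = (b - 1) * w' + (w' - 1) - ((a - 1) * w x + (w x - 1)) by ring.
have h1 := normcB ((b - 1) * w' + (w' - 1)) ((a - 1) * w x + (w x - 1)).
have h2 := normcD ((b - 1) * w') (w' - 1); have h3 := normcD ((a - 1) * w x) (w x - 1).
rewrite !Normc.normcM in h2 h3.
have hb : nc (b - 1) <= eta.
  rewrite -cis0 (le_trans (normc_cisB _ _))// subr0 (le_trans _ ud)// normrM.
  by rewrite mulrCA ler_wpM2l// ler_wpM2l.
have /andP[b1 b2] := wb (pcons j x); have /andP[x1 x2] := wb x; have /andP[l1 l2] := ab.
have hw' := w1 (pcons j x); have hx := w1 x.
have m1 : nc (b - 1) * nc w' <= eta * (3 / 2) by rewrite ler_pM ?normc_ge0.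
have m2 : nc (a - 1) * nc (w x) <= eta * (3 / 2) by rewrite ler_pM ?normc_ge0.
have e0 : 0 <= e by have := le_trans (normc_ge0 _) hx; lra.
have m3 : e * (1 / 2 * (1 / 2)) <= e * (nc a * nc (w x)) by rewrite ler_wpM2l// ler_pM.
rewrite -/w' in hw' b1 b2 *; lra.
Qed.

Lemma conjugated_stochastic e : 24 * eta <= e -> near_stochastic c e p q.
Proof.
have [/andP[c0 _] _ p1 pc _] := hp.
move=> etae; split => // x; rewrite -[leRHS]mul1r -(p1 x) mulr_suml.
by apply: ler_sum => j jx; exact: conjugated_near.
Qed.

Let ratio j z := w (pcons j z) / w z.

Let normc_ratio j z : nc (ratio j z) <= 3.
Proof.
rewrite Normc.normcM Normc.normcV ler_pdivrMr//.
by have /andP[? ?] := wb z; have /andP[? ?] := wb (pcons j z); lra.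
Qed.

Let normc_ratioB j x y m : adm j x -> agree m.+1 x y ->
  nc (ratio j x - ratio j y) <= 12 * K2 * theta ^+ m.+1.
Proof.
move=> jx xy; have jy : adm j y by rewrite -(agree_adm _ xy).
have /andP[x1 _] := wb x; have /andP[y1 y2] := wb y; have /andP[_ jy2] := wb (pcons j y).
have h1 : nc (w (pcons j x) - w (pcons j y)) <= K2 * theta ^+ m.+1.
  by apply: wK; apply: agreeW (agree_pcons jx jy xy).
have h2 : nc (w x - w y) <= K2 * theta ^+ m.+1 by exact: wK.
set T := theta ^+ m.+1 in h1 h2 *.
have m1 : nc (w (pcons j x) - w (pcons j y)) * nc (w y) <= K2 * T * (3 / 2).
  by rewrite ler_pM ?normc_ge0.
have m2 : nc (w (pcons j y)) * nc (w x - w y) <= 3 / 2 * (K2 * T).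
  by rewrite ler_pM ?normc_ge0.
by apply: le_trans (normc_quotient_dist _ _ x1 y1) _; lra.
Qed.

Let conjugated_dist j x y m : adm j x -> agree m.+1 x y -> nc (q j x - q j y) <=
  6 * nc (twist_weight u j x - twist_weight u j y) + p j y * (24 * K2 * theta ^+ m.+1).
Proof.
move=> jx xy; have jy : adm j y by rewrite -(agree_adm _ xy).
have qE z : q j z = twist_weight u j z * ratio j z * a^-1 by rewrite /q /ratio invfM; ring.
have -> : q j x - q j y = ((twist_weight u j x - twist_weight u j y) * ratio j x +
  twist_weight u j y * (ratio j x - ratio j y)) * a^-1 by rewrite !qE; ring.
rewrite Normc.normcM Normc.normcV.
have h1 := normcD ((twist_weight u j x - twist_weight u j y) * ratio j x)
  (twist_weight u j y * (ratio j x - ratio j y)).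
rewrite (Normc.normcM (_ - _)) (Normc.normcM (twist_weight u j y)) in h1.
rewrite (normc_twist_weight f hp u jy) in h1.
have h2 := ler_wpM2l (normc_ge0 (twist_weight u j x - twist_weight u j y)) (normc_ratio j x).
have h3 := ler_wpM2l (p0 jy) (normc_ratioB jx xy).
set S := nc (_ + _) in h1 *; have S0 : 0 <= S by exact: normc_ge0.
have ia : (nc a)^-1 <= 2 by have /andP[? _] := ab; rewrite invf_ple ?posrE//; lra.
by have h4 := ler_wpM2l S0 ia; lra.
Qed.

Lemma conjugated_lip : lip_weights theta (12 * (D + 2 * F) + 24 * K2) q.
Proof.
have [_ D0 p1 _ _] := hp; have [_ F0 _ _] := hf.
move=> m x y xy; set T := theta ^+ m.+1; have T0 : 0 <= T by rewrite exprn_ge0// ltW.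
apply: (@le_trans _ _ (\sum_(j | adm j x) (6 * nc (twist_weight u j x - twist_weight u j y) +
    p j y * (24 * K2 * T)))).
  by apply: ler_sum => j jx; exact: conjugated_dist.
rewrite big_split/= -mulr_sumr -mulr_suml.
rewrite (eq_bigl (fun j => adm j y) (fun j => p j y)); last by move=> j; rewrite (agree_adm _ xy).
rewrite p1 mul1r.
have := twist_weight_lip t0 t1 hp hf u xy; rewrite -/T.
have : (D + 2 * F) * (1 + `|u|) * T <= (D + 2 * F) * 2 * T.
  by rewrite ler_wpM2r// ler_wpM2l ?addr_ge0 ?mulr_ge0// (lerD2l 1 _ 1).
lra.
Qed.

Let W h n := iter n (weighted_op q) (fun x => h x / w x).

Let iter_twist_conj h n x : iter n (twist u) h x = a ^+ n * (w x * W h n x).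
Proof.
have wn0 z := normc_gt_neq0 (w0 z); have an0 := normc_gt_neq0 a0.
elim: n x => [|n ih] x; first by rewrite /W expr0 mul1r mulrC divfK.
rewrite iterS (_ : iter n (twist u) h = fun x => a ^+ n * (w x * W h n x)); last exact/funext.
rewrite /W iterS -/(W h n) /weighted_op exprS.
have -> : a * a ^+ n * (w x * \sum_(j | adm j x) q j x * W h n (pcons j x)) =
  a ^+ n * \sum_(j | adm j x) a * w x * (q j x * W h n (pcons j x)).
  by rewrite -mulr_sumr; ring.
rewrite /twisted_op /weighted_op mulr_sumr; apply: eq_bigr => j jx.
by rewrite /q; field; rewrite wn0 an0.
Qed.

Let conj_start h B K : normc_bound B h -> lip_bound theta K h ->
  [/\ normc_bound (2 * B) (W h 0%N), osc_bound (4 * B) (W h 0%N)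
    & lip_bound theta (6 * K + 4 * B * K2) (W h 0%N)].
Proof.
move=> hB hK; have B0 := normc_bound_ge0 hB.
have W0B : normc_bound (2 * B) (W h 0%N).
  move=> x; rewrite /W /= Normc.normcM Normc.normcV ler_pdivrMr//.
  apply: le_trans (hB x) _; have /andP[? _] := wb x.
  rewrite mulrAC ler_peMl//; lra.
split => //.
  by move=> x y; rewrite (le_trans (normcB _ _))//; have := W0B x; have := W0B y; lra.
move=> m x y xy; set T := theta ^+ m.+1.
have /andP[x1 x2] := wb x; have /andP[y1 y2] := wb y.
apply: le_trans (normc_quotient_dist _ _ x1 y1) _.
have m1 : nc (h x - h y) * nc (w y) <= K * T * (3 / 2) by rewrite ler_pM ?normc_ge0 ?hK.
have m2 : nc (h y) * nc (w x - w y) <= B * (K2 * T) by rewrite ler_pM ?normc_ge0 ?hB ?wK.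
lra.
Qed.

Variables (e g C : R).
Hypotheses (e0 : 0 < e) (g01 : 0 < g < 1) (C0 : 0 < C) (etae : 24 * eta <= e).
Hypothesis contr : forall W, (forall n x, W n.+1 x = weighted_op q (W n) x) -> forall O K,
  osc_bound O (W 0%N) -> lip_bound theta K (W 0%N) -> 0 <= K ->
  forall n, osc_bound (C * (O + K) * g ^+ n) (W n) /\
    lip_bound theta (C * (O + K) * g ^+ n) (W n).

Let P : R := C * 12 * (1 + K2).
Let Q : R := 4 * ((1 + e) * P / (1 - g)) + 2.

Let conj_chain h n B K : normc_bound B h -> lip_bound theta K h -> 0 <= K ->
  normc_bound (Q * (B + K)) (W h n) /\ lip_bound theta (P * (B + K)) (W h n).
Proof.
move=> hB hK K0; have B0 := normc_bound_ge0 hB; have [W0B W0O W0K] := conj_start hB hK.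
have K'0 : 0 <= 6 * K + 4 * B * K2 by rewrite addr_ge0 ?mulr_ge0.
have hW k x : W h k.+1 x = weighted_op q (W h k) x by [].
have st := contr hW W0O W0K K'0; set O := _ + (_ + _) in st.
have OB : C * O <= P * (B + K).
  rewrite /P -!mulrA ler_wpM2l ?(ltW C0)// /O.
  by have := mulr_ge0 B0 K20; have := mulr_ge0 K0 K20; lra.
have PB : 0 <= P * (B + K) by rewrite !mulr_ge0 ?addr_ge0 ?(ltW C0).
have /andP[g0 g1] := g01; have gn k : 0 <= g ^+ k <= 1.
  by rewrite exprn_ge0 ?exprn_ile1 ?(ltW g0) ?(ltW g1).
split; last first.
  move=> m x y xy; apply: le_trans ((st n).2 m x y xy) _.
  rewrite ler_wpM2r ?exprn_ge0 ?(ltW t0)// (le_trans (ler_wpM2r _ OB))//; case/andP: (gn n) => // *.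
  by rewrite ler_piMr.
move=> x; have c0 : 0 < c by have [/andP[]] := hp.
(* The chain theorem contracts oscillations but gives no sup bound. That one comes from the
   increments at a fixed point, which are geometrically summable because an average moves a value by
   no more than the oscillation. *)
have drift i : nc (W h i.+1 x - W h i x) <= (1 + e) * (P * (B + K)) * g ^+ i.
  rewrite hW; apply: le_trans (weighted_op_osc c0 (conjugated_stochastic etae) (st i).1 x x) _.
  rewrite -[leRHS]mulrA ler_wpM2l ?addr_ge0 ?(ltW e0)//.
  by rewrite ler_wpM2r//; case/andP: (gn i).
have gle : 0 <= g < 1 by rewrite (ltW g0).
have [L hL] := geometric_cauchy_complex gle drift.
have PQ : 0 <= (1 + e) * (P * (B + K)) / (1 - g).
  by rewrite divr_ge0 ?subr_ge0 ?(ltW g1)// mulr_ge0// addr_ge0// ltW.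
have h1 i : nc (W h i x - L) <= 2 * ((1 + e) * (P * (B + K)) / (1 - g)).
  by apply: le_trans (hL i) _; apply: ler_piMr; [exact: mulr_ge0 | case/andP: (gn i)].
have -> : W h n x = (W h n x - L) - (W h 0%N x - L) + W h 0%N x by ring.
apply: le_trans (normcD _ _) _; rewrite /Q mulrDl.
have -> : 4 * ((1 + e) * P / (1 - g)) * (B + K) = 4 * ((1 + e) * (P * (B + K)) / (1 - g)) by ring.
apply: lerD; last by rewrite (le_trans (W0B x))// ler_wpM2l// lerDl.
by apply: le_trans (normcB _ _) _; have := h1 n; have := h1 0%N; lra.
Qed.

(** The conjugated chain stays bounded, so the whole decay is the factor [a ^+ n] taken out by the
    conjugation; this is why the rate is exactly [nc a]. *)
Lemma conjugated_decay : twist_decay u (3 / 2 * P + (K2 + 3 / 2) * Q) (nc a).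
Proof.
move=> n h B K hB hK K0; have [WB WK] := conj_chain n hB hK K0.
have B0 := normc_bound_ge0 hB; have BK : 0 <= B + K by rewrite addr_ge0.
have P0 : 0 <= P by rewrite !mulr_ge0 ?addr_ge0 ?(ltW C0).
have /andP[g0 g1] := g01; have Q0 : 0 <= Q.
  apply: addr_ge0 => //; apply: mulr_ge0 => //; apply: divr_ge0; last by rewrite subr_ge0 ltW.
  by apply: mulr_ge0 => //; rewrite addr_ge0// ltW.
have PK := mulr_ge0 P0 BK; have QK := mulr_ge0 Q0 BK; have KQ := mulr_ge0 K20 QK.
split=> [x|m x y xy].
  rewrite iter_twist_conj Normc.normcM normcX.
  rewrite (mulrAC _ (nc a ^+ n)) [leLHS]mulrC ler_wpM2r ?exprn_ge0 ?normc_ge0// Normc.normcM.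
  have : nc (w x) * nc (W h n x) <= 3 / 2 * (Q * (B + K)).
    by have /andP[_ ?] := wb x; rewrite ler_pM ?normc_ge0.
  lra.
rewrite !iter_twist_conj -mulrBr Normc.normcM normcX.
rewrite 2!(mulrAC _ (nc a ^+ n)) [leLHS]mulrC ler_wpM2r ?exprn_ge0 ?normc_ge0//.
set T := theta ^+ m.+1; have T0 : 0 <= T by rewrite exprn_ge0// ltW.
have -> : w x * W h n x - w y * W h n y =
  w x * (W h n x - W h n y) + (w x - w y) * W h n y by ring.
apply: le_trans (normcD _ _) _; rewrite !Normc.normcM.
have h1 : nc (w x) * nc (W h n x - W h n y) <= 3 / 2 * (P * (B + K) * T).
  by have /andP[_ ?] := wb x; rewrite ler_pM ?normc_ge0//; exact: WK.
have h2 : nc (w x - w y) * nc (W h n y) <= K2 * T * (Q * (B + K)).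
  by rewrite ler_pM ?normc_ge0// wK.
have := mulr_ge0 QK T0; lra.
Qed.

End conjugation.

Lemma small_twist_decay (r : R) (lam : R -> R[i]) : 0 < r ->
  (forall u, `|u| < r -> exists v B K,
    [/\ normc_bound B v, lip_bound theta K v, v <> (fun=> 0) & forall x, twist u v x = lam u * v x]) ->
  (forall e : R, 0 < e -> exists2 u0 : R, 0 < u0 & forall u, `|u| <= u0 -> nc (lam u - 1) <= e) ->
  exists u1 C : R, [/\ 0 < u1, 0 < C & forall u, `|u| <= u1 -> twist_decay u C (nc (lam u))].
Proof.
move=> r0 eig lamc.
have [c01 D0 _ _ _] := hp; have [d0 F0 _ _] := hf.
have K20 := eigen_lip_const_ge0 t0 t1 hp hf.
have eigw := normalised_eigenfunction t0 t1 hp hf r0 eig lamc.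
move: (eigen_lip_const theta D F) K20 eigw => K2 K20 eigw.
have D'0 : 0 <= 12 * (D + 2 * F) + 24 * K2 by rewrite addr_ge0// mulr_ge0// addr_ge0// mulr_ge0.
(* The tolerance [e] depends on the Lipschitz constant of the conjugated weights, hence on [K2]. As
   [K2] is the same for all [eta], [eta] can still be chosen afterwards in terms of [e]. *)
have [e [g [C [e0 g01 C0 contr]]]] := chain_contraction A t0 t1 c01 D'0.
pose eta : R := Order.min (1 / 2) (e / 24).
have eta0 : 0 < eta by rewrite lt_min !divr_gt0.
have eta2 : eta <= 1 / 2 by rewrite ge_min lexx.
have etae : 24 * eta <= e by have : eta <= e / 24; [rewrite ge_min lexx orbT | lra].
have [u1 u10 hu1] := eigw _ eta0.
have d1 : 0 < 2 * (d + 1) by rewrite mulr_gt0// ltr_wpDl.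
exists (Order.min (Order.min u1 1) (eta / (2 * (d + 1)))).
exists (3 / 2 * (C * 12 * (1 + K2)) +
  (K2 + 3 / 2) * (4 * ((1 + e) * (C * 12 * (1 + K2)) / (1 - g)) + 2)).
split; first by rewrite !lt_min u10 ltr01 divr_gt0.
  have /andP[g0 g1] := g01.
  have P0 : 0 < C * 12 * (1 + K2) by rewrite !mulr_gt0// ltr_wpDr.
  have Q0 : 0 <= (1 + e) * (C * 12 * (1 + K2)) / (1 - g).
    by rewrite divr_ge0 ?subr_ge0 ?(ltW g1)// mulr_ge0 ?(ltW P0)// addr_ge0// ltW.
  by rewrite addr_gt0// mulr_gt0// ?ltr_wpDl// mulr_ge0.
move=> u; rewrite !le_min => /andP[/andP[/hu1[w [hw w1 wK lam1]] u1'] ud].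
have ud' : `|u| * (2 * d) <= eta.
  by move: ud; rewrite ler_pdivlMr//; apply: le_trans; rewrite ler_wpM2l// ler_wpM2l// lerDl.
apply: (conjugated_decay eta2 K20 ud' hw w1 wK lam1 e0 g01 C0 etae) => W hW O K hO hK K0 n.
apply: (contr (fun=> p) (fun=> conjugated_weight u (lam u) w)) => // _.
  exact: (conjugated_stochastic eta2 ud' hw w1 lam1).
exact: (conjugated_lip eta2 u1' w1 wK lam1).
Qed.

End twisted_decay.

(** * Decay at frequencies in a compact set away from zero *)

Section unit_disc.
Variable R : realType.
Local Notation nc := (@Normc.normc R).

Lemma normc_expB (k : nat) (x y : R[i]) : nc x <= 1 -> nc y <= 1 ->
  nc (x ^+ k - y ^+ k) <= k%:R * nc (x - y).
Proof.
move=> x1 y1; elim: k => [|k ih]; first by rewrite !expr0 subrr Normc.normc0 mul0r.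
have -> : x ^+ k.+1 - y ^+ k.+1 = x * (x ^+ k - y ^+ k) + (x - y) * y ^+ k.
  by rewrite !exprS; ring.
apply: le_trans (normcD _ _) _; rewrite -natr1 [leRHS]mulrDl mul1r !Normc.normcM; apply: lerD.
  by rewrite -[leRHS]mul1r ler_pM ?normc_ge0.
by rewrite ler_piMr ?normc_ge0// normcX exprn_ile1 ?normc_ge0.
Qed.

Lemma normc_1B_sqr (z : R[i]) : nc z <= 1 -> nc (1 - z) ^+ 2 <= 2 * (1 - complex.Re z).
Proof.
case: z => a b /= h.
have h1 : a ^+ 2 + b ^+ 2 <= 1.
  have s0 : 0 <= a ^+ 2 + b ^+ 2 by rewrite addr_ge0 ?sqr_ge0.
  by rewrite -(sqr_sqrtr s0) exprn_ile1 ?sqrtr_ge0.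
rewrite sub0r sqrrN sqr_sqrtr ?addr_ge0 ?sqr_ge0//; nra.
Qed.

(** The bound is affine in the real part of [z], so it survives averaging with probabilities. It
    comes from [k t <= 1 / 4 + k^2 t^2] with [t] the modulus of [1 - z], whose square is at most
    [2 * (1 - Re z)]. *)
Lemma normc_1B_exp (k : nat) (z : R[i]) : nc z <= 1 ->
  nc (1 - z ^+ k) <= 1 / 4 + 2 * k%:R ^+ 2 * (1 - complex.Re z).
Proof.
move=> z1; have := @normc_expB k 1 z; rewrite expr1n Normc.normc1 => /(_ (lexx _) z1) h.
apply: le_trans h _; have := normc_1B_sqr z1; set t := nc _; set s := 1 - _ => h.
have k0 : 0 <= k%:R ^+ 2 :> R by rewrite exprn_ge0.
have := ler_wpM2l k0 h; have := sqr_ge0 (k%:R * t - 1 / 2).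
by rewrite sqrrB exprMn; lra.
Qed.

End unit_disc.

Section intermediate_frequencies.
Variables (R : realType) (A : transition) (theta : R).
Hypotheses (t0 : 0 < theta) (t1 : theta < 1).
Local Notation X := (shift_space A).
Local Notation I := 'I_(kappa A).
Local Notation nc := (@Normc.normc R).
Implicit Types (w g : X -> R[i]) (B K u : R).
Variables (p : I -> X -> R) (f : X -> R) (c D d F : R).
Hypotheses (hp : g_function theta c D p) (hf : lip_function theta d F f).
Local Notation twist := (twisted_op p f).
Local Notation twist_weight := (twisted_weight p f).

Lemma birkhoff_pcons n j x : adm j x ->
  birkhoff f n.+1 (pcons j x) = f (pcons j x) + birkhoff f n x.
Proof.
move=> jx; rewrite /birkhoff big_ord_recl /=; congr (_ + _).
by apply: eq_bigr => i _; rewrite add0n -iterS iterSr pconsK.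
Qed.

(** All phases move into the test function. Its [k]-th power then carries the phases of the
    frequency [k * u], under the same untwisted operator. *)
Lemma twist_birkhoff u n w x : iter n (twist u) w x =
  iter n (twist 0) (fun y => cis (u * birkhoff f n y) * w y) x.
Proof.
elim: n w x => [|n ih] w x; first by rewrite /= /birkhoff big_ord0 mulr0 cis0 mul1r.
rewrite iterSr ih iterSr; congr (iter n _ _ x); apply/funext => y.
rewrite /twisted_op /weighted_op mulr_sumr; apply: eq_bigr => j jy.
by rewrite /twisted_weight birkhoff_pcons// mulrDr cisD mul0r cis0; ring.
Qed.

Lemma twist0_affine n (a b : R[i]) w x :
  iter n (twist 0) (fun y => a + b * w y) x = a + b * iter n (twist 0) w x.
Proof.
have [_ _ p1 _ _] := hp.
elim: n x => [//|n ih] x; rewrite !iterS.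
rewrite (_ : iter n (twist 0) (fun y => a + b * w y) = fun y => a + b * iter n (twist 0) w y); last exact/funext.
have s1 : \sum_(j | adm j x) twist_weight 0 j x = 1.
  rewrite (eq_bigr (fun j => (p j x)%:C%C)); last first.
    by move=> j _; rewrite /twisted_weight mul0r cis0 mulr1.
  by rewrite -(rmorph_sum (real_complex R)) p1.
rewrite /twisted_op /weighted_op mulr_sumr -[X in X + _]mul1r -s1 mulr_suml -big_split.
by apply: eq_bigr => j _ /=; ring.
Qed.

Lemma twist0_dominate n w g : (forall y, nc (w y) <= complex.Re (g y)) ->
  forall x, nc (iter n (twist 0) w x) <= complex.Re (iter n (twist 0) g x).
Proof.
have [/andP[c0 _] _ _ pc _] := hp.
move=> h; elim: n => [//|n ih] x; rewrite !iterS Re_sum.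
apply: le_trans (normc_sum _ _ _) _; apply: ler_sum => j jx.
have pj : 0 <= p j x by rewrite (le_trans (ltW c0))// pc.
rewrite /twisted_weight mul0r cis0 mulr1 Re_realM Normc.normcM normc_real ger0_norm//.
by rewrite ler_wpM2l.
Qed.

Lemma twistZ u (a : R[i]) w n x :
  iter n (twist u) (fun y => a * w y) x = a * iter n (twist u) w x.
Proof.
elim: n x => [//|n ih] x; rewrite !iterS.
rewrite (_ : iter n (twist u) (fun y => a * w y) = fun y => a * iter n (twist u) w y); last exact/funext.
by rewrite /twisted_op /weighted_op mulr_sumr; apply: eq_bigr => j _; rewrite mulrCA.
Qed.

(* If |M_u^N w| were close to 1 at x, the terms cis (u f^N) w would be nearly aligned
   over the preimages of x, and so would be their k-th powers: M_{ku}^N (w^k) would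
   be large too. *)
Lemma twist_power_gap u (k N : nat) w : normc_bound 1 w ->
  normc_bound (1 / 2) (iter N (twist (k%:R * u)) (fun y => w y ^+ k)) ->
  normc_bound (1 - 1 / (8 * k%:R ^+ 2)) (iter N (twist u) w).
Proof.
move=> w1 hk x; have [->|k0] := posnP k.
  rewrite mulr0n expr0n /= mulr0 invr0 mulr0 subr0.
  exact: (twist_iter_bound f hp N u w1 x).
have k1 : 1 <= k%:R ^+ 2 :> R by rewrite exprn_ege1// ler1n.
pose G y := cis (u * birkhoff f N y) * w y.
pose M := iter N (twist u) w x.
have ME : M = iter N (twist 0) G x by rewrite /M twist_birkhoff.
rewrite -/M; have [M0|Mn0] := eqVneq M 0.
  rewrite M0 Normc.normc0 subr_ge0 ler_pdivrMr; nra.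
have nM : 0 < nc M.
  by rewrite lt_def normc_ge0 andbT; apply: contra Mn0 => /eqP/normc_eq0 ->.
pose o : R[i] := (nc M)%:C%C / M.
have o1 : nc o = 1.
  by rewrite Normc.normcM Normc.normcV normc_real ger0_norm ?normc_ge0// divff// gt_eqF.
have oM : o * M = (nc M)%:C%C by rewrite divfK.
have G1 y : nc (o * G y) <= 1.
  by rewrite Normc.normcM o1 mul1r Normc.normcM normc_cis mul1r.
pose h : X -> R[i] := fun y => (1 / 4 + 2 * k%:R ^+ 2)%:C%C + (- (2 * k%:R ^+ 2)%:C%C * o) * G y.
have dom y : nc (1 + - o ^+ k * G y ^+ k) <= complex.Re (h y).
  rewrite mulNr -exprMn (le_trans (normc_1B_exp k (G1 y)))//.
  rewrite /h.
  have -> : - (2 * k%:R ^+ 2)%:C%C * o * G y = (- (2 * k%:R ^+ 2))%:C%C * (o * G y).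
    by rewrite rmorphN/=; ring.
  rewrite ReD.
  by rewrite Re_realM /=; apply: ler_of_eq; ring.
have := twist0_dominate N dom x; rewrite !twist0_affine -ME.
have -> : iter N (twist 0) (fun y => G y ^+ k) x = iter N (twist (k%:R * u)) (fun y => w y ^+ k) x.
  rewrite [RHS]twist_birkhoff; congr (iter N _ _ x); apply/funext => y.
  by rewrite /G exprMn cisX mulrA.
set Z := iter N _ _ x; have Z2 : nc Z <= 1 / 2 by exact: hk.
have -> : complex.Re ((1 / 4 + 2 * k%:R ^+ 2)%:C%C + - (2 * k%:R ^+ 2)%:C%C * o * M) =
    1 / 4 + 2 * k%:R ^+ 2 * (1 - nc M).
  by rewrite -mulrA oM -rmorphN -rmorphM -rmorphD /=; ring.
have := normc_lerB 1 (o ^+ k * Z); rewrite mulNr Normc.normc1 Normc.normcM normcX o1 expr1n mul1r.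
move=> h1 h2.
have h3 : 1 / 4 <= 2 * k%:R ^+ 2 * (1 - nc M) by lra.
rewrite lerBrDl -lerBrDr ler_pdivrMr; lra.
Qed.

Section power_gap.
Variables (u L : R) (k N : nat).
(** Slope of a cone that [N] steps map into itself: with [theta ^+ N <= 1 / 4] the new Lipschitz
    constant is at most [(K1 / 4 + L) * B <= K1 / 2 * B], which fits because [1 - eta >= 7 / 8]. *)
Let K1 : R := 4 * L + 1.
Let eta : R := 1 / (8 * k.+1%:R ^+ 2).
Hypotheses (L0 : 0 <= L) (uL : twist_lip_const theta D F * (1 + `|u|) <= L).
Hypotheses (N0 : (0 < N)%N) (tN : theta ^+ N <= 1 / 4).
Hypothesis power_half : forall v, normc_bound 1 v -> lip_bound theta K1 v ->
  normc_bound (1 / 2) (iter N (twist (k.+1%:R * u)) (fun y => v y ^+ k.+1)).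

Let K11 : 1 <= K1. Proof. by rewrite lerDr mulr_ge0. Qed.
Let K10 : 0 <= K1. Proof. exact: le_trans K11. Qed.

Let eta0 : 0 < eta. Proof. by rewrite divr_gt0// mulr_gt0// exprn_gt0. Qed.

Let eta8 : eta <= 1 / 8.
Proof.
have k2 : 1 <= k.+1%:R ^+ 2 :> R by rewrite exprn_ege1// ler1n.
by rewrite /eta ler_pdivrMr ?mulr_gt0 ?exprn_gt0//; lra.
Qed.

Let iter_lip n B w : normc_bound B w -> lip_bound theta (K1 * B) w ->
  lip_bound theta (theta ^+ n * (K1 * B) + L * B) (iter n (twist u) w).
Proof.
move=> h1 h2; have B0 := normc_bound_ge0 h1.
have KB0 : 0 <= K1 * B by rewrite mulr_ge0.
move=> m x y xy; apply: le_trans (twist_iter_lip t0 t1 hp hf n u h1 h2 KB0 xy) _.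
by rewrite ler_wpM2r ?exprn_ge0 ?(ltW t0)// lerD2l ler_wpM2r.
Qed.

Let gap_bound B w : 0 < B -> normc_bound B w -> lip_bound theta (K1 * B) w ->
  normc_bound ((1 - eta) * B) (iter N (twist u) w).
Proof.
move=> B0 h1 h2; have iB : 0 <= B^-1 by rewrite invr_ge0 ltW.
pose v : X -> R[i] := fun y => (B^-1)%:C%C * w y.
have v1 : normc_bound 1 v.
  move=> y; rewrite Normc.normcM normc_real ger0_norm// mulrC ler_pdivrMr// mul1r.
  exact: h1.
have vK : lip_bound theta K1 v.
  move=> m x y xy; rewrite -mulrBr Normc.normcM normc_real ger0_norm// mulrC ler_pdivrMr//.
  by rewrite mulrAC; exact: h2.
move=> x; have := twist_power_gap v1 (power_half v1 vK) x.
by rewrite twistZ Normc.normcM normc_real ger0_norm// mulrC ler_pdivrMr.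
Qed.

Let gap_lip B w : normc_bound B w -> lip_bound theta (K1 * B) w ->
  lip_bound theta (K1 * ((1 - eta) * B)) (iter N (twist u) w).
Proof.
move=> h1 h2; have B0 := normc_bound_ge0 h1.
move=> m x y xy; apply: le_trans (iter_lip N h1 h2 xy) _.
rewrite ler_wpM2r ?exprn_ge0 ?(ltW t0)//.
have KB : 0 <= K1 * B by rewrite mulr_ge0.
have := ler_wpM2r KB tN; have := ler_wpM2r KB eta8.
have KE : K1 * B = 4 * (L * B) + B by rewrite /K1; ring.
have -> : K1 * ((1 - eta) * B) = K1 * B - eta * (K1 * B) by ring.
by move: (eta * _) (theta ^+ N * _) => *; lra.
Qed.

Let blocks a B w : 0 < B -> normc_bound B w -> lip_bound theta (K1 * B) w ->
  normc_bound ((1 - eta) ^+ a * B) (iter (a * N) (twist u) w) /\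
  lip_bound theta (K1 * ((1 - eta) ^+ a * B)) (iter (a * N) (twist u) w).
Proof.
move=> B0 h1 h2; elim: a => [|a [ih1 ih2]]; first by rewrite expr0 mul1r mul0n.
have e1 : 0 < 1 - eta by have := eta8; lra.
have := gap_bound (mulr_gt0 (exprn_gt0 a e1) B0) ih1 ih2; have := gap_lip ih1 ih2.
by rewrite mulSn iterD exprS mulrA.
Qed.

Lemma power_gap_decay (b : R) : 0 <= b ->
  (forall n, (1 - eta) ^+ (n %/ N) <= 2 * b ^+ n) -> twist_decay theta p f u (4 * K1) b.
Proof.
move=> b0 hb n w B K hB hK K0; have B0 := normc_bound_ge0 hB.
(* [gap_bound] rescales by the inverse of the bound, so the zero function is treated apart. *)
have [BK0|BKn0] := eqVneq (B + K) 0.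
  have B00 : B = 0 by lra. have K00 : K = 0 by lra.
  rewrite BK0 mulr0; split.
    by apply: (twist_iter_bound f hp); rewrite -B00.
  move=> m x y xy; apply: le_trans (twist_iter_lip t0 t1 hp hf n u hB hK K0 xy) _.
  by rewrite B00 K00 !mulr0 addr0.
have BK : 0 < B + K by rewrite lt_def BKn0 addr_ge0.
have h1 : normc_bound (B + K) w by move=> x; rewrite (le_trans (hB x))// lerDl.
have h2 : lip_bound theta (K1 * (B + K)) w.
  move=> m x y xy; rewrite (le_trans (hK m x y xy))// ler_wpM2r ?exprn_ge0 ?(ltW t0)//.
  by rewrite (@le_trans _ _ (B + K)) ?lerDr// ler_peMl// ltW.
have [g1 g2] := blocks (n %/ N)%N BK h1 h2.
rewrite (_ : iter n _ w = iter (n %% N) (twist u) (iter (n %/ N * N) (twist u) w)); last first.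
  by rewrite -iterD addnC -divn_eq.
set v := iter (n %/ N * N) _ _ in g1 g2 *; set Bn := _ * (B + K) in g1 g2.
have Bn0 : 0 <= Bn := normc_bound_ge0 g1.
have BnE : Bn <= 2 * b ^+ n * (B + K) by rewrite /Bn ler_wpM2r ?(ltW BK).
have KBn : K1 * Bn <= K1 * (2 * b ^+ n * (B + K)) by rewrite ler_wpM2l.
split.
  move=> x; apply: le_trans (twist_iter_bound f hp (n %% N) u g1 x) _.
  have : Bn <= K1 * Bn by rewrite ler_peMl.
  have := mulr_ge0 K10 Bn0; lra.
move=> m x y xy; apply: le_trans (iter_lip (n %% N)%N g1 g2 xy) _.
rewrite ler_wpM2r ?exprn_ge0 ?(ltW t0)//.
have KB : 0 <= K1 * Bn by rewrite mulr_ge0.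
have : theta ^+ (n %% N) * (K1 * Bn) <= K1 * Bn by rewrite ler_piMl// exprn_ile1// ltW.
have : L * Bn <= K1 * Bn by rewrite ler_wpM2r// /K1; have := L0 => ?; lra.
lra.
Qed.

End power_gap.

(** A single multiplier [k.+1] serves the whole range: it is at least [a0 / u0], so every multiple
    [k.+1 * u] lies in the contracting region and below [k.+1 * a1]. The [k.+1]-th power of a
    function of sup norm at most 1 and Lipschitz constant [4 * L + 1] has constant at most
    [k.+1 * (4 * L + 1)]; the block length is taken so large that the contraction brings its image
    below [1 / 2]. *)
Lemma mid_twist_decay (a0 u0 a1 rho : R) : 0 < u0 -> 0 < rho < 1 ->
  (forall a2 : R, exists2 C : R, 0 < C & forall u n w B K, a0 <= `|u| <= a2 ->
    normc_bound B w -> lip_bound theta K w -> 0 < B -> 0 <= K ->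
    normc_bound (C * rho ^+ n * (B + K)) (iter n (twist u) w)) ->
  exists b C : R, [/\ 0 < b < 1, 0 < C & forall u, u0 <= `|u| <= a1 ->
    twist_decay theta p f u C b].
Proof.
move=> u00 /andP[r0 r1] hW.
have [k hk] : exists k : nat, a0 / u0 <= k%:R.
  by exists (Num.bound `|a0 / u0|); rewrite (le_trans (ler_norm _))// ltW// archi_boundP.
have ku0 : a0 <= k.+1%:R * u0.
  by rewrite -ler_pdivrMr// (le_trans hk)// ler_nat.
have [C C0 hC] := hW (k.+1%:R * a1).
have T0 := twist_lip_const_ge0 t1 hp hf.
pose L : R := twist_lip_const theta D F * (1 + `|a1|).
have L0 : 0 <= L by apply: mulr_ge0 => //; exact: addr_ge0.
have K10 : 0 <= 4 * L + 1 by rewrite addr_ge0// mulr_ge0.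
have Ck : 0 < C * (1 + k.+1%:R * (4 * L + 1)) by rewrite mulr_gt0// ltr_wpDr// mulr_ge0.
pose s : R := Order.max theta rho.
have s01 : 0 <= s < 1 by rewrite le_max (ltW t0)/= gt_max t1.
have [N1 hN1] : exists N, s ^+ N <= Order.min (1 / 4) (1 / 2 / (C * (1 + k.+1%:R * (4 * L + 1)))).
  by apply: geometric_small => //; rewrite lt_min !divr_gt0.
have : s ^+ N1.+1 <= s ^+ N1 by case/andP: s01 => ? ?; rewrite exprS ler_piMl ?exprn_ge0// ltW.
move=> /le_trans/(_ hN1); rewrite le_min => /andP[hN4 hNC].
have tN : theta ^+ N1.+1 <= 1 / 4.
  by apply: le_trans hN4; rewrite lerXn2r ?nnegrE ?le_max ?lexx ?(ltW t0).
have rN : C * rho ^+ N1.+1 * (1 + k.+1%:R * (4 * L + 1)) <= 1 / 2.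
  rewrite mulrAC mulrC -ler_pdivlMr//; apply: le_trans hNC.
  by rewrite lerXn2r ?nnegrE ?(ltW r0)// ?le_max ?lexx ?orbT// (ltW t0).
have e12 : 1 / 2 <= (1 - 1 / (8 * k.+1%:R ^+ 2) : R) < 1.
  have k2 : 1 <= k.+1%:R ^+ 2 :> R by rewrite exprn_ege1// ler1n.
  have k80 : 0 < 8 * k.+1%:R ^+ 2 :> R by rewrite mulr_gt0// exprn_gt0.
  have : 0 < 1 / (8 * k.+1%:R ^+ 2) :> R by rewrite divr_gt0.
  have : 1 / (8 * k.+1%:R ^+ 2) <= 1 / 2 :> R by rewrite ler_pdivrMr//; lra.
  by move: (1 / (8 * _)) => x x2 x0; apply/andP; split; lra.
have [b /andP[b0 b1] hb] := bernoulli_root N1.+1 e12.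
exists b, (4 * (4 * L + 1)); split; [by rewrite b0 | by rewrite mulr_gt0// ltr_wpDl// mulr_ge0 |].
move=> u /andP[uu0 ua1]; have a10 : 0 <= a1 := le_trans (normr_ge0 u) ua1.
apply: (@power_gap_decay u L k N1.+1) => //; last 2 first.
- exact: ltW.
- by move=> n; apply: block_geometric => //; case/andP: e12.
- by rewrite /L ler_wpM2l// lerD2l (ger0_norm a10).
move=> v v1 vK; have vk1 : normc_bound 1 (fun y => v y ^+ k.+1).
  by move=> y; rewrite normcX exprn_ile1 ?normc_ge0.
have vkK : lip_bound theta (k.+1%:R * (4 * L + 1)) (fun y => v y ^+ k.+1).
  move=> m x y xy; apply: le_trans (normc_expB _ (v1 _) (v1 _)) _.
  by rewrite -mulrA ler_wpM2l// vK.
have ku : a0 <= `|k.+1%:R * u| <= k.+1%:R * a1.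
  by rewrite normrM normr_nat ler_wpM2l// andbT (le_trans ku0)// ler_wpM2l.
move=> y; apply: le_trans rN.
exact: (hC (k.+1%:R * u) N1.+1 _ 1 (k.+1%:R * (4 * L + 1)) ku vk1 vkK ltr01 (mulr_ge0 (ler0n _ _) K10)).
Qed.

End intermediate_frequencies.

(** * Periodic points and branches *)

Section periodic_points.
Variable A : transition.
Local Notation X := (shift_space A).
Local Notation I := 'I_(kappa A).
Local Notation sg := (@left_shift A).
Implicit Types (v : seq I) (x y z : X).

Fixpoint words (m : nat) : seq (seq I) :=
  if m is m'.+1 then [seq rcons v j | v <- words m', j <- enum 'I_(kappa A)]
  else [:: [::]].

Lemma mem_words m v : (v \in words m) = (size v == m).
Proof.
elim: m v => [|m ih] v; first by rewrite inE size_eq0.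
apply/allpairsP/eqP => [[[w j] /= [+ _ ->]]|].
  by rewrite ih size_rcons => /eqP ->.
case/lastP: v => // w j; rewrite size_rcons => -[wm].
by exists (w, j); rewrite ih wm mem_enum.
Qed.

Lemma sum_words_rcons (V : nmodType) m (G : seq I -> V) :
  \sum_(v <- words m.+1) G v = \sum_(v <- words m) \sum_j G (rcons v j).
Proof.
rewrite /= big_allpairs_dep; apply: eq_bigr => v _; exact: big_enum.
Qed.

Lemma words_uniq m : uniq (words m).
Proof.
elim: m => // m ih; apply: allpairs_uniq => //; first exact: enum_uniq.
by move=> [v j] [w k] _ _ /= /rcons_inj[-> ->].
Qed.

Definition itinerary x m : seq I := mkseq x m.

Lemma itineraryS x m : itinerary x m.+1 = rcons (itinerary x m) (x m).
Proof. by rewrite /itinerary mkseqS. Qed.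

Lemma agree_itinerary m x y : agree m x y <-> itinerary x m = itinerary y m.
Proof.
split=> [h|h i im].
  by apply/eq_in_map => i; rewrite mem_iota => /h.
by have := congr1 (fun s => nth (x i) s i) h; rewrite /itinerary !nth_mkseq.
Qed.

Definition cycle_words m v := `[< exists x, itinerary x m = v /\ iter m sg x = x >].

(* A point of the cylinder [v]; it is the periodic one when there is one, and
   junk when the cylinder is empty. *)
Definition word_point v : X :=
  xget (xget point [set x | itinerary x (size v) = v])
       [set x | itinerary x (size v) = v /\ iter (size v) sg x = x].

Lemma word_pointP v x : itinerary x (size v) = v -> itinerary (word_point v) (size v) = v.
Proof.
move=> xv; rewrite /word_point; case: xgetP => [y _ [] //|_].
by case: xgetP => [y _ //|/(_ x)].
Qed.

Lemma word_point_cycle v : cycle_words (size v) v ->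
  itinerary (word_point v) (size v) = v /\ iter (size v) sg (word_point v) = word_point v.
Proof.
move=> /asboolP[x hx]; rewrite /word_point; case: xgetP => [y _ []//|/(_ x)].
by move=> /(_ hx).
Qed.

Lemma periodic_coord m x i k : iter m sg x = x -> x (k * m + i)%N = x i.
Proof.
move=> h; elim: k => [|k ih]; first by rewrite mul0n.
by rewrite mulSn -addnA -iter_shift h ih.
Qed.

Lemma periodic_itinerary_inj m x y : (0 < m)%N -> iter m sg x = x -> iter m sg y = y ->
  itinerary x m = itinerary y m -> x = y.
Proof.
move=> m0 hx hy /agree_itinerary h; apply: shift_ext => i.
by rewrite (divn_eq i m) !periodic_coord// h// ltn_mod.
Qed.

Definition periodic_seq m : seq X := [seq word_point v | v <- words m & cycle_words m v].

Lemma mem_periodic_seq m x : (0 < m)%N -> reflect (iter m sg x = x) (x \in periodic_seq m).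
Proof.
move=> m0; apply: (iffP mapP) => [[v]|hx].
  by rewrite mem_filter mem_words => /andP[+ /eqP mv]; rewrite -mv => /word_point_cycle[_ ?] ->.
have cx : cycle_words m (itinerary x m) by apply/asboolP; exists x.
have sx : size (itinerary x m) = m by rewrite size_mkseq.
exists (itinerary x m); first by rewrite mem_filter cx mem_words sx eqxx.
have := @word_point_cycle (itinerary x m); rewrite sx => /(_ cx)[h1 h2].
exact: (@periodic_itinerary_inj m).
Qed.

Lemma periodic_seq_uniq m : (0 < m)%N -> uniq (periodic_seq m).
Proof.
move=> m0; rewrite map_inj_in_uniq; first by apply: filter_uniq; exact: words_uniq.
move=> v w; rewrite !mem_filter !mem_words => /andP[cv /eqP mv] /andP[cw /eqP mw] vw.
rewrite -mv in cv; have [<- _] := word_point_cycle cv.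
by rewrite -mw in cw; have [<- _] := word_point_cycle cw; rewrite vw mv mw.
Qed.

(** From [pzx] the symbol of [z] at time [m], which is the first one of [x], equals the first one of
    [z]. The word therefore closes up, and repeating it gives an admissible periodic point. *)
Lemma ex_cycle m x z : (0 < m)%N -> iter m sg z = x -> itinerary z m = itinerary x m ->
  cycle_words m (itinerary x m).
Proof.
move=> m0 zx pzx.
have z0 : z m = z 0%N.
  have : iter m sg z 0%N = z 0%N by rewrite zx; move/agree_itinerary: pzx => ->.
  by rewrite iter_shift addn0.
have yP j : tmx A (z (j %% m)%N) (z (j.+1 %% m)%N) = 1%N.
  have jm : (j %% m < m)%N by rewrite ltn_mod.
  rewrite -addn1 -modnDml addn1; have [jm1|jm1] := ltnP (j %% m).+1 m.
    by rewrite (modn_small jm1) coordP.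
  have -> : (j %% m).+1 = m by apply/eqP; rewrite eqn_leq jm jm1.
  rewrite modnn -z0 -[X in tmx A _ (z X)](_ : (j %% m).+1 = m); first exact: coordP.
  by apply/eqP; rewrite eqn_leq jm jm1.
apply/asboolP; exists (ShiftSpace yP); rewrite -pzx; split.
  by apply/agree_itinerary => i im /=; rewrite modn_small.
by apply: shift_ext => i; rewrite iter_shift /= modnDl.
Qed.

Lemma ex_first_symbol (i : I) : exists x : X, x 0%N = i.
Proof.
have [M _ hM] := tmx_aperiodic A.
by have [z [zi _]] := ex_path_pow (hM i ((point : X) 0%N)); exists z.
Qed.

End periodic_points.

Section branches.
Variables (R : realType) (A : transition) (theta : R).
Hypotheses (t0 : 0 < theta) (t1 : theta < 1).
Local Notation X := (shift_space A).
Local Notation I := 'I_(kappa A).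
Local Notation sg := (@left_shift A).
Local Notation nc := (@Normc.normc R).
Implicit Types (w g : X -> R[i]) (B K u : R) (v : seq I).
Variables (p : I -> X -> R) (f : X -> R) (c D d F : R).
Hypotheses (hp : g_function theta c D p) (hf : lip_function theta d F f).
Local Notation twist := (twisted_op p f).
Local Notation twist_weight := (twisted_weight p f).

Let p0 j x : adm j x -> 0 < p j x.
Proof. by case: hp => /andP[c0 _] _ _ pc _ /pc; apply: lt_le_trans. Qed.

Definition branch u j w x := if adm j x then twist_weight u j x * w (pcons j x) else 0.

(** The last letter of [v] is prepended to [x] first, so the value at [x] is [w] at the point [v x]
    times the twisted weight of this inverse branch. It is 0 if the word is not admissible before
    [x]; the sum over all words of length [n] is the [n]-th iterate of the operator. *)
Definition branches u v w := foldl (fun w j => branch u j w) w v.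

Lemma branches_rcons u v j w : branches u (rcons v j) w = branch u j (branches u v w).
Proof. by rewrite /branches foldl_rcons. Qed.

Lemma twist_branch u w x : twist u w x = \sum_j branch u j w x.
Proof. by rewrite /twisted_op /weighted_op big_mkcond. Qed.

Lemma twist_iter_sum u n (J : Type) (r : seq J) (G : J -> X -> R[i]) x :
  iter n (twist u) (fun y => \sum_(j <- r) G j y) x = \sum_(j <- r) iter n (twist u) (G j) x.
Proof.
elim: n x => [//|n ih] x; rewrite iterS.
rewrite (_ : iter n _ _ = fun y => \sum_(j <- r) iter n (twist u) (G j) y); last exact/funext.
rewrite /twisted_op /weighted_op; under eq_bigr => i _ do rewrite mulr_sumr.
by rewrite exchange_big.
Qed.

Lemma branches_neq0 u v w x : branches u v w x != 0 ->
  exists z, itinerary z (size v) = v /\ iter (size v) sg z = x.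
Proof.
elim/last_ind: v x => [|v j ih] x; first by exists x.
rewrite branches_rcons /branch; case: ifPn => [jx|]; last by rewrite eqxx.
rewrite mulf_eq0 negb_or => /andP[_ /ih[z [zv zx]]].
exists z; rewrite size_rcons itineraryS zv iterS zx pconsK//; split => //.
by congr rcons; rewrite -(addn0 (size v)) -iter_shift zx pcons0.
Qed.

Lemma branches_itinerary u z n w : branches u (itinerary z n) w (iter n sg z) =
  (\prod_(i < n) p (z i) (iter i.+1 sg z))%:C%C * cis (u * birkhoff f n z) * w z.
Proof.
elim: n => [|n ih]; first by rewrite /birkhoff !big_ord0 mulr0 cis0 mulr1 mul1r.
have zn : z n = iter n sg z 0%N by rewrite iter_shift addn0.
rewrite itineraryS branches_rcons /branch iterS zn adm_head pcons_head ih.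
rewrite /birkhoff !big_ord_recr /= /twisted_weight pcons_head -iterS -zn.
by rewrite mulrDr cisD rmorphM/=; ring.
Qed.

Definition branch_mass v x : R :=
  foldl (fun (g : X -> R) j y => if adm j y then p j y * g (pcons j y) else 0) (fun=> 1) v x.

Lemma branch_mass_rcons v j x : branch_mass (rcons v j) x =
  if adm j x then p j x * branch_mass v (pcons j x) else 0.
Proof. by rewrite /branch_mass foldl_rcons. Qed.

Lemma branch_mass_ge0 v x : 0 <= branch_mass v x.
Proof.
elim/last_ind: v x => [|v j ih] x //; rewrite branch_mass_rcons; case: ifP => // jx.
by rewrite mulr_ge0// ltW// p0.
Qed.

Lemma sum_branch_mass m x : \sum_(v <- words A m) branch_mass v x = 1.
Proof.
have [_ _ p1 _ _] := hp.
elim: m x => [|m ih] x; first by rewrite big_seq1.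
rewrite sum_words_rcons exchange_big /= -(p1 x) [RHS]big_mkcond.
apply: eq_bigr => j _; under eq_bigr => v _ do rewrite branch_mass_rcons.
by case: ifP => jx; [rewrite -mulr_sumr ih mulr1 | rewrite big1].
Qed.

(** The solution of [E = D / c + E * theta]; dividing by the lower bound [c] of the weights converts
    their additive variation into a relative one. *)
Let E : R := D / c / (1 - theta).

Let c0 : 0 < c. Proof. by case: hp => /andP[]. Qed.
Let D0 : 0 <= D. Proof. by case: hp. Qed.
Let E0 : 0 <= E.
Proof. by rewrite /E divr_ge0 ?divr_ge0 ?(ltW c0)// subr_ge0 ltW. Qed.

Lemma branch_mass_log_lip v : log_lip theta E (branch_mass v).
Proof.
have [_ _ _ pc pl] := hp; have t1' := t1; have c0' := c0.
elim/last_ind: v => [|v j ih] m x y xy.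
  rewrite mulr1 -[X in X <= _]expR0 ler_expR mulr_ge0// exprn_ge0// ltW//.
rewrite !branch_mass_rcons -(agree_adm _ xy); case: ifP => jx; last by rewrite mulr0.
have jy : adm j y by rewrite -(agree_adm _ xy).
have EE : E * theta ^+ m.+1 = D / c * theta ^+ m.+1 + E * theta ^+ m.+2.
  by rewrite [theta ^+ m.+2]exprS /E; field; apply/andP; split; lra.
rewrite EE expRD mulrACA; apply: ler_pM; rewrite ?branch_mass_ge0 ?(ltW (p0 jx))//; last first.
  by apply: ih; exact: agree_pcons.
have h1 : p j x - p j y <= D * theta ^+ m.+1.
  rewrite (le_trans (ler_norm _))// -normc_real rmorphB/=; apply: le_trans (pl _ _ _ xy).
  by rewrite (bigD1 j)//= lerDl sumr_ge0// => i _; exact: normc_ge0.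
have h2 := pc _ _ jy; set T := D * _ in h1; have T0 : 0 <= T by rewrite mulr_ge0// exprn_ge0// ltW.
apply: (@le_trans _ _ ((1 + T / c) * p j y)).
  rewrite mulrDl mul1r mulrAC -mulrA.
  have : T <= T * (p j y / c) by rewrite ler_peMr// ler_pdivlMr// mul1r.
  by lra.
rewrite ler_wpM2r ?(ltW (p0 jy))// (le_trans (expR_ge1Dx _))// ler_expR.
by apply: ler_of_eq; rewrite /T; ring.
Qed.

Definition branch_lip_const u : R := (D + 2 * F) * (1 + `|u|) / c * expR E / (1 - theta).

Local Notation L := branch_lip_const.

Lemma normc_branches u v x : nc (branches u v (fun=> 1) x) <= branch_mass v x.
Proof.
elim/last_ind: v x => [|v k ih] z.
  by rewrite -[branches _ _ _ _]/(1 : R[i]) Normc.normc1.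
rewrite branches_rcons branch_mass_rcons /branch; case: ifP => kz; last by rewrite Normc.normc0.
rewrite Normc.normcM (normc_twist_weight f hp u kz).
by rewrite ler_wpM2l ?(ltW (p0 kz)).
Qed.

(** Bounded distortion: the Lipschitz constant of a branch is proportional to the mass of that
    branch. Summed over the words of a given length it therefore does not grow with the length,
    although the number of words does. *)
Lemma branches_lip u v m x y : agree m.+1 x y ->
  nc (branches u v (fun=> 1) x - branches u v (fun=> 1) y) <= L u * theta ^+ m.+1 * branch_mass v x.
Proof.
have [_ _ _ pc pl] := hp; have [_ F0 _ _] := hf; have t1' := t1; have c0' := c0.
pose Du : R := (D + 2 * F) * (1 + `|u|).
have Du0 : 0 <= Du.
  by apply: mulr_ge0; apply: addr_ge0 => //; exact: mulr_ge0.
have L0 : 0 <= L u.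
  apply: divr_ge0; last by rewrite subr_ge0 ltW.
  by apply: mulr_ge0; [apply: divr_ge0 => //; exact: ltW | exact: expR_ge0].
elim/last_ind: v m x y => [|v j ih] m x y xy.
  have e0 z : branches u [::] (fun=> 1) z = 1 by [].
  have e1 z : branch_mass [::] z = 1 by [].
  by rewrite !e0 subrr Normc.normc0 e1 mulr1 mulr_ge0// exprn_ge0// ltW.
rewrite !branches_rcons branch_mass_rcons /branch -(agree_adm _ xy).
case: ifP => jx; last by rewrite subrr Normc.normc0 mulr0.
have jy : adm j y by rewrite -(agree_adm _ xy).
have jxy := agree_pcons jx jy xy.
set T := theta ^+ m.+1; have T0 : 0 <= T by rewrite exprn_ge0// ltW.
have B1 z : nc (branches u v (fun=> 1) z) <= branch_mass v z.
  exact: normc_branches.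
set gx := branches u v _ _; set gy := branches u v _ (pcons j y).
have -> : twist_weight u j x * gx - twist_weight u j y * gy =
  twist_weight u j x * (gx - gy) + (twist_weight u j x - twist_weight u j y) * gy by ring.
have h1 : nc (gx - gy) <= L u * theta ^+ m.+2 * branch_mass v (pcons j x) by exact: ih.
have h2 : nc (twist_weight u j x - twist_weight u j y) <= Du * T.
  apply: le_trans (twist_weight_lip t0 t1 hp hf u xy).
  by rewrite (bigD1 j)//= lerDl sumr_ge0// => i _; exact: normc_ge0.
have h3 : nc gy <= expR E * branch_mass v (pcons j x).
  apply: le_trans (B1 _) _.
  have h4 := branch_mass_log_lip v (agree_sym jxy).
  apply: le_trans h4 _; rewrite ler_wpM2r ?branch_mass_ge0// ler_expR ler_piMr//.
  by rewrite exprn_ile1// ltW.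
have px := pc _ _ jx.
set b := branch_mass v (pcons j x) in h1 h3 *; have b0 : 0 <= b := branch_mass_ge0 _ _.
have h5 : Du * T <= Du / c * T * p j x.
  have DT : 0 <= Du * T by rewrite mulr_ge0.
  have -> : Du / c * T * p j x = Du * T * (p j x / c) by ring.
  by rewrite ler_peMr// ler_pdivlMr// mul1r.
have Lu : L u = L u * theta + Du / c * expR E.
  by rewrite /branch_lip_const -/Du; field; apply/andP; split; lra.
apply: le_trans (normcD _ _) _.
rewrite (Normc.normcM (twist_weight u j x)) (Normc.normcM (_ - _)).
rewrite (normc_twist_weight f hp u jx).
have -> : L u * T * (p j x * b) = p j x * (L u * theta ^+ m.+2 * b) +
    Du / c * T * p j x * (expR E * b).
  by rewrite {1}Lu [theta ^+ m.+2]exprS -/T; ring.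
apply: lerD; first by rewrite ler_wpM2l// ltW// p0.
by apply: ler_pM; rewrite ?normc_ge0// (le_trans h2).
Qed.

(** Distortion bounds the mass at [x] by that at a representative with the same first symbol, and
    for each representative the masses of the words of one length sum to 1. The total [Q] is thus
    the same for all lengths. *)
Lemma branch_mass_total : exists (S : seq I -> R) (Q : R),
  [/\ 0 < Q, forall v x, branch_mass v x <= S v & forall m, \sum_(v <- words A m) S v = Q].
Proof.
have /choice[rep hrep] : forall i : I, exists x : X, x 0%N = i by exact: ex_first_symbol.
exists (fun v => expR E * \sum_i branch_mass v (rep i)), (expR E * (kappa A)%:R); split.
- by rewrite mulr_gt0 ?expR_gt0// ltr0n (leq_trans _ (kappa_ge2 A)).
- move=> v x; have xr : agree 1 x (rep (x 0%N)) by case => // _; rewrite hrep.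
  have h := branch_mass_log_lip v xr; apply: le_trans h _.
  apply: ler_pM; rewrite ?expR_ge0 ?branch_mass_ge0//.
    by rewrite ler_expR ler_piMr// exprn_ile1// ltW.
  rewrite (bigD1 (x 0%N))//= lerDl sumr_ge0// => i _; exact: branch_mass_ge0.
- move=> m; rewrite -mulr_sumr; congr (_ * _); rewrite exchange_big/=.
  under eq_bigr => i _ do rewrite sum_branch_mass.
  by rewrite sumr_const card_ord.
Qed.

End branches.

(** * Traces over words *)

Section traces.
Variables (R : realType) (A : transition) (theta : R).
Hypotheses (t0 : 0 < theta) (t1 : theta < 1).
Local Notation X := (shift_space A).
Local Notation I := 'I_(kappa A).
Local Notation sg := (@left_shift A).
Local Notation nc := (@Normc.normc R).
Implicit Types (w g : X -> R[i]) (B K u : R) (v : seq I).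
Variables (p : I -> X -> R) (f : X -> R) (c D d F : R).
Hypotheses (hp : g_function theta c D p) (hf : lip_function theta d F f).
Local Notation twist := (twisted_op p f).
Local Notation branches := (branches p f).
Local Notation L := (branch_lip_const theta c D F).

(** The operator is expanded along words of length [m] only, each evaluated at a point of its own
    cylinder. The case [m = n] is the periodic sum; in the case [m = 1] the iterates of the operator
    do almost all the work and their decay applies. *)
Definition word_trace u n m : R[i] :=
  \sum_(v <- words A m) iter (n - m) (twist u) (branches u v (fun=> 1)) (word_point v).

Lemma branch_lip_const_ge0 u : 0 <= L u.
Proof.
have [/andP[c0 _] D0 _ _ _] := hp; have [_ F0 _ _] := hf.
apply: divr_ge0; last by rewrite subr_ge0 ltW.
apply: mulr_ge0; last exact: expR_ge0.
apply: divr_ge0; last exact: ltW.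
by apply: mulr_ge0; apply: addr_ge0 => //; exact: mulr_ge0.
Qed.

Lemma branch_lip_const_le u a : `|u| <= a -> L u <= L a.
Proof.
move=> ua; have [/andP[c0 _] D0 _ _ _] := hp; have [_ F0 _ _] := hf.
rewrite /branch_lip_const ler_wpM2r ?invr_ge0 ?subr_ge0 ?(ltW t1)//.
rewrite ler_wpM2r ?expR_ge0// ler_wpM2r ?invr_ge0 ?(ltW c0)// ler_wpM2l ?addr_ge0 ?mulr_ge0//.
by rewrite lerD2l (le_trans ua)// ler_norm.
Qed.

(** Splitting one step of the operator into its branches rewrites the trace of level [m] as a sum
    over words of length [m.+1]. The two traces then differ only in the base points, those of
    [rcons v j] and of [v], which agree on [m] symbols; the Lipschitz decay supplies the rest. *)
Lemma word_trace_step : exists2 Q : R, 0 < Q & forall (u C b : R) n m, 0 < C -> 0 <= b ->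
  twist_decay theta p f u C b -> (0 < m < n)%N ->
  nc (word_trace u n m.+1 - word_trace u n m) <=
    Q * (C * b ^+ (n - m.+1) * (1 + L u) * theta ^+ m).
Proof.
have [S [Q [Q0 hS hQ]]] := branch_mass_total t0 t1 hp.
exists Q => // u C b n m C0 b0 dec /andP[m0 mn].
have -> : word_trace u n m = \sum_(v <- words A m) \sum_j
    iter (n - m.+1) (twist u) (branches u (rcons v j) (fun=> 1)) (word_point v).
  apply: eq_bigr => v _; rewrite -(subnSK mn) iterSr -twist_iter_sum.
  congr (iter _ _ _ _); apply/funext => y; rewrite twist_branch.
  by apply: eq_bigr => j _; rewrite branches_rcons.
rewrite /word_trace sum_words_rcons -sumrB.
under eq_bigr => v _ do rewrite -sumrB.
have S0 v : 0 <= S v := le_trans (branch_mass_ge0 hp v point) (hS v point).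
set c1 := C * _ * _ * _; rewrite -(hQ m.+1) mulr_suml sum_words_rcons.
apply: le_trans (normc_sum _ _ _) _; rewrite big_seq [leRHS]big_seq.
apply: ler_sum => v; rewrite mem_words => /eqP sv.
apply: le_trans (normc_sum _ _ _) _; apply: ler_sum => j _.
set w := rcons v j; set G := iter _ _ _.
(* If no branch along [w] is admissible, [word_point w] may be junk, but the function under the
   iterates vanishes identically. *)
have [[x gx]|h0] := pselect (exists x, branches u w (fun=> 1) x != 0); last first.
  have G0 : normc_bound 0 G.
    apply: (twist_iter_bound f hp) => y; have [->|h] := eqVneq (branches u w (fun=> 1) y) 0.
      by rewrite Normc.normc0.
    by exfalso; apply: h0; exists y.
  rewrite (@le_trans _ _ (0 + 0))//.
    by rewrite (le_trans (normcB _ _))// lerD// G0.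
  rewrite addr0 mulr_ge0// /c1 !mulr_ge0 ?(ltW C0) ?exprn_ge0 ?(ltW t0)// addr_ge0//.
  exact: branch_lip_const_ge0.
have [z [zw _]] := branches_neq0 gx.
have sw : size w = m.+1 by rewrite size_rcons sv.
have pw := word_pointP zw; rewrite sw in pw zw.
have zv : itinerary z (size v) = v by move: zw; rewrite itineraryS sv => /rcons_inj[].
have pv := word_pointP zv.
have am : agree m (word_point w) (word_point v).
  apply/agree_itinerary; move: pw; rewrite itineraryS => /rcons_inj[-> _].
  by rewrite -{1}pv sv.
have LS : 0 <= L u * S w by rewrite mulr_ge0// branch_lip_const_ge0.
have hB : normc_bound (S w) (branches u w (fun=> 1)).
  by move=> y; apply: le_trans (normc_branches f hp u w y) (hS w y).
have hK : lip_bound theta (L u * S w) (branches u w (fun=> 1)).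
  move=> k y y' yy; apply: le_trans (branches_lip t0 t1 hp hf u w yy) _.
  rewrite mulrAC ler_wpM2r ?exprn_ge0 ?(ltW t0)//.
  by apply: ler_wpM2l => //; exact: branch_lip_const_ge0.
have [_ lipG] := dec (n - m.+1)%N _ _ _ hB hK LS.
case: m m0 {mn sv sw pw zw} am @c1 @G lipG => // m _ am c1 G lipG.
apply: le_trans (lipG _ _ _ am) _; rewrite /c1; apply: ler_of_eq; ring.
Qed.

Lemma word_trace_periodic u n : (0 < n)%N -> word_trace u n n =
  \sum_(x <- periodic_seq A n)
    (\prod_(i < n) p (x i) (iter i.+1 sg x))%:C%C * cis (u * birkhoff f n x).
Proof.
move=> n0; rewrite /word_trace subnn /= /periodic_seq big_map big_filter.
(* A word that does not close up contributes 0: a non-zero branch at its own point would yield, by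
   [ex_cycle], a periodic point in its cylinder. *)
rewrite [LHS](bigID (cycle_words n))/= [X in _ + X]big1_seq ?addr0; last first.
  move=> v /andP[nc /[!mem_words] /eqP sv]; apply/eqP; apply: contraT => h.
  have [z [zv zx]] := branches_neq0 h; rewrite sv in zv zx.
  have := @word_pointP _ v z; rewrite sv => /(_ zv) pv.
  have := ex_cycle n0 zx; rewrite zv pv => /(_ erefl) cv.
  by rewrite cv in nc.
rewrite big_seq_cond [RHS]big_seq_cond; apply: eq_bigr => v /andP[].
rewrite mem_words => /eqP sv cv; rewrite -sv in cv *.
have [h1 h2] := word_point_cycle cv.
have := branches_itinerary p f u (word_point v) (size v) (fun=> 1).
by rewrite h1 h2 mulr1.
Qed.

(* The ratio q of successive terms is uniform because (1 + theta) / 2 <= b. *)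
Lemma word_trace_tail (a C : R) : 0 < C -> exists2 Q : R, 0 < Q & forall (u b : R) n k,
  `|u| <= a -> (1 + theta) / 2 <= b <= 1 -> twist_decay theta p f u C b -> (0 < k <= n)%N ->
  nc (word_trace u n n - word_trace u n k) <= Q * b ^+ n * (2 * theta / (1 + theta)) ^+ k.
Proof.
move=> C0; have [Q Q0 hQ] := word_trace_step; have [t0' t1'] := (t0, t1).
pose q : R := 2 * theta / (1 + theta).
have q0 : 0 < q by rewrite divr_gt0 ?mulr_gt0//; lra.
have q1 : q < 1 by rewrite ltr_pdivrMr; lra.
have La := branch_lip_const_ge0 a.
pose M : R := Q * C * (1 + L a); have M0 : 0 < M by rewrite !mulr_gt0//; lra.
exists (2 * M / (1 - q)) => [|u b n k ua /andP[bt b1] dec /andP[k0 kn]].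
  by rewrite divr_gt0 ?mulr_gt0//; lra.
have b0 : 0 < b by lra.
have tbq : theta <= b * q.
  rewrite /q mulrA ler_pdivlMr; nra.
have bn0 : 0 < b ^+ n.-1 by rewrite exprn_gt0.
have main i : (k + i <= n)%N -> nc (word_trace u n (k + i) - word_trace u n k) <=
    M * b ^+ n.-1 * ((q ^+ k - q ^+ (k + i)) / (1 - q)).
  elim: i => [|i ih] ki; first by rewrite addn0 !subrr Normc.normc0 mul0r mulr0.
  rewrite addnS in ki *.
  apply: le_trans (normc_dist _ _ (word_trace u n (k + i))) _.
  have kin : (0 < k + i < n)%N by rewrite addn_gt0 k0.
  have h1 := hQ u C b n (k + i)%N C0 (ltW b0) dec kin.
  have h2 := ih (ltnW ki).
  have h3 : Q * (C * b ^+ (n - (k + i).+1) * (1 + L u) * theta ^+ (k + i)) <= M * b ^+ n.-1 * q ^+ (k + i).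
    have tk : theta ^+ (k + i) <= b ^+ (k + i) * q ^+ (k + i).
      by rewrite -exprMn lerXn2r ?nnegrE ?(ltW t0)// mulr_ge0// ltW.
    have bE : b ^+ n.-1 = b ^+ (n - (k + i).+1) * b ^+ (k + i).
      have en : n.-1 = (n - (k + i).+1 + (k + i))%N by clear -ki; lia.
      by rewrite -exprD -en.
    rewrite /M bE.
    have -> : Q * C * (1 + L a) * (b ^+ (n - (k + i).+1) * b ^+ (k + i)) * q ^+ (k + i) =
      Q * (C * b ^+ (n - (k + i).+1) * (1 + L a) * (b ^+ (k + i) * q ^+ (k + i))) by ring.
    rewrite ler_wpM2l ?(ltW Q0)//; apply: ler_pM => //.
    - rewrite !mulr_ge0 ?exprn_ge0 ?(ltW C0) ?(ltW b0)// addr_ge0//; exact: branch_lip_const_ge0.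
    - by rewrite exprn_ge0// ltW.
    rewrite ler_wpM2l ?mulr_ge0 ?exprn_ge0 ?(ltW C0) ?(ltW b0)// lerD2l.
    exact: branch_lip_const_le.
  have -> : M * b ^+ n.-1 * ((q ^+ k - q ^+ (k + i).+1) / (1 - q)) =
     M * b ^+ n.-1 * q ^+ (k + i) + M * b ^+ n.-1 * ((q ^+ k - q ^+ (k + i)) / (1 - q)).
    by rewrite exprS; field; lra.
  by rewrite lerD// (le_trans h1).
have := main (n - k)%N; rewrite subnKC// => /(_ (leqnn n)) h; apply: le_trans h _.
have bn : b ^+ n.-1 <= 2 * b ^+ n.
  have -> : b ^+ n = b * b ^+ n.-1 by rewrite -exprS prednK// (leq_trans k0).
  by rewrite mulrA ler_peMl ?(ltW bn0)//; lra.
rewrite -/q; have qk : q ^+ k - q ^+ n <= q ^+ k by rewrite lerBlDr lerDl exprn_ge0 ?(ltW q0).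
have qn : q ^+ n <= q ^+ k by rewrite ler_wiXn2l ?(ltW q0) ?(ltW q1).
have -> : 2 * M / (1 - q) * b ^+ n * q ^+ k = M * (2 * b ^+ n) * (q ^+ k / (1 - q)) by ring.
have iq : 0 <= (1 - q)^-1 by rewrite invr_ge0; lra.
apply: ler_pM; [| | by rewrite ler_wpM2l// ltW | by rewrite ler_wpM2r].
  by apply: mulr_ge0; exact: ltW.
by apply: mulr_ge0 => //; rewrite subr_ge0.
Qed.

Lemma word_trace1_bound (C : R) : 0 < C -> exists2 Q : R, 0 < Q & forall (u b : R) n (a : R), `|u| <= a ->
  1 / 2 <= b <= 1 -> twist_decay theta p f u C b -> (0 < n)%N ->
  nc (word_trace u n 1) <= Q * (1 + L a) * b ^+ n.
Proof.
move=> C0; have [S [Q [Q0 hS hQ]]] := branch_mass_total t0 t1 hp.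
exists (2 * Q * C) => [|u b n a ua /andP[b2 b1] dec n0]; first by rewrite !mulr_gt0.
have S0 v : 0 <= S v := le_trans (branch_mass_ge0 hp v point) (hS v point).
have b0 : 0 < b by lra.
apply: le_trans (normc_sum _ _ _) _.
apply: (@le_trans _ _ (\sum_(v <- words A 1) S v * (C * b ^+ (n - 1) * (1 + L a)))).
  apply: ler_sum => v _.
  have LS : 0 <= L u * S v by rewrite mulr_ge0// branch_lip_const_ge0.
  have hB : normc_bound (S v) (branches u v (fun=> 1)).
    by move=> y; apply: le_trans (normc_branches f hp u v y) (hS v y).
  have hK : lip_bound theta (L u * S v) (branches u v (fun=> 1)).
    move=> k y y' yy; apply: le_trans (branches_lip t0 t1 hp hf u v yy) _.
    rewrite mulrAC ler_wpM2r ?exprn_ge0 ?(ltW t0)//.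
    by apply: ler_wpM2l => //; exact: branch_lip_const_ge0.
  have [supG _] := dec (n - 1)%N _ _ _ hB hK LS.
  apply: le_trans (supG _) _.
  have -> : C * b ^+ (n - 1) * (S v + L u * S v) = S v * (C * b ^+ (n - 1) * (1 + L u)) by ring.
  rewrite ler_wpM2l// ler_wpM2l ?mulr_ge0 ?exprn_ge0 ?(ltW C0) ?(ltW b0)// lerD2l.
  exact: branch_lip_const_le.
rewrite -mulr_suml hQ.
have bn : b ^+ (n - 1) <= 2 * b ^+ n.
  have -> : b ^+ n = b * b ^+ (n - 1) by rewrite -exprS subn1 prednK.
  by rewrite mulrA ler_peMl ?exprn_ge0 ?(ltW b0)//; lra.
have := branch_lip_const_ge0 a.
have -> : Q * (C * b ^+ (n - 1) * (1 + L a)) = Q * C * (1 + L a) * b ^+ (n - 1) by ring.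
have -> : 2 * Q * C * (1 + L a) * b ^+ n = Q * C * (1 + L a) * (2 * b ^+ n) by ring.
by move=> La; rewrite ler_wpM2l// !mulr_ge0 ?(ltW Q0) ?(ltW C0)// addr_ge0.
Qed.

End traces.

(** * Gaussian bounds and asymptotics of the traces *)

Section trace_asymptotics.
Variables (R : realType) (A : transition) (theta : R).
Hypotheses (t0 : 0 < theta) (t1 : theta < 1).
Local Notation X := (shift_space A).
Local Notation I := 'I_(kappa A).
Local Notation nc := (@Normc.normc R).
Implicit Types (w g : X -> R[i]) (B K u : R) (v : seq I).
Variables (p : I -> X -> R) (f : X -> R) (c D d F : R).
Hypotheses (hp : g_function theta c D p) (hf : lip_function theta d F f).
Local Notation twist := (twisted_op p f).
Local Notation branches := (branches p f).
Local Notation word_trace := (word_trace p f).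
Local Notation twist_decay := (twist_decay theta p f).

Lemma twist_decayW u (C C' b b' : R) : 0 <= C -> C <= C' -> 0 <= b -> b <= b' ->
  twist_decay u C b -> twist_decay u C' b'.
Proof.
move=> C0 CC b0 bb dec n w B K hB hK K0; have [h1 h2] := dec n w B K hB hK K0.
have B0 := normc_bound_ge0 hB.
have le : C * b ^+ n * (B + K) <= C' * b' ^+ n * (B + K).
  rewrite ler_wpM2r ?addr_ge0// ler_pM ?exprn_ge0// lerXn2r ?nnegrE//.
  exact: le_trans bb.
split; first by move=> x; exact: le_trans (h1 x) le.
move=> m x y xy; apply: le_trans (h2 m x y xy) _.
by rewrite ler_wpM2r ?exprn_ge0 ?(ltW t0).
Qed.

Variables (r : R) (lam : R -> R[i]) (a0 rho : R).
Hypothesis r0 : 0 < r.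
Hypothesis eig : forall u, `|u| < r -> exists g B K,
  [/\ normc_bound B g, lip_bound theta K g, g <> (fun=> 0) & forall x, twist u g x = lam u * g x].
Hypothesis lam_cvg : forall e : R, 0 < e ->
  exists2 u0 : R, 0 < u0 & forall u, `|u| <= u0 -> nc (lam u - 1) <= e.
Hypothesis lam_gauss : exists c1 u2 : R,
  [/\ 0 < c1, 0 < u2 & forall u, `|u| <= u2 -> nc (lam u) <= expR (- c1 * u ^+ 2)].
Hypothesis rho01 : 0 < rho < 1.
Hypothesis hW : forall a2 : R, exists2 C : R, 0 < C & forall u n w B K, a0 <= `|u| <= a2 ->
  normc_bound B w -> lip_bound theta K w -> 0 < B -> 0 <= K ->
  normc_bound (C * rho ^+ n * (B + K)) (iter n (twist u) w).

(** Merges the decay near 0 with that on the rest of the range into one Gaussian rate. Taking [c1]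
    smaller only weakens the claim, and it also keeps the rate above [(1 + theta) / 2], as
    [word_trace_tail] demands. *)
Lemma uniform_decay (a : R) : exists C c1 : R, [/\ 0 < C, 0 < c1 & forall u, `|u| <= a ->
  (1 + theta) / 2 <= expR (- c1 * u ^+ 2) /\ twist_decay u C (expR (- c1 * u ^+ 2))].
Proof.
have [t0' t1'] := (t0, t1).
have [u1 [C1 [u10 C10 dec1]]] := small_twist_decay t0 t1 hp hf r0 eig lam_cvg.
have [c1 [u2 [c10 u20 hlam]]] := lam_gauss.
pose u3 : R := Order.min u1 u2; have u30 : 0 < u3 by rewrite lt_min u10.
have [b [C2 [/andP[b0 b1] C20 dec2]]] := mid_twist_decay t0 t1 hp hf a u30 rho01 hW.
pose s : R := Order.max b ((1 + theta) / 2).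
have s0 : 0 < s by rewrite lt_max b0.
have s1 : s < 1 by rewrite gt_max b1; lra.
have a20 : 0 < a ^+ 2 + 1 by rewrite ltr_wpDl// sqr_ge0.
pose cc : R := Order.min c1 (- ln s / (a ^+ 2 + 1)).
have ls : ln s < 0 by rewrite ln_lt0// s0.
have cc0 : 0 < cc by rewrite lt_min c10 divr_gt0// oppr_gt0.
have C12 : 0 < Order.max C1 C2 by rewrite lt_max C10.
exists (Order.max C1 C2), cc; split => // u ua.
have a0' : 0 <= a := le_trans (normr_ge0 _) ua.
have u2a : u ^+ 2 <= a ^+ 2 + 1.
  rewrite -real_normK ?num_real// (@le_trans _ _ (a ^+ 2)) ?lerDl//.
  by rewrite lerXn2r ?nnegrE.
have low : s <= expR (- cc * u ^+ 2).
  rewrite -[leLHS]lnK ?posrE// ler_expR mulNr lerNr.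
  have h : cc <= - ln s / (a ^+ 2 + 1) by rewrite ge_min lexx orbT.
  rewrite (le_trans (ler_wpM2l (ltW cc0) u2a))// -ler_pdivlMr//.
split; first by apply: le_trans low; rewrite le_max lexx orbT.
have [u3u|uu3] := leP `|u| u3.
  move: u3u; rewrite le_min => /andP[uu1 uu2].
  apply: twist_decayW (dec1 u uu1); rewrite ?normc_ge0 ?(ltW C10) ?le_max ?lexx//.
  apply: le_trans (hlam u uu2) _; rewrite ler_expR !mulNr lerN2 ler_wpM2r ?sqr_ge0//.
  by rewrite ge_min lexx.
have du : u3 <= `|u| <= a by rewrite (ltW uu3).
apply: twist_decayW (dec2 u du); rewrite ?(ltW b0) ?(ltW C20) ?le_max ?lexx ?orbT//.
by apply: le_trans low; rewrite le_max lexx.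
Qed.

Lemma trace_gaussian_bound (a : R) : exists C c1 : R, [/\ 0 < C, 0 < c1 & forall u n,
  `|u| <= a -> (0 < n)%N -> nc (word_trace u n n) <= C * expR (- c1 * u ^+ 2) ^+ n].
Proof.
have [t0' t1'] := (t0, t1).
have [C [c1 [C0 c10 dec]]] := uniform_decay a.
have [Q1 Q10 tail] := word_trace_tail t0 t1 hp hf a C0.
have [Q2 Q20 first_]:= word_trace1_bound t0 t1 hp hf C0.
have La := branch_lip_const_ge0 t1 hp hf a.
set L := branch_lip_const _ _ _ _ a in La.
exists (Q1 + Q2 * (1 + L)), c1; split => //.
  by rewrite addr_gt0// mulr_gt0//; lra.
move=> u n ua n0; have [hb decu] := dec u ua; set b := expR _ in hb decu *.
have b0 : 0 < b by exact: expR_gt0.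
have b1 : b <= 1.
  by rewrite -expR0 ler_expR mulNr oppr_le0 mulr_ge0 ?sqr_ge0 ?(ltW c10).
have b12 : (1 + theta) / 2 <= b <= 1 by rewrite hb.
have b2 : 1 / 2 <= b <= 1 by rewrite b1 andbT; lra.
have h1 := tail u b n 1%N ua b12 decu n0; rewrite expr1 in h1.
have h2 := first_ u b n a ua b2 decu n0; rewrite -/L in h2.
have q1 : 2 * theta / (1 + theta) <= 1 by rewrite ler_pdivrMr; lra.
have bn : 0 <= Q1 * b ^+ n by rewrite mulr_ge0 ?(ltW Q10)// exprn_ge0// ltW.
have h3 := normcD (word_trace u n n - word_trace u n 1) (word_trace u n 1).
rewrite subrK in h3; have := ler_wpM2l bn q1; lra.
Qed.

Lemma branches_diff u v x :
  nc (branches u v (fun=> 1) x - branches 0 v (fun=> 1) x) <=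
  (size v)%:R * (2 * (`|u| * d)) * branch_mass p v x.
Proof.
have [_ _ _ pc _] := hp; have [/andP[c0 _] _ _ _ _] := hp; have [d0 _ fd _] := hf.
elim/last_ind: v x => [|v j ih] x.
  rewrite -[branches u _ _ x]/(1 : R[i]) -[branches 0 _ _ x]/(1 : R[i]).
  by rewrite subrr Normc.normc0 !mul0r.
rewrite !branches_rcons branch_mass_rcons /branch; case: ifP => jx; last first.
  by rewrite subrr Normc.normc0 mulr0.
have px : 0 <= p j x by rewrite (le_trans (ltW c0))// pc.
set gu := branches u v _ _; set g0 := branches 0 v _ _.
have -> : twisted_weight p f u j x * gu - twisted_weight p f 0 j x * g0 =
  (p j x)%:C%C * (cis (u * f (pcons j x)) * (gu - g0) + (cis (u * f (pcons j x)) - cis 0) * g0).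
  by rewrite /twisted_weight mul0r; ring.
rewrite Normc.normcM normc_real ger0_norm// mulrCA ler_wpM2l//.
rewrite size_rcons -natr1 [((size v)%:R + 1) * _]mulrDl mul1r [leRHS]mulrDl.
apply: le_trans (normcD _ _) _; rewrite !Normc.normcM normc_cis mul1r.
apply: lerD; first exact: ih.
apply: ler_pM; rewrite ?normc_ge0//; last exact: (normc_branches f hp).
by rewrite (le_trans (normc_cisB _ _))// subr0 normrM ler_wpM2l// ler_wpM2l.
Qed.

Lemma branch_mass_le1 v x : branch_mass p v x <= 1.
Proof.
rewrite -(sum_branch_mass hp (size v) x) (bigD1_seq v)/= ?words_uniq//.
  by rewrite lerDl sumr_ge0// => w _; exact: (branch_mass_ge0 hp).
by rewrite mem_words.
Qed.

Lemma sum_branches n x : \sum_(v <- words A n) branches 0 v (fun=> 1) x = 1.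
Proof.
have [_ _ p1 _ _] := hp.
elim: n x => [|n ih] x; first by rewrite big_seq1.
rewrite sum_words_rcons exchange_big /=.
rewrite (eq_bigr (fun j => if adm j x then (p j x)%:C%C else 0)); last first.
  move=> j _; under eq_bigr => v _ do rewrite branches_rcons /branch.
  case: ifP => jx; last by rewrite big1.
  by rewrite -mulr_sumr ih mulr1 /twisted_weight mul0r cis0 mulr1.
by rewrite -big_mkcond/= -(rmorph_sum (real_complex R)) p1.
Qed.

Lemma iter_twistB u n w g x :
  iter n (twist u) (fun y => w y - g y) x = iter n (twist u) w x - iter n (twist u) g x.
Proof.
elim: n x => [//|n ih] x; rewrite !iterS -(twistB p f).
by congr (twisted_op _ _ _ _ _); apply/funext.
Qed.

Let branches1 u v : normc_bound 1 (branches u v (fun=> 1)).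
Proof. by move=> x; apply: le_trans (normc_branches f hp u v x) (branch_mass_le1 v x). Qed.

(** [L v] is the stationary mass of the cylinder of [v]. All branches have sup norm at most 1 and a
    common Lipschitz constant, so one number [j] of mixing steps serves words of every length. *)
Lemma ex_branch_limits (h : R) : 0 < h -> exists (j : nat) (L : seq I -> R[i]), forall v x,
  nc (iter j (twist 0) (branches 0 v (fun=> 1)) x - L v) <= h.
Proof.
move=> h0; have [C [g [g01 C0 hC]]] := twist0_cvg t0 t1 f hp.
pose L0 : R := branch_lip_const theta c D F 0.
have L00 : 0 <= L0 := branch_lip_const_ge0 t1 hp hf 0.
have g01' : 0 <= g < 1 by case/andP: g01 => /ltW -> ->.
have C3 : 0 < C * (2 + L0) by rewrite mulr_gt0// ltr_wpDr.
have [j hj] := geometric_small g01' (divr_gt0 h0 C3).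
suff /choice[L hL] : forall v, exists L : R[i], forall x,
    nc (iter j (twist 0) (branches 0 v (fun=> 1)) x - L) <= h by exists j, L.
move=> v; have O2 : osc_bound 2 (branches 0 v (fun=> 1)).
  by move=> x y; rewrite (le_trans (normcB _ _))// (lerD (branches1 0 v x) (branches1 0 v y)).
have K0 : lip_bound theta L0 (branches 0 v (fun=> 1)).
  move=> m x y xy; apply: le_trans (branches_lip t0 t1 hp hf 0 v xy) _.
  by rewrite ler_piMr ?branch_mass_le1// mulr_ge0// exprn_ge0// ltW.
have [L hL] := hC _ _ _ O2 K0 L00; exists L => x.
by apply: le_trans (hL j x) _; rewrite mulrC -ler_pdivlMr.
Qed.

Section branch_limits.
Variables (h : R) (j k : nat) (L : seq I -> R[i]).
Hypothesis hL : forall v x, nc (iter j (twist 0) (branches 0 v (fun=> 1)) x - L v) <= h.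

Let sum_limits : nc (\sum_(v <- words A k) L v - 1) <= (size (words A k))%:R * h.
Proof.
have <- : \sum_(v <- words A k) iter j (twist 0) (branches 0 v (fun=> 1)) point = 1.
  rewrite -(twist_iter_sum p f 0 j (words A k) (fun v => branches 0 v (fun=> 1))).
  have -> : (fun y => \sum_(v <- words A k) branches 0 v (fun=> 1) y) =
      (fun y => 1 + 0 * (fun=> 0 : R[i]) y).
    by apply/funext => y; rewrite sum_branches mul0r addr0.
  by rewrite (twist0_affine f hp) mul0r addr0.
rewrite -sumrB; apply: le_trans (normc_sum _ _ _) _.
apply: (@le_trans _ _ (\sum_(v <- words A k) h)).
  by apply: ler_sum => v _; rewrite normc_subC.
by rewrite big_const_seq count_predT iter_addr_0 mulr_natl.
Qed.

Hypothesis h1 : h <= 1.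

Let normc_limit v : nc (L v) <= 2.
Proof.
have h2 := twist_iter_bound f hp j 0 (branches1 0 v) point; have := hL v point.
set z := iter _ _ _ _ in h2 *; rewrite normc_subC => h3.
by have := normcD (L v - z) z; have := h1; rewrite subrK; lra.
Qed.

Variables (u : R) (a : R[i]) (w : X -> R[i]).
Hypotheses (uJ : (j + k)%:R * (2 * (`|u| * d)) <= h) (a1 : nc a <= 1).
Hypotheses (hw : forall x, twist u w x = a * w x) (w1 : forall x, nc (w x - 1) <= h).

Let near_limit v x : size v = k -> nc (iter j (twist u) (branches u v (fun=> 1)) x - L v) <= 2 * h.
Proof.
move=> sv; have [d0 _ _ _] := hf.
have Bd : normc_bound (k%:R * (2 * (`|u| * d))) (fun y => branches u v (fun=> 1) y - branches 0 v (fun=> 1) y).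
  move=> y; apply: le_trans (branches_diff u v y) _; rewrite sv ler_piMr ?branch_mass_le1//.
  by rewrite !mulr_ge0.
have h2 := twist_iter_diff hp hf j u (branches1 u v) x.
have h3 := twist_iter_bound f hp j 0 Bd x; rewrite iter_twistB in h3.
have h4 := hL v x; move: uJ; rewrite natrD mulrDl => h5.
set G := iter j (twist u) _ x in h2 *.
set G' := iter j (twist 0) (branches u v _) x in h2 h3.
set G0 := iter j (twist 0) (branches 0 v _) x in h3 h4.
have := normc_dist G (L v) G0; have := normc_dist G G0 G'; lra.
Qed.

Let near_eigen N v x : size v = k ->
  nc (iter N (twist u) (iter j (twist u) (branches u v (fun=> 1))) x - a ^+ N * L v) <= 6 * h.
Proof.
move=> sv; set G := iter j _ _; have hh : 0 <= h := le_trans (normc_ge0 _) (w1 x).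
have GLw : normc_bound (4 * h) (fun y => G y - L v * w y).
  move=> y; have -> : G y - L v * w y = (G y - L v) - L v * (w y - 1) by ring.
  apply: le_trans (normcB _ _) _; rewrite Normc.normcM.
  have : nc (L v) * nc (w y - 1) <= 2 * h by rewrite ler_pM ?normc_ge0 ?normc_limit ?w1.
  by have := near_limit y sv; rewrite -/G; lra.
have h2 := twist_iter_bound f hp N u GLw x.
rewrite iter_twistB twistZ (eigen_iter hw) in h2.
apply: le_trans (normc_dist _ _ (L v * (a ^+ N * w x))) _.
have -> : L v * (a ^+ N * w x) - a ^+ N * L v = L v * a ^+ N * (w x - 1) by ring.
have : nc (L v * a ^+ N * (w x - 1)) <= 2 * 1 * h.
  rewrite 2!Normc.normcM normcX.
  by rewrite !ler_pM ?mulr_ge0 ?exprn_ge0 ?exprn_ile1 ?normc_ge0 ?normc_limit ?w1.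
lra.
Qed.

(** After [j] steps each branch is close to the constant [L v], hence to [L v * w], on which the
    remaining steps act as multiplication by [a]. Each word costs [6 * h]: [4 * h] for the
    replacement, [2 * h] for [w] against 1. One more [h] per word comes from the masses [L v], which
    sum to nearly 1. *)
Lemma word_trace_near n : (k + j <= n)%N -> (0 < k)%N ->
  nc (word_trace u n k - a ^+ (n - (k + j))) <= 7 * ((size (words A k))%:R * h).
Proof.
move=> kjn k0; set N := (n - (k + j))%N.
have -> : word_trace u n k - a ^+ N = (word_trace u n k - a ^+ N * \sum_(v <- words A k) L v) +
  a ^+ N * (\sum_(v <- words A k) L v - 1) by ring.
apply: le_trans (normcD _ _) _; rewrite (_ : 7 = 6 + 1 :> R); last by ring.
rewrite [leRHS]mulrDl; apply: lerD; last first.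
  by rewrite Normc.normcM normcX ler_pM ?exprn_ge0 ?exprn_ile1 ?normc_ge0.
rewrite mulr_sumr -sumrB; apply: le_trans (normc_sum _ _ _) _.
rewrite big_seq; apply: (@le_trans _ _ (\sum_(v <- words A k | v \in words A k) 6 * h)).
  apply: ler_sum => v; rewrite mem_words => /eqP sv.
  have -> : (n - k = N + j)%N by rewrite /N; clear -kjn; lia.
  by rewrite iterD; exact: near_eigen.
by rewrite -big_seq big_const_seq count_predT iter_addr_0 -[(6 * h) *+ _]mulr_natl mulrCA.
Qed.

End branch_limits.

Lemma trace_asymptotic (e : R) : 0 < e -> exists (u3 : R) (n0 : nat), 0 < u3 /\
  forall u n, `|u| <= u3 -> (n0 <= n)%N -> nc (word_trace u n n - lam u ^+ n) <= e.
Proof.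
move=> e0; have [d0 _ _ _] := hf.
(* Nine shares: seven for [word_trace_near], one for the tail of the telescoping sum, one for the
   change of exponent from [N] to [n]. *)
pose e8 : R := e / 9; have e80 : 0 < e8 by rewrite divr_gt0.
have [C [c1 [C0 c10 dec]]] := uniform_decay 1.
have [Q Q0 tail] := word_trace_tail t0 t1 hp hf 1 C0.
have q01 : 0 <= 2 * theta / (1 + theta) < 1.
  have [t0' t1'] := (t0, t1).
  by rewrite divr_ge0 ?ltr_pdivrMr//=; lra.
have [k' hk'] := geometric_small q01 (divr_gt0 e80 Q0).
set q := 2 * theta / (1 + theta) in q01 hk' tail; pose k := k'.+1.
have hk : Q * q ^+ k <= e8.
  rewrite mulrC -ler_pdivlMr// (le_trans _ hk')// /k exprS; case/andP: q01 => q0 q1.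
  by rewrite ler_piMl ?exprn_ge0// ltW.
(* The tail has fixed the word length [k]; the error per word must now beat the number of words of
   that length. *)
pose h : R := Order.min 1 (e8 / (size (words A k)).+1%:R).
have h0 : 0 < h by rewrite lt_min ltr01 divr_gt0.
have h1 : h <= 1 by rewrite ge_min lexx.
have hW8 : (size (words A k))%:R * h <= e8.
  rewrite (@le_trans _ _ ((size (words A k)).+1%:R * h))//.
    by rewrite ler_wpM2r ?(ltW h0)// ler_nat.
  by rewrite mulrC -ler_pdivlMr// ge_min lexx orbT.
have [j [Lv hLv]] := ex_branch_limits h0.
have [u1 u10 eigw] := normalised_eigenfunction t0 t1 hp hf r0 eig lam_cvg h0.
have [c2 [u2 [c20 u20 hlam]]] := lam_gauss.
pose J : R := (j + k).+1%:R; have J0 : 0 < J by rewrite ltr0n.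
have [u4 u40 hu4] := lam_cvg (divr_gt0 e80 J0).
have Jd : 0 < J * (2 * (d + 1)) by rewrite !mulr_gt0// ltr_wpDl.
exists (Order.min (Order.min (Order.min u1 u2) (Order.min u4 1)) (h / (J * (2 * (d + 1))))), (k + j)%N.
split; first by rewrite !lt_min u10 u20 u40 ltr01 divr_gt0.
move=> u n; rewrite !le_min -!andbA => /and5P[uu1 uu2 uu4 uu5 uJ] kjn.
have [w [hw w1 _ _]] := eigw u uu1.
have lamle : nc (lam u) <= 1.
  by rewrite (le_trans (hlam u uu2))// -expR0 ler_expR mulNr oppr_le0 mulr_ge0 ?sqr_ge0 ?(ltW c20).
have uJ' : (j + k)%:R * (2 * (`|u| * d)) <= h.
  move: uJ; rewrite ler_pdivlMr//; apply: le_trans.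
  have -> : (j + k)%:R * (2 * (`|u| * d)) = `|u| * ((j + k)%:R * (2 * d)) by ring.
  by rewrite ler_wpM2l// ler_pM ?mulr_ge0 ?ler_nat// ler_wpM2l// lerDl.
have Tk := word_trace_near hLv h1 uJ' lamle hw w1 kjn (ltn0Sn k').
set N := (n - (k + j))%N in Tk.
have [hb decu] := dec u uu5; set b := expR _ in hb decu.
have b1 : b <= 1.
  by rewrite -expR0 ler_expR mulNr oppr_le0 mulr_ge0 ?sqr_ge0 ?(ltW c10).
have b0 : 0 <= b by rewrite expR_ge0.
have b12 : (1 + theta) / 2 <= b <= 1 by rewrite hb.
have kn : (0 < k <= n)%N by rewrite /= (leq_trans _ kjn)// leq_addr.
have T1 : nc (word_trace u n n - word_trace u n k) <= e8.
  apply: le_trans (tail u b n k uu5 b12 decu kn) _; rewrite -/q.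
  apply: le_trans hk; rewrite mulrAC ler_piMr ?exprn_ile1//.
  by rewrite mulr_ge0 ?(ltW Q0)// exprn_ge0//; case/andP: q01.
(* The [k + j] steps spent on words and mixing are missing in the exponent; their number is fixed,
   so it suffices that [lam u] is close to 1. *)
have lamE : nc (lam u ^+ N - lam u ^+ n) <= e8.
  have -> : lam u ^+ N - lam u ^+ n = lam u ^+ N * (1 ^+ (k + j) - lam u ^+ (k + j)).
    have -> : lam u ^+ n = lam u ^+ N * lam u ^+ (k + j) by rewrite -exprD subnK.
    by rewrite expr1n; ring.
  rewrite Normc.normcM; apply: (@le_trans _ _ (1 * ((k + j)%:R * nc (1 - lam u)))).
    rewrite ler_pM ?normc_ge0 ?normcX ?exprn_ile1 ?normc_ge0//; apply: normc_expB => //.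
    by rewrite Normc.normc1.
  rewrite mul1r normc_subC; have := hu4 u uu4; rewrite ler_pdivlMr// => h2.
  apply: le_trans h2; rewrite mulrC ler_wpM2l ?normc_ge0// ler_nat addnC//.
apply: le_trans (normc_dist _ _ (lam u ^+ N)) _.
have := normc_dist (word_trace u n n) (lam u ^+ N) (word_trace u n k).
by rewrite /e8 in hW8 T1 lamE *; lra.
Qed.

End trace_asymptotics.

(** * Expansion of the pressure *)

Section power_series.
Variable R : realType.
Local Notation nc := (@Normc.normc R).

(** Convergence at the single point [r / 2] bounds the terms [c k * (r / 2) ^+ k]. For
    [|s| <= r / 4] the tail from the third term on is then dominated by a geometric series of ratio
    at most [1 / 2]. *)
Lemma power_series_expansion2 (c : nat -> R[i]) (Phi : R[i] -> R[i]) (r : R) : 0 < r ->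
  (forall s : R[i], nc s < r ->
     nc (\sum_(k < n) c k * s ^+ k - Phi s) @[n --> \oo] --> (0 : R)) ->
  exists M : R, 0 <= M /\ forall s : R[i], nc s <= r / 4 ->
    nc (Phi s - (c 0%N + c 1%N * s + c 2%N * s ^+ 2)) <= M * nc s ^+ 3.
Proof.
move=> r0 hPhi.
pose s0 : R[i] := (r / 2)%:C%C.
have ns0 : nc s0 = r / 2 by rewrite normc_real ger0_norm// divr_ge0// ltW.
have ns0r : nc s0 < r by rewrite ns0; lra.
pose S s n : R[i] := \sum_(k < n) c k * s ^+ k.
have cv0 := hPhi s0 ns0r.
have cc : cvgn (fun n => nc (S s0 n - Phi s0)) by apply/cvg_ex; exists 0; exact: cv0.
have [B0 [_ hB0]] := cvg_seq_bounded cc.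
pose B : R := `|B0| + 1.
have hB n : nc (S s0 n - Phi s0) <= B.
  have h := hB0 B _; have : B0 < B by rewrite /B; have := ler_norm B0; lra.
  by move=> /h /(_ n I) /=; rewrite ger0_norm ?normc_ge0.
have Bp : 0 < B by rewrite /B; have := normr_ge0 B0; lra.
have cb k : nc (c k) * (r / 2) ^+ k <= 2 * B.
  rewrite -ns0 -normcX -Normc.normcM.
  have -> : c k * s0 ^+ k = (S s0 k.+1 - Phi s0) - (S s0 k - Phi s0).
    by rewrite /S big_ord_recr /=; ring.
  have := normcB (S s0 k.+1 - Phi s0) (S s0 k - Phi s0).
  by have := hB k; have := hB k.+1; lra.
exists (4 * B * (2 / r) ^+ 3); split.
  by rewrite mulr_ge0 ?exprn_ge0 ?divr_ge0 ?(ltW r0)// mulr_ge0// ltW.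
move=> s hs; set P2 := _ + _ + _; set x := nc s.
have x0 : 0 <= x := normc_ge0 s.
pose y : R := 2 * x / r.
have y0 : 0 <= y by rewrite divr_ge0 ?mulr_ge0// ltW.
have y2 : y <= 1 / 2 by rewrite /y ler_pdivrMr//; move: hs; rewrite -/x; lra.
have term k : nc (c k * s ^+ k) <= 2 * B * y ^+ k.
  rewrite Normc.normcM normcX -/x.
  have -> : nc (c k) * x ^+ k = nc (c k) * (r / 2) ^+ k * y ^+ k.
    rewrite -mulrA -exprMn; congr (_ * _ ^+ _); rewrite /y; field; lra.
  by rewrite ler_wpM2r// exprn_ge0.
have part n : nc (S s (n + 3)%N - P2) <= 4 * B * y ^+ 3 * (1 - (1 / 2) ^+ n).
  elim: n => [|n ih].
    rewrite expr0 subrr mulr0 add0n /S !big_ord_recr big_ord0 /= /P2.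
    have -> : 0 + c 0%N * s ^+ 0 + c 1%N * s ^+ 1 + c 2%N * s ^+ 2 -
      (c 0%N + c 1%N * s + c 2%N * s ^+ 2) = 0 by rewrite expr0 expr1; ring.
    by rewrite Normc.normc0.
  have -> : S s (n.+1 + 3)%N - P2 = (S s (n + 3)%N - P2) + c (n + 3)%N * s ^+ (n + 3).
    by rewrite /S addSn big_ord_recr /=; ring.
  apply: le_trans (normcD _ _) _.
  have h1 := term (n + 3)%N.
  have h2 : y ^+ (n + 3) <= (1 / 2) ^+ n * y ^+ 3.
    by rewrite exprD ler_wpM2r ?exprn_ge0// lerXn2r ?nnegrE.
  have h3 : (1 / 2 : R) ^+ n.+1 = 1 / 2 * (1 / 2) ^+ n by rewrite exprS.
  have := ler_wpM2l (ltW Bp) h2; rewrite h3; move: ((1 / 2) ^+ n) (y ^+ 3) ih h1 => a b.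
  by move=> *; lra.
have bnd n : nc (Phi s - P2) <= 4 * B * y ^+ 3 + nc (S s (n + 3)%N - Phi s).
  have h1 := normc_dist (Phi s) P2 (S s (n + 3)%N).
  have h2 := part n; rewrite normc_subC in h1.
  have h3 : 0 <= 4 * B * y ^+ 3 * (1 / 2) ^+ n.
    by rewrite mulr_ge0 ?exprn_ge0// mulr_ge0 ?exprn_ge0// mulr_ge0// ltW.
  by move: h1; rewrite [nc (P2 - _)]normc_subC [nc (Phi s - S s _)]normc_subC; lra.
have -> : 4 * B * (2 / r) ^+ 3 * x ^+ 3 = 4 * B * y ^+ 3.
  by rewrite -mulrA -exprMn /y; congr (_ * _ ^+ _); field; lra.
have sr : nc s < r by move: hs; rewrite -/x; lra.
apply/ler_addgt0Pr => e e0.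
have /cvgrPdist_le/(_ _ e0)[N _ hN] := hPhi s sr.
have := hN (N + 3)%N (leq_addr _ _); rewrite /= sub0r normrN ger0_norm ?normc_ge0// => h.
by rewrite (le_trans (bnd N))// lerD2l.
Qed.

(** The factor [k.+1 <= 2 ^+ k] created by differentiation is absorbed by halving the radius. *)
Lemma pseries_diffs_bound (a : nat -> R) (M s : R) : 0 < s ->
  (forall k, `|a k| <= M * s^-1 ^+ k) ->
  forall k, `|pseries_diffs a k| <= M / s * (s / 2)^-1 ^+ k.
Proof.
move=> s0 ha k; rewrite /pseries_diffs normrM normr_nat.
have n2 : (k.+1%:R : R) <= 2 ^+ k by rewrite -natrX ler_nat ltn_expl.
have M0 : 0 <= M by have := ha 0%N; rewrite expr0 mulr1; apply: le_trans.
rewrite (@le_trans _ _ (2 ^+ k * (M * s^-1 ^+ k.+1)))//; first by rewrite ler_pM.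
rewrite invf_div exprMn exprS.
by apply: ler_of_eq; ring.
Qed.

Lemma pseries_cvg_bound (a : nat -> R) (M s x : R) : 0 < s ->
  (forall k, `|a k| <= M * s^-1 ^+ k) -> `|x| <= s / 2 -> cvgn (pseries a x).
Proof.
move=> s0 ha xs.
have M0 : 0 <= M by have := ha 0%N; rewrite expr0 mulr1; apply: le_trans.
apply: normed_cvg.
apply: (@series_le_cvg _ _ (geometric M (1 / 2))).
- by move=> n; exact: normr_ge0.
- by move=> n; rewrite /= mulr_ge0// exprn_ge0.
- move=> n; rewrite /= normrM normrX.
  rewrite (@le_trans _ _ (M * s^-1 ^+ n * (s / 2) ^+ n))//.
    by rewrite ler_pM// ?exprn_ge0// lerXn2r ?nnegrE// divr_ge0// ltW.
  rewrite -mulrA -exprMn; apply: ler_of_eq; congr (_ * _ ^+ _).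
  by field; lra.
apply: is_cvg_geometric_series; rewrite ger0_norm//; lra.
Qed.

Lemma pseries0 (a : nat -> R) : limn (pseries a 0) = a 0%N.
Proof.
apply: (@cvg_lim R) => //; apply: cvg_near_cst; exists 1%N => // n /= n0.
rewrite /pseries /series /= big_ltn// expr0 mulr1 big1_seq ?addr0// => i.
by move=> /andP[_]; rewrite mem_index_iota => /andP[i0 _]; rewrite expr0n gtn_eqF// mulr0.
Qed.

Lemma second_derivative_power_series (a : nat -> R) (g : R -> R) (r : R) : 0 < r ->
  (forall u : R, `|u| < r -> (\sum_(k < n) a k * u ^+ k) @[n --> \oo] --> g u) ->
  derive1n 2 g 0 = 2 * a 2%N.
Proof.
move=> r0 hg; pose s : R := r / 2; have s0 : 0 < s by rewrite divr_gt0.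
have psE b u : pseries b u = (fun n => \sum_(k < n) b k * u ^+ k).
  by apply/funext => n; rewrite /pseries /series /= big_mkord.
have gE u : `|u| < r -> g u = limn (pseries a u).
  by move=> ur; rewrite psE; apply/esym/cvg_lim => //; exact: hg.
have sr : `|s| < r by rewrite ger0_norm ?(ltW s0)// /s; lra.
have cs : cvgn (pseries a s) by rewrite psE; apply/cvg_ex; exists (g s); exact: hg.
have [M0 [_ hM0]] := cvg_series_bounded cs.
pose M : R := `|M0| + 1.
have ha k : `|a k| <= M * s^-1 ^+ k.
  have : M0 < M by rewrite /M; have := ler_norm M0; lra.
  move=> /hM0 /(_ k I) /=; rewrite normrM normrX (ger0_norm (ltW s0)) => h.
  by rewrite exprVn ler_pdivlMr// exprn_gt0.
have h1 := pseries_diffs_bound s0 ha; have s20 : 0 < s / 2 by rewrite divr_gt0.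
have h2 := pseries_diffs_bound s20 h1; have s40 : 0 < s / 2 / 2 by rewrite divr_gt0.
have h3 := pseries_diffs_bound s40 h2; have s80 : 0 < s / 2 / 2 / 2 by rewrite divr_gt0.
(* Three differentiations leave coefficient bounds of radius [s / 8], and [pseries_cvg_bound] gives
   convergence up to half of it. *)
pose K : R := s / 16; have K0 : 0 < K by rewrite divr_gt0.
have nK : `|K| = K by rewrite ger0_norm// ltW.
have d1 u : `|u| < K -> is_derive u (1 : R) (fun x => limn (pseries a x))
    (limn (pseries (pseries_diffs a) u)).
  move=> uK; apply: (@pseries_snd_diffs _ _ K); rewrite ?nK//.
  - by apply: (pseries_cvg_bound s0 ha); rewrite nK /K; lra.
  - by apply: (pseries_cvg_bound s20 h1); rewrite nK /K; lra.
  - by apply: (pseries_cvg_bound s40 h2); rewrite nK /K; lra.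
have d2 : is_derive (0 : R) (1 : R) (fun x => limn (pseries (pseries_diffs a) x))
    (limn (pseries (pseries_diffs (pseries_diffs a)) 0)).
  apply: (@pseries_snd_diffs _ _ K); rewrite ?nK ?normr0//.
  - by apply: (pseries_cvg_bound s20 h1); rewrite nK /K; lra.
  - by apply: (pseries_cvg_bound s40 h2); rewrite nK /K; lra.
  - by apply: (pseries_cvg_bound s80 h3); rewrite nK /K; lra.
have nearb (x e : R) : 0 < e -> `|x| < e -> \near x, `|x| < e.
  move=> e0 xe; near=> y.
  have : `|x - y| < e - `|x|.
    by near: y; exists (e - `|x|) => //=; rewrite subr_gt0.
  rewrite distrC => h; rewrite -(subrK x y) (le_lt_trans (ler_normD _ _))//; lra.
have g1 u : `|u| < K -> derive1 g u = limn (pseries (pseries_diffs a) u).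
  move=> uK; rewrite derive1E.
  rewrite (@near_eq_derive _ _ _ g (fun x => limn (pseries a x)) u 1); last first.
    near=> y; apply: gE.
    have : `|y| < K by near: y; exact: nearb.
    by rewrite /K /s; have := r0; lra.
  by have [_ ->] := d1 u uK.
rewrite /derive1n /= derive1E.
rewrite (@near_eq_derive _ _ _ _ (fun x => limn (pseries (pseries_diffs a) x)) 0 1); last first.
  near=> y; apply: g1; near: y; apply: nearb => //; by rewrite normr0.
have [_ ->] := d2.
by rewrite pseries0 /pseries_diffs mul1r.
Unshelve. all: by end_near.
Qed.

End power_series.

Section pressure_expansion.
Variable R : realType.
Local Notation nc := (@Normc.normc R).

Lemma cubic_coef (a b M r : R) : 0 < r ->
  (forall t : R, 0 < t <= r -> a + b * t <= M * t ^+ 2) -> a <= 0.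
Proof.
move=> r0 h; rewrite leNgt; apply/negP => a0.
pose t : R := Order.min r (a / (2 * (`|b| + `|M| * r + 1))).
have d0 : 0 < 2 * (`|b| + `|M| * r + 1).
  by rewrite mulr_gt0// ltr_wpDl// addr_ge0// mulr_ge0// ltW.
have t0 : 0 < t by rewrite lt_min r0 divr_gt0.
have tr : t <= r by rewrite ge_min lexx.
have ta : t * (2 * (`|b| + `|M| * r + 1)) <= a by rewrite -ler_pdivlMr// ge_min lexx orbT.
have t00 := ltW t0.
have := h t; rewrite t0 tr => /(_ isT).
have h1 : - b * t <= `|b| * t by rewrite ler_wpM2r// -normrN ler_norm.
have h2 : M * t ^+ 2 <= `|M| * r * t.
  rewrite (@le_trans _ _ (`|M| * t ^+ 2))//; first by rewrite ler_wpM2r ?sqr_ge0// ler_norm.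
  by rewrite -mulrA ler_wpM2l// expr2 ler_wpM2r.
nra.
Qed.

(** The first-order coefficient is found without differentiating the pressure: its graph lies above
    the line of slope [alpha] on both sides of 0, which forces the real part to be [alpha]. Being
    real on the real axis kills the imaginary parts of the first two coefficients, and the second
    derivative along the imaginary axis gives the remaining real one. *)
Lemma pressure_expansion (c : nat -> R[i]) (Phi : R[i] -> R[i]) (r alpha sigma : R) : 0 < r ->
  (forall s : R[i], nc s < r ->
     nc (\sum_(k < n) c k * s ^+ k - Phi s) @[n --> \oo] --> (0 : R)) ->
  Phi 0 = 0 ->
  (forall t : R, `|t| < r -> t * alpha <= complex.Re (Phi t%:C%C) /\ complex.Im (Phi t%:C%C) = 0) ->
  derive1n 2 (fun u : R => complex.Re (Phi (0 +i* u)%C)) 0 = - sigma ^+ 2 ->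
  exists M : R, 0 <= M /\ forall u : R, `|u| <= r / 4 ->
    `|complex.Re (Phi (0 +i* u)%C) + sigma ^+ 2 / 2 * u ^+ 2| <= M * `|u| ^+ 3 /\
    `|complex.Im (Phi (0 +i* u)%C) - alpha * u| <= M * `|u| ^+ 3.
Proof.
move=> r0 hPhi Phi0 hreal hsig.
have [M [M0 hM]] := power_series_expansion2 r0 hPhi.
have r40 : 0 < r / 4 by rewrite divr_gt0.
have c0 : c 0%N = 0.
  have := hM 0; rewrite Normc.normc0 expr0n /= mulr0 => /(_ (ltW r40)).
  rewrite Phi0 mulr0 expr0n /= mulr0 !addr0 sub0r normc_opp => h.
  by apply: normc_eq0; apply/eqP; rewrite eq_le h normc_ge0.
have hreal4 (t : R) : `|t| <= r / 4 ->
    nc (Phi t%:C%C - (c 1%N * t%:C%C + c 2%N * (t%:C%C) ^+ 2)) <= M * `|t| ^+ 3.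
  by move=> tr; have := hM t%:C%C; rewrite normc_real c0 add0r => /(_ tr).
have lt4 (t : R) : `|t| <= r / 4 -> `|t| < r by lra.
have reE (t : R) : complex.Re (c 1%N * t%:C%C + c 2%N * (t%:C%C) ^+ 2) =
    complex.Re (c 1%N) * t + complex.Re (c 2%N) * t ^+ 2.
  rewrite -rmorphXn; case: (c 1%N) => a b; case: (c 2%N) => a' b' /=; ring.
have imE (t : R) : complex.Im (c 1%N * t%:C%C + c 2%N * (t%:C%C) ^+ 2) =
    complex.Im (c 1%N) * t + complex.Im (c 2%N) * t ^+ 2.
  rewrite -rmorphXn; case: (c 1%N) => a b; case: (c 2%N) => a' b' /=; ring.
have Rebound (t : R) : `|t| <= r / 4 ->
    t * alpha <= complex.Re (c 1%N) * t + complex.Re (c 2%N) * t ^+ 2 + M * `|t| ^+ 3.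
  move=> tr; have [h1 _] := hreal t (lt4 t tr).
  have := le_trans (Re_le_normc _) (hreal4 t tr); rewrite ReB reE ler_norml => /andP[_]; lra.
have Imbound (t : R) : `|t| <= r / 4 ->
    `|complex.Im (c 1%N) * t + complex.Im (c 2%N) * t ^+ 2| <= M * `|t| ^+ 3.
  move=> tr; have [_ h1] := hreal t (lt4 t tr).
  by have := le_trans (Im_le_normc _) (hreal4 t tr); rewrite ImB imE h1 sub0r normrN.
have c1Re : complex.Re (c 1%N) = alpha.
  apply/eqP; rewrite eq_le; apply/andP; split; rewrite -subr_le0.
    apply: (@cubic_coef _ (- complex.Re (c 2%N)) M (r / 4)) => // t /andP[t0 tr].
    have := Rebound (- t); rewrite normrN (ger0_norm (ltW t0)) => /(_ tr) h.
    rewrite -(ler_pM2r t0); move: h; rewrite !exprS expr0 !mulr1; lra.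
  apply: (@cubic_coef _ (- complex.Re (c 2%N)) M (r / 4)) => // t /andP[t0 tr].
  have := Rebound t; rewrite (ger0_norm (ltW t0)) => /(_ tr) h.
  rewrite -(ler_pM2r t0); move: h; rewrite !exprS expr0 !mulr1; lra.
have c1Im : complex.Im (c 1%N) = 0.
  apply/eqP; rewrite eq_le; apply/andP; split; last rewrite -oppr_le0.
    apply: (@cubic_coef _ (complex.Im (c 2%N)) M (r / 4)) => // t /andP[t0 tr].
    have := Imbound t; rewrite (ger0_norm (ltW t0)) => /(_ tr); rewrite ler_norml => /andP[_ h].
    by rewrite -(ler_pM2r t0); move: h; rewrite !exprS expr0 !mulr1; lra.
  apply: (@cubic_coef _ (- complex.Im (c 2%N)) M (r / 4)) => // t /andP[t0 tr].
  have := Imbound t; rewrite (ger0_norm (ltW t0)) => /(_ tr); rewrite ler_norml => /andP[h _].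
  by rewrite -(ler_pM2r t0); move: h; rewrite !exprS expr0 !mulr1; lra.
have c2Im : complex.Im (c 2%N) = 0.
  have Im2 (t : R) : 0 < t <= r / 4 -> `|complex.Im (c 2%N)| <= M * t.
    move=> /andP[t0 tr]; have := Imbound t; rewrite (ger0_norm (ltW t0)) => /(_ tr).
    rewrite c1Im mul0r add0r normrM (ger0_norm (sqr_ge0 t)) => h.
    rewrite -(ler_pM2r (exprn_gt0 2 t0)); apply: le_trans h _.
    by apply: ler_of_eq; rewrite !exprS expr0; ring.
  apply/eqP; rewrite -normr_eq0 eq_le normr_ge0 andbT.
  apply/ler_addgt0Pr => e e0; rewrite add0r.
  have M1 : 0 < M + 1 by lra.
  pose t : R := Order.min (r / 4) (e / (M + 1)).
  have t0 : 0 < t by rewrite lt_min r40 divr_gt0.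
  have te : t * (M + 1) <= e by rewrite -ler_pdivlMr// ge_min lexx orbT.
  have := Im2 t; rewrite t0 ge_min lexx => /(_ isT); lra.
have c2Re : complex.Re (c 2%N) = sigma ^+ 2 / 2.
  pose a k := complex.Re (c k * (0 +i* 1)%C ^+ k).
  have iuE (u : R) : (0 +i* u)%C = u%:C%C * (0 +i* 1)%C :> R[i].
    by rewrite -[RHS]/((_ +i* _)%C); congr (_ +i* _)%C; ring.
  have niu (u : R) : nc (0 +i* u)%C = `|u| by rewrite /= expr0n /= add0r sqrtr_sqr.
  have hg (u : R) : `|u| < r ->
      (\sum_(k < n) a k * u ^+ k) @[n --> \oo] --> complex.Re (Phi (0 +i* u)%C).
    move=> ur; have := hPhi (0 +i* u)%C; rewrite niu => /(_ ur) h.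
    apply/cvgrPdist_le => e e0; have /cvgrPdist_le/(_ _ e0)[N _ hN] := h.
    exists N => // n /= /hN /=; rewrite sub0r normrN ger0_norm ?normc_ge0// => hn.
    rewrite distrC; apply: le_trans hn; apply: le_trans (Re_le_normc _).
    rewrite ReB Re_sum; apply: ler_of_eq; congr `|_ - _|; apply: eq_bigr => k _.
    rewrite iuE exprMn -rmorphXn /= mulrCA Re_realM /a; ring.
  have := second_derivative_power_series r0 hg; rewrite hsig.
  have -> : a 2%N = - complex.Re (c 2%N).
    rewrite /a; case: (c 2%N) => x y; rewrite expr2 /=; ring.
  lra.
exists M; split => // u ur.
have niu : nc (0 +i* u)%C = `|u| by rewrite /= expr0n /= add0r sqrtr_sqr.
have := hM (0 +i* u)%C; rewrite niu c0 add0r => /(_ ur) h.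
have E2 : c 1%N * (0 +i* u)%C + c 2%N * (0 +i* u)%C ^+ 2 =
    (- (sigma ^+ 2 / 2 * u ^+ 2) +i* (alpha * u))%C :> R[i].
  move: c1Re c1Im c2Re c2Im; case: (c 1%N) => a b /= -> ->; case: (c 2%N) => a' b' /= -> ->.
  by rewrite expr2 -[LHS]/((_ +i* _)%C); congr (_ +i* _)%C; ring.
rewrite E2 in h; split.
  by apply: le_trans h; apply: le_trans (Re_le_normc _); rewrite ReB /= opprK.
by apply: le_trans h; apply: le_trans (Im_le_normc _); rewrite ImB /=.
Qed.

End pressure_expansion.

Section maximal_eigenvalue.
Variable R : realType.
Local Notation nc := (@Normc.normc R).
Variables (Phi : R[i] -> R[i]) (r alpha sigma M : R).
Hypotheses (r0 : 0 < r) (sigma0 : 0 < sigma) (M0 : 0 <= M).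
Hypothesis hPhi : forall u : R, `|u| <= r ->
  `|complex.Re (Phi (0 +i* u)%C) + sigma ^+ 2 / 2 * u ^+ 2| <= M * `|u| ^+ 3 /\
  `|complex.Im (Phi (0 +i* u)%C) - alpha * u| <= M * `|u| ^+ 3.
Let lam (u : R) : R[i] := cexp (Phi (0 +i* u)%C).

Lemma cexp_cis (z : R[i]) : cexp z = (expR (complex.Re z))%:C%C * cis (complex.Im z).
Proof.
case: z => x y; rewrite /cexp /cis /=.
by rewrite -[RHS]/((_ +i* _)%C); congr (_ +i* _)%C; ring.
Qed.

Lemma normc_cexp (z : R[i]) : nc (cexp z) = expR (complex.Re z).
Proof. by rewrite cexp_cis Normc.normcM normc_cis mulr1 normc_real ger0_norm ?expR_ge0. Qed.

(** For small [u] the cubic error uses up at most half of the quadratic term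
    [sigma ^+ 2 / 2 * u ^+ 2]. *)
Lemma eigenvalue_gaussian : exists c1 u2 : R, [/\ 0 < c1, 0 < u2 &
  forall u, `|u| <= u2 -> nc (lam u) <= expR (- c1 * u ^+ 2)].
Proof.
have s2 : 0 < sigma ^+ 2 by rewrite exprn_gt0.
pose u2 : R := Order.min r (sigma ^+ 2 / (4 * (M + 1))).
have M1 : 0 < 4 * (M + 1) by have := M0; lra.
have u20 : 0 < u2 by rewrite lt_min r0 divr_gt0.
exists (sigma ^+ 2 / 4), u2; split => //; first by rewrite divr_gt0.
move=> u uu; have ur : `|u| <= r by rewrite (le_trans uu)// ge_min lexx.
have us : `|u| * (4 * (M + 1)) <= sigma ^+ 2.
  by rewrite -ler_pdivlMr// (le_trans uu)// ge_min lexx orbT.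
have [h _] := hPhi ur; rewrite normc_cexp ler_expR.
move: h; rewrite ler_norml => /andP[_].
have -> : `|u| ^+ 3 = u ^+ 2 * `|u| by rewrite exprSr real_normK ?num_real.
have h1 : M * (u ^+ 2 * `|u|) <= u ^+ 2 * (sigma ^+ 2 / 4).
  rewrite mulrCA ler_wpM2l ?sqr_ge0//; have := normr_ge0 u; move: us; lra.
lra.
Qed.

Lemma eigenvalue_continuous (e : R) : 0 < e ->
  exists2 u0 : R, 0 < u0 & forall u, `|u| <= u0 -> nc (lam u - 1) <= e.
Proof.
move=> e0; pose C : R := (sigma ^+ 2 / 2 + `|alpha| + 2 * M) * (expR 1 + 2) + 1.
have C0 : 0 < C.
  rewrite ltr_wpDl//; apply: mulr_ge0; last by have := expR_gt0 (1 : R); lra.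
  by have := sqr_ge0 sigma; have := normr_ge0 alpha; have := M0; lra.
pose b : R := sigma ^+ 2 / 2 + `|alpha| + 2 * M.
have b0 : 0 <= b by rewrite /b; have := sqr_ge0 sigma; have := normr_ge0 alpha; have := M0; lra.
pose u0 : R := Order.min (Order.min r 1) (Order.min (e / C) (1 / (b + 1))).
have b1 : 0 < b + 1 by lra.
exists u0; first by rewrite !lt_min r0 ltr01 !divr_gt0.
move=> u; rewrite !le_min => /andP[/andP[ur u1] /andP[ue ub]].
have [h1 h2] := hPhi ur.
have ub' : `|u| * (b + 1) <= 1 by rewrite -ler_pdivlMr.
have ue' : `|u| * C <= e by rewrite -ler_pdivlMr.
have u3 : `|u| ^+ 3 <= `|u| by rewrite exprS ler_piMr// exprn_ile1.
have u2 : u ^+ 2 <= `|u| by rewrite -real_normK ?num_real// expr2 ler_piMr.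
pose x := complex.Re (Phi (0 +i* u)%C); pose y := complex.Im (Phi (0 +i* u)%C).
have v0 := normr_ge0 u.
have Mu : M * `|u| ^+ 3 <= M * `|u| by rewrite ler_wpM2l.
have s0 := sqr_ge0 sigma; have a0 := normr_ge0 alpha.
have hx : `|x| <= b * `|u|.
  rewrite -(addrK (sigma ^+ 2 / 2 * u ^+ 2) x) (le_trans (ler_normB _ _))//.
  have : `|sigma ^+ 2 / 2 * u ^+ 2| <= sigma ^+ 2 / 2 * `|u|.
    have s20 : 0 <= sigma ^+ 2 / 2 by rewrite divr_ge0.
    rewrite normrM (ger0_norm s20) (ger0_norm (sqr_ge0 u)).
    exact: ler_wpM2l.
  have := mulr_ge0 a0 v0; have := mulr_ge0 M0 v0; move: h1; rewrite -/x /b; lra.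
have hy : `|y| <= b * `|u|.
  rewrite -(subrK (alpha * u) y) (le_trans (ler_normD _ _))// normrM.
  have := mulr_ge0 s0 v0; have := mulr_ge0 M0 v0; move: h2; rewrite -/y /b; lra.
rewrite /lam cexp_cis -/x -/y.
have -> : (expR x)%:C%C * cis y - 1 = (expR x - expR 0)%:C%C * cis y + (cis y - cis 0).
  by rewrite cis0 expR0 rmorphB /=; ring.
rewrite (le_trans (normcD _ _))// Normc.normcM normc_cis mulr1 normc_real.
have h3 : `|expR x - expR 0| <= expR 1 * (b * `|u|).
  rewrite distrC (le_trans (expR_sub_norm _ _))// expR0 mul1r sub0r normrN.
  rewrite ler_pM ?expR_ge0// ler_expR (le_trans hx)//; move: ub'; lra.
have h4 : nc (cis y - cis 0) <= 2 * (b * `|u|).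
  by rewrite (le_trans (normc_cisB _ _))// subr0 ler_wpM2l.
by move: ue'; rewrite /C -/b; move: (expR 1) h3 h4 => E; lra.
Qed.

Lemma eigenvalue_clt (v e : R) : 0 < e -> exists N, forall n, (N <= n)%N ->
  nc (lam (v / Num.sqrt n%:R) ^+ n * cis (- (alpha * v * Num.sqrt n%:R)) -
      (expR (- (sigma ^+ 2 * v ^+ 2 / 2)))%:C%C) <= e.
Proof.
move=> e0.
pose C : R := M * `|v| ^+ 3; have C0 : 0 <= C by rewrite mulr_ge0 ?exprn_ge0.
pose K : R := expR 1 + 2; have K0 : 0 < K by rewrite /K; have := expR_gt0 (1 : R); lra.
pose N := (Num.truncn (`|v| / r) + Num.truncn (K * C / e) + Num.truncn C + 3)%N.
exists (N ^ 2)%N => n nN.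
have n1 : (0 < n)%N by rewrite (leq_trans _ nN)// expn_gt0 /N addn3.
have n0 : 0 < n%:R :> R by rewrite ltr0n.
pose q : R := Num.sqrt (n%:R : R); have q0 : 0 < q by rewrite sqrtr_gt0.
have q2 : q ^+ 2 = n%:R by rewrite sqr_sqrtr// ltW.
have qN : (N%:R : R) <= q.
  rewrite -(ler_pXn2r (_ : 0 < 2)%N)// ?nnegrE ?ler0n ?(ltW q0)//.
  by rewrite q2 -natrX ler_nat.
have tr (x : R) : x < (Num.truncn x).+1%:R.
  exact: truncnS_gt.
have hN (a b c : nat) : [/\ a < a + b + c + 3, b < a + b + c + 3 & c < a + b + c + 3]%N.
  by clear; split; lia.
have q1 : `|v| / r < q.
  apply: lt_le_trans (tr _) (le_trans _ qN); by rewrite ler_nat; have [] := hN (Num.truncn (`|v| / r)) (Num.truncn (K * C / e)) (Num.truncn C).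
have q3 : K * C / e < q.
  apply: lt_le_trans (tr _) (le_trans _ qN); by rewrite ler_nat; have [] := hN (Num.truncn (`|v| / r)) (Num.truncn (K * C / e)) (Num.truncn C).
have q4 : C < q.
  apply: lt_le_trans (tr _) (le_trans _ qN); by rewrite ler_nat; have [] := hN (Num.truncn (`|v| / r)) (Num.truncn (K * C / e)) (Num.truncn C).
pose u : R := v / q.
have nu : `|u| = `|v| / q by rewrite /u normrM normfV (gtr0_norm q0).
have ur : `|u| <= r by rewrite nu ler_pdivrMr// mulrC -ler_pdivrMr// ltW.
have [h1 h2] := hPhi ur.
have Cn : n%:R * (M * `|u| ^+ 3) = C / q.
  by rewrite nu -q2 /C; field; rewrite gt_eqF.
pose A : R := n%:R * complex.Re (Phi (0 +i* u)%C); pose B : R := n%:R * (complex.Im (Phi (0 +i* u)%C) - alpha * u).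
have hA : `|A - (- (sigma ^+ 2 * v ^+ 2 / 2))| <= C / q.
  rewrite -Cn -(ger0_norm (ltW n0)) -[leRHS](ger0_norm); last first.
    by rewrite mulr_ge0// mulr_ge0 ?exprn_ge0.
  rewrite normrM [in leRHS]normr_id (ger0_norm (_ : 0 <= M * _)) ?mulr_ge0 ?exprn_ge0//.
  rewrite (_ : A - _ = n%:R * (complex.Re (Phi (0 +i* u)%C) + sigma ^+ 2 / 2 * u ^+ 2)).
    by rewrite normrM ler_wpM2l.
  by rewrite /A -q2 /u; field; rewrite gt_eqF.
have hB : `|B| <= C / q by rewrite -Cn /B normrM (ger0_norm (ltW n0)) ler_wpM2l// ltW.
have lamE : lam u ^+ n * cis (- (alpha * v * q)) = (expR A)%:C%C * cis B.
  rewrite /lam cexp_cis exprMn cisX -rmorphXn -expRM_natl -[LHS]mulrA -(cisD (n%:R * _)).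
  congr (_ * cis _); rewrite /B /u -q2; field; lra.
rewrite -/q -/u lamE.
set E := - (_ / 2) in hA *.
have E0 : E <= 0 by rewrite /E oppr_le0 divr_ge0// mulr_ge0 ?sqr_ge0.
have Cq : K * (C / q) <= e.
  by rewrite mulrA ler_pdivrMr// [e * q]mulrC -ler_pdivrMr// ltW.
have Cq1 : C / q <= 1 by rewrite ler_pdivrMr// mul1r ltW.
have eE : expR E <= 1 by rewrite -expR0 ler_expR.
have hE : `|expR A - expR E| <= expR 1 * (C / q).
  rewrite distrC (le_trans (expR_sub_norm _ _))// [`|E - A|]distrC.
  have h3 : expR `|A - E| <= expR 1 by rewrite ler_expR (le_trans hA).
  rewrite ler_pM ?mulr_ge0 ?expR_ge0//.
  by rewrite -[leRHS]mul1r ler_pM ?expR_ge0.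
have -> : (expR A)%:C%C * cis B - (expR E)%:C%C =
  (expR A - expR E)%:C%C * cis B + (expR E)%:C%C * (cis B - cis 0).
  by rewrite cis0 rmorphB /=; ring.
apply: le_trans (normcD _ _) _; rewrite !Normc.normcM normc_cis mulr1 !normc_real.
rewrite (ger0_norm (expR_ge0 E)).
have h4 : expR E * nc (cis B - cis 0) <= 1 * (2 * (C / q)).
  rewrite ler_pM ?expR_ge0 ?normc_ge0// (le_trans (normc_cisB _ _))// subr0.
  by rewrite ler_wpM2l.
by move: Cq hE h4; rewrite /K; lra.
Qed.

End maximal_eigenvalue.

(** * Periodic sums *)

Section pressure_tangent.
Variables (R : realType) (A : transition) (theta : R).
Hypotheses (t0 : 0 < theta) (t1 : theta < 1).
Local Notation X := (shift_space A).
Implicit Types f : X -> R.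
Local Open Scope ereal_scope.

Lemma lip_function_measurable (d F : R) f : lip_function theta d F f ->
  measurable_fun setT (f : borel_shift A -> R).
Proof.
move=> [_ F0 _ hF]; apply: (measurability _ (measurable_realfun.RGenOInfty.measurableE R)) => //.
move=> _ [_ [a ->] <-]; rewrite setTI; apply: sub_sigma_algebra => x /=.
rewrite in_itv /= andbT => ax.
have F1 : (0 < F + 1)%R by lra.
have e0 : (0 < (f x - a) / (F + 1))%R by rewrite divr_gt0// subr_gt0.
have t01 : (0 <= theta < 1)%R by rewrite ltW ?t0 ?t1.
have [m hm] := geometric_small t01 e0.
exists m => y xy; rewrite /= in_itv /= andbT.
have := hF m x y xy; rewrite ler_norml => /andP[_ h].
have h2 : ((F + 1) * theta ^+ m <= f x - a)%R by rewrite mulrC -ler_pdivlMr.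
have h3 : (0 < theta ^+ m)%R by rewrite exprn_gt0.
by move: h h2 h3; move: (theta ^+ m)%R => z; lra.
Qed.

Lemma lip_function_integrable (d F : R) f (mu : probability (borel_shift A) R) :
  lip_function theta d F f -> mu.-integrable setT (EFin \o (f : borel_shift A -> R)).
Proof.
move=> hf; apply: measurable_bounded_integrable => //.
- by apply: le_lt_trans (probability_le1 mu measurableT) (ltry _).
- exact: lip_function_measurable hf.
case: hf => _ _ h _; exists d; split; first exact: num_real.
by move=> y dy x _; rewrite /= (le_trans (h x))// ltW.
Qed.

Lemma integral_between (d F d0 d1 alpha : R) f (mu : probability (borel_shift A) R) :
  lip_function theta d F f -> (forall x, d0 <= f x)%R -> (forall x, f x <= d1)%R ->
  alpha%:E = \int[mu]_x (f x)%:E -> (d0 <= alpha <= d1)%R.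
Proof.
move=> hf h0 h1 ha; have hi := lip_function_integrable mu hf.
have cst (k : R) : \int[mu]_x (k%:E) = k%:E.
  rewrite integral_cst// -[RHS]mule1; congr (_ * _).
  exact: probability_setT.
have icst (k : R) : mu.-integrable setT (EFin \o (fun=> k)).
  by apply: finite_measure_integrable_cst.
rewrite -!lee_fin ha -{1}(cst d0) -(cst d1); apply/andP; split.
- by apply: le_integral => //; [exact: icst | move=> x _; rewrite lee_fin].
- by apply: le_integral => //; [exact: icst | move=> x _; rewrite lee_fin].
Qed.

(** The equilibrium state competes in the supremum that defines the pressure of the perturbed
    potential: this is the supporting line of a convex function at 0. *)
Lemma pressure_tangent (d F Pf alpha t : R) f (mu : probability (borel_shift A) R) :
  lip_function theta d F f ->
  pressure (fun x => - Pf * f x)%R = 0 -> equilibrium_state (fun x => - Pf * f x)%R mu ->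
  alpha%:E = \int[mu]_x (f x)%:E ->
  (t * alpha)%:E <= pressure (fun x => - Pf * f x + t * f x)%R.
Proof.
move=> hf hP [hinv hE] ha; have hi := lip_function_integrable mu hf.
have intZ (k : R) : \int[mu]_x (k * f x)%:E = (k * alpha)%:E.
  under eq_integral do rewrite EFinM.
  by rewrite integralZl// -ha.
move: hE; rewrite hP /free_energy intZ => hE.
apply: ereal_sup_ubound; exists mu => //; rewrite /free_energy.
under eq_integral do rewrite -mulrDl.
rewrite intZ mulrDl EFinD addeA hE add0e//.
Qed.

End pressure_tangent.

Section transfer_normalisation.
Variables (R : realType) (A : transition) (theta : R).
Hypotheses (t0 : 0 < theta) (t1 : theta < 1).
Local Notation X := (shift_space A).
Local Notation I := 'I_(kappa A).
Local Notation sg := (@left_shift A).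

Lemma transferE (P u : R) (f : X -> R) w x : transfer (- P +i* u)%C f w x =
  \sum_(j | adm j x) (expR (- P * f (pcons j x)))%:C%C * cis (u * f (pcons j x)) * w (pcons j x).
Proof.
rewrite /transfer ruelle_opE; apply: eq_bigr => j _.
by rewrite /cfun cexp_transfer.
Qed.

Lemma transferZ (P u : R) (f : X -> R) (a : R) w :
  transfer (- P +i* u)%C f (fun x => a%:C%C * w x) = (fun x => a%:C%C * transfer (- P +i* u)%C f w x).
Proof.
apply/funext => x; rewrite !transferE mulr_sumr; apply: eq_bigr => j _; ring.
Qed.

Lemma transfer_iterZ (P u : R) (f : X -> R) n (a : R) w :
  iter n (transfer (- P +i* u)%C f) (fun x => a%:C%C * w x) =
  (fun x => a%:C%C * iter n (transfer (- P +i* u)%C f) w x).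
Proof. by elim: n => //= n ->; rewrite transferZ. Qed.

Variables (P : R) (f : X -> R) (d F : R).
Hypothesis hf : lip_function theta d F f.
Variables (c D : R) (h : X -> R).
Hypotheses (c0 : 0 < c) (D0 : 0 <= D) (hc : forall x, c <= h x <= c^-1).
Hypothesis hlog : log_lip theta D h.
Hypothesis hfix : forall x,
  \sum_(j | adm j x) expR (- P * f (pcons j x)) * h (pcons j x) = h x.

Let h0 x : 0 < h x. Proof. by have /andP[h1 _] := hc x; apply: lt_le_trans h1. Qed.

Definition normalised_weight (j : I) (x : X) : R := expR (- P * f (pcons j x)) * h (pcons j x) / h x.
Local Notation p := normalised_weight.

Lemma normalised_weight_ge0 j x : 0 < p j x.
Proof. by rewrite divr_gt0// mulr_gt0// expR_gt0. Qed.

Lemma normalised_g_function : exists c' D' : R, g_function theta c' D' p.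
Proof.
have [d0 F0 fd hF] := hf.
pose S : R := (`|P| * F + D) * theta + D.
have S0 : 0 <= S.
  by rewrite /S; apply: addr_ge0 => //; apply: mulr_ge0; [apply: addr_ge0 => //; apply: mulr_ge0 | exact: ltW].
have pm m j x y : agree m.+1 x y -> adm j x -> p j x <= expR (S * theta ^+ m.+1) * p j y.
  move=> xy jx; have jy : adm j y by rewrite -(agree_adm _ xy).
  have xy' := agree_pcons jx jy xy.
  have h1 : expR (- P * f (pcons j x)) <= expR (`|P| * F * theta ^+ m.+2) * expR (- P * f (pcons j y)).
    rewrite -expRD ler_expR -lerBlDr -mulrBr.
    rewrite (le_trans (ler_norm _))// normrM normrN -mulrA ler_wpM2l//.
    exact: hF.
  have h2 := hlog xy'; have h3 := hlog (agree_sym xy).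
  rewrite /p ler_pdivrMr// mulrAC.
  have -> : expR (S * theta ^+ m.+1) = expR (`|P| * F * theta ^+ m.+2) *
      expR (D * theta ^+ m.+2) * expR (D * theta ^+ m.+1).
    by rewrite -!expRD; congr expR; rewrite /S (exprS _ m.+1); ring.
  have h4 : h y / h y = 1 by rewrite divff// gt_eqF.
  rewrite -[X in X <= _]mulr1 -h4.
  set a := expR _ in h1 *; set b := expR _ in h1 *; set b' := expR (- P * _) in h1 *.
  set e := expR _ in h2 *; set g := expR _ in h3 *.
  have a0 : 0 <= a by exact: expR_ge0.
  have i0 : 0 <= (h y)^-1 by rewrite invr_ge0 ltW.
  have -> : b * e * g * h x * (b' * h (pcons j y) / h y) =
      (b * b') * (e * h (pcons j y)) * ((g * h x) * (h y)^-1) by ring.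
  apply: ler_pM => //.
  - by apply: mulr_ge0 => //; exact: ltW.
  - by apply: mulr_ge0 => //; exact: ltW.
  - by apply: ler_pM => //; exact: ltW.
  - by apply: ler_pM => //; exact: ltW.
have psum x : \sum_(j | adm j x) p j x = 1.
  by rewrite /p -mulr_suml hfix divff// gt_eqF.
pose c1 : R := expR (- (`|P| * d)) * c * c.
exists (Order.min 1 c1), (2 * S * expR S); split.
- by rewrite ge_min lexx /= andbT lt_min ltr01 /c1 !mulr_gt0// expR_gt0.
- by apply: mulr_ge0; [apply: mulr_ge0 | exact: expR_ge0].
- exact: psum.
- move=> x j jx; rewrite ge_min; apply/orP; right.
  have /andP[l1 u1] := hc x; have /andP[l2 _] := hc (pcons j x).
  rewrite /c1 /p; apply: ler_pM; [|exact: ltW| |].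
  + by apply: mulr_ge0; [exact: expR_ge0|exact: ltW].
  + apply: ler_pM => //; [exact: ltW|].
    rewrite ler_expR lerNl (le_trans (ler_norm _))// normrN normrM normrN.
    by rewrite ler_wpM2l.
  + by rewrite -[leLHS]invrK lef_pV2// ?posrE ?invr_gt0.
move=> m x y xy; set s := S * theta ^+ m.+1.
have s0 : 0 <= s by apply: mulr_ge0 => //; rewrite exprn_ge0// ltW.
have sS : s <= S by rewrite /s ler_piMr// exprn_ile1// ltW.
apply: (@le_trans _ _ (\sum_(j | adm j x) s * expR s * (p j x + p j y))).
  apply: ler_sum => j jx; rewrite -rmorphB normc_real.
  have jy : adm j y by rewrite -(agree_adm _ xy).
  apply: ratio_norm_le => //; [exact/ltW/normalised_weight_ge0|exact/ltW/normalised_weight_ge0|exact: pm|].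
  exact: pm (agree_sym xy) jy.
rewrite -mulr_sumr big_split /= psum.
rewrite (eq_bigl (fun j => adm j y)); last by move=> j; rewrite (agree_adm _ xy).
rewrite psum (_ : s * expR s * (1 + 1) = 2 * (s * expR s)); last by ring.
rewrite (_ : 2 * S * expR S * theta ^+ m.+1 = 2 * (s * expR S)); last by rewrite /s; ring.
by rewrite ler_wpM2l// ler_wpM2l// ler_expR.
Qed.

Lemma transfer_twist u w x : transfer (- P +i* u)%C f w x =
  (h x)%:C%C * twisted_op p f u (fun y => (h y)^-1%:C%C * w y) x.
Proof.
rewrite transferE /twisted_op /weighted_op mulr_sumr; apply: eq_bigr => j jx.
rewrite /twisted_weight /p; set e := expR _; set a := cis _; set y := pcons j x.
rewrite !rmorphM !fmorphV /=.
have hx : (h x)%:C%C != 0 :> R[i] by rewrite fmorph_eq0 gt_eqF.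
have hy : (h y)%:C%C != 0 :> R[i] by rewrite fmorph_eq0 gt_eqF.
by field; apply/andP.
Qed.

Lemma transfer_iter_twist u w n x : iter n (transfer (- P +i* u)%C f) w x =
  (h x)%:C%C * iter n (twisted_op p f u) (fun y => (h y)^-1%:C%C * w y) x.
Proof.
have hx y : (h y)%:C%C != 0 :> R[i] by rewrite fmorph_eq0 gt_eqF.
elim: n x => [|n ih] x; first by rewrite /= fmorphV mulVKf.
rewrite [LHS]/= transfer_twist; congr (_ * _).
rewrite iterS; congr (twisted_op _ _ _ _ x); apply/funext => y.
rewrite ih; have -> : (h y)^-1%:C%C = ((h y)%:C%C)^-1 :> R[i] by rewrite fmorphV.
by rewrite mulKf.
Qed.

Let Kh : R := D * expR D * c^-1.
Lemma eigenfunction_lip m x y : agree m.+1 x y -> `|h x - h y| <= Kh * theta ^+ m.+1.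
Proof.
have one a b : agree m.+1 a b -> h a - h b <= Kh * theta ^+ m.+1.
  move=> ab; set s := D * theta ^+ m.+1.
  have s0 : 0 <= s by apply: mulr_ge0 => //; rewrite exprn_ge0// ltW.
  have sD : s <= D by rewrite /s ler_piMr// exprn_ile1// ltW.
  have h1 : h a - h b <= (expR s - 1) * h b by rewrite mulrBl mul1r lerB// hlog.
  apply: le_trans h1 _.
  have h2 := expR_sub_le s 0; rewrite expR0 subr0 in h2.
  have /andP[_ h3] := hc b.
  rewrite (_ : Kh * _ = expR D * s * c^-1); last by rewrite /Kh /s; ring.
  apply: ler_pM => //; [by rewrite subr_ge0 -expR0 ler_expR|exact: ltW|].
  by apply: le_trans h2 _; rewrite ler_wpM2r// ler_expR.
move=> xy; rewrite ler_norml; apply/andP; split; last exact: one.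
by rewrite lerNl opprB; apply: one; apply: agree_sym.
Qed.

Lemma Kh_ge0 : 0 <= Kh.
Proof. by rewrite /Kh; apply: mulr_ge0; [apply: mulr_ge0 => //; exact: expR_ge0|rewrite invr_ge0 ltW]. Qed.

Lemma mul_eigenfunction_bounds B K w : normc_bound B w -> lip_bound theta K w ->
  normc_bound (c^-1 * B) (fun x => (h x)%:C%C * w x) /\
  lip_bound theta (c^-1 * K + Kh * B) (fun x => (h x)%:C%C * w x).
Proof.
move=> hB hK; split=> [x|m x y xy].
  rewrite Normc.normcM normc_real (gtr0_norm (h0 x)).
  have /andP[_ h3] := hc x; apply: ler_pM => //; [exact: ltW|exact: normc_ge0].
have -> : (h x)%:C%C * w x - (h y)%:C%C * w y =
  (h x)%:C%C * (w x - w y) + (h x - h y)%:C%C * w y by rewrite rmorphB /=; ring.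
apply: le_trans (normcD _ _) _; rewrite !Normc.normcM !normc_real (gtr0_norm (h0 x)) mulrDl.
have /andP[_ h3] := hc x.
apply: lerD; first by rewrite -mulrA; apply: ler_pM (hK _ _ _ xy) => //; [exact: ltW|exact: normc_ge0].
rewrite mulrAC; apply: ler_pM => //; [exact: normc_ge0|exact: eigenfunction_lip].
Qed.

Lemma div_eigenfunction_bounds B K w : normc_bound B w -> lip_bound theta K w ->
  normc_bound (c^-1 * B) (fun x => (h x)^-1%:C%C * w x) /\
  lip_bound theta (c^-1 * K + c^-1 * c^-1 * Kh * B) (fun x => (h x)^-1%:C%C * w x).
Proof.
have hV x : 0 <= (h x)^-1 <= c^-1.
  have /andP[h3 _] := hc x; rewrite invr_ge0 ltW//=.
  by rewrite lef_pV2 ?posrE.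
move=> hB hK; split=> [x|m x y xy].
  rewrite Normc.normcM normc_real; have /andP[v0 v1] := hV x; rewrite (ger0_norm v0).
  by apply: ler_pM => //; exact: normc_ge0.
have -> : (h x)^-1%:C%C * w x - (h y)^-1%:C%C * w y =
  (h x)^-1%:C%C * (w x - w y) + ((h x)^-1 - (h y)^-1)%:C%C * w y by rewrite [in RHS]rmorphB /=; ring.
apply: le_trans (normcD _ _) _; rewrite !Normc.normcM !normc_real mulrDl.
have /andP[v0 v1] := hV x; have /andP[v0' v1'] := hV y; rewrite (ger0_norm v0).
apply: lerD; first by rewrite -mulrA; apply: ler_pM (hK _ _ _ xy) => //; exact: normc_ge0.
rewrite mulrAC; apply: ler_pM => //; first exact: normc_ge0.
have -> : (h x)^-1 - (h y)^-1 = (h x)^-1 * (h y)^-1 * (h y - h x).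
  by field; rewrite !gt_eqF.
rewrite normrM ger0_norm ?mulr_ge0// -[leRHS]mulrA; apply: ler_pM.
- by apply: mulr_ge0.
- by [].
- by apply: ler_pM.
- by rewrite distrC; exact: eigenfunction_lip.
Qed.

(** The quotients of values of [h] telescope around the orbit, so the normalisation is invisible on
    periodic points. *)
Lemma normalised_weight_cycle n x : iter n sg x = x ->
  \prod_(i < n) p (x i) (iter i.+1 sg x) = expR (- P * birkhoff f n x).
Proof.
move=> xn.
have pE i : p (x i) (iter i.+1 sg x) =
    expR (- P * f (iter i sg x)) * (h (iter i sg x) / h (iter i.+1 sg x)).
  rewrite /p; have -> : x i = iter i sg x 0%N by rewrite iter_shift addn0.
  by rewrite iterS pcons_head mulrA.
under eq_bigr do rewrite pE.
rewrite big_split /=.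
have -> : \prod_(i < n) (h (iter i sg x) / h (iter i.+1 sg x)) = 1.
  have : \prod_(i < n) (h (iter i sg x) / h (iter i.+1 sg x)) = h x / h (iter n sg x).
    elim: n {xn} => [|n ih]; first by rewrite big_ord0 /= divff// gt_eqF.
    by rewrite big_ord_recr /= ih /=; field; rewrite !gt_eqF.
  by rewrite xn => ->; rewrite divff// gt_eqF.
by rewrite mulr1 /birkhoff mulr_sumr expR_sum.
Qed.

End transfer_normalisation.

Section periodic_sums.
Variables (R : realType) (A : transition) (theta : R).
Hypotheses (t0 : 0 < theta) (t1 : theta < 1).
Local Notation X := (shift_space A).
Local Notation I := 'I_(kappa A).
Local Notation nc := (@Normc.normc R).
Local Notation sg := (@left_shift A).

Definition periodic_sum (P : R) (f : X -> R) (n : nat) (u : R) : R[i] :=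
  \sum_(x <- periodic_seq A n) (expR (- P * birkhoff f n x))%:C%C * cis (u * birkhoff f n x).

Variables (P : R) (f : X -> R) (d F : R).
Hypothesis hf : lip_function theta d F f.

Lemma ruelle_transfer u v x :
  ruelle_op (fun y => (- P * f y +i* (u * f y))%C) v x = transfer (- P +i* u)%C f v x.
Proof.
rewrite /transfer /ruelle_op; apply: eq_fsbigr => y _; congr (cexp _ * _).
by rewrite /cfun -[RHS]/((_ +i* _)%C); congr (_ +i* _)%C; ring.
Qed.

Lemma lipschitz_bounded (v : X -> R[i]) : lipschitz_theta theta v ->
  exists B K : R, [/\ 0 <= K, normc_bound B v & lip_bound theta K v].
Proof.
move=> /(lipschitz_bounds t0 t1)[K K0 hK]; exists (nc (v point) + K), K; split => //.
- move=> x; have := hK 0%N x point; rewrite expr0 mulr1 => h.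
  have {}h : nc (v x - v point) <= K by apply: h.
  by have := normc_lerB (v x) (v point); lra.
- by move=> m x y; exact: hK.
Qed.

(** The eigenvalue [lam] of the positive eigenfunction [h] has to be identified with 1. If they
    differed, maximality of 1 would give [lam < 1]; but an eigenfunction [v] for 1 is dominated by a
    multiple of [h], hence by [lam ^+ n * h] for every [n] up to a constant, and would vanish. *)
Lemma perron_normalisation :
  simple_maximal_eigenvalue theta (fun x => (- P * f x +i* (0 * f x))%C) 1 ->
  exists (c D : R) (h : X -> R), [/\ 0 < c, 0 <= D, forall x, c <= h x <= c^-1,
    log_lip theta D h & forall x,
    \sum_(j | adm j x) expR (- P * f (pcons j x)) * h (pcons j x) = h x].
Proof.
move=> [[v [Ev v0 Tv _]] hmax].
have [d0 F0 fd hF] := hf.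
have PF0 : 0 <= `|P| * F by exact: mulr_ge0.
have hPF m x y : agree m x y -> `|- P * f x - - P * f y| <= `|P| * F * theta ^+ m.
  move=> xy; rewrite -mulrBr normrM normrN -mulrA.
  by apply: ler_wpM2l => //; exact: hF.
have [lam [c [D [h [lam0 c0 D0 [hc hlog hfix]]]]]] :=
  @perron_eigenfunction R A theta t0 t1 (fun x => - P * f x) (`|P| * F) PF0 hPF.
suff lam1 : lam = 1.
  by exists c, D, h; split => // x; rewrite hfix lam1 mul1r.
have hp x : 0 < h x by have /andP[h1 _] := hc x; apply: lt_le_trans h1.
have Th x : transfer (- P +i* 0)%C f (fun y => (h y)%:C%C) x = (lam * h x)%:C%C.
  rewrite transferE -hfix rmorph_sum /=; apply: eq_bigr => j _.
  by rewrite mul0r cis0 mulr1 rmorphM.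
have hlip := eigenfunction_lip t0 t1 c0 D0 hc hlog.
have Eh : lipschitz_theta theta (fun y => (h y)%:C%C).
  apply: (@sup_lip_lipschitz _ _ _ t0 _ c^-1 (D * expR D * c^-1)).
  - exact: Kh_ge0.
  - by move=> x; rewrite normc_real gtr0_norm//; have /andP[] := hc x.
  - by move=> m x y xy; rewrite -rmorphB normc_real; exact: hlip.
have h0 : (fun y => (h y)%:C%C) <> (fun=> 0) :> (X -> R[i]).
  move=> /(congr1 (fun g => complex.Re (g point))) /= e.
  by have := hp point; rewrite e ltxx.
apply/eqP; apply: contrapT => /negP lam1.
have lamlt : lam < 1.
  have := hmax lam%:C%C _ Eh h0; rewrite Normc.normc1 normc_real gtr0_norm//; apply.
    by apply/funext => x; rewrite ruelle_transfer Th rmorphM /= subrr.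
  by move=> /(congr1 (@complex.Re R)) /= e; rewrite e eqxx in lam1.
apply: v0; apply/funext => x; apply: normc_eq0; apply/eqP; rewrite eq_le normc_ge0 andbT.
have [B [K [_ hB _]]] := lipschitz_bounded Ev.
have B0 : 0 <= B by apply: le_trans (hB point); exact: normc_ge0.
have vE y : v y = transfer (- P +i* 0)%C f v y.
  have := congr1 (fun g => g y) Tv; rewrite ruelle_transfer mul1r => /eqP.
  by rewrite subr_eq0 => /eqP ->.
have bnd n y : nc (v y) <= B / c * lam ^+ n * h y.
  elim: n y => [|n ih] y.
    rewrite expr0 mulr1 (le_trans (hB y))// -mulrA ler_peMr//.
    by rewrite mulrC ler_pdivlMr// mul1r; have /andP[] := hc y.
  rewrite vE transferE (le_trans (normc_sum _ _ _))//.
  rewrite exprSr [B / c * (_ * _)]mulrA -[leRHS]mulrA -hfix mulr_sumr; apply: ler_sum => j _.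
  rewrite !Normc.normcM normc_cis mulr1 normc_real (ger0_norm (expR_ge0 _)).
  rewrite [leRHS](_ : _ = expR (- P * f (pcons j y)) * (B / c * lam ^+ n * h (pcons j y))); last ring.
  by rewrite ler_wpM2l// expR_ge0.
apply: (@ler_geometric _ _ _ (B / c * h x) lam); first by rewrite ltW.
by move=> n; rewrite add0r mulrAC.
Qed.

Lemma periodic_sum_trace (c : R) (h : X -> R) n u : 0 < c ->
  (forall x, c <= h x <= c^-1) -> (0 < n)%N ->
  word_trace (normalised_weight P f h) f u n n = periodic_sum P f n u.
Proof.
move=> c0 hc n0; rewrite word_trace_periodic// /periodic_sum.
rewrite big_seq [RHS]big_seq; apply: eq_bigr => x /(mem_periodic_seq _ n0) xn.
by rewrite (normalised_weight_cycle P f c0 hc xn).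
Qed.

Variables (rho : R).
Hypothesis rho01 : 0 < rho < 1.
Hypothesis hW : contraction_with theta P f rho.

Lemma contraction_bound (eps : R) : 0 < eps -> exists (a0 C : R), [/\ 1 <= a0, 0 < C &
  forall u n w B K, a0 <= `|u| -> normc_bound B w -> lip_bound theta K w -> 0 < B -> 0 <= K ->
  normc_bound (C * rho ^+ n * (`|u| `^ eps) * (B + K)) (iter n (transfer (- P +i* u)%C f) w)].
Proof.
(* For [|u| >= 1] the quantity [B + (K + 2 * B) / |u|] of [opnorm_sup] is at most [3 * (B + K)]. *)
move=> /hW[a0 [C [a00 C0 hC]]]; exists (Order.max a0 1), (3 * C).
rewrite le_max lexx orbT; split => //; first by rewrite mulr_gt0.
move=> u n w B K; rewrite ge_max => /andP[u0 u1] hB hK B0 K0 x.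
have ne : u != 0 by apply/eqP => u00; move: u1; rewrite u00 normr0 ler10.
have := hC u n u0 => /(opnorm_sup t0 (transfer_iterZ P u f n)) /(_ ne B0 K0 hB hK x) h.
apply: le_trans h _.
have iu : `|u|^-1 <= 1 by rewrite invf_le1//; lra.
have iu0 : 0 <= `|u|^-1 by rewrite invr_ge0.
have /andP[rho0 _] := rho01.
have C1 : 0 <= C * rho ^+ n * (`|u| `^ eps).
  apply: mulr_ge0; last exact: powR_ge0.
  by apply: mulr_ge0; [exact: ltW | rewrite exprn_ge0// ltW].
rewrite [leRHS](_ : _ = C * rho ^+ n * (`|u| `^ eps) * (3 * (B + K))); last by ring.
apply: ler_wpM2l => //.
by move: (`|u|^-1) iu iu0 => i; nra.
Qed.

Variables (alpha sigma : R) (Phi : R[i] -> R[i]) (m0 : probability (borel_shift A) R).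
Hypotheses (sigma0 : 0 < sigma)
  (hP : pressure (fun x => - P * f x) = 0%E)
  (hm0 : equilibrium_state (fun x => - P * f x) m0)
  (halpha : (alpha%:E = \int[m0]_x (f x)%:E)%E)
  (hPhi : pressure_continuation theta (fun x => - P * f x) f Phi)
  (hsigma : derive1n 2 (fun u : R => complex.Re (Phi (0 +i* u)%C)) 0 = - sigma ^+ 2).

Lemma periodic_sum_small_frequencies :
  (forall v e : R, 0 < e -> exists N, forall n, (N <= n)%N ->
    nc (periodic_sum P f n (v / Num.sqrt n%:R) * cis (- (alpha * v * Num.sqrt n%:R)) -
      (expR (- (sigma ^+ 2 * v ^+ 2 / 2)))%:C%C) <= e) /\
  (forall a : R, exists C c1 : R, [/\ 0 < C, 0 < c1 & forall u n,
    `|u| <= a -> (0 < n)%N -> nc (periodic_sum P f n u) <= C * expR (- c1 * u ^+ 2) ^+ n]).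
Proof.
have [r r0 [[cc hcc] hreal hmax]] := hPhi.
have Phi0 : Phi 0 = 0.
  have := hreal 0; rewrite normr0 => /(_ r0)[h1 h2].
  have e : (fun x => - P * f x + 0 * f x) = (fun x => - P * f x).
    by apply/funext => x; rewrite mul0r addr0.
  move: h1; rewrite e hP => -[h1].
  have -> : 0 = 0%:C%C :> R[i] by [].
  by case: (Phi _) h1 h2 => a b /= <- ->.
have htan (t : R) : `|t| < r ->
    t * alpha <= complex.Re (Phi t%:C%C) /\ complex.Im (Phi t%:C%C) = 0.
  move=> /hreal[h1 h2]; split => //; rewrite -lee_fin -h1.
  exact: (pressure_tangent t0 t1 _ hf hP hm0 halpha).
have [M [M0 hM]] := pressure_expansion r0 hcc Phi0 htan hsigma.
have r40 : 0 < r / 4 by rewrite divr_gt0.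
have hgauss := eigenvalue_gaussian r40 sigma0 M0 hM.
have hclt := eigenvalue_clt r40 M0 hM.
have [c [D [h [c0 D0 hc hlog hfix]]]] : exists (c D : R) (h : X -> R),
    [/\ 0 < c, 0 <= D, forall x, c <= h x <= c^-1, log_lip theta D h & forall x,
    \sum_(j | adm j x) expR (- P * f (pcons j x)) * h (pcons j x) = h x].
  apply: perron_normalisation; have := hmax 0; rewrite normr0 => /(_ r0).
  have -> : (0 +i* 0)%C = 0 :> R[i] by [].
  suff -> : cexp (Phi 0) = 1 by [].
  by rewrite Phi0 cexp_cis /= expR0 cis0 mulr1.
pose p := normalised_weight P f h.
have [c' [D' hp]] := normalised_g_function t0 t1 hf c0 D0 hc hlog hfix.
pose lam (u : R) : R[i] := cexp (Phi (0 +i* u)%C).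
have h0 x : 0 < h x by have /andP[h1 _] := hc x; apply: lt_le_trans h1.
have hx y : (h y)%:C%C != 0 :> R[i] by rewrite fmorph_eq0 gt_eqF.
have iV (y : X) : (h y)^-1%:C%C = ((h y)%:C%C)^-1 :> R[i] by rewrite fmorphV.
have eig (u : R) : `|u| < r -> exists g B K, [/\ normc_bound B g, lip_bound theta K g,
    g <> (fun=> 0) & forall x, twisted_op p f u g x = lam u * g x].
  move=> /hmax[[v [Ev v0 Tv _]] _].
  have [B [K [K0 hB hK]]] := lipschitz_bounded Ev.
  have [hB' hK'] := div_eigenfunction_bounds t0 t1 c0 D0 hc hlog hB hK.
  exists (fun x => (h x)^-1%:C%C * v x); do 2 eexists; split; [exact: hB'|exact: hK'| |].
    move=> e; apply: v0; apply/funext => x; have := congr1 (fun g => g x) e => /= /eqP.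
    by rewrite mulf_eq0 iV invr_eq0 (negbTE (hx x)) => /eqP.
  move=> x; apply: (mulfI (hx x)); rewrite -(transfer_twist P f c0 hc).
  have := congr1 (fun g => g x) Tv; rewrite ruelle_transfer => /eqP.
  by rewrite subr_eq0 => /eqP ->; rewrite mulrCA iV mulVKf.
have lamc : forall e : R, 0 < e ->
    exists2 u0 : R, 0 < u0 & forall u, `|u| <= u0 -> nc (lam u - 1) <= e.
  exact: (eigenvalue_continuous r40 M0 hM).
(* The exponent 1 will do here: in [hW'] the frequency is bounded by [a2], so the power of [|u|]
   becomes a constant. *)
have [a0 [Ca [a01 Ca0 hCa]]] := contraction_bound ltr01.
have hW' : forall a2 : R, exists2 C : R, 0 < C & forall u n w B K, a0 <= `|u| <= a2 ->
    normc_bound B w -> lip_bound theta K w -> 0 < B -> 0 <= K ->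
    normc_bound (C * rho ^+ n * (B + K)) (iter n (twisted_op p f u) w).
  move=> a2; pose b : R := `|a2| + 1.
  have [Kh eKh] : exists Kh : R, Kh = D * expR D * c^-1 by exists (D * expR D * c^-1).
  have Kh0 : 0 <= Kh by rewrite eKh; exact: Kh_ge0 c0 D0.
  have b0 : 0 < b by rewrite ltr_wpDl.
  have ic0 : 0 < c^-1 by rewrite invr_gt0.
  have S0 : 0 < c^-1 * (c^-1 + Kh) by rewrite mulr_gt0// ltr_wpDr.
  exists (Ca * b * (c^-1 * (c^-1 + Kh))); first exact: (mulr_gt0 (mulr_gt0 Ca0 b0) S0).
  move=> u n w B K /andP[u0 u2] hB hK B0 K0 x.
  have [hB' hK'] := mul_eigenfunction_bounds t0 t1 c0 D0 hc hlog hB hK.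
  rewrite -eKh in hK'.
  have K1 : 0 <= c^-1 * K + Kh * B by apply: addr_ge0; apply: mulr_ge0 => //; exact: ltW.
  have := hCa u n _ _ _ u0 hB' hK' (mulr_gt0 ic0 B0) K1 x.
  rewrite (transfer_iter_twist P f c0 hc) Normc.normcM normc_real (gtr0_norm (h0 x)).
  set w1 := fun y => _; have -> : w1 = w.
    by apply/funext => y; rewrite /w1 iV mulKf.
  rewrite powRr1// => h1; have /andP[h2 _] := hc x.
  have -> : Ca * b * (c^-1 * (c^-1 + Kh)) * rho ^+ n * (B + K) =
    (Ca * rho ^+ n * b * ((c^-1 + Kh) * (B + K))) / c by ring.
  rewrite ler_pdivlMr// mulrC; apply: le_trans (ler_wpM2r (normc_ge0 _) h2) _.
  apply: le_trans h1 _.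
  have /andP[rho0 _] := rho01.
  have q0 : 0 <= Ca * rho ^+ n by rewrite mulr_ge0 ?exprn_ge0// ltW.
  apply: ler_pM.
  - by apply: mulr_ge0.
  - by apply: addr_ge0 => //; apply: mulr_ge0; exact: ltW.
  - by apply: ler_wpM2l => //; rewrite /b; have := ler_norm a2; lra.
  by move: (c^-1) ic0 => i i0; nra.
split.
  move=> v e e0; have e20 : 0 < e / 2 by rewrite divr_gt0.
  have [N hN] := hclt v _ e20.
  have [u3 [n0 [u30 hu3]]] := trace_asymptotic t0 t1 hp hf r0 eig lamc hgauss rho01 hW' e20.
  exists (N + n0 + (Num.truncn ((`|v| / u3) ^+ 2)).+1)%N => n nN.
  have hn (i j k l : nat) : (i + j + k.+1 <= l)%N -> [/\ 0 < l, i <= l, j <= l & k < l]%N.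
    by clear => h; split; lia.
  have [n1 nN1 nN2 nN3] := hn _ _ _ _ nN.
  have q0 : 0 < Num.sqrt (n%:R : R) by rewrite sqrtr_gt0 ltr0n.
  pose u : R := v / Num.sqrt n%:R.
  have uu : `|u| <= u3.
    rewrite /u normrM normfV (gtr0_norm q0) ler_pdivrMr// mulrC -ler_pdivrMr//.
    have vu : 0 <= `|v| / u3 by rewrite divr_ge0// ltW.
    rewrite -(ger0_norm vu) -sqrtr_sqr ler_wsqrtr// (le_trans (ltW (truncnS_gt _)))//.
    by rewrite ler_nat.
  have h1 := hN n; have h2 := hu3 u n uu.
  rewrite -/u; set x := cis _ in h1 *; set y := expR _ in h1 *.
  have E : periodic_sum P f n u * x - y%:C%C =
      (word_trace p f u n n - lam u ^+ n) * x + (lam u ^+ n * x - y%:C%C).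
    by rewrite (periodic_sum_trace u c0 hc n1); ring.
  rewrite E (le_trans (normcD _ _))// Normc.normcM normc_cis mulr1.
  have h3 : nc (word_trace p f u n n - lam u ^+ n) <= e / 2 by exact: h2.
  have h4 : nc (lam u ^+ n * x - y%:C%C) <= e / 2 by exact: h1.
  by rewrite (splitr e) lerD.
move=> a; have [C [c1 [C0 c10 hC]]] := trace_gaussian_bound t0 t1 hp hf r0 eig lamc hgauss rho01 hW' a.
exists C, c1; split => // u n ua n0.
by rewrite -(periodic_sum_trace u c0 hc n0); exact: hC.
Qed.

Variables (xi : I -> X) (rho1 : R).
Hypotheses (rho1_gt0 : 0 < rho1) (rho1_lt : rho1 < rho).
Hypothesis hrho1 : ruelle_lemma_constant theta f xi rho1.

(** The exponent [e1] in Ruelle's lemma is chosen with [rho1 * expR e1 = rho]. As the pressure at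
    [- P] vanishes, each of the at most [n] terms of its sum is then bounded by the same multiple of
    [rho ^+ n]. The square of [|u|] combines the factor in that lemma with the one lost in
    [opnorm_theta_le]. *)
Lemma periodic_sum_large_frequencies (eps : R) : 0 < eps -> exists a C : R, [/\ 1 <= a, 0 < C &
  forall u n, a <= `|u| -> (2 <= n)%N ->
    nc (periodic_sum P f n u) <= C * n%:R * rho ^+ n * (`|u| ^+ 2 * `|u| `^ eps)].
Proof.
move=> eps0; have /andP[rho0 rho11] := rho01.
pose e1 : R := ln (rho / rho1).
have e10 : 0 < e1 by rewrite ln_gt0// ltr_pdivlMr// mul1r.
have e1E : rho1 * expR e1 = rho.
  by rewrite lnK ?posrE ?divr_gt0//; field; rewrite gt_eqF.
have P1 : 0 < `|P| + 1 by rewrite ltr_wpDl.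
have [Cr Cr0 hCr] := hrho1 P1 ltr01 e10.
have [a0 [Ca [a00 Ca0 hCa]]] := hW eps0.
have [a1 [Cb [a11 Cb0 hCb]]] := contraction_bound eps0.
have k0 : 0 <= (kappa A)%:R :> R by exact: ler0n.
exists (Order.max a0 a1), (Cr * Ca + (kappa A)%:R * Cb + 1).
rewrite le_max a11 orbT; split => //.
  by rewrite ltr_wpDl// addr_ge0// mulr_ge0// ltW.
move=> u n; rewrite ge_max => /andP[u0 u1] n2.
have u11 : 1 <= `|u| by apply: le_trans u1.
have up : 0 < `|u| by lra.
have n0 : (0 < n)%N by apply: leq_trans n2.
have q0 : 0 <= `|u| `^ eps := powR_ge0 _ _.
have hPP : `|- P| <= `|P| + 1 by rewrite normrN lerDl.
have := hCr n (- P) u n2 hPP u11; rewrite hP /=.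
have -> : \sum_(x \in [set x : X | iter n sg x = x])
    cexp ((- P +i* u)%C * (birkhoff f n x)%:C%C) = periodic_sum P f n u.
  rewrite (_ : [set x | _] = [set` periodic_seq A n]); last first.
    by apply/seteqP; split=> x /= /(mem_periodic_seq _ n0).
  rewrite -fsbig_seq; last exact: periodic_seq_uniq.
  by apply: eq_bigr => x _; rewrite cexp_transfer.
set Sn := \sum_(i < kappa A) _.
move=> hR.
have hSn : nc Sn <= (kappa A)%:R * (Cb * rho ^+ n * `|u| `^ eps).
  rewrite (le_trans (normc_sum _ _ _))// (@le_trans _ _ (\sum_(i < kappa A) (Cb * rho ^+ n * `|u| `^ eps)))//.
    apply: ler_sum => i _; rewrite -[leRHS]mulr1 -[1 in leRHS]addr0.
    apply: hCb => //.
      by move=> x; rewrite /cylinder_fun; case: ifP => _; rewrite ?Normc.normc1 ?Normc.normc0.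
    move=> m x y xy; rewrite /cylinder_fun (xy 0%N)// subrr Normc.normc0 mul0r//.
  by rewrite sumr_const card_ord mulr_natl.
pose T := transfer (- P +i* u)%C f; rewrite -/T in hR.
have hop k : (opnorm theta (norm_theta theta) (iter k T) <=
    (`|u| * (Ca * rho ^+ k * `|u| `^ eps))%:E)%E.
  apply: opnorm_theta_le u11 _ (hCa u k u0).
  by rewrite mulr_ge0 ?mulr_ge0 ?exprn_ge0// ltW.
set b := `|u| * (Ca * rho ^+ n * `|u| `^ eps).
have hsum : (\sum_(2 <= m < n.+1) opnorm theta (norm_theta theta)
    (iter (n - m) T) * (rho1 ^+ m * expR (m%:R * (e1 + 0)))%:E <=
    (n%:R * b)%:E)%E.
  apply: (@le_trans _ _ (\sum_(2 <= m < n.+1) b%:E)%E).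
    rewrite big_nat_cond [leRHS]big_nat_cond; apply: lee_sum => m; rewrite andbT => /andP[_ mn].
    rewrite addr0 expRM_natl -exprMn e1E.
    apply: le_trans (lee_wpmul2r _ (hop (n - m)%N)) _.
      by rewrite lee_fin exprn_ge0// ltW.
    rewrite -EFinM lee_fin /b; apply: ler_of_eq.
    have -> : rho ^+ n = rho ^+ (n - m) * rho ^+ m by rewrite -exprD subnK.
    by ring.
  have -> : (\sum_(2 <= m < n.+1) b%:E)%E = ((n.+1 - 2)%:R * b)%:E.
    by rewrite mulr_natl -sumr_const_nat -sumEFin.
  rewrite lee_fin ler_wpM2r//.
    by rewrite /b mulr_ge0// mulr_ge0// mulr_ge0 ?exprn_ge0// ltW.
  by rewrite ler_nat subSS leq_subr.
have {}hR : nc (periodic_sum P f n u - Sn) <= Cr * `|u| * (n%:R * b).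
  rewrite -lee_fin (le_trans hR)// EFinM.
  by apply: lee_wpmul2l hsum; rewrite lee_fin mulr_ge0// ltW.
have := normc_dist (periodic_sum P f n u) 0 Sn; rewrite !subr0 => h.
apply: le_trans h _; apply: le_trans (lerD hR hSn) _.
rewrite !mulrDl; set y := rho ^+ n * (`|u| ^+ 2 * `|u| `^ eps).
have y0 : 0 <= rho ^+ n by rewrite exprn_ge0// ltW.
have n1 : 1 <= n%:R :> R by rewrite ler1n.
have h1 : (kappa A)%:R * (Cb * rho ^+ n * `|u| `^ eps) <=
    (kappa A)%:R * Cb * n%:R * rho ^+ n * (`|u| ^+ 2 * `|u| `^ eps).
  have e : 1 <= n%:R * `|u| ^+ 2 by rewrite mulr_ege1// expr_ge1.
  rewrite [leRHS](_ : _ = (kappa A)%:R * (Cb * rho ^+ n * `|u| `^ eps) * (n%:R * `|u| ^+ 2)); last by ring.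
  by rewrite ler_peMr// mulr_ge0// mulr_ge0// mulr_ge0// ltW.
rewrite -[leLHS]addr0; apply: lerD; last first.
  by rewrite mulr_ge0 ?mulr_ge0 ?sqr_ge0// mulr_ge0.
apply: lerD => //; rewrite /b; apply: ler_of_eq; ring.
Qed.

End periodic_sums.

(** * Gaussian integrals *)

Section gaussian.
Variable R : realType.
Local Notation mu := (@lebesgue_measure R).

Definition gaussian (k : R) (v : R) : R := expR (- k * v ^+ 2).

Lemma gaussian_ge0 k v : 0 <= gaussian k v. Proof. exact: expR_ge0. Qed.

Lemma gaussian_le1 k v : 0 <= k -> gaussian k v <= 1.
Proof. by move=> k0; rewrite -expR0 ler_expR mulNr oppr_le0 mulr_ge0// sqr_ge0. Qed.

Let dev (k : R) := Num.sqrt (2 * k)^-1.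

Let dev_neq0 k : 0 < k -> dev k != 0.
Proof. by move=> k0; rewrite gt_eqF// sqrtr_gt0 invr_gt0 mulr_gt0. Qed.

Let gaussian_pdf k : 0 < k ->
  normal_pdf 0 (dev k) = (fun v => (Num.sqrt (pi / k))^-1 * gaussian k v).
Proof.
move=> k0; have s2 : dev k ^+ 2 = (2 * k)^-1.
  by rewrite sqr_sqrtr// invr_ge0 mulr_ge0// ltW.
rewrite normal_pdfE ?dev_neq0//; apply/funext => v; congr (_ * _).
  rewrite /normal_peak s2; congr (Num.sqrt _)^-1.
  by rewrite -mulr_natl; field; rewrite gt_eqF.
rewrite /normal_fun /gaussian s2 subr0; congr expR.
by rewrite -mulr_natl; field; rewrite gt_eqF.
Qed.

Lemma gaussian_integrable k : 0 < k -> mu.-integrable setT (EFin \o gaussian k).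
Proof.
move=> k0; have h := integrable_normal_pdf 0 (dev k).
have q0 : 0 < Num.sqrt (pi / k) by rewrite sqrtr_gt0 divr_gt0// pi_gt0.
have -> : EFin \o gaussian k =
    (fun v => (Num.sqrt (pi / k))%:E * (normal_pdf 0 (dev k) v)%:E)%E.
  apply/funext => v /=; rewrite gaussian_pdf// -EFinM.
  by rewrite mulrA divff ?mul1r// gt_eqF.
by apply: integrableZl.
Qed.

Lemma integral_gaussian k : 0 < k -> \int[mu]_v gaussian k v = Num.sqrt (pi / k).
Proof.
move=> k0; have h := integral_normal_pdf 0 (dev k).
have q0 : 0 < Num.sqrt (pi / k) by rewrite sqrtr_gt0 divr_gt0// pi_gt0.
move: h; rewrite gaussian_pdf//.
under eq_integral do rewrite EFinM.
rewrite integralZl//; last exact: gaussian_integrable.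
have fin : (\int[mu]_v (gaussian k v)%:E)%E \is a fin_num.
  by apply: integrable_fin_num => //; exact: gaussian_integrable.
rewrite -(fineK fin) -EFinM => -[h].
by apply: (mulfI (invr_neq0 (lt0r_neq0 q0))); rewrite h mulVf// gt_eqF.
Qed.

Lemma gaussian_bound_integrable (k K : R) (g : R -> R) : 0 < k ->
  measurable_fun setT g -> (forall v, `|g v| <= K * gaussian k v) ->
  mu.-integrable setT (EFin \o g).
Proof.
move=> k0 mg hg.
apply: (@le_integrable _ _ _ mu _ measurableT _ (EFin \o (fun v => K * gaussian k v))).
- exact/measurable_EFinP.
- by move=> v _ /=; rewrite lee_fin (le_trans (hg v))// ler_norm.
- have -> : EFin \o (fun v => K * gaussian k v) = (fun v => K%:E * (EFin \o gaussian k) v)%E.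
    by apply/funext => v /=; rewrite EFinM.
  by apply: integrableZl => //; exact: gaussian_integrable.
Qed.

Lemma normr_le_gaussian (k : R) : 0 < k -> exists2 K : R, 0 < K &
  forall v, `|v| * gaussian k v <= K * gaussian (k / 2) v.
Proof.
move=> k0; exists (1 + 2 / k); first by rewrite ltr_wpDl// divr_gt0.
move=> v; have -> : gaussian k v = gaussian (k / 2) v * gaussian (k / 2) v.
  by rewrite /gaussian -expRD; congr expR; field.
rewrite mulrA ler_wpM2r ?gaussian_ge0//.
rewrite /gaussian mulNr expRN ler_pdivrMr ?expR_gt0//.
have h1 : 1 + k / 2 * v ^+ 2 <= expR (k / 2 * v ^+ 2) by exact: expR_ge1Dx.
have v2 : v ^+ 2 = `|v| ^+ 2 by rewrite real_normK ?num_real.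
have i0 : 0 < 2 / k by rewrite divr_gt0.
have e1 : 2 / k * (k / 2 * v ^+ 2) = v ^+ 2 by field; rewrite gt_eqF.
have c0 : 0 <= k / 2 * v ^+ 2 by rewrite mulr_ge0 ?sqr_ge0// divr_ge0// ltW.
apply: le_trans (ler_wpM2l _ h1); last by lra.
by rewrite v2 in e1 c0 *; move: (2 / k) i0 e1 => i i0 e1; have := normr_ge0 v; nra.
Qed.

Lemma continuous_gaussian k : continuous (gaussian k).
Proof.
move=> v; apply: (cvg_comp _ expR); last exact: continuous_expR.
by apply: cvgM; [exact: cvg_cst | exact: exprn_continuous].
Qed.

Lemma continuous_cosM (y : R) : continuous (fun v : R => cos (v * y)).
Proof.
move=> v; apply: (cvg_comp (fun v => v * y) cos); last exact: continuous_cos.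
by apply: cvgM; [exact: cvg_id | exact: cvg_cst].
Qed.

Lemma continuous_sinM (y : R) : continuous (fun v : R => sin (v * y)).
Proof.
move=> v; apply: (cvg_comp (fun v => v * y) sin); last exact: continuous_sin.
by apply: cvgM; [exact: cvg_id | exact: cvg_cst].
Qed.

Lemma gaussian_cos_integrable k y : 0 < k ->
  mu.-integrable setT (EFin \o (fun v => gaussian k v * cos (v * y))).
Proof.
move=> k0; apply: (@gaussian_bound_integrable k 1) => //.
  apply: continuous_measurable_fun => v.
  by apply: cvgM; [exact: continuous_gaussian | exact: continuous_cosM].
move=> v; rewrite normrM ger0_norm ?gaussian_ge0// mul1r ler_piMr ?gaussian_ge0//.
exact: cos_max.
Qed.

Lemma gaussian_vsin_integrable k y : 0 < k ->
  mu.-integrable setT (EFin \o (fun v => v * gaussian k v * sin (v * y))).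
Proof.
move=> k0; have [K K0 hK] := normr_le_gaussian k0.
have k20 : 0 < k / 2 by rewrite divr_gt0.
apply: (@gaussian_bound_integrable (k / 2) K) => //.
  apply: continuous_measurable_fun => v.
  apply: cvgM; last exact: continuous_sinM.
  by apply: cvgM; [exact: cvg_id | exact: continuous_gaussian].
move=> v; rewrite !normrM (ger0_norm (gaussian_ge0 k v)).
apply: le_trans (hK v); rewrite ler_piMr// ?mulr_ge0// ?gaussian_ge0//.
exact: sin_max.
Qed.

Lemma is_derive_mulr (y v : R) : is_derive v (1 : R) (fun v : R => v * y) y.
Proof.
have h : is_derive v (1 : R) (cst y) 0 by exact: is_derive_cst.
have h' : is_derive v (1 : R) id 1 by exact: is_derive_id.
by apply: is_derive_eq (is_deriveM h' h) _; rewrite /GRing.scale /= mulr0 mulr1 add0r.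
Qed.

Lemma is_derive_gaussian k (v : R) : is_derive v (1 : R) (gaussian k) (- 2 * k * v * gaussian k v).
Proof.
have h : is_derive v (1 : R) (fun v : R => - k * v ^+ 2) (- k * (2 * v)).
  by apply: is_derive_eq; rewrite /GRing.scale /=; ring.
have := @is_derive1_comp _ expR (fun v : R => - k * v ^+ 2) v _ _ (is_derive_expR _) h.
by move=> hh; apply: is_derive_eq hh _; rewrite /gaussian; ring.
Qed.

(** The derivative of [gaussian k v * sin (v * y)] has integral 0: over symmetric intervals the
    boundary values vanish in the limit, and dominated convergence passes to the line. *)
Lemma integral_gaussian_parts k y : 0 < k ->
  2 * k * \int[mu]_v (v * gaussian k v * sin (v * y)) = y * \int[mu]_v (gaussian k v * cos (v * y)).
Proof.
move=> k0.
pose H v := gaussian k v * sin (v * y).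
pose h v := y * (gaussian k v * cos (v * y)) - 2 * k * (v * gaussian k v * sin (v * y)).
have dH (v : R) : is_derive v (1 : R) H (h v).
  have hs : is_derive v (1 : R) (fun v : R => sin (v * y)) (cos (v * y) * y).
    by apply: (@is_derive1_comp _ sin (fun v : R => v * y)); exact: is_derive_mulr.
  have hg := is_derive_gaussian k v.
  by apply: is_derive_eq; rewrite /h /GRing.scale /=; ring.
have cH : continuous H.
  move=> v; apply: cvgM; [exact: continuous_gaussian | exact: continuous_sinM].
have ch : continuous h.
  move=> v; apply: cvgB; apply: cvgM; try exact: cvg_cst.
    by apply: cvgM; [exact: continuous_gaussian | exact: continuous_cosM].
  apply: cvgM; last exact: continuous_sinM.
  by apply: cvgM; [exact: cvg_id | exact: continuous_gaussian].
have i1 := gaussian_cos_integrable y k0; have i2 := gaussian_vsin_integrable y k0.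
have i3 : mu.-integrable setT (EFin \o (fun v => y * (gaussian k v * cos (v * y)))).
  have -> : EFin \o (fun v => y * (gaussian k v * cos (v * y))) =
    (fun v => y%:E * (gaussian k v * cos (v * y))%:E)%E by apply/funext => v /=; rewrite EFinM.
  exact: integrableZl.
have i4 : mu.-integrable setT (EFin \o (fun v => 2 * k * (v * gaussian k v * sin (v * y)))).
  have -> : EFin \o (fun v => 2 * k * (v * gaussian k v * sin (v * y))) =
    (fun v => (2 * k)%:E * (v * gaussian k v * sin (v * y))%:E)%E by apply/funext => v /=; rewrite EFinM.
  exact: integrableZl.
have ih : mu.-integrable setT (EFin \o h).
  have -> : EFin \o h = ((EFin \o (fun v => y * (gaussian k v * cos (v * y)))%R) \-
    (EFin \o (fun v => 2 * k * (v * gaussian k v * sin (v * y)))%R))%E.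
    by apply/funext => v /=; rewrite EFinB.
  exact: integrableB.
pose I (n : nat) : set R := `[(- n.+1%:R), (n.+1%:R)]%classic.
have hn (n : nat) : (\int[mu]_(v in I n) (h v)%:E = (H n.+1%:R - H (- n.+1%:R))%:E)%E.
  rewrite (@continuous_FTC2 _ h H)//.
  - by rewrite (@lt_trans _ _ 0) ?oppr_lt0 ?ltr0n.
  - by apply: continuous_subspaceT.
  - split; [move=> x _; exact: ex_derive | |].
    + by apply: cvg_at_right_filter; exact: cH.
    + by apply: cvg_at_left_filter; exact: cH.
  - by move=> x _; rewrite derive1E; have [_ ->] := dH x.
have H0 : H n.+1%:R - H (- n.+1%:R) @[n --> \oo] --> (0 : R).
  have g0 : 2 * gaussian k n.+1%:R @[n --> \oo] --> (0 : R).
    have h0 : 2 / k * harmonic n @[n --> \oo] --> (0 : R).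
      by rewrite -(mulr0 (2 / k)); apply: cvgM; [exact: cvg_cst | exact: cvg_harmonic].
    apply: (@squeeze_cvgr _ _ _ _ (cst 0) _ _ _ _ _ h0); last exact: cvg_cst.
    apply: nearW => n; rewrite mulr_ge0 ?gaussian_ge0//= -mulrA ler_wpM2l//.
    rewrite /gaussian mulNr expRN -invfM lef_pV2 ?posrE ?expR_gt0 ?mulr_gt0//.
    have h1 : 1 + k * n.+1%:R ^+ 2 <= expR (k * n.+1%:R ^+ 2) by exact: expR_ge1Dx.
    have n1 : 1 <= n.+1%:R :> R by rewrite ler1n.
    apply: le_trans h1; rewrite ler_wpDl// ler_wpM2l// ?(ltW k0)// expr2.
    by rewrite ler_peMl// ler0n.
  apply: norm_cvg0; apply: (@squeeze_cvgr _ _ _ _ (cst 0) _ _ _ _ _ g0); last exact: cvg_cst.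
  apply: nearW => n; rewrite normr_ge0 /= (le_trans (ler_normB _ _))//.
  have b v : `|H v| <= gaussian k v.
    rewrite normrM (ger0_norm (gaussian_ge0 k v)) ler_piMr ?gaussian_ge0//; exact: sin_max.
  have e : gaussian k (- n.+1%:R) = gaussian k n.+1%:R by rewrite /gaussian sqrrN.
  have := b n.+1%:R; have := b (- n.+1%:R); rewrite e; lra.
have H1 : (\int[mu]_(v in I n) (h v)%:E)%E @[n --> \oo] --> (\int[mu]_v (h v)%:E)%E.
  under eq_fun do rewrite integral_mkcond.
  apply: (@dominated_cvg _ _ _ mu _ measurableT _ _ (fun v => `|(h v)%:E|%E)) => //.
  - move=> n; apply/(measurable_restrictT _ _).1; first exact: measurable_itv.
    by apply: measurable_funTS; apply/measurable_EFinP; exact: continuous_measurable_fun.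
  - move=> v _; apply: cvg_near_cst; near=> n.
    rewrite patchE mem_set// /I /= in_itv /= -ler_norml.
    by rewrite (le_trans (ltW (truncnS_gt _)))// ler_nat ltnS; near: n; exact: nbhs_infty_ge.
  - exact: integrable_abse.
  - by move=> n v _; rewrite patchE; case: ifP => //; rewrite abse0.
have Hint0 : \int[mu]_v h v = 0.
  have fin : (\int[mu]_v (h v)%:E)%E \is a fin_num by apply: integrable_fin_num.
  rewrite -(fineK fin) in H1; have H2 := @fine_cvg _ _ _ _ _ _ H1.
  have E : fine \o (fun n => (\int[mu]_(v in I n) (h v)%:E)%E) = (fun n => H n.+1%:R - H (- n.+1%:R)).
    by apply/funext => n /=; rewrite hn.
  rewrite E in H2; exact: (cvg_unique (@Rhausdorff R) (H2 _) H0).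
have : \int[mu]_v h v = y * \int[mu]_v (gaussian k v * cos (v * y)) -
    2 * k * \int[mu]_v (v * gaussian k v * sin (v * y)).
  rewrite /h RintegralB// RintegralZl//; congr (_ - _).
  by rewrite RintegralZl.
by rewrite Hint0 => /esym/eqP; rewrite subr_eq0 => /eqP ->.
Unshelve. all: by end_near.
Qed.

(** Differentiation under the integral and [integral_gaussian_parts] give the equation
    [F' = - y / (2 k) F], so [F y * expR (y ^+ 2 / (4 * k))] is constant. *)
Lemma integral_gaussian_cos k y : 0 < k ->
  \int[mu]_v (gaussian k v * cos (v * y)) = Num.sqrt (pi / k) * expR (- y ^+ 2 / (4 * k)).
Proof.
move=> k0; pose F y := \int[mu]_v (gaussian k v * cos (v * y)).
pose fam (y v : R) := gaussian k v * cos (v * y).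
have dcos (x v : R) : is_derive x (1 : R) (fam ^~ v) (- (v * gaussian k v * sin (v * x))).
  have hs : is_derive x (1 : R) (fun x : R => cos (v * x)) (- sin (v * x) * v).
    apply: (@is_derive1_comp _ cos (fun x : R => v * x)).
    by under eq_fun do rewrite mulrC; exact: is_derive_mulr.
  rewrite /fam; apply: is_derive_eq; rewrite /GRing.scale /=; ring.
have [K K0 hK] := normr_le_gaussian k0.
have k20 : 0 < k / 2 by rewrite divr_gt0.
have dF (x : R) : is_derive x (1 : R) F (- (x / (2 * k)) * F x).
  pose G v := K * gaussian (k / 2) v.
  have iG : mu.-integrable setT (EFin \o G).
    apply: (@gaussian_bound_integrable (k / 2) K) => //.
      apply: continuous_measurable_fun => v; apply: cvgM; [exact: cvg_cst|exact: continuous_gaussian].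
    by move=> v; rewrite ger0_norm// mulr_ge0 ?gaussian_ge0// ltW.
  have G0 v : 0 <= G v by rewrite mulr_ge0 ?gaussian_ge0// ltW.
  have Ix : `]x - 1, x + 1[%classic x by rewrite /= in_itv /=; lra.
  have intf z : `]x - 1, x + 1[%classic z -> mu.-integrable setT (EFin \o fam z).
    by move=> _; exact: gaussian_cos_integrable.
  have der z v : `]x - 1, x + 1[%classic z -> setT v -> derivable (fam ^~ v) z 1.
    by move=> _ _; have [] := dcos z v.
  have ub z v : `]x - 1, x + 1[%classic z -> setT v -> `|partial1of2 fam z v| <= G v.
    move=> _ _; rewrite /partial1of2 derive1E; have [_ ->] := dcos z v.
    rewrite normrN !normrM (ger0_norm (gaussian_ge0 k v)).
    by apply: le_trans (hK v); rewrite ler_piMr// ?mulr_ge0 ?gaussian_ge0// sin_max.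
  have h1 := derivable_under_integral measurableT Ix intf der G0 iG ub.
  have h2 := differentiation_under_integral measurableT Ix intf der G0 iG ub.
  apply: DeriveDef => //; rewrite -derive1E h2.
  have -> : \int[mu]_v partial1of2 fam x v = \int[mu]_v (- 1 * (v * gaussian k v * sin (v * x))).
    apply: eq_Rintegral => v _; rewrite /partial1of2 derive1E; have [_ ->] := dcos x v.
    by rewrite mulN1r.
  rewrite RintegralZl//; last exact: gaussian_vsin_integrable.
  have := integral_gaussian_parts x k0; rewrite -/(F x) => e.
  rewrite mulN1r mulNr mulrAC -e; field; rewrite gt_eqF//.
have dE (x : R) : is_derive x (1 : R) (fun x : R => F x * expR (x ^+ 2 / (4 * k))) 0.
  have h : is_derive x (1 : R) (fun x : R => x ^+ 2 / (4 * k)) (x / (2 * k)).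
    apply: is_derive_eq; rewrite /GRing.scale /=; field; rewrite gt_eqF//.
  have he := @is_derive1_comp _ expR (fun x : R => x ^+ 2 / (4 * k)) x _ _ (is_derive_expR _) h.
  have hF := dF x; apply: is_derive_eq; rewrite /GRing.scale /=; ring.
have := is_derive_0_is_cst y 0 dE.
rewrite expr0n /= mul0r expR0 mulr1 {2}/F.
have -> : \int[mu]_v (gaussian k v * cos (v * 0)) = Num.sqrt (pi / k).
  rewrite -integral_gaussian//; apply: eq_Rintegral => v _; by rewrite mulr0 cos0 mulr1.
by move=> <-; rewrite -mulrA -expRD mulNr subrr expR0 mulr1.
Qed.

End gaussian.

(** * Local limit theorem *)

Section trigonometric_sums.
Variables (R : realType) (J : Type).
Local Notation mu := (@lebesgue_measure R).

Lemma measurable_cos_sum (r : seq J) (w y : J -> R) :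
  measurable_fun setT (fun v : R => \sum_(x <- r) w x * cos (v * y x)).
Proof.
apply: measurable_sum => x; apply: continuous_measurable_fun => v.
by apply: cvgM; [exact: cvg_cst | exact: continuous_cosM].
Qed.

Lemma measurable_sin_sum (r : seq J) (w y : J -> R) :
  measurable_fun setT (fun v : R => \sum_(x <- r) w x * sin (v * y x)).
Proof.
apply: measurable_sum => x; apply: continuous_measurable_fun => v.
by apply: cvgM; [exact: cvg_cst | exact: continuous_sinM].
Qed.

Lemma gaussian_cos_sum_integrable k (r : seq J) (w y : J -> R) : 0 < k ->
  mu.-integrable setT (EFin \o (fun v => gaussian k v * \sum_(x <- r) w x * cos (v * y x))).
Proof.
move=> k0; apply: (@gaussian_bound_integrable _ k (\sum_(x <- r) `|w x|)) => //.
  apply: measurable_funM; last exact: measurable_cos_sum.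
  by apply: continuous_measurable_fun; exact: continuous_gaussian.
move=> v; rewrite normrM (ger0_norm (gaussian_ge0 k v)) mulrC ler_wpM2r ?gaussian_ge0//.
rewrite (le_trans (ler_norm_sum _ _ _))//; apply: ler_sum => x _.
by rewrite normrM ler_piMr// cos_max.
Qed.

Lemma integral_gaussian_cos_sum k (r : seq J) (w y : J -> R) : 0 < k ->
  \int[mu]_v (gaussian k v * \sum_(x <- r) w x * cos (v * y x)) =
  \sum_(x <- r) w x * (Num.sqrt (pi / k) * expR (- y x ^+ 2 / (4 * k))).
Proof.
move=> k0; elim: r => [|x r ih].
  rewrite big_nil; under eq_Rintegral do rewrite big_nil mulr0.
  by rewrite Rintegral_cst// mul0r.
rewrite big_cons -ih -integral_gaussian_cos//.
have i1 : mu.-integrable setT (EFin \o (fun v => w x * (gaussian k v * cos (v * y x)))).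
  have -> : EFin \o (fun v => w x * (gaussian k v * cos (v * y x))) =
    (fun v => (w x)%:E * (gaussian k v * cos (v * y x))%:E)%E by apply/funext => v /=; rewrite EFinM.
  by apply: integrableZl => //; exact: gaussian_cos_integrable.
rewrite -RintegralZl//; last exact: gaussian_cos_integrable.
rewrite -RintegralD//; last exact: gaussian_cos_sum_integrable.
by apply: eq_Rintegral => v _; rewrite big_cons; ring.
Qed.

(** Serves to absorb the growth [|u|^(2+e)] of the periodic sums into part of the Gaussian damping.
    The two summands of the constant bound [2 * X ^+ 2] and [X ^+ 4]. *)
Lemma sqr_expR_bound (t : R) : 0 < t -> exists2 K : R, 0 < K &
  forall X, 0 <= X -> X ^+ 2 * (1 + X) <= K * expR (t * X ^+ 2).
Proof.
move=> t0; exists (2 / t + 4 / t ^+ 2).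
  by rewrite addr_gt0// divr_gt0// exprn_gt0.
move=> X X0; set y := t * X ^+ 2.
have y0 : 0 <= y by rewrite mulr_ge0 ?sqr_ge0// ltW.
have h1 : 1 + y <= expR y by exact: expR_ge1Dx.
have h2 : y ^+ 2 / 4 <= expR y.
  have h := expR_ge1Dx (y / 2); have -> : expR y = expR (y / 2) ^+ 2.
    by rewrite expr2 -expRD -splitr.
  have : (y / 2) ^+ 2 <= expR (y / 2) ^+ 2.
    rewrite lerXn2r ?nnegrE ?divr_ge0 ?expR_ge0//; lra.
  by rewrite expr_div_n; lra.
have e1 : X ^+ 2 = y / t by rewrite /y; field; rewrite gt_eqF.
have e2 : X ^+ 4 = y ^+ 2 / t ^+ 2.
  by rewrite -expr_div_n -e1 -exprM.
have h3 : X ^+ 2 * (1 + X) <= 2 * X ^+ 2 + X ^+ 4.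
  have : 0 <= X ^+ 2 * (X - 1 / 2) ^+ 2 by rewrite mulr_ge0 ?sqr_ge0.
  have := sqr_ge0 X; rewrite !exprS expr0 !mulr1; lra.
apply: le_trans h3 _; rewrite [leRHS]mulrDl; apply: lerD.
  by rewrite e1 mulrA mulrAC ler_wpM2l ?divr_ge0 ?(ltW t0)//; lra.
by rewrite e2 [4 / _ * _]mulrAC ler_wpM2r ?invr_ge0 ?sqr_ge0//; lra.
Qed.

Lemma sqrtrMsqr (a c : R) : 0 <= a -> 0 <= c -> Num.sqrt (a * c ^+ 2) = Num.sqrt a * c.
Proof. by move=> a0 c0; rewrite sqrtrM// sqrtr_sqr ger0_norm. Qed.

Lemma powR_le1D (X e : R) : 0 <= X -> 0 < e <= 1 -> X `^ e <= 1 + X.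
Proof.
move=> X0 /andP[e0 e1]; have [X1|X1] := leP X 1.
  apply: (@le_trans _ _ (1 `^ e)); last by rewrite powR1; lra.
  by apply: ge0_ler_powR; rewrite ?nnegrE// ltW.
apply: (@le_trans _ _ (X `^ 1)); last by rewrite powRr1//; lra.
by apply: ler_powR => //; exact: ltW.
Qed.

End trigonometric_sums.

Section local_limit.
Variables (R : realType) (J : Type).
Local Notation mu := (@lebesgue_measure R).
Local Notation nc := (@Normc.normc R).
Variables (per : nat -> seq J) (w phi : nat -> J -> R) (alpha sigma rho e : R).
Hypotheses (sigma0 : 0 < sigma) (rho0 : 0 < rho) (he : 0 < e <= 1).
Let Z (m : nat) (u : R) : R[i] := \sum_(x <- per m) (w m x)%:C%C * cis (u * phi m x).
Hypothesis Z_clt : forall v eta : R, 0 < eta -> exists N, forall n, (N <= n)%N ->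
  nc (Z n (v / Num.sqrt n%:R) * cis (- (alpha * v * Num.sqrt n%:R)) -
     (expR (- (sigma ^+ 2 * v ^+ 2 / 2)))%:C%C) <= eta.
Hypothesis Z_small : forall a : R, exists C c1 : R, [/\ 0 < C, 0 < c1 & forall u n,
  `|u| <= a -> (0 < n)%N -> nc (Z n u) <= C * expR (- c1 * u ^+ 2) ^+ n].
Hypothesis Z_large : exists a C : R, [/\ 1 <= a, 0 < C &
  forall u n, a <= `|u| -> (2 <= n)%N ->
    nc (Z n u) <= C * n%:R * rho ^+ n * (`|u| ^+ 2 * `|u| `^ e)].

(** The characteristic function of [phi m], centred at [m * alpha] and rescaled by [sqrt m], for the
    weights [w m]; these have total mass 1 only in the limit. *)
Let zeta (m : nat) (v : R) : R[i] :=
  Z m (v / Num.sqrt m%:R) * cis (- (alpha * v * Num.sqrt m%:R)).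
Let y m x := phi m x / Num.sqrt m%:R - alpha * Num.sqrt m%:R.
Let G (v : R) := gaussian (sigma ^+ 2 / 2) v.

Let zetaE m v : zeta m v = \sum_(x <- per m) (w m x)%:C%C * cis (v * y m x).
Proof.
rewrite /zeta /Z mulr_suml; apply: eq_bigr => x _; rewrite -mulrA -cisD.
by congr (_ * cis _); rewrite /y; ring.
Qed.

Let Re_zeta m v : complex.Re (zeta m v) = \sum_(x <- per m) w m x * cos (v * y m x).
Proof. by rewrite zetaE Re_sum; apply: eq_bigr => x _; rewrite Re_realM. Qed.

Let Im_zeta m v : complex.Im (zeta m v) = \sum_(x <- per m) w m x * sin (v * y m x).
Proof. by rewrite zetaE Im_sum; apply: eq_bigr => x _; rewrite Im_realM. Qed.

(** A majorant, independent of [eps] and [T], of the bounded-frequency part of the error and of the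
    Gaussian tail beyond it. The smoothing factor [gaussian k] has [k = eps ^+ 2 / (4 * b * m)];
    replacing it by the one for [eps = 1] bounds its distance to 1 for all [eps <= 1]. *)
Let bulk (a b : R) (m : nat) (v : R) : R :=
  if `|v| <= a * Num.sqrt m%:R
  then `|complex.Re (zeta m v) - G v| + `|complex.Im (zeta m v)| +
    (1 - gaussian (4 * b * m%:R)^-1 v) * G v
  else G v.

Let G_E v : G v = expR (- (sigma ^+ 2 * v ^+ 2 / 2)).
Proof. by rewrite /G /gaussian; congr expR; field. Qed.

Let measurable_bulk a b m : measurable_fun setT (bulk a b m).
Proof.
have mG : measurable_fun setT G by apply: continuous_measurable_fun; exact: continuous_gaussian.
apply: measurable_fun_ifT => //.
- apply: measurable_fun_ler; last exact: measurable_cst.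
  by apply: continuous_measurable_fun; exact: norm_continuous.
apply: measurable_funD; [apply: measurable_funD|].
- apply: measurableT_comp => //; apply: measurable_funB => //.
  by under eq_fun do rewrite Re_zeta; exact: measurable_cos_sum.
- apply: measurableT_comp => //.
  by under eq_fun do rewrite Im_zeta; exact: measurable_sin_sum.
- apply: measurable_funM => //; apply: measurable_funB => //.
  by apply: continuous_measurable_fun; exact: continuous_gaussian.
Qed.

Let bulk_ge0 a b m v : 0 < b -> 0 <= bulk a b m v.
Proof.
move=> b0; rewrite /bulk; case: ifP => _; last exact: gaussian_ge0.
rewrite !addr_ge0// mulr_ge0 ?gaussian_ge0// subr_ge0 gaussian_le1//.
by rewrite invr_ge0 mulr_ge0// mulr_ge0// ltW.
Qed.

(** Supplies the integrable majorant for dominated convergence: with [u = v / sqrt m], the bound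
    [expR (- c1 * u ^+ 2) ^+ m] equals [gaussian c1 v] for every [m]. *)
Let bulk_dominated a b : 0 < b -> exists K c : R, 0 < c /\ forall m v, (0 < m)%N ->
  `|bulk a b m v| <= K * gaussian c v.
Proof.
move=> b0; have [C [c1 [C0 c10 hC]]] := Z_small a.
have s0 : 0 < sigma ^+ 2 / 2 by rewrite divr_gt0// exprn_gt0.
exists (2 * C + 3), (Order.min c1 (sigma ^+ 2 / 2)).
split; first by rewrite lt_min c10.
move=> m v m0; set c := Order.min _ _.
have gm k : c <= k -> gaussian k v <= gaussian c v.
  by move=> ck; rewrite ler_expR !mulNr lerN2 ler_wpM2r// sqr_ge0.
have hG : G v <= gaussian c v by apply: gm; rewrite ge_min lexx orbT.
have hc1 : gaussian c1 v <= gaussian c v by apply: gm; rewrite ge_min lexx.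
have g0 := gaussian_ge0 c v; have G0 : 0 <= G v := gaussian_ge0 _ _.
rewrite ger0_norm ?bulk_ge0// /bulk; case: ifP => [hv|_]; last first.
  by apply: le_trans hG _; rewrite ler_peMl//; lra.
have q0 : 0 < Num.sqrt (m%:R : R) by rewrite sqrtr_gt0 ltr0n.
have hz : nc (zeta m v) <= C * gaussian c1 v.
  rewrite /zeta Normc.normcM normc_cis mulr1.
  have hu : `|v / Num.sqrt m%:R| <= a by rewrite normrM normfV (gtr0_norm q0) ler_pdivrMr.
  apply: le_trans (hC _ _ hu m0) _; rewrite -expRM_natl; apply: ler_of_eq.
  congr (_ * expR _); rewrite expr_div_n sqr_sqrtr ?ler0n//; field.
  by rewrite pnatr_eq0 -lt0n.
have h1 := Re_le_normc (zeta m v); have h2 := Im_le_normc (zeta m v).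
have h3 : `|complex.Re (zeta m v) - G v| <= `|complex.Re (zeta m v)| + G v.
  by rewrite (le_trans (ler_normB _ _))// lerD2l ger0_norm.
have h4 : (1 - gaussian (4 * b * m%:R)^-1 v) * G v <= G v.
  by rewrite ler_piMl// lerBlDr lerDl gaussian_ge0.
have h5 : C * gaussian c1 v <= C * gaussian c v by rewrite ler_wpM2l// ltW.
have -> : (2 * C + 3) * gaussian c v = 2 * (C * gaussian c v) + 3 * gaussian c v by ring.
lra.
Qed.

Let bulk_cvg (a b v : R) : 0 < a -> 0 < b -> bulk a b m.+1 v @[m --> \oo] --> (0 : R).
Proof.
move=> a0 b0; apply/cvgrPdist_le => eta eta0.
have eta3 : 0 < eta / 3 by rewrite divr_gt0.
have [N hN] := Z_clt v eta3.
pose N1 := (Num.truncn ((`|v| / a) ^+ 2)).+1; pose N2 := (Num.truncn (v ^+ 2 / (4 * b) / (eta / 3))).+1.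
exists (N + N1 + N2)%N => // m /= hm.
have hle (i j k l : nat) : (i + j + k <= l)%N -> [/\ i <= l.+1, j <= l.+1 & k <= l.+1]%N.
  by clear => h; split; lia.
have [m1 m2 m3] := hle _ _ _ _ hm.
have q0 : 0 < Num.sqrt (m.+1%:R : R) by rewrite sqrtr_gt0 ltr0n.
rewrite sub0r normrN ger0_norm ?bulk_ge0// /bulk.
have -> : `|v| <= a * Num.sqrt m.+1%:R.
  rewrite mulrC -ler_pdivrMr//; have va : 0 <= `|v| / a by rewrite divr_ge0// ltW.
  rewrite -(ger0_norm va) -sqrtr_sqr ler_wsqrtr// (le_trans (ltW (truncnS_gt _)))//.
  by rewrite ler_nat.
have h := hN _ m1; rewrite -/(zeta _ _) -G_E in h.
have h1 := le_trans (Re_le_normc _) h; have h2 := le_trans (Im_le_normc _) h.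
rewrite ReB ImB /= subr0 in h1 h2.
have G0 : 0 <= G v := gaussian_ge0 _ _.
have G1 : G v <= 1 by apply: gaussian_le1; rewrite divr_ge0 ?sqr_ge0.
have k0 : 0 < 4 * b by rewrite mulr_gt0.
have h3 : 1 - gaussian (4 * b * m.+1%:R)^-1 v <= eta / 3.
  have := expR_ge1Dx (- (4 * b * m.+1%:R)^-1 * v ^+ 2); rewrite -/(gaussian _ _).
  rewrite mulNr => h6; suff h5 : (4 * b * m.+1%:R)^-1 * v ^+ 2 <= eta / 3.
    by rewrite lerBlDr; apply: le_trans (lerD h5 h6); rewrite addrCA subrr addr0.
  have -> : (4 * b * m.+1%:R)^-1 * v ^+ 2 = v ^+ 2 / (4 * b) / m.+1%:R.
    by field; rewrite addrC natr1 pnatr_eq0 /= gt_eqF.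
  rewrite ler_pdivrMr ?ltr0n// [eta / 3 * _]mulrC -ler_pdivrMr//.
  by rewrite (le_trans (ltW (truncnS_gt _)))// ler_nat.
have h4 : 0 <= 1 - gaussian (4 * b * m.+1%:R)^-1 v.
  by rewrite subr_ge0 gaussian_le1// invr_ge0 mulr_ge0// ltW.
have h5 : (1 - gaussian (4 * b * m.+1%:R)^-1 v) * G v <= eta / 3.
  by apply: le_trans h3; rewrite ler_piMr.
have -> : eta = eta / 3 + eta / 3 + eta / 3 by field.
by rewrite !lerD.
Qed.

Let integral_bulk_small (a b eta : R) : 0 < a -> 0 < b -> 0 < eta ->
  exists N, forall m, (N < m)%N -> \int[mu]_v bulk a b m v <= eta.
Proof.
move=> a0 b0 eta0; have [K [c [c0 hK]]] := bulk_dominated a b0.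
have H : (\int[mu]_v (bulk a b m.+1 v)%:E)%E @[m --> \oo] --> (\int[mu]_v (cst 0 v))%E.
  apply: (@dominated_cvg _ _ _ mu _ measurableT _ _ (fun v => (K * gaussian c v)%:E)) => //.
  - by move=> n; apply/measurable_EFinP; exact: measurable_bulk.
  - by move=> v _; apply: cvg_EFin; [exact: nearW | exact: bulk_cvg].
  - apply: (@gaussian_bound_integrable _ c `|K|) => //.
      by apply: measurable_funM => //; apply: continuous_measurable_fun; exact: continuous_gaussian.
    by move=> v; rewrite normrM (ger0_norm (gaussian_ge0 c v)).
  - by move=> n v _; rewrite /= lee_fin hK.
rewrite integral0 in H; have H2 := @fine_cvg _ _ _ _ _ _ H.
have H3 : (fine \o (fun m => (\int[mu]_v (bulk a b m.+1 v)%:E)%E)) m @[m --> \oo] --> (0 : R) by apply: H2.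
have /cvgrPdist_le/(_ _ eta0)[N _ hN] := H3.
exists N => -[//|m] Nm; have := hN m Nm; rewrite /= sub0r normrN.
exact: le_trans (ler_norm _).
Qed.

(** Both sides are Gaussian integrals of characteristic functions, by [integral_gaussian_cos_sum]
    and [integral_gaussian_cos], so the error is an integral over frequencies. Frequencies
    [|u| <= a] go into [bulk]. The others are paid for by the condition on [rho ^+ m], which leaves
    the estimate uniform in [eps] and [T]. *)
Lemma local_limit (b eta : R) : 0 < b -> 0 < eta -> exists (kap : R) (M : nat), 0 < kap /\
  forall m (eps T : R), (M <= m)%N -> 0 < eps <= 1 ->
  m%:R ^+ 2 * rho ^+ m <= kap * (eps ^+ 3 * eps `^ e) ->
  `|\sum_(x <- per m) w m x * gaussian (b / eps ^+ 2) (phi m x - T) * (Num.sqrt (4 * b * pi * m%:R) / eps)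
    - Num.sqrt (2 * pi) / sigma * gaussian (2 * sigma ^+ 2)^-1 ((m%:R * alpha - T) / Num.sqrt m%:R)| <= eta.
Proof.
move=> b0 eta0; have [a [C [a1 C0 hC]]] := Z_large; have a0 : 0 < a by lra.
have eta2 : 0 < eta / 2 by rewrite divr_gt0.
have [N hN] := integral_bulk_small a0 b0 eta2.
have b8 : 0 < (8 * b)^-1 by rewrite invr_gt0 mulr_gt0.
have [K1 K10 hK1] := sqr_expR_bound b8.
pose K2 : R := C * K1 * Num.sqrt (8 * b * pi).
have q80 : 0 < Num.sqrt (8 * b * pi : R) by rewrite sqrtr_gt0 !mulr_gt0// pi_gt0.
have K20 : 0 < K2 by rewrite !mulr_gt0.
exists (eta / (2 * K2)), (N + 2)%N; split; first by rewrite divr_gt0// mulr_gt0.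
move=> m eps T Mm /andP[eps0 eps1] hm.
have m2 : (2 <= m)%N by apply: leq_trans Mm; rewrite leq_addl.
have Nm : (N < m)%N by apply: leq_trans Mm; rewrite -addn1 leq_add2l.
have m0 : 0 < m%:R :> R by rewrite ltr0n ltnW.
set q := Num.sqrt (m%:R : R); have q0 : 0 < q by rewrite sqrtr_gt0.
have q2 : q ^+ 2 = m%:R by rewrite sqr_sqrtr// ltW.
(* The parameter for which the transform of [gaussian k] at [(phi - T) / sqrt m] is the window
   [gaussian (b / eps ^+ 2) (phi - T)]. *)
pose k : R := eps ^+ 2 / (4 * b * m%:R).
have k0 : 0 < k by rewrite divr_gt0 ?exprn_gt0// !mulr_gt0.
have s20 : 0 < sigma ^+ 2 / 2 by rewrite divr_gt0// exprn_gt0.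
pose s : R := (m%:R * alpha - T) / q.
pose P v := gaussian k v * \sum_(x <- per m) w m x * cos (v * ((phi m x - T) / q)).
pose Q v := G v * cos (v * s).
have -> : \sum_(x <- per m) w m x * gaussian (b / eps ^+ 2) (phi m x - T) *
    (Num.sqrt (4 * b * pi * m%:R) / eps) = \int[mu]_v P v.
  rewrite integral_gaussian_cos_sum//; apply: eq_bigr => x _; rewrite -mulrA; congr (_ * _).
  rewrite mulrC; congr (_ * _); last first.
    rewrite /gaussian; congr expR; rewrite /k -q2; field; rewrite !gt_eqF//=.
  have -> : pi / k = 4 * b * pi * m%:R * (eps^-1) ^+ 2 by rewrite /k; field; rewrite !gt_eqF.
  by rewrite sqrtrMsqr ?invr_ge0 ?(ltW eps0)// !mulr_ge0 ?pi_ge0// ltW.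
have -> : Num.sqrt (2 * pi) / sigma * gaussian (2 * sigma ^+ 2)^-1 s = \int[mu]_v Q v.
  rewrite integral_gaussian_cos//; congr (_ * _).
    have -> : pi / (sigma ^+ 2 / 2) = 2 * pi * (sigma^-1) ^+ 2 by field; rewrite gt_eqF.
    by rewrite sqrtrMsqr ?mulr_ge0 ?pi_ge0// invr_ge0 ltW.
  by rewrite /gaussian; congr expR; field; rewrite gt_eqF.
pose B v := C * m%:R * rho ^+ m * K1 / (eps ^+ 2 * eps `^ e) * gaussian (k / 2) v.
have PQ v : `|P v - Q v| <= bulk a b m v + B v.
  have PQE : P v - Q v = complex.Re (cis (v * s) * ((gaussian k v)%:C%C * zeta m v - (G v)%:C%C)).
    have -> : cis (v * s) * ((gaussian k v)%:C%C * zeta m v - (G v)%:C%C) =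
      (gaussian k v)%:C%C * (cis (v * s) * zeta m v) - (G v)%:C%C * cis (v * s) by ring.
    rewrite ReB !Re_realM; congr (_ * _ - _).
    rewrite zetaE mulr_sumr Re_sum; apply: eq_bigr => x _.
    rewrite [cis _ * _]mulrCA Re_realM -cisD /=; congr (_ * cos _).
    by rewrite /y /s -/q -q2; field; rewrite gt_eqF.
  rewrite PQE (le_trans (Re_le_normc _))// Normc.normcM normc_cis mul1r.
  have g0 := gaussian_ge0 k v; have G0 : 0 <= G v := gaussian_ge0 _ _.
  have g1 : gaussian k v <= 1 := gaussian_le1 _ (ltW k0).
  have Bv0 : 0 <= B v.
    rewrite /B mulr_ge0 ?gaussian_ge0// divr_ge0//; last first.
      by rewrite mulr_ge0 ?sqr_ge0// powR_ge0.
    by rewrite !mulr_ge0 ?exprn_ge0// ltW.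
  rewrite /bulk -/q; case: ifP => hv.
    have -> : (gaussian k v)%:C%C * zeta m v - (G v)%:C%C =
      (gaussian k v)%:C%C * (zeta m v - (G v)%:C%C) - ((1 - gaussian k v) * G v)%:C%C.
      by rewrite rmorphM rmorphB /=; ring.
    apply: le_trans (normcB _ _) _; rewrite Normc.normcM !normc_real (ger0_norm g0).
    rewrite ger0_norm; last by rewrite mulr_ge0// subr_ge0.
    rewrite -[leLHS]addr0; apply: lerD => //; apply: lerD.
      apply: le_trans (ler_piMl (normc_ge0 _) g1) _.
      by apply: le_trans (normc_le_ReIm _) _; rewrite ReB ImB /= subr0.
    apply: ler_wpM2r => //; rewrite lerD2l lerN2 ler_expR !mulNr lerN2 ler_wpM2r ?sqr_ge0//.
    by rewrite /k ler_piMl ?exprn_ile1// ?ltW// invr_gt0 !mulr_gt0.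
  apply: le_trans (normcB _ _) _; rewrite Normc.normcM !normc_real (ger0_norm g0) (ger0_norm G0).
  rewrite addrC lerD2l; set u := v / q.
  have hu : a <= `|u|.
    by rewrite /u normrM normfV (gtr0_norm q0) ler_pdivlMr// ltW// ltNge hv.
  have hz : nc (zeta m v) <= C * m%:R * rho ^+ m * (`|u| ^+ 2 * `|u| `^ e).
    by rewrite /zeta Normc.normcM normc_cis mulr1; exact: hC.
  (* The damping is split in two halves. One, equal to [expR (- X ^+ 2 / (8 * b))], absorbs the
     powers of [|u|] at the price of [eps^(-2-e)]; the other, [gaussian (k / 2)], keeps the bound
     integrable. *)
  pose X : R := eps * `|u|; have X0 : 0 <= X by rewrite mulr_ge0// ltW.
  have hX : X ^+ 2 * X `^ e <= K1 * expR ((8 * b)^-1 * X ^+ 2).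
    by apply: le_trans (hK1 X X0); rewrite ler_wpM2l ?sqr_ge0// powR_le1D.
  have eX : X ^+ 2 * X `^ e = (eps ^+ 2 * eps `^ e) * (`|u| ^+ 2 * `|u| `^ e).
    by rewrite /X exprMn powRM ?(ltW eps0)//; ring.
  have gE : gaussian k v = (expR ((8 * b)^-1 * X ^+ 2))^-1 * gaussian (k / 2) v.
    rewrite -expRN -expRD; congr expR; rewrite /X exprMn real_normK ?num_real// /u expr_div_n q2 /k.
    by field; rewrite !gt_eqF.
  have p0 : 0 < eps ^+ 2 * eps `^ e by rewrite mulr_gt0 ?exprn_gt0// powR_gt0.
  have E0 := expR_gt0 ((8 * b)^-1 * X ^+ 2).
  have c0 : 0 <= C * m%:R * rho ^+ m by rewrite !mulr_ge0 ?exprn_ge0// ltW.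
  apply: le_trans (ler_wpM2l g0 hz) _; rewrite gE /B.
  have hY : `|u| ^+ 2 * `|u| `^ e <= K1 * expR ((8 * b)^-1 * X ^+ 2) / (eps ^+ 2 * eps `^ e).
    by rewrite ler_pdivlMr// mulrC -eX.
  move: hY; move: (`|u| ^+ 2 * `|u| `^ e) => Y hY.
  set E := expR _ in E0 hY *; set d := eps ^+ 2 * _ in p0 hY *.
  have gk := gaussian_ge0 (k / 2) v; move: (gaussian (k / 2) v) gk => gk gk0.
  rewrite (_ : E^-1 * gk * _ = C * m%:R * rho ^+ m * gk * (Y / E)); last by ring.
  rewrite (_ : C * m%:R * rho ^+ m * K1 / d * gk = C * m%:R * rho ^+ m * gk * (K1 / d)); last by ring.
  apply: ler_wpM2l; first exact: mulr_ge0.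
  by rewrite ler_pdivrMr//; apply: le_trans hY _; apply: ler_of_eq; ring.
have iP : mu.-integrable setT (EFin \o P) by exact: gaussian_cos_sum_integrable.
have iQ : mu.-integrable setT (EFin \o Q) by exact: gaussian_cos_integrable.
have iPQ : mu.-integrable setT (EFin \o (fun v => P v - Q v)).
  have -> : EFin \o (fun v => P v - Q v) = ((EFin \o P) \- (EFin \o Q))%E.
    by apply/funext => v /=; rewrite EFinB.
  exact: integrableB.
have k20 : 0 < k / 2 by rewrite divr_gt0.
pose cB : R := C * m%:R * rho ^+ m * K1 / (eps ^+ 2 * eps `^ e).
have iB : mu.-integrable setT (EFin \o B).
  have -> : EFin \o B = (fun v => cB%:E * (gaussian (k / 2) v)%:E)%E.
    by apply/funext => v /=; rewrite EFinM.
  by apply: integrableZl => //; exact: gaussian_integrable.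
have [Kb [cb [cb0 hKb]]] := bulk_dominated a b0.
have ib : mu.-integrable setT (EFin \o bulk a b m).
  apply: (@gaussian_bound_integrable _ cb Kb) => // v.
  by apply: hKb; apply: ltnW.
have ibB : mu.-integrable setT (EFin \o (fun v => bulk a b m v + B v)).
  have -> : EFin \o (fun v => bulk a b m v + B v) = ((EFin \o bulk a b m) \+ (EFin \o B))%E.
    by apply/funext => v /=; rewrite EFinD.
  exact: integrableD.
rewrite -RintegralB//; apply: le_trans (le_normr_Rintegral measurableT iPQ) _.
apply: (@le_trans _ _ (\int[mu]_v (bulk a b m v + B v))).
  apply: le_Rintegral => //.
  have -> : EFin \o (fun v => `|P v - Q v|) = (fun v => `|(EFin \o (fun v => (P v - Q v)%R)) v|%E) by [].
  exact: integrable_abse.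
rewrite RintegralD// (splitr eta); apply: lerD; first exact: hN.
rewrite /B RintegralZl//; last exact: gaussian_integrable.
rewrite integral_gaussian//.
(* The mass of [gaussian (k / 2)] brings the third factor [1 / eps], and a factor [sqrt m <= m];
   hence the condition compares [m ^+ 2 * rho ^+ m] with [eps^(3+e)]. *)
have -> : Num.sqrt (pi / (k / 2)) = Num.sqrt (8 * b * pi) * q / eps.
  have -> : pi / (k / 2) = 8 * b * pi * m%:R * (eps^-1) ^+ 2 by rewrite /k; field; rewrite !gt_eqF.
  rewrite sqrtrMsqr ?invr_ge0 ?(ltW eps0)//; last by rewrite !mulr_ge0 ?pi_ge0// ltW.
  by rewrite sqrtrM// !mulr_ge0 ?pi_ge0// ltW.
have p0 : 0 < eps `^ e by rewrite powR_gt0.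
have qm : q <= m%:R.
  by rewrite -q2 expr2 ler_peMl ?(ltW q0)// -[leLHS]sqrtr1 ler_wsqrtr// ler1n ltnW.
have r0 : 0 <= rho ^+ m by rewrite exprn_ge0// ltW.
have -> : C * m%:R * rho ^+ m * K1 / (eps ^+ 2 * eps `^ e) * (Num.sqrt (8 * b * pi) * q / eps) =
    K2 * (m%:R * q * rho ^+ m) / (eps ^+ 3 * eps `^ e).
  by rewrite /K2; field; rewrite !gt_eqF.
rewrite ler_pdivrMr ?mulr_gt0 ?exprn_gt0//.
apply: (@le_trans _ _ (K2 * (m%:R ^+ 2 * rho ^+ m))).
  by rewrite ler_wpM2l ?(ltW K20)// ler_wpM2r// expr2 ler_wpM2l// ltW.
apply: le_trans (ler_wpM2l (ltW K20) hm) _.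
by apply: ler_of_eq; field; rewrite gt_eqF.
Qed.

End local_limit.

(** * Counting in windows *)

Section error_scale.
Variables (R : realType) (alpha rho d1 delta : R).
Hypotheses (alpha0 : 0 < alpha) (rho0 : 0 < rho) (rho1 : rho < 1) (d10 : 0 < d1).
Hypothesis hdelta : 0 < delta < - (ln rho * alpha / (3 * d1)).
Let eps (n : nat) : R := expR (- delta * n%:R).

(** The condition on [delta] leaves the margin [Dl = lam * alpha / d1 - 3 * delta > 0]. One quarter
    of it pays for the exponent [e], one for the factor [m ^+ 2], and the remaining half still
    decays exponentially in [n], which beats any constant [kap]. The shift [c] costs a fixed
    factor. *)
Lemma error_scale : exists2 e : R, 0 < e <= 1 & forall c kap : R, 0 < kap ->
  exists N, forall n m, (N <= n)%N -> (n%:R * alpha - c) / d1 <= m%:R ->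
  m%:R ^+ 2 * rho ^+ m <= kap * (eps n ^+ 3 * eps n `^ e).
Proof.
have /andP[dl0 dl1] := hdelta.
pose lam : R := - ln rho; have lam0 : 0 < lam by rewrite oppr_gt0 ln_lt0// rho0.
pose Dl : R := lam * alpha / d1 - 3 * delta.
have Dl0 : 0 < Dl.
  rewrite subr_gt0 -ltr_pdivlMl// -[3^-1]mul1r; apply: lt_le_trans dl1 _.
  by apply: ler_of_eq; rewrite /lam; field; rewrite gt_eqF.
pose e : R := Order.min 1 (Dl / (4 * delta)).
have e0 : 0 < e by rewrite lt_min ltr01 divr_gt0// mulr_gt0.
have ed : e * delta <= Dl / 4.
  apply: (@le_trans _ _ (Dl / (4 * delta) * delta)).
    by rewrite ler_wpM2r ?(ltW dl0)// ge_min lexx orbT.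
  by apply: ler_of_eq; field; rewrite gt_eqF.
exists e; first by rewrite e0 ge_min lexx.
move=> c kap kap0.
(* [m ^+ 2] is dominated by a multiple of [expR (g * m)]. Keeping [g] below [lam] preserves decay in
   [m], so the lower bound on [m] can be inserted. *)
pose g : R := Order.min (lam / 2) (Dl * d1 / (4 * alpha)).
have g0 : 0 < g by rewrite lt_min !divr_gt0// !mulr_gt0.
have gl : g < lam by apply: (@le_lt_trans _ _ (lam / 2)); [rewrite ge_min lexx | lra].
have ga : g * alpha / d1 <= Dl / 4.
  apply: (@le_trans _ _ (Dl * d1 / (4 * alpha) * alpha / d1)).
    by rewrite ler_wpM2r ?invr_ge0 ?(ltW d10)// ler_wpM2r ?(ltW alpha0)// ge_min lexx orbT.
  by apply: ler_of_eq; field; rewrite !gt_eqF.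
pose K : R := 4 / g ^+ 2 * expR ((lam - g) * c / d1).
have K0 : 0 < K by rewrite mulr_gt0 ?expR_gt0// divr_gt0// exprn_gt0.
exists (Num.truncn (2 * K / (Dl * kap))).+1 => n m nN hm.
have h1 : m%:R ^+ 2 <= 4 / g ^+ 2 * expR (g * m%:R).
  have t0 : 0 <= g * m%:R by rewrite mulr_ge0// ltW.
  have h := expR_ge1Dx (g * m%:R / 2).
  have h' : (g * m%:R / 2) ^+ 2 <= expR (g * m%:R).
    have -> : expR (g * m%:R) = expR (g * m%:R / 2) ^+ 2 by rewrite [RHS]expr2 -expRD -splitr.
    by rewrite lerXn2r ?nnegrE ?divr_ge0 ?expR_ge0//; lra.
  have -> : m%:R ^+ 2 = 4 / g ^+ 2 * (g * m%:R / 2) ^+ 2 by field; rewrite gt_eqF.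
  by rewrite ler_wpM2l// divr_ge0// sqr_ge0.
have rE : rho ^+ m = expR (- lam * m%:R).
  by rewrite /lam opprK mulrC expRM_natl lnK.
have -> : eps n ^+ 3 * eps n `^ e = expR (- ((3 + e) * delta * n%:R)).
  rewrite /eps -expRM_natl -expRM -expRD; congr expR; ring.
have h2 : m%:R ^+ 2 * rho ^+ m <= K * expR (- (lam - g) * (n%:R * alpha) / d1).
  rewrite rE; apply: le_trans (ler_wpM2r (expR_ge0 _) h1) _.
  rewrite /K -[leLHS]mulrA -[leRHS]mulrA ler_wpM2l ?divr_ge0 ?sqr_ge0//.
  rewrite -!expRD ler_expR.
  have := hm; rewrite -(ler_pM2l (_ : 0 < lam - g)) ?subr_gt0// => h.
  have -> : g * m%:R + - lam * m%:R = - ((lam - g) * m%:R) by ring.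
  rewrite lerNl; apply: le_trans h; apply: ler_of_eq; ring.
apply: le_trans h2 _.
have -> : - (lam - g) * (n%:R * alpha) / d1 =
    - ((3 + e) * delta * n%:R) - (lam * alpha / d1 - g * alpha / d1 - (3 + e) * delta) * n%:R.
  by ring.
rewrite expRD mulrCA mulrC ler_wpM2r ?expR_ge0//.
have h3 : Dl / 2 <= lam * alpha / d1 - g * alpha / d1 - (3 + e) * delta.
  by rewrite /Dl in ed ga *; lra.
have n0 : 0 <= n%:R :> R by exact: ler0n.
apply: (@le_trans _ _ (K * expR (- (Dl / 2 * n%:R)))).
  by rewrite ler_wpM2l ?(ltW K0)// ler_expR lerN2 ler_wpM2r.
rewrite expRN ler_pdivrMr ?expR_gt0//.
have h4 : 1 + Dl / 2 * n%:R <= expR (Dl / 2 * n%:R) by exact: expR_ge1Dx.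
have h5 : 2 * K / (Dl * kap) <= n%:R.
  by rewrite (le_trans (ltW (truncnS_gt _)))// ler_nat.
rewrite ler_pdivrMr ?mulr_gt0// in h5.
apply: (@le_trans _ _ (kap * (1 + Dl / 2 * n%:R))); last by rewrite ler_wpM2l// ltW.
by move: h5; nra.
Qed.

End error_scale.

(** Clamp [x] to the interval from [t - L] to [t + L + 1]. Every [m] within distance [L] of [t]
    makes the clamp grow by exactly 1 from [m] to [m.+1], the other increments are non-negative, and
    the total growth is at most [2 * L + 1]. *)
Lemma sum_near_le (R : realType) (t L : R) (k : nat) : 0 <= L ->
  \sum_(1 <= m < k.+1) (if `|m%:R - t| <= L then 1 else 0) <= 2 * L + 1.
Proof.
move=> L0.
pose cl (x : R) := Order.max (t - L) (Order.min (t + L + 1) x).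
have mono x : cl x <= cl (x + 1).
  by rewrite /cl le_max2 // le_min2// lerDl.
apply: (@le_trans _ _ (\sum_(1 <= m < k.+1) (cl (m.+1%:R) - cl m%:R))).
  apply: ler_sum => m _; case: ifP => [|_]; last first.
    by rewrite subr_ge0 -natr1 mono.
  rewrite ler_norml => /andP[h1 h2].
  have -> : cl m%:R = m%:R.
    rewrite /cl min_r ?max_r//; lra.
  have -> : cl m.+1%:R = m.+1%:R.
    rewrite /cl -natr1 min_r ?max_r//; lra.
  by rewrite -natr1; lra.
rewrite telescope_sumr//.
have h1 : cl k.+1%:R <= t + L + 1.
  by rewrite /cl ge_max ge_min lexx /= andbT; lra.
have h2 : t - L <= cl 1%:R by rewrite /cl le_max lexx.
lra.
Qed.

(** The closing arithmetic of [window_upper_bound], with [X] for the square root of [n]. The small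
    terms, at most [K1 * X ^+ 2] of them, use a quarter of [kp] by the choice of [eta]; the central
    periods, of order [B * X] in number, contribute a bounded amount, absorbed by [X] once it is
    large. *)
Lemma upper_total (R : realType) (L C q K1 kp eta B X E : R) : 0 < L -> 0 < C -> 0 < q -> 0 < K1 -> 0 < kp -> 1 <= B ->
  1 <= X -> 0 <= E -> eta = kp * q / (4 * C * (L + 1) * K1) ->
  (2 * C * L * (2 * B + 1) / (q * kp)) ^+ 2 <= X ^+ 2 ->
  C * E / (q * X) * ((L + 1) * (eta * (K1 * X ^+ 2)) + L * (2 * (B * X) + 1)) <= kp * (E * X).
Proof.
move=> L0 C0 q0 K10 kp0 B1 X1 E0 etaE hX; have L10 : 0 < L + 1 by rewrite addr_gt0.
have X0 : 0 < X by exact: lt_le_trans X1.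
have B0 : 0 < 2 * B + 1 by rewrite ltr_wpDl// mulr_ge0// (le_trans _ B1).
have -> : C * E / (q * X) * ((L + 1) * (eta * (K1 * X ^+ 2)) + L * (2 * (B * X) + 1)) =
  E * (kp / 4 * X + C * L / q * (2 * B + X^-1)).
  by rewrite etaE; field; rewrite !gt_eqF.
rewrite [leRHS]mulrCA; apply: ler_wpM2l => //.
have h3 : 2 * C * L * (2 * B + 1) / (q * kp) <= X.
  move: hX; rewrite ler_pXn2r// nnegrE ?(ltW X0)// divr_ge0//.
    by rewrite mulr_ge0 ?(ltW B0)// mulr_ge0 ?(ltW L0)// mulr_ge0// ltW.
  by rewrite mulr_ge0 ?(ltW q0)// ltW.
rewrite ler_pdivrMr ?mulr_gt0// in h3.
have h4 : C * L / q * (2 * B + X^-1) <= kp / 2 * X.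
  apply: (@le_trans _ _ (C * L / q * (2 * B + 1))).
    apply: ler_wpM2l; last by rewrite lerD2l invf_le1.
    by apply: divr_ge0; [apply: mulr_ge0|]; exact: ltW.
  rewrite mulrAC ler_pdivrMr//; lra.
have := mulr_ge0 (ltW kp0) (ltW X0); lra.
Qed.

Section window_counts.
Variables (R : realType) (J : eqType) (per : nat -> seq J) (phi : nat -> J -> R).
Variables (P alpha sigma rho d0 d1 e : R) (eps : nat -> R).
Hypotheses (sigma0 : 0 < sigma) (rho0 : 0 < rho) (d00 : 0 < d0).
Hypotheses (alpha_ge : d0 <= alpha) (alpha_le : alpha <= d1).
Hypothesis phi_bounds : forall m x, d0 * m%:R <= phi m x <= d1 * m%:R.
Hypothesis eps01 : forall n, 0 < eps n <= 1.
Let w m x := expR (- P * phi m x).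
Hypothesis hlimit : forall b eta : R, 0 < b -> 0 < eta -> exists (kap : R) (M : nat), 0 < kap /\
  forall m (eps T : R), (M <= m)%N -> 0 < eps <= 1 ->
  m%:R ^+ 2 * rho ^+ m <= kap * (eps ^+ 3 * eps `^ e) ->
  `|\sum_(x <- per m) w m x * gaussian (b / eps ^+ 2) (phi m x - T) * (Num.sqrt (4 * b * pi * m%:R) / eps)
    - Num.sqrt (2 * pi) / sigma * gaussian (2 * sigma ^+ 2)^-1 ((m%:R * alpha - T) / Num.sqrt m%:R)| <= eta.
Hypothesis hscale : forall c kap : R, 0 < kap ->
  exists N, forall n m, (N <= n)%N -> (n%:R * alpha - c) / d1 <= m%:R ->
  m%:R ^+ 2 * rho ^+ m <= kap * (eps n ^+ 3 * eps n `^ e).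

Let alpha0 : 0 < alpha. Proof. exact: lt_le_trans alpha_ge. Qed.
Let d10 : 0 < d1. Proof. exact: lt_le_trans alpha_le. Qed.
Let L : R := Num.sqrt (2 * pi) / sigma.
Let g (s : R) : R := gaussian (2 * sigma ^+ 2)^-1 s.
Let L0 : 0 < L.
Proof. by rewrite divr_gt0// sqrtr_gt0 mulr_gt0// pi_gt0. Qed.

Let S b n m T := \sum_(x <- per m) w m x * gaussian (b / eps n ^+ 2) (phi m x - T).
Let dev b n m : R := eps n / Num.sqrt (4 * b * pi * m%:R).

Let ex_nat (x : R) : exists N : nat, forall n, (N <= n)%N -> x <= n%:R.
Proof.
exists (Num.truncn x).+1 => n nN; rewrite (le_trans (ltW (truncnS_gt _)))//.
by rewrite ler_nat.
Qed.

Let window_limit (b eta c : R) : 0 < b -> 0 < eta -> exists N, forall n m T, (N <= n)%N ->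
  (n%:R * alpha - c) / d1 <= m%:R ->
  dev b n m * (L * g ((m%:R * alpha - T) / Num.sqrt m%:R) - eta) <= S b n m T <=
  dev b n m * (L * g ((m%:R * alpha - T) / Num.sqrt m%:R) + eta).
Proof.
move=> b0 eta0; have [kap [M [kap0 hM]]] := hlimit b0 eta0.
have [N1 hN1] := hscale c kap0.
have [N2 hN2] := ex_nat ((M.+1%:R * d1 + c) / alpha).
exists (maxn N1 N2) => n m T; rewrite geq_max => /andP[n1 n2] hm.
have Mm : (M.+1 <= m)%N.
  rewrite -(ler_nat R); apply: le_trans hm; rewrite ler_pdivlMr//.
  by have := hN2 n n2; rewrite ler_pdivrMr//; lra.
have m0 : (0 < m)%N by apply: leq_trans Mm.
have := hM m (eps n) T (ltnW Mm) (eps01 n) (hN1 n m n1 hm).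
have /andP[e0 _] := eps01 n.
have q0 : 0 < Num.sqrt (4 * b * pi * m%:R).
  by rewrite sqrtr_gt0 !mulr_gt0 ?pi_gt0// ltr0n.
have D0 : 0 < dev b n m by rewrite divr_gt0.
have SE : \sum_(x <- per m) w m x * gaussian (b / eps n ^+ 2) (phi m x - T) *
    (Num.sqrt (4 * b * pi * m%:R) / eps n) = S b n m T / dev b n m.
  by rewrite -mulr_suml /dev invf_div.
rewrite SE -/L -/(g _) ler_distl => /andP[h1 h2].
by apply/andP; split; rewrite mulrC; [rewrite -ler_pdivlMr | rewrite -ler_pdivrMr].
Qed.

Definition window n m (T r : R) : seq J := [seq x <- per m | `|phi m x - T| <= r * eps n].

Let w_bounds n m T r x : 0 <= r -> `|phi m x - T| <= r * eps n ->
  expR (- (P * T)) * expR (- (`|P| * r)) <= w m x <= expR (- (P * T)) * expR (`|P| * r).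
Proof.
move=> r0 h; have /andP[e0 e1] := eps01 n.
have h1 : `|phi m x - T| <= r by apply: le_trans h _; rewrite ler_piMr.
have h2 : `|P * (phi m x - T)| <= `|P| * r by rewrite normrM ler_wpM2l.
rewrite -!expRD !ler_expR; move: h2; rewrite ler_norml => /andP[h2 h3].
by apply/andP; split; lra.
Qed.

(** The indicator of the window is at most [expR (r ^+ 2)] times the Gaussian of the same scale, and
    inside the window [w m x] equals [expR (- (P * T))] up to the factor [expR (|P| * r)]. *)
Let count_upper n m T r : 0 <= r ->
  (size (window n m T r))%:R <= expR (P * T) * expR (`|P| * r + r ^+ 2) * S 1 n m T.
Proof.
move=> r0; have /andP[e0 e1] := eps01 n.
have c0 : 0 <= expR (P * T) * expR (`|P| * r + r ^+ 2) by rewrite mulr_ge0 ?expR_ge0.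
rewrite -sum1_size natr_sum /window big_filter mulr_sumr [leRHS](bigID (fun x => `|phi m x - T| <= r * eps n)) /=.
rewrite -[leLHS]addr0; apply: lerD; last first.
  apply: sumr_ge0 => x _; apply: (mulr_ge0 c0).
  by apply: mulr_ge0; [exact: expR_ge0 | exact: gaussian_ge0].
apply: ler_sum => x hx; have /andP[hw _] := w_bounds r0 hx.
have hg : expR (- r ^+ 2) <= gaussian (1 / eps n ^+ 2) (phi m x - T).
  rewrite /gaussian ler_expR mulNr lerN2 mul1r mulrC ler_pdivrMr ?exprn_gt0//.
  rewrite -exprMn -real_normK ?num_real//.
  by rewrite lerXn2r ?nnegrE// mulr_ge0// ltW.
have {}hg := ler_pM (mulr_ge0 (expR_ge0 _) (expR_ge0 _)) (expR_ge0 _) hw hg.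
apply: le_trans (ler_wpM2l c0 hg).
by rewrite -!expRD -[leLHS]expR0 ler_expR; lra.
Qed.

(** The indicator is bounded below by the difference of two Gaussians. Outside the window, the one
    of parameter [b] is the square of the one of parameter [b / 2], hence at most
    [gaussian (b / 2) r] times it, and the difference is non-positive. *)
Let count_lower b n m T r : 0 < b -> 0 <= r ->
  expR (P * T) * expR (- (`|P| * r)) * (S b n m T - gaussian (b / 2) r * S (b / 2) n m T) <=
  (size (window n m T r))%:R.
Proof.
move=> b0 r0; have /andP[e0 e1] := eps01 n.
rewrite -sum1_size natr_sum /window big_filter.
have c0 : 0 <= expR (P * T) * expR (- (`|P| * r)) by rewrite mulr_ge0 ?expR_ge0.
rewrite /S mulr_sumr -sumrB mulr_sumr (bigID (fun x => `|phi m x - T| <= r * eps n)) /=.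
rewrite -[leRHS]addr0; apply: lerD.
  apply: ler_sum => x hx; have /andP[_ hw] := w_bounds r0 hx.
  have g1 : gaussian (b / eps n ^+ 2) (phi m x - T) <= 1.
    by apply: gaussian_le1; rewrite divr_ge0 ?sqr_ge0// ltW.
  have h : w m x * gaussian (b / eps n ^+ 2) (phi m x - T) -
      gaussian (b / 2) r * (w m x * gaussian (b / 2 / eps n ^+ 2) (phi m x - T)) <= w m x.
    rewrite lerBlDr -[leLHS]addr0; apply: lerD; first by rewrite ler_piMr ?expR_ge0.
    apply: mulr_ge0; first exact: gaussian_ge0.
    by apply: mulr_ge0; [exact: expR_ge0 | exact: gaussian_ge0].
  apply: le_trans (ler_wpM2l c0 (le_trans h hw)) _.
  by rewrite -!expRD -[leRHS]expR0 ler_expR; lra.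
apply: sumr_le0 => x; rewrite -ltNge => hx.
rewrite mulr_ge0_le0//.
rewrite subr_le0 mulrCA ler_wpM2l ?expR_ge0// /gaussian -expRD ler_expR.
set y := phi m x - T in hx *.
have hy : r ^+ 2 <= y ^+ 2 / eps n ^+ 2.
  rewrite ler_pdivlMr ?exprn_gt0// -exprMn -[leRHS]real_normK ?num_real//.
  have re0 : 0 <= r * eps n by apply: mulr_ge0 => //; exact: ltW.
  by rewrite lerXn2r ?nnegrE// ltW.
have -> : - (b / eps n ^+ 2) * y ^+ 2 = - (b * (y ^+ 2 / eps n ^+ 2)) by ring.
have -> : - (b / 2 / eps n ^+ 2) * y ^+ 2 = - (b / 2 * (y ^+ 2 / eps n ^+ 2)) by ring.
by have := ler_wpM2l (ltW b0) hy; lra.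
Qed.

(** The constant [c1] precedes [K] and [D]: the number of periods is later chosen in terms of [c1].
    This works because any fixed number of periods stays within the centre of the Gaussian once [n]
    is large. *)
Lemma window_lower_bound (r : R) : 0 < r -> exists2 c1 : R, 0 < c1 & forall (K : nat) (D : R),
  exists N, forall n j T, (N <= n)%N -> (j <= K)%N -> `|T - n%:R * alpha| <= D ->
  c1 * (expR (P * T) * eps n / Num.sqrt n%:R) <= (size (window n (n + j) T r))%:R.
Proof.
(* With [b = 2 / r ^+ 2] the subtracted Gaussian has coefficient [expR (- 1)]. Its window is wider
   by [sqrt 2], so the difference keeps the proportion [1 - sqrt 2 / expR 1], which is positive. *)
move=> r0; have [b [b0 bE]] : exists b : R, 0 < b /\ b = 2 / r ^+ 2.
  by exists (2 / r ^+ 2); rewrite divr_gt0// exprn_gt0.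
pose be : R := Num.sqrt 2 * expR (- 1).
have be0 : 0 < be by rewrite mulr_gt0 ?expR_gt0// sqrtr_gt0.
have be1 : be < 1.
  have h1 : 2 <= expR 1 :> R by have := expR_ge1Dx (1 : R); lra.
  have h2 : Num.sqrt 2 < 2 :> R.
    have e4 : Num.sqrt (2 ^+ 2) = 2 :> R by rewrite sqrtr_sqr ger0_norm.
    rewrite -[ltRHS]e4 ltr_sqrt ?exprn_gt0//; lra.
  rewrite /be expRN ltr_pdivrMr ?expR_gt0//; lra.
(* The main term is at least [2 * c0] because [g s >= 1 / 2]; the limit errors [eta * (1 + be)] are
   set equal to [c0]. *)
pose c0 : R := L * (1 - be) / 4; have c00 : 0 < c0 by rewrite divr_gt0// mulr_gt0// subr_gt0.
pose q8 : R := Num.sqrt (8 * b * pi : R); have q80 : 0 < q8 by rewrite sqrtr_gt0 !mulr_gt0// pi_gt0.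
exists (expR (- (`|P| * r)) * c0 / q8); first by rewrite divr_gt0// mulr_gt0// expR_gt0.
move=> K D; pose eta : R := c0 / (1 + be); have eta0 : 0 < eta by rewrite divr_gt0// addr_gt0.
have b20 : 0 < b / 2 by rewrite divr_gt0.
have [N1 hN1] := window_limit 0 b0 eta0.
have [N2 hN2] := window_limit 0 b20 eta0.
(* From here on [s ^+ 2 <= sigma ^+ 2], that is, all [K] periods lie within one standard
   deviation. *)
have [N3 hN3] := ex_nat ((K%:R * alpha + D) ^+ 2 / sigma ^+ 2).
exists (N1 + N2 + N3 + K + 1)%N => n j T nN jK hT.
have hn (a1 a2 a3 k l : nat) : (a1 + a2 + a3 + k + 1 <= l)%N ->
    [/\ a1 <= l, a2 <= l, a3 <= l, k <= l & 0 < l]%N by clear => h; split; lia.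
have [n1 n2 n3 n4 n5] := hn _ _ _ _ _ nN.
have n0 : 0 < n%:R :> R by rewrite ltr0n.
set m := (n + j)%N.
have nm : n%:R <= m%:R :> R by rewrite ler_nat leq_addr.
have m2n : m%:R <= 2 * n%:R :> R.
  by rewrite -natrM ler_nat /m mul2n -addnn leq_add2l (leq_trans jK).
have m0 : 0 < m%:R :> R by apply: lt_le_trans nm.
have hm : (n%:R * alpha - 0) / d1 <= m%:R.
  rewrite subr0 ler_pdivrMr//; apply: le_trans (_ : n%:R * d1 <= _).
    by rewrite ler_wpM2l// ltW.
  by rewrite ler_wpM2r// ltW.
set s := (m%:R * alpha - T) / Num.sqrt m%:R.
have hs : s ^+ 2 <= sigma ^+ 2.
  rewrite /s expr_div_n sqr_sqrtr ?(ltW m0)// ler_pdivrMr//.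
  have h1 : `|m%:R * alpha - T| <= K%:R * alpha + D.
    have -> : m%:R * alpha - T = j%:R * alpha - (T - n%:R * alpha) by rewrite /m natrD; ring.
    apply: le_trans (ler_normB _ _) _; apply: lerD => //.
    rewrite ger0_norm ?mulr_ge0 ?(ltW alpha0)//; apply: ler_wpM2r; first exact: ltW.
    by rewrite ler_nat.
  have h2 : (m%:R * alpha - T) ^+ 2 <= (K%:R * alpha + D) ^+ 2.
    rewrite -[leLHS]real_normK ?num_real// lerXn2r ?nnegrE//.
    exact: le_trans h1.
  have := hN3 n n3; rewrite ler_pdivrMr ?exprn_gt0// => h3.
  apply: le_trans h2 _; apply: le_trans h3 _; rewrite mulrC.
  by rewrite ler_wpM2l ?sqr_ge0.
have hg : 1 / 2 <= g s.
  have h := expR_ge1Dx (- (2 * sigma ^+ 2)^-1 * s ^+ 2); rewrite -/(gaussian _ _) -/(g s) in h.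
  apply: le_trans h; rewrite mulNr.
  have : (2 * sigma ^+ 2)^-1 * s ^+ 2 <= 1 / 2.
    rewrite mulrC ler_pdivrMr ?mulr_gt0 ?exprn_gt0//; lra.
  lra.
have /andP[h1 _] := hN1 n m T n1 hm; have /andP[_ h2] := hN2 n m T n2 hm.
rewrite -/s in h1 h2.
have devE : dev (b / 2) n m = Num.sqrt 2 * dev b n m.
  have eq2 : Num.sqrt (4 * b * pi * m%:R) = Num.sqrt 2 * Num.sqrt (4 * (b / 2) * pi * m%:R).
    by rewrite -sqrtrM//; congr Num.sqrt; field.
  have p1 : 0 < Num.sqrt 2 :> R by rewrite sqrtr_gt0.
  have p2 : 0 < Num.sqrt (4 * (b / 2) * pi * m%:R) by rewrite sqrtr_gt0 !mulr_gt0// pi_gt0.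
  rewrite /dev eq2; move: (Num.sqrt _) (Num.sqrt _) p1 p2 => x1 x2 p1 p2.
  by field; rewrite !gt_eqF.
have gr : gaussian (b / 2) r = expR (- 1).
  by rewrite /gaussian bE; congr expR; field; rewrite gt_eqF.
have D0 : 0 < dev b n m.
  have /andP[e0 _] := eps01 n.
  by rewrite divr_gt0// sqrtr_gt0 !mulr_gt0// pi_gt0.
have h3 : dev b n m * c0 <= S b n m T - gaussian (b / 2) r * S (b / 2) n m T.
  have h4 : expR (- 1) * S (b / 2) n m T <= dev b n m * (be * (L * g s + eta)).
    apply: le_trans (ler_wpM2l (expR_ge0 _) h2) _; rewrite devE /be.
    by apply: ler_of_eq; ring.
  rewrite gr; apply: le_trans (lerB h1 h4); rewrite -mulrBr ler_wpM2l ?(ltW D0)//.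
  have e1 : eta * (1 + be) = c0 by rewrite /eta; field; rewrite gt_eqF// addr_gt0.
  have h5 : L * (1 - be) * (1 / 2) <= L * (1 - be) * g s.
    by rewrite ler_wpM2l// mulr_ge0 ?subr_ge0 ?(ltW L0)// ltW.
  have -> : L * g s - eta - be * (L * g s + eta) = L * (1 - be) * g s - eta * (1 + be) by ring.
  by rewrite e1; move: h5; rewrite /c0; lra.
apply: le_trans (count_lower n m T b0 (ltW r0)).
have h4 : eps n / (q8 * Num.sqrt n%:R) <= dev b n m.
  have /andP[e0 _] := eps01 n.
  rewrite /dev ler_wpM2l ?(ltW e0)// lef_pV2 ?posrE ?mulr_gt0 ?sqrtr_gt0 ?mulr_gt0 ?pi_gt0//.
  rewrite /q8 -sqrtrM; last by rewrite !mulr_ge0 ?pi_ge0// ltW.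
  rewrite ler_wsqrtr//.
  have -> : 8 * b * pi * n%:R = 4 * b * pi * (2 * n%:R) by ring.
  by rewrite ler_wpM2l// !mulr_ge0 ?pi_ge0// ltW.
have -> : expR (- (`|P| * r)) * c0 / q8 * (expR (P * T) * eps n / Num.sqrt n%:R) =
    expR (P * T) * expR (- (`|P| * r)) * (eps n / (q8 * Num.sqrt n%:R) * c0).
  by field; rewrite !gt_eqF// sqrtr_gt0.
rewrite ler_wpM2l ?mulr_ge0 ?expR_ge0//.
by apply: le_trans h3; rewrite ler_wpM2r// ltW.
Qed.

Let gaussian_le_inv (s : R) (v : R) : 0 < v -> v <= s ^+ 2 -> g s <= 2 * sigma ^+ 2 / v.
Proof.
move=> v0 vs; have t0 : 0 < sigma ^+ 2 by rewrite exprn_gt0.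
rewrite /g /gaussian mulNr expRN -[leRHS]invrK lef_pV2 ?posrE ?expR_gt0//; last first.
  by rewrite invr_gt0 divr_gt0// mulr_gt0.
have h := expR_ge1Dx ((2 * sigma ^+ 2)^-1 * s ^+ 2).
have h' : (2 * sigma ^+ 2)^-1 * s ^+ 2 <= expR ((2 * sigma ^+ 2)^-1 * s ^+ 2) by lra.
apply: le_trans h'; rewrite invf_div mulrC ler_wpM2l// invr_ge0 mulr_ge0// ltW//.
Qed.

Let window_nil (r T : R) (n m : nat) : 0 <= r -> n%:R * alpha <= T ->
  m%:R < (n%:R * alpha - r) / d1 -> window n m T r = [::].
Proof.
move=> r0 T0 hm; apply/eqP; rewrite -[_ == _]negbK -has_filter; apply/hasPn => x _.
rewrite -ltNge; have /andP[_ h1] := phi_bounds m x.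
rewrite ltr_pdivlMr// in hm.
rewrite distrC; apply: lt_le_trans (ler_norm _).
have : r * eps n <= r by have /andP[_ ?] := eps01 n; rewrite ler_piMr.
by move: h1; rewrite mulrC; lra.
Qed.

Let dev_le (r : R) (n m : nat) : (0 < n)%N -> (0 < m)%N -> 2 * r / alpha <= n%:R ->
  (n%:R * alpha - r) / d1 <= m%:R ->
  dev 1 n m <= eps n / (Num.sqrt (2 * pi * alpha / d1) * Num.sqrt n%:R).
Proof.
move=> n0 m0 hn hm; have /andP[e0 _] := eps01 n.
have p0 : 0 < 2 * pi * alpha / d1 by rewrite divr_gt0// mulr_gt0// mulr_gt0// pi_gt0.
rewrite /dev ler_wpM2l ?(ltW e0)// lef_pV2 ?posrE; last 2 first.
- by rewrite sqrtr_gt0 mulr_gt0 ?ltr0n// mulr_gt0 ?pi_gt0// mulr_gt0.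
- by rewrite mulr_gt0// sqrtr_gt0// ltr0n.
rewrite -sqrtrM ?(ltW p0)// ler_wsqrtr// mulr1.
have -> : 2 * pi * alpha / d1 * n%:R = 4 * pi * (n%:R * alpha / 2 / d1) by field; rewrite gt_eqF.
rewrite ler_wpM2l ?mulr_ge0 ?pi_ge0//; apply: le_trans hm.
rewrite ler_wpM2r ?invr_ge0 ?(ltW d10)//.
by move: hn; rewrite ler_pdivrMr//; lra.
Qed.

Let gaussian_off_centre (K1 B X T : R) (m : nat) : 0 < K1 -> 0 < B -> 0 < X -> (0 < m)%N ->
  m%:R <= K1 * X ^+ 2 -> B * X < `|m%:R - T / alpha| ->
  g ((m%:R * alpha - T) / Num.sqrt m%:R) <= 2 * sigma ^+ 2 * K1 / (alpha ^+ 2 * B ^+ 2).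
Proof.
move=> K10 B0 X0 m0 mK hV; have m0' : 0 < m%:R :> R by rewrite ltr0n.
have v0 : 0 < alpha ^+ 2 * B ^+ 2 / K1 by rewrite divr_gt0// mulr_gt0// exprn_gt0.
have -> : 2 * sigma ^+ 2 * K1 / (alpha ^+ 2 * B ^+ 2) = 2 * sigma ^+ 2 / (alpha ^+ 2 * B ^+ 2 / K1).
  by field; rewrite !gt_eqF.
apply: gaussian_le_inv v0 _.
rewrite expr_div_n sqr_sqrtr ?(ltW m0')// ler_pdivlMr//.
have -> : m%:R * alpha - T = alpha * (m%:R - T / alpha) by field; rewrite gt_eqF.
rewrite exprMn -[alpha ^+ 2 * B ^+ 2 / K1]mulrA -[leLHS]mulrA ler_wpM2l ?sqr_ge0//.
have h3 : (B * X) ^+ 2 <= (m%:R - T / alpha) ^+ 2.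
  rewrite -[leRHS]real_normK ?num_real// lerXn2r ?nnegrE ?(ltW hV)//.
  by rewrite mulr_ge0 ?(ltW X0) ?(ltW B0).
apply: le_trans h3; rewrite exprMn -mulrA ler_wpM2l ?sqr_ge0//.
by rewrite mulrC ler_pdivrMr// mulrC.
Qed.

(** For any [kp] the periods far from [T / alpha] on the scale [sqrt n] have a Gaussian factor below
    [eta]; there are [O(n)] of them, each with weight of order [1 / sqrt n]. The central ones number
    [O(sqrt n)] and contribute [O(1)] in all. Thus the sum is [o(sqrt n)] in these units. *)
Lemma window_upper_bound (r kp : R) : 0 <= r -> 0 < kp -> exists N, forall n k T, (N <= n)%N ->
  n%:R * alpha <= T <= n%:R * alpha + alpha -> d0 * k%:R <= T + r ->
  \sum_(1 <= m < k.+1) (size (window n m T r))%:R <= kp * (expR (P * T) * eps n * Num.sqrt n%:R).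
Proof.
move=> r0 kp0.
have [C1 [C10 C1E]] : exists C1 : R, 0 < C1 /\ C1 = expR (`|P| * r + r ^+ 2).
  by exists (expR (`|P| * r + r ^+ 2)); rewrite expR_gt0.
have [q [q0 qE]] : exists q : R, 0 < q /\ q = Num.sqrt (2 * pi * alpha / d1).
  exists (Num.sqrt (2 * pi * alpha / d1)); split => //.
  by rewrite sqrtr_gt0 divr_gt0// mulr_gt0// mulr_gt0// pi_gt0.
have [K1 [K10 K1E]] : exists K1 : R, 0 < K1 /\ K1 = (2 * alpha + r) / d0.
  exists ((2 * alpha + r) / d0); split => //.
  by rewrite divr_gt0// ltr_wpDr// mulr_gt0.
have L10 : 0 < L + 1 by rewrite addr_gt0.
have [eta [eta0 etaE]] : exists eta : R, 0 < eta /\ eta = kp * q / (4 * C1 * (L + 1) * K1).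
  exists (kp * q / (4 * C1 * (L + 1) * K1)); split => //.
  by apply: divr_gt0; [exact: mulr_gt0 | apply: mulr_gt0 => //; apply: mulr_gt0 => //; exact: mulr_gt0].
have s2 : 0 < sigma ^+ 2 by rewrite exprn_gt0.
have a2 : 0 < alpha ^+ 2 by rewrite exprn_gt0.
(* The crude bound [2 * sigma ^+ 2 / s ^+ 2] for the Gaussian suffices beyond distance
   [A * sqrt n]. *)
have [A [A1 hA]] : exists A : R, 1 <= A /\ 2 * sigma ^+ 2 * K1 / (alpha ^+ 2 * A ^+ 2) <= eta.
  pose B : R := 2 * sigma ^+ 2 * K1 / (alpha ^+ 2 * eta).
  have B0 : 0 < B by apply: divr_gt0; [apply: mulr_gt0 => //; exact: mulr_gt0 | exact: mulr_gt0].
  exists (1 + B); split; first by rewrite lerDl ltW.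
  have hB : B <= (1 + B) ^+ 2 by rewrite expr2; nra.
  rewrite ler_pdivrMr; last by rewrite mulr_gt0// exprn_gt0// addr_gt0.
  have -> : 2 * sigma ^+ 2 * K1 = B * (alpha ^+ 2 * eta) by rewrite /B; field; rewrite !gt_eqF.
  rewrite (_ : eta * _ = (1 + B) ^+ 2 * (alpha ^+ 2 * eta)); last by ring.
  by rewrite ler_wpM2r// mulr_ge0// ltW.
have [N1 hN1] := window_limit r (ltr01 : 0 < 1 :> R) eta0.
have [N2 hN2] := ex_nat (2 * r / alpha).
have [N3 hN3] := ex_nat ((2 * C1 * L * (2 * A + 1) / (q * kp)) ^+ 2).
exists (N1 + N2 + N3 + 1)%N => n k T nN /andP[T0 T1] kT.
have hn (i1 i2 i3 l : nat) : (i1 + i2 + i3 + 1 <= l)%N ->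
    [/\ i1 <= l, i2 <= l, i3 <= l & 0 < l]%N by clear => h; split; lia.
have [n1 n2 n3 n4] := hn _ _ _ _ nN.
have n0 : 0 < n%:R :> R by rewrite ltr0n.
have n11 : 1 <= n%:R :> R by rewrite ler1n.
have [X [X0 X2 XE]] : exists X : R, [/\ 0 < X, X ^+ 2 = n%:R & X = Num.sqrt n%:R].
  by exists (Num.sqrt n%:R); rewrite sqrtr_gt0 sqr_sqrtr// ltW.
have X1 : 1 <= X by rewrite XE -[leLHS]sqrtr1 ler_wsqrtr.
have /andP[e0 e1] := eps01 n.
have kK : k%:R <= K1 * n%:R.
  rewrite K1E mulrAC ler_pdivlMr// mulrC; apply: le_trans kT _.
  have := ler_wpM2r r0 n11; have := ler_wpM2r (ltW alpha0) n11; lra.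
(* Marks the central periods, for which the Gaussian is simply bounded by 1. *)
pose V m : R := if `|m%:R - T / alpha| <= A * X then 1 else 0.
have E0 : 0 <= C1 * (expR (P * T) * eps n) / (q * X).
  apply: divr_ge0; last by rewrite mulr_ge0// ltW.
  by rewrite mulr_ge0 ?(ltW C10)// mulr_ge0 ?expR_ge0// ltW.
have bound m : (1 <= m < k.+1)%N -> (size (window n m T r))%:R <=
    C1 * (expR (P * T) * eps n) / (q * X) * (L * (eta + V m) + eta).
  move=> /andP[m1 mk]; have m0 : 0 < m%:R :> R by rewrite ltr0n.
  have V0 : 0 <= V m by rewrite /V; case: ifP.
  have R0 : 0 <= L * (eta + V m) + eta.
    by apply: addr_ge0; [apply: mulr_ge0; [exact: ltW | apply: addr_ge0 => //; exact: ltW] | exact: ltW].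
  (* Too short a period cannot reach the window since [phi <= d1 * m]; the local limit theorem
     covers the others. *)
  have [hm|hm] := ltP m%:R ((n%:R * alpha - r) / d1).
    by rewrite window_nil// mulr_ge0.
  apply: le_trans (count_upper _ _ _ r0) _; rewrite -C1E.
  have /andP[_ h1] := hN1 n m T n1 hm.
  have hd : dev 1 n m <= eps n / (q * X).
    by rewrite qE XE; apply: dev_le hm => //; exact: hN2.
  have hg : g ((m%:R * alpha - T) / Num.sqrt m%:R) <= eta + V m.
    rewrite /V; case: ifP => hV.
      have g1 : g ((m%:R * alpha - T) / Num.sqrt m%:R) <= 1.
        by apply: gaussian_le1; rewrite invr_ge0 mulr_ge0// ltW.
      by rewrite (le_trans g1)// lerDr ltW.
    rewrite addr0; apply: le_trans hA.
    apply: (@gaussian_off_centre K1 A X) => //; first exact: lt_le_trans A1.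
      by rewrite X2 (le_trans _ kK)// ler_nat -ltnS.
    by rewrite ltNge hV.
  have hS : S 1 n m T <= eps n / (q * X) * (L * (eta + V m) + eta).
    apply: le_trans h1 _; apply: ler_pM => //.
    - by rewrite divr_ge0 ?sqrtr_ge0// ltW.
    - by rewrite addr_ge0 ?(ltW eta0)// mulr_ge0 ?gaussian_ge0// ltW.
    - by rewrite lerD2r ler_wpM2l// ltW.
  apply: le_trans (ler_wpM2l _ hS) _.
    by rewrite mulr_ge0 ?expR_ge0// ltW.
  by apply: ler_of_eq; ring.
rewrite big_nat; apply: le_trans (ler_sum _ bound) _.
rewrite -big_nat -mulr_sumr big_split /= -mulr_sumr big_split /= !sumr_const_nat subn1 /=.
have hV : \sum_(1 <= m < k.+1) V m <= 2 * (A * X) + 1.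
  by apply: sum_near_le; rewrite mulr_ge0 ?(ltW X0)// (le_trans _ A1).
have ek : eta *+ k <= eta * (K1 * X ^+ 2) by rewrite -mulr_natr X2 ler_wpM2l// ltW.
apply: (@le_trans _ _ (C1 * (expR (P * T) * eps n) / (q * X) *
    ((L + 1) * (eta * (K1 * X ^+ 2)) + L * (2 * (A * X) + 1)))).
  apply: ler_wpM2l => //.
  have := ler_wpM2l (ltW L0) hV; have := ler_wpM2l (ltW L0) ek; move: ek; lra.
rewrite -XE; apply: upper_total => //; last by rewrite X2 hN3.
by rewrite mulr_ge0 ?expR_ge0// ltW.
Qed.

End window_counts.

(** * Cardinalities and the two bounds for the counting function *)

Section counting_bounds.
Variables (R : realType) (T : choiceType).

Lemma counting_le_size (E : set T) (s : seq T) : (forall x, E x -> x \in s) ->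
  (@counting T R E <= (size s)%:R%:E)%E.
Proof.
move=> Es; have fE : finite_set E.
  by apply: (sub_finite_set (B := [set` s])); [move=> x /Es | exact: finite_seq].
rewrite /counting asboolT// lee_fin ler_nat.
apply: uniq_leq_size; first exact: finmap.fset_uniq.
by move=> x; rewrite in_fset_set// => /set_mem/Es.
Qed.

Lemma counting_ge_size (E : set T) (s : seq T) : uniq s -> (forall x, x \in s -> E x) ->
  ((size s)%:R%:E <= @counting T R E)%E.
Proof.
move=> us sE; rewrite /counting; case: asboolP => [fE|_]; last exact: leey.
rewrite lee_fin ler_nat; apply: uniq_leq_size => // x xs.
by rewrite in_fset_set//; apply/mem_set; exact: sE.
Qed.

End counting_bounds.

Lemma uniq_union (T : eqType) (W : nat -> seq T) K : (forall j, uniq (W j)) ->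
  (forall i j x, x \in W i -> x \in W j -> i = j) ->
  exists s, [/\ uniq s, size s = (\sum_(0 <= j < K) size (W j))%N &
    forall x, x \in s -> exists2 j, (j < K)%N & x \in W j].
Proof.
move=> uW dW; elim: K => [|K [s [us ss hs]]]; first by exists [::]; rewrite big_geq.
exists (s ++ W K); split.
- rewrite cat_uniq us uW andbT /=; apply/hasPn => x xK; apply/negP => /hs[j jK xj].
  by move: jK; rewrite (dW _ _ _ xj xK) ltnn.
- by rewrite size_cat ss big_nat_recr.
move=> x; rewrite mem_cat => /orP[/hs[j jK xj]|xK]; last by exists K.
by exists j => //; apply: ltnW.
Qed.

Theorem theorem2 (R : realType) (A : transition) (theta : R)
    (f : shift_space A -> R)
    (Pf alpha sigma0 rho rho1 d0 d1 delta : R)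
    (m0 : probability (borel_shift A) R) (Phi : R[i] -> R[i])
    (xi : 'I_(kappa A) -> shift_space A)
    (htheta : 0 < theta < 1)
    (hlip : lipschitz_theta theta (cfun f))
    (hpos : forall x, 0 < f x)
    (hnl : non_lattice f)
    (hPf : pressure (fun x => - Pf * f x) = 0%E)
    (hm0 : equilibrium_state (fun x => - Pf * f x) m0)
    (halpha : (alpha%:E = \int[m0]_x (f x)%:E)%E)
    (hPhi : pressure_continuation theta (fun x => - Pf * f x) f Phi)
    (hsigma0 : 0 < sigma0)
    (hsigmaRe : derive1n 2 (fun u : R => complex.Re (Phi (0 +i* u)%C)) 0
                = - sigma0 ^+ 2)
    (hsigmaIm : derive1n 2 (fun u : R => complex.Im (Phi (0 +i* u)%C)) 0 = 0)
    (hwc : weakly_contracting theta Pf f)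
    (hxi : forall i, xi i 0%N = i)
    (hrho1 : ruelle_lemma_constant theta f xi rho1)
    (hrho : [/\ 0 < rho1, rho1 < rho & rho < 1])
    (hW : contraction_with theta Pf f rho)
    (hd0 : (exists x, f x = d0) /\ (forall x, d0 <= f x))
    (hd1 : (exists x, f x = d1) /\ (forall x, f x <= d1))
    (hdelta : 0 < delta < - (ln rho * alpha / (3 * d1)))
    (p q : R) (hpq : p < q) :
  let eps (n : nat) := expR (- delta * n%:R) in
  let r := pi / (4 * alpha) in
  (forall a : R, 0 < a ->
   exists2 o_a : nat -> R, o_a n @[n --> \oo] --> (0 : R) &
   \forall n \near \oo, forall z : R, 0 <= z <= alpha ->
     ((expR (Pf * (z + n%:R * alpha)) * (q - p) * eps n
       * (1 / (Num.sqrt (pi * n%:R) * sigma0)) * (2 * r / a)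
       * (1 + o_a n))%:E
      <= periodic_count f alpha n z p q (eps n))%E) /\
  (exists2 o : nat -> R, o n @[n --> \oo] --> (0 : R) &
   \forall n \near \oo, forall z : R, 0 <= z <= alpha ->
     (periodic_count f alpha n z p q (eps n)
      <= (expR (Pf * (z + n%:R * alpha)) * (q - p) * eps n
          * (2 * Num.sqrt (2 * n%:R) / (Num.sqrt pi * sigma0))
          * (Num.sqrt (alpha / d0) - Num.sqrt (alpha / d1) + o n))%:E)%E).
Proof.
have /andP[t0 t1] := htheta.
have [[xd0 fxd0] hd0'] := hd0; have [[xd1 fxd1] hd1'] := hd1.
have [rho10 rho1rho rho_lt1] := hrho.
have rho0 : 0 < rho by apply: lt_trans rho1rho.
have rho01 : 0 < rho < 1 by rewrite rho0.
have d00 : 0 < d0 by rewrite -fxd0.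
have d10 : 0 < d1 by rewrite -fxd1.
have [F hf] : exists F, lip_function theta d1 F f.
  have [F F0 hF] := lipschitz_bounds t0 t1 hlip; exists F; split => //.
  - exact: ltW.
  - by move=> x; rewrite ger0_norm// ltW.
  - by move=> m x y /hF; rewrite /cfun -rmorphB normc_real.
have /andP[alpha_ge alpha_le] := integral_between t0 t1 hf hd0' hd1' halpha.
have alpha0 : 0 < alpha by apply: lt_le_trans alpha_ge.
have d01 : d0 < d1.
  rewrite lt_neqAle (le_trans alpha_ge alpha_le) andbT; apply/eqP => e01; apply: hnl.
  exists d0, 0, (fun=> 0), (fun=> 0); split.
  - by exists 0 => x; rewrite normr0.
  - by exists 0 => x; rewrite normr0.
  move=> x; rewrite subrr mul0r add0r addr0.
  by apply/eqP; rewrite eq_le hd0' e01 hd1'.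
pose per := periodic_seq A; pose phi m x : R := birkhoff f m x.
have phi_bounds m x : d0 * m%:R <= phi m x <= d1 * m%:R.
  have cst (d : R) : d * m%:R = \sum_(i < m) d by rewrite sumr_const card_ord mulr_natr.
  by rewrite /phi /birkhoff !cst; apply/andP; split; apply: ler_sum.
(* At one point, Birkhoff sums of different lengths are at least [d0] apart; this is what separates
   the windows of different periods. *)
have phi_gap m k x : phi m x + d0 * k%:R <= phi (m + k)%N x.
  elim: k => [|k ih]; first by rewrite mulr0 addr0 addn0.
  rewrite addnS /phi /birkhoff big_ord_recr /= -natr1 mulrDr mulr1 addrA.
  by apply: lerD; [exact: ih | exact: hd0'].
have [e he hscale] := error_scale alpha0 rho0 rho_lt1 d10 hdelta.
have e0 : 0 < e by case/andP: he.
have [Zclt Zsmall] := periodic_sum_small_frequencies t0 t1 hf rho01 hW hsigma0 hPf hm0 halpha hPhi hsigmaRe.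
have Zlarge := periodic_sum_large_frequencies t0 rho01 hW hPf rho10 rho1rho hrho1 e0.
have hlimit := @local_limit R _ per (fun m x => expR (- Pf * phi m x)) phi alpha sigma0 rho e
  hsigma0 rho0 he Zclt Zsmall Zlarge.
move=> eps r.
have eps01 n : 0 < eps n <= 1.
  rewrite expR_gt0 -expR0 ler_expR mulNr oppr_le0 mulr_ge0//.
  by case/andP: hdelta => /ltW.
have spi : 0 < Num.sqrt (pi : R) by rewrite sqrtr_gt0 pi_gt0.
split.
  (* For large [n] the count exceeds the main term itself, so the correction can be 0; the
     dependence on [a] sits in the threshold for [n]. *)
  move=> a a0; exists (fun=> 0); first exact: cvg_cst.
  pose h : R := (q - p) / 2; have h0 : 0 < h by rewrite divr_gt0// subr_gt0.
  have [c1 c10 hc1] := window_lower_bound hsigma0 d00 alpha_ge alpha_le eps01 hlimit hscale h0.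
  pose s : R := `|p + q| / 2; have s0 : 0 <= s by rewrite divr_ge0.
  pose C : R := (q - p) / (Num.sqrt pi * sigma0) * (2 * r / a).
  have c20 : 0 < c1 * expR (- (`|Pf| * s)) by rewrite mulr_gt0 ?expR_gt0.
  (* [K] periods outweigh the constant [C], which contains [2 * r / a]. The factor
     [expR (- (|Pf| * s))] pays for moving the centre of the window from [z + n * alpha] to [T]. *)
  pose K := (Num.truncn (C / (c1 * expR (- (`|Pf| * s))))).+1.
  have hK : C <= K%:R * (c1 * expR (- (`|Pf| * s))).
    by rewrite -ler_pdivrMr// ltW// Num.Theory.truncnS_gt.
  have [N hN] := hc1 K (alpha + s).
  have dl0 : 0 < delta by case/andP: hdelta.
  pose N2 := (Num.truncn ((q - p) / d0 / delta)).+1.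
  exists (N + N2)%N => // n /= nN z /andP[z0 z1].
  have nN1 : (N <= n)%N by apply: leq_trans nN; exact: leq_addr.
  have n0 : (0 < n)%N by rewrite (leq_trans _ nN)// /N2 addnS.
  have nN2 : (N2 <= n)%N by apply: leq_trans nN; exact: leq_addl.
  have /andP[en0 en1] := eps01 n.
  (* Once the interval is shorter than [d0], no point can lie in the windows of two periods, so the
     contributions of the [K] periods add up without repetition. *)
  have small : (q - p) * eps n < d0.
    have h1 := expR_ge1Dx (delta * n%:R).
    have h2 : (q - p) / d0 / delta <= n%:R.
      by rewrite (le_trans (ltW (Num.Theory.truncnS_gt _)))// ler_nat.
    rewrite ler_pdivrMr// ler_pdivrMr// in h2.
    rewrite /eps mulNr expRN ltr_pdivrMr ?expR_gt0//.
    have h3 := ler_wpM2l (ltW d00) h1; clear -h2 h3 d00; lra.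
  (* Centred at the midpoint of [p] and [q], the window of radius [h * eps n] is exactly the
     interval of the counting function. *)
  pose T : R := z + n%:R * alpha + (p + q) / 2 * eps n.
  pose W j := window per phi eps n (n + j) T h.
  have inW j x : x \in W j -> iter (n + j) (@left_shift A) x = x /\
      z + n%:R * alpha + p * eps n <= phi (n + j)%N x <= z + n%:R * alpha + q * eps n.
    rewrite mem_filter => /andP[hx /(mem_periodic_seq _ (ltn_addr j n0)) xp].
    split => //; move: hx; rewrite /T /h ler_distl => /andP[h1 h2].
    by clear -h1 h2; apply/andP; split; lra.
  have lt_disjoint i j x : x \in W i -> x \in W j -> ~~ (i < j)%N.
    move=> /inW[_ /andP[h1 h2]] /inW[_ /andP[h3 h4]]; apply/negP => ij.
    have := phi_gap (n + i)%N (j - i)%N x; rewrite -addnA subnKC ?(ltnW ij)// => h5.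
    have h6 : d0 <= d0 * (j - i)%:R by rewrite ler_peMr ?(ltW d00)// ler1n subn_gt0.
    by clear -small h1 h4 h5 h6; lra.
  have [s' [us ss hs]] : exists s', [/\ uniq s', size s' = (\sum_(0 <= j < K) size (W j))%N &
      forall x, x \in s' -> exists2 j, (j < K)%N & x \in W j].
    apply: uniq_union => [j|i j x xi' xj].
      by apply: filter_uniq; apply: periodic_seq_uniq; exact: ltn_addr.
    apply/eqP; rewrite eqn_leq leqNgt (lt_disjoint _ _ _ xj xi') leqNgt.
    by rewrite (lt_disjoint _ _ _ xi' xj).
  have low : K%:R * (c1 * (expR (Pf * T) * eps n / Num.sqrt n%:R)) <= (size s')%:R.
    rewrite ss natr_sum mulr_natl -{1}(subn0 K) -sumr_const_nat.
    rewrite [leLHS]big_nat_cond [leRHS]big_nat_cond; apply: ler_sum => j.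
    rewrite andbT => /andP[_ jK].
    apply: hN => //; first exact: ltnW.
    have -> : T - n%:R * alpha = z + (p + q) / 2 * eps n by rewrite /T; ring.
    apply: le_trans (ler_normD _ _) _; apply: lerD; first by rewrite ger0_norm.
    by rewrite normrM (ger0_norm (ltW en0)) normrM (ger0_norm (_ : 0 <= 2^-1))// ler_piMr.
  apply: (@le_trans _ _ (size s')%:R%:E); last first.
    apply: counting_ge_size => // x /hs[j jK /inW[xp hx]]; exists (n + j)%N; split => //.
    exact: ltn_addr.
  rewrite lee_fin addr0 mulr1; apply: le_trans low.
  have q0 : 0 < Num.sqrt (n%:R : R) by rewrite sqrtr_gt0 ltr0n.
  have X0 : 0 <= expR (Pf * (z + n%:R * alpha)) * eps n / Num.sqrt n%:R.
    by apply: divr_ge0; [apply: mulr_ge0; [exact: expR_ge0 | exact: ltW] | exact: ltW].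
  have -> : expR (Pf * (z + n%:R * alpha)) * (q - p) * eps n *
      (1 / (Num.sqrt (pi * n%:R) * sigma0)) * (2 * r / a) =
      C * (expR (Pf * (z + n%:R * alpha)) * eps n / Num.sqrt n%:R).
    rewrite sqrtrM ?pi_ge0// /C; field; rewrite !gt_eqF//.
  apply: le_trans (ler_wpM2r X0 hK) _.
  rewrite -[leLHS]mulrA ler_wpM2l ?ler0n// -[leLHS]mulrA ler_wpM2l ?(ltW c10)//.
  rewrite !mulrA ler_wpM2r ?invr_ge0 ?(ltW q0)// ler_wpM2r ?(ltW en0)//.
  rewrite -expRD ler_expR /T [Pf * (_ + (p + q) / 2 * eps n)]mulrDr [leLHS]addrC lerD2l.
  have h1 : `|Pf * ((p + q) / 2 * eps n)| <= `|Pf| * s.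
    rewrite normrM ler_wpM2l// normrM (ger0_norm (ltW en0)) normrM (ger0_norm (_ : 0 <= 2^-1))//.
    by rewrite ler_piMr.
  by move: h1; rewrite /s ler_norml => /andP[+ _]; rewrite mulrA.
(* The constant [kap] is the full bracket of the claim, positive because [d0 < d1]. Since
   [window_upper_bound] accepts any positive constant, the correction can again be 0. *)
exists (fun=> 0); first exact: cvg_cst.
pose kap : R := (q - p) * (2 * Num.sqrt 2 / (Num.sqrt pi * sigma0)) * (Num.sqrt (alpha / d0) - Num.sqrt (alpha / d1)).
have kap0 : 0 < kap.
  apply: mulr_gt0; first apply: mulr_gt0; first by rewrite subr_gt0.
    by apply: divr_gt0; [rewrite mulr_gt0// sqrtr_gt0 | exact: mulr_gt0].
  rewrite subr_gt0 ltr_sqrt ?divr_gt0// ltr_pM2l// ltf_pV2 ?posrE//.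
have s0 : 0 <= `|p| + `|q| by rewrite addr_ge0.
have [N hN] := window_upper_bound hsigma0 d00 alpha_ge alpha_le phi_bounds eps01 hlimit hscale s0 kap0.
exists N => // n nN z /andP[z0 z1]; pose T : R := z + n%:R * alpha.
have hT : n%:R * alpha <= T <= n%:R * alpha + alpha by rewrite /T lerDr z0 addrC lerD2l.
have /andP[en0 en1] := eps01 n.
(* A symmetric window around [T] that contains the interval from [p * eps n] to [q * eps n],
   whatever the signs of [p] and [q]. *)
pose rr : R := `|p| + `|q|.
have T0 : 0 <= (T + rr) / d0.
  by rewrite divr_ge0 ?(ltW d00)// addr_ge0// addr_ge0// mulr_ge0// ltW.
pose k := Num.truncn ((T + rr) / d0).
have kT : d0 * k%:R <= T + rr.
  by have /andP[h _] := Num.Theory.truncn_itv T0; rewrite mulrC -ler_pdivlMr.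
have bq : `|q * eps n| <= rr * eps n.
  by rewrite normrM (ger0_norm (ltW en0)) ler_wpM2r ?(ltW en0)// lerDr.
have bp : `|p * eps n| <= rr * eps n.
  by rewrite normrM (ger0_norm (ltW en0)) ler_wpM2r ?(ltW en0)// lerDl.
have re : rr * eps n <= rr by rewrite ler_piMr.
(* A point may occur in this list for several of its periods; for an upper bound the repetitions are
   harmless. The last period [k] is the largest compatible with [d0 * m <= phi m x]. *)
pose s := flatten [seq window per phi eps n m T rr | m <- index_iota 1 k.+1].
apply: (@le_trans _ _ (size s)%:R%:E).
  apply: counting_le_size => x [m [mpos xp]]; rewrite -/T -/(phi m x) => /andP[h1 h2].
  have mk : (m <= k)%N.
    rewrite Num.Theory.truncn_ge_nat// ler_pdivlMr// mulrC.
    have /andP[h3 _] := phi_bounds m x.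
    by move: bq; rewrite ler_norml => /andP[_ bq]; clear -h2 h3 bq re; lra.
  apply/flattenP; exists (window per phi eps n m T rr).
    by apply/mapP; exists m => //; rewrite mem_index_iota mpos ltnS mk.
  rewrite mem_filter; apply/andP; split; last exact/mem_periodic_seq.
  move: bq bp; rewrite !ler_norml => /andP[_ bq] /andP[bp _].
  by clear -h1 h2 bq bp; apply/andP; split; lra.
rewrite lee_fin addr0 /s size_flatten /shape -map_comp sumnE big_map natr_sum.
apply: le_trans (hN n k T nN hT kT) _; apply: ler_of_eq.
by rewrite /kap /T sqrtrM//; field; rewrite !gt_eqF.
Qed.
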